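(* If $(\rho^*,m^* )\in C$ and $\rho^*>0$, then the following statements are equivalent: 1. there is $\phi^*$ such that $m^*=-\rho^*D_pH(\cdot,\nabla\phi^* )$ and $(\rho^*,\phi^* )$ solves the mean-field game system $$\begin{cases}-\partial_t\phi-\nu\Delta\phi+H(x,\nabla\phi)=f(x,\rho(\cdot,t)),&(x,t)\in Q_T,\\ \partial_t\rho-\nu\Delta\rho-\nabla\cdot(\rho D_pH(x,\nabla\phi))=0,&(x,t)\in Q_T,\\ \phi(x,T)=f_T(x,\rho(\cdot,T)),\quad\rho(x,0)=\rho_0(x),&x\in\mathbb T^d;\end{cases}$$ 2. $(\rho^*,m^* )=\operatorname{argmin}_{(\tilde\rho,\tilde m)\in C}J(\tilde\rho,\tilde m;\rho^* )$; 3. $g(\rho^*,m^* )=0$.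
   Context: **Domain and notation.** Fix $T>0$, $\nu>0$, $\mathbb T^d=\mathbb R^d/\mathbb Z^d$, $Q_T=\mathbb T^d\times(0,T)$. $\langle\cdot,\cdot\rangle_{\mathbb T^d},\|\cdot\|_{\mathbb T^d}$ and $\langle\cdot,\cdot\rangle_{Q_T},\|\cdot\|_{Q_T}$ are the $L^2$ inner products and norms on $\mathbb T^d$ and $Q_T$. $\mathcal P(\mathbb T^d)$ is the set of Borel probability measures on $\mathbb T^d$; an absolutely continuous measure is identified with its density. A density evolution is $\rho=(\rho_t)_{t\in[0,T]}$ with $\rho_t=\rho(\cdot,t)\in\mathcal P(\mathbb T^d)$; $\rho>0$ means the density is positive everywhere. Solutions of the mean-field game system are classical. **Standing assumptions on the data.** $\rho_0$ is a probability measure on $\mathbb T^d$ with a $C^2$ positive density. The Hamiltonian $H:\mathbb T^d\times\mathbb R^d\to\mathbb R$, $(x,p)\mapsto H(x,p)$, is $C^2$ in $x$, smooth and strictly convex in $p$, and $\lim_{|p|\to\infty}H(x,p)/|p|=+\infty$ for all $x$. The interaction cost $f$ is either nonlocal, $f:\mathbb T^d\times\mathcal P(\mathbb T^d)\to\mathbb R$ with $f(\cdot,\rho)\in C^2(\mathbb T^d)$ for each $\rho\in\mathcal P(\mathbb T^d)$, or local, $f\in C^2(\mathbb T^d\times[0,\infty))$, in which case $f(x,\rho)$ means $f(x,\rho(x))$ for a density $\rho$. The terminal cost $f_T$ is likewise nonlocal with $f_T(\cdot,\rho)\in C^3(\mathbb T^d)$, or local with $f_T\in C^3(\mathbb T^d\times[0,\infty))$.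 For a density evolution $\rho$, $f(\rho)$ is the function $(x,t)\mapsto f(x,\rho_t)$ and $f_T(\rho_T)$ is $x\mapsto f_T(x,\rho_T)$. **Constraint set and costs.** $C$ is the set of $(\rho,m)$ with $\rho\in C([0,T],L^1(\mathbb T^d)\cap\mathcal P(\mathbb T^d))$, $m\in L^1(\mathbb T^d\times[0,T];\mathbb R^d)$, $\rho(\cdot,0)=\rho_0$ and $\partial_t\rho-\nu\Delta\rho+\nabla\cdot m=0$ in the sense of distributions. $L(x,v)=\sup_p\{-\langle p,v\rangle-H(x,p)\}$. The dynamic cost is $R(\rho,m)=\int_0^T\int_{\mathbb T^d}\rho\,L(x,m/\rho)\,dx\,dt$, where for $\rho=0$, $L(x,m/\rho):=0$ if $m=0$ and $+\infty$ if $m\ne0$. For $(\tilde\rho,\tilde m)\in C$ and a density evolution $\rho$, $J(\tilde\rho,\tilde m;\rho)=R(\tilde\rho,\tilde m)+\langle f(\rho),\tilde\rho\rangle_{Q_T}+\langle f_T(\rho_T),\tilde\rho_T\rangle_{\mathbb T^d}$. The gain of the best response is $g(\rho,m)=J(\rho,m;\rho)-\min_{(\tilde\rho,\tilde m)\in C}J(\tilde\rho,\tilde m;\rho)$ for $(\rho,m)\in C$. **Well-posedness convention.** The density evolutions $\rho$ for which $\operatorname{argmin}_{C}J(\cdot,\cdot;\rho)$ (the best response) is considered (here $\rho^*$) are regular enough that the backward equation $-\partial_t\hat\phi-\nu\Delta\hat\phi+H(x,\nabla\hat\phi)=f(x,\rho_t)$ in $Q_T$, $\hat\phi(\cdot,T)=f_T(\cdot,\rho_T)$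 has a unique classical solution $\hat\phi$ and the forward equation $\partial_t\hat\rho-\nu\Delta\hat\rho-\nabla\cdot(\hat\rho D_pH(x,\nabla\hat\phi))=0$, $\hat\rho(\cdot,0)=\rho_0$ has a unique classical solution, which is positive; the best response then exists and is unique. (The paper asserts this well-posedness as a standard fact when $\rho\in C^2(\overline{Q_T})$, $\rho>0$, $\rho(\cdot,t)\in\mathcal P(\mathbb T^d)$, $\rho(\cdot,0)=\rho_0$.) *)

(* Defs.v *)
From HB Require Import structures.
From mathcomp Require Import all_boot all_order all_algebra.
From mathcomp Require Import all_classical all_reals all_analysis.
From mathcomp Require Import measurable_realfun.

Set Implicit Arguments.
Unset Strict Implicit.
Unset Printing Implicit Defensive.

Import Order.TTheory GRing.Theory Num.Theory.
Import numFieldNormedType.Exports.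

Local Open Scope classical_set_scope.
Local Open Scope ring_scope.

(* Conventions.
   - A function on the torus T^d = R^d / Z^d is a function on 'rV[R]_d that is
     1-periodic in each coordinate.
   - An integral over T^d is an integral over the fundamental cube [0,1)^d;
     a Borel measure on T^d is a Borel measure on R^d carried by that cube
     (the restriction to [0,1)^d of R^d -> T^d is a Borel isomorphism).
   - An element of an L^1 space is given by one of its representatives; two
     representatives are compared almost everywhere. *)

(* sigma-algebra generated by the entries: on 'rV[R]_d, the Borel one *)
Section measurable_matrix.
Context {disp : measure_display} {S : measurableType disp} (m n : nat).

Definition mx_cylinders : set (set 'M[S]_(m, n)) :=
  [set A | exists i j, exists2 B : set S,
    measurable B & A = (fun M : 'M[S]_(m, n) => M i j) @^-1` B].

Let mx_set0 : <<s mx_cylinders >> set0.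
Proof. exact: sigma_algebra0. Qed.

Let mx_setC A : <<s mx_cylinders >> A -> <<s mx_cylinders >> (~` A).
Proof. exact: sigma_algebraC. Qed.

Let mx_bigcup (F : (set 'M[S]_(m, n))^nat) :
  (forall i, <<s mx_cylinders >> (F i)) -> <<s mx_cylinders >> (\bigcup_i F i).
Proof. exact: sigma_algebra_bigcup. Qed.

HB.instance Definition _ := @isMeasurable.Build disp 'M[S]_(m, n)
  <<s mx_cylinders >> mx_set0 mx_setC mx_bigcup.

Lemma measurable_fun_mx d' (U : measurableType d') (g : U -> 'M[S]_(m, n)) :
  (forall i j, measurable_fun setT (fun u => g u i j)) -> measurable_fun setT g.
Proof.
move=> mg; apply: (@measurability _ _ _ _ _ _ mx_cylinders) => //.
move=> _ [A [i [j [B mB ->]]] <-].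
exact: (mg i j).
Qed.

Lemma measurable_mx_entry i j :
  measurable_fun setT (fun M : 'M[S]_(m, n) => M i j).
Proof.
move=> _ B mB; rewrite setTI; apply: sub_sigma_algebra.
by exists i, j, B.
Qed.

End measurable_matrix.

Section cube_measure.
Context {R : realType}.

Let itv01_meas : measurable (`[0, 1[%classic : set (measurableTypeR R)).
Proof. exact: measurable_itv. Qed.

Definition leb01 : set (measurableTypeR R) -> \bar R :=
  mrestr (@lebesgue_measure R) itv01_meas.

HB.instance Definition _ := Measure.on leb01.

Let leb01_setT : leb01 setT = 1%E.
Proof.
by rewrite /leb01 /mrestr setTI lebesgue_measure_itv/= lte_fin ltr01 oppr0 adde0.
Qed.

HB.instance Definition _ := Measure_isProbability.Build _ _ _ leb01 leb01_setT.

Definition mx_cons n (z : measurableTypeR R * 'rV[R]_n) : 'rV[R]_n.+1 :=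
  \row_j oapp (z.2 0) z.1 (unlift ord0 j).

Lemma measurable_mx_cons n : measurable_fun setT (@mx_cons n).
Proof.
apply: measurable_fun_mx => i j.
rewrite (_ : (fun _ => _) =
    fun z : measurableTypeR R * 'rV[R]_n => oapp (z.2 0) z.1 (unlift ord0 j)); last first.
  by apply/funext => z; rewrite mxE.
case: (unlift ord0 j) => [k|] /=; last exact: measurable_fst.
exact: (measurableT_comp (measurable_mx_entry 0 k) measurable_snd).
Qed.

HB.instance Definition _ n := isMeasurableFun.Build _ _ _ _ (@mx_cons n)
  (@measurable_mx_cons n).

(* Lebesgue measure of R^n restricted to [0,1)^n *)
Fixpoint cube_leb (n : nat) : probability 'rV[R]_n R :=
  match n with
  | 0 => \d_(0 : 'rV[R]_0)
  | n'.+1 => distribution (leb01 \x cube_leb n')%E (@mx_cons n')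
  end.

End cube_measure.

Section calculus.
Context {R : realType}.

(* C^k on D up to the boundary: the directional derivatives of order <= k of f
   exist in the interior of D and extend continuously to D. *)
Fixpoint Ck_on {V : normedModType R} (k : nat) (D : set V) (f : V -> R) : Prop :=
  {within D, continuous f} /\
  match k with
  | 0 => True
  | k'.+1 => forall v, exists g,
      (forall x, (D^°)%classic x -> is_derive x v f (g x)) /\ Ck_on k' D g
  end.

Definition Ck {V : normedModType R} k (f : V -> R) := Ck_on k setT f.

Definition smooth {V : normedModType R} (f : V -> R) := forall k, Ck k f.

Definition unit_vec {d} (i : 'I_d) : 'rV[R]_d := delta_mx 0 i.

Definition periodic {d} {U : Type} (f : 'rV[R]_d -> U) :=
  forall x i, f (x + unit_vec i) = f x.

Definition dot {d} (u v : 'rV[R]_d) : R := \sum_i u 0 i * v 0 i.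

Definition euclid_norm {d} (u : 'rV[R]_d) : R := Num.sqrt (dot u u).

Definition partial {d} (i : 'I_d) (u : 'rV[R]_d -> R) (x : 'rV[R]_d) : R :=
  'D_(unit_vec i) u x.

Definition grad {d} (u : 'rV[R]_d -> R) (x : 'rV[R]_d) : 'rV[R]_d :=
  \row_i partial i u x.

Definition laplacian {d} (u : 'rV[R]_d -> R) (x : 'rV[R]_d) : R :=
  \sum_i partial i (partial i u) x.

Definition divergence {d} (F : 'rV[R]_d -> 'rV[R]_d) (x : 'rV[R]_d) : R :=
  \sum_i partial i (fun y => F y 0 i) x.

Definition time_deriv {d} (u : 'rV[R]_d -> R -> R) (x : 'rV[R]_d) (t : R) : R :=
  'D_1 (u x) t.

(* R^d x (0,T) and R^d x [0,T], the lifts of Q_T and of its closure *)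
Definition QT {d} (T : R) : set ('rV[R]_d * R) := [set z | 0 < z.2 < T].
Definition QTbar {d} (T : R) : set ('rV[R]_d * R) := [set z | 0 <= z.2 <= T].

Definition cont_QTbar {d} (T : R) (u : 'rV[R]_d -> R -> R) :=
  {within QTbar T, continuous (fun z => u z.1 z.2)}.

Definition extends_cont {d} (T : R) (u : 'rV[R]_d -> R -> R) :=
  exists g : 'rV[R]_d -> R -> R, cont_QTbar T g /\
    forall x t, 0 < t < T -> g x t = u x t.

(* C^{2,1}, the regularity of classical solutions, up to the boundary: u, d_t u, d_i u and d_j d_i u are defined in
   Q_T and extend continuously to its closure *)
Definition C21 {d} (T : R) (u : 'rV[R]_d -> R -> R) : Prop :=
  [/\ cont_QTbar T u,
      forall x t, 0 < t < T -> derivable (u x) t 1,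
      forall x t i, 0 < t < T -> derivable (u ^~ t) x (unit_vec i),
      forall x t i j, 0 < t < T ->
        derivable (partial i (u ^~ t)) x (unit_vec j)
    & [/\ extends_cont T (time_deriv u),
          forall i, extends_cont T (fun x t => partial i (u ^~ t) x)
        & forall i j,
            extends_cont T (fun x t => partial j (partial i (u ^~ t)) x)]].

End calculus.

Section torus_densities.
Context {R : realType} {d : nat}.

Definition unit_cube : set 'rV[R]_d := [set x | forall i, 0 <= x 0 i < 1].

Definition is_density (r : 'rV[R]_d -> R) : Prop :=
  [/\ periodic r, measurable_fun setT r, forall x, 0 <= r x
    & (\int[cube_leb d]_x (r x)%:E = 1)%E].

Section density_prob.
Variables (r : 'rV[R]_d -> R) (hr : is_density r).

Definition density_measure of is_density r : set 'rV[R]_d -> \bar R :=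
  fun A => (\int[cube_leb d]_(x in A) (r x)%:E)%E.

Local Notation nu := (density_measure hr).

Let nu0 : nu set0 = 0%E.
Proof. by rewrite /density_measure integral_set0. Qed.

Let nu_ge0 A : (0 <= nu A)%E.
Proof.
by have [_ _ r0 _] := hr; apply: integral_ge0 => x _; rewrite lee_fin.
Qed.

Let nu_sigma_additive : semi_sigma_additive nu.
Proof.
have [_ mr r0 _] := hr => F mF tF mUF; rewrite /density_measure; apply: cvg_toP.
  apply: ereal_nondecreasing_is_cvgn => m n mn.
  apply: lee_sum_nneg_natr => // k _ _.
  by apply: integral_ge0 => x _; rewrite lee_fin.
rewrite ge0_integral_bigcup//=.
- by apply: measurable_funTS; exact/measurable_EFinP.
- by move=> x _; rewrite lee_fin.
Qed.

HB.instance Definition _ := isMeasure.Build _ _ _ nu nu0 nu_ge0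
  nu_sigma_additive.

Let nu_setT : nu setT = 1%E.
Proof. by have [] := hr. Qed.

HB.instance Definition _ := Measure_isProbability.Build _ _ _ nu nu_setT.

Definition density_prob : probability 'rV[R]_d R := nu.

End density_prob.

(* the probability measure r dx; the uniform law if r is not a density *)
Definition law (r : 'rV[R]_d -> R) : probability 'rV[R]_d R :=
  if pselect (is_density r) is left hr then density_prob hr else cube_leb d.

(* local costs are functions of (x, r) with r >= 0 the value of the density at
   x, nonlocal ones are functions of (x, mu) with mu in P(T^d) *)
Inductive coupling : Type :=
  | Local_cost of ('rV[R]_d -> R -> R)
  | Nonlocal_cost of ('rV[R]_d -> probability 'rV[R]_d R -> R).

Definition coupling_Ck (k : nat) (c : coupling) : Prop :=
  match c with
  | Local_cost f =>
      (forall r, 0 <= r -> periodic (f ^~ r)) /\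
      Ck_on k [set z : 'rV[R]_d * R | 0 <= z.2] (fun z => f z.1 z.2)
  | Nonlocal_cost F =>
      forall mu : probability 'rV[R]_d R, mu unit_cube = 1%E ->
        periodic (F ^~ mu) /\ Ck k (F ^~ mu)
  end.

Definition cost (c : coupling) (x : 'rV[R]_d) (r : 'rV[R]_d -> R) : R :=
  match c with
  | Local_cost f => f x (r x)
  | Nonlocal_cost F => F x (law r)
  end.

End torus_densities.
Arguments coupling : clear implicits.

Section mean_field_game.
Context {R : realType} {d : nat}.
Local Notation Rd := 'rV[R]_d.

Record mfg_data := MFGData {
  horizon : R;
  viscosity : R;
  init_density : Rd -> R;
  hamiltonian : Rd -> Rd -> R;
  running_cost : coupling R d;
  terminal_cost : coupling R d }.

Definition hamiltonian_assumptions (H : Rd -> Rd -> R) : Prop :=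
  [/\ forall p, periodic (H ^~ p) /\ Ck 2 (H ^~ p),
      forall x, smooth (H x),
      forall x p q (s : R), p != q -> 0 < s < 1 ->
        H x (s *: p + (1 - s) *: q) < s * H x p + (1 - s) * H x q
    & forall x (A : R), exists B : R, forall p,
        B < euclid_norm p -> A < H x p / euclid_norm p].

Definition standing_assumptions (D : mfg_data) : Prop :=
  [/\ 0 < horizon D /\ 0 < viscosity D,
      [/\ is_density (init_density D), Ck 2 (init_density D)
        & forall x, 0 < init_density D x],
      hamiltonian_assumptions (hamiltonian D),
      coupling_Ck 2 (running_cost D)
    & coupling_Ck 3 (terminal_cost D)].

Variable D : mfg_data.
Local Notation T := (horizon D).
Local Notation nu := (viscosity D).
Local Notation H := (hamiltonian D).
Local Notation f := (running_cost D).
Local Notation fT := (terminal_cost D).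
Local Notation rho0 := (init_density D).

Definition DpH (x p : Rd) : Rd := grad (H x) p.

Definition space_time_leb : set (Rd * measurableTypeR R) -> \bar R :=
  (cube_leb d \x @lebesgue_measure R)%E.

HB.instance Definition _ := Measure.on space_time_leb.

Definition density_evolution (rho : Rd -> R -> R) : Prop :=
  forall t, 0 <= t <= T -> is_density (rho ^~ t).

Definition solves_HJB (rho phi : Rd -> R -> R) : Prop :=
  [/\ forall t, 0 <= t <= T -> periodic (phi ^~ t),
      C21 T phi,
      forall x t, 0 < t < T ->
        - time_deriv phi x t - nu * laplacian (phi ^~ t) x
          + H x (grad (phi ^~ t) x) = cost f x (rho ^~ t)
    & forall x, phi x T = cost fT x (rho ^~ T)].

Definition drift_flux (rho phi : Rd -> R -> R) (x : Rd) (t : R) : Rd :=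
  rho x t *: DpH x (grad (phi ^~ t) x).

(* the derivatives in the divergence are required to exist and be continuous,
   like the other derivatives in the equation *)
Definition solves_FP (phi rho : Rd -> R -> R) : Prop :=
  [/\ forall t, 0 <= t <= T -> periodic (rho ^~ t),
      C21 T rho,
      forall i,
        (forall x t, 0 < t < T ->
          derivable (fun y => drift_flux rho phi y t 0 i) x (unit_vec i)) /\
        {within QT T, continuous (fun z =>
          partial i (fun y => drift_flux rho phi y z.2 0 i) z.1)},
      forall x t, 0 < t < T ->
        time_deriv rho x t - nu * laplacian (rho ^~ t) x
          - divergence (fun y => drift_flux rho phi y t) x = 0
    & forall x, rho x 0 = rho0 x].

Definition classical_MFG (rho phi : Rd -> R -> R) : Prop :=
  [/\ density_evolution rho, solves_HJB rho phi & solves_FP phi rho].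

(* the regularity required of rho for the best response to be considered *)
Definition well_posed (rho : Rd -> R -> R) : Prop :=
  exists phi,
    [/\ solves_HJB rho phi,
        forall psi, solves_HJB rho psi ->
          forall x t, 0 <= t <= T -> psi x t = phi x t
      & exists r,
        [/\ solves_FP phi r,
            forall s, solves_FP phi s ->
              forall x t, 0 <= t <= T -> s x t = r x t
          & forall x t, 0 <= t <= T -> 0 < r x t]].

Definition test_function (psi : Rd -> R -> R) : Prop :=
  [/\ forall t, periodic (psi ^~ t),
      smooth (fun z : Rd * R => psi z.1 z.2)
    & exists a b, [/\ 0 < a, b < T &
        forall x t, psi x t != 0 -> a <= t <= b]].

(* the equation d_t rho - nu Lap rho + div m = 0 in the sense of distributions *)
Definition continuity_equation (rho : Rd -> R -> R) (m : Rd -> R -> Rd) : Prop :=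
  forall psi, test_function psi ->
    (\int[space_time_leb]_(z in QT T)
      (rho z.1 z.2 * (time_deriv psi z.1 z.2
                      + nu * laplacian (psi ^~ z.2) z.1)
       + dot (m z.1 z.2) (grad (psi ^~ z.2) z.1))%:E = 0)%E.

(* rho is required to be a jointly measurable representative *)
Definition admissible (rho : Rd -> R -> R) (m : Rd -> R -> Rd) : Prop :=
  [/\ density_evolution rho /\
        measurable_fun (QT T : set (Rd * measurableTypeR R))
          (fun z => rho z.1 z.2),
      forall s, 0 <= s <= T ->
        (fun t => \int[cube_leb d]_x `|rho x t - rho x s|%:E)%E
          @ within `[0, T] (nbhs s) --> 0%E,
      (forall t, 0 < t < T -> periodic (m ^~ t)) /\
        (forall i, space_time_leb.-integrable (QT T)
          (fun z => (m z.1 z.2 0 i)%:E)),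
      {ae cube_leb d, forall x, rho x 0 = rho0 x}
    & continuity_equation rho m].

(* equality in C([0,T], L^1(T^d)) x L^1(T^d x [0,T]; R^d) *)
Definition same_density (rho rho' : Rd -> R -> R) : Prop :=
  forall t, 0 <= t <= T -> {ae cube_leb d, forall x, rho x t = rho' x t}.

Definition same_momentum (m m' : Rd -> R -> Rd) : Prop :=
  {ae space_time_leb, forall z, QT T z -> m z.1 z.2 = m' z.1 z.2}.

(* Each rho_t is an element of L^1, known up to null sets: rho solves the
   system classically when its smooth version does. *)
Definition solves_MFG (rho phi : Rd -> R -> R) : Prop :=
  exists2 r, same_density r rho & classical_MFG r phi.

Definition lagrangian (x v : Rd) : \bar R :=
  ereal_sup [set (- dot p v - H x p)%:E | p in [set: Rd]].

(* r L(x, w / r), extended to r = 0 *)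
Definition kinetic (x : Rd) (r : R) (w : Rd) : \bar R :=
  if r == 0 then (if w == 0 then 0%E else +oo%E)
  else (r%:E * lagrangian x (r^-1 *: w))%E.

Definition dynamic_cost (rho : Rd -> R -> R) (m : Rd -> R -> Rd) : \bar R :=
  (\int[space_time_leb]_(z in QT T)
     kinetic z.1 (rho z.1 z.2) (m z.1 z.2))%E.

(* total_cost rho r m is J(r, m; rho) *)
Definition total_cost (rho r : Rd -> R -> R) (m : Rd -> R -> Rd) : \bar R :=
  (dynamic_cost r m
   + \int[space_time_leb]_(z in QT T)
       (cost f z.1 (rho ^~ z.2) * r z.1 z.2)%:E
   + \int[cube_leb d]_x (cost fT x (rho ^~ T) * r x T)%:E)%E.

Definition minimizer (rho r : Rd -> R -> R) (m : Rd -> R -> Rd) : Prop :=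
  admissible r m /\
  forall r' m', admissible r' m' ->
    (total_cost rho r m <= total_cost rho r' m')%E.

(* (r, m) is the unique minimizer of J(., .; rho) over the constraint set *)
Definition is_argmin (rho r : Rd -> R -> R) (m : Rd -> R -> Rd) : Prop :=
  minimizer rho r m /\
  forall r' m', minimizer rho r' m' -> same_density r' r /\ same_momentum m' m.

(* the infimum is the minimum of J(., .; rho) whenever the latter is attained *)
Definition gain (rho : Rd -> R -> R) (m : Rd -> R -> Rd) : \bar R :=
  (total_cost rho rho m
   - ereal_inf [set total_cost rho z.1 z.2
               | z in [set z | admissible z.1 z.2]])%E.

End mean_field_game.
Arguments mfg_data : clear implicits.

(* Main.v *)
(** Let [phi] solve the backward equation for the frozen density [rho].  Testing
    the continuity equation of an admissible pair [(r, m)] with [phi] gives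
      [J(r, m; rho) = \int rho0 phi(., 0)
         + \iint (r L(x, m / r) + <grad phi, m> + r H(x, grad phi))].
    By definition of [L] the last integrand is nonnegative, and by
    differentiability of [H] it vanishes iff [m = - r D_p H(x, grad phi)].  The
    classical solution [u] of the forward equation attains this lower bound, so
    the minimizers are the admissible pairs with this feedback momentum, and the
    gain vanishes exactly on them.

    The minimizer is unique: let [(r, m)] be an admissible pair with
    [m = - r b], [b] continuous.  The functions [w = K_N * r], for trigonometric
    kernels [K_N], are smooth and solve the forward equation up to a flux error
    at most [omega w + o(1)], with [omega] arbitrarily small.  The relative
    energy [\int w^2 / u] then satisfies a Gronwall inequality and tends to its
    initial limit [1], hence [\int (w - u)^2 / u -> 0] and [r = u].

    Finally a density and its smooth version have the same law, and their local
    costs are continuous and agree almost everywhere, so they have the same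
    backward equation. *)
From HB Require Import structures.
Require Import Defs.
From mathcomp Require Import all_boot all_order all_algebra.
From mathcomp Require Import all_classical all_reals all_analysis.
From mathcomp Require Import measurable_realfun.
From mathcomp Require Import ring lra zify.
Import Order.TTheory GRing.Theory Num.Theory.
Import numFieldNormedType.Exports.
Local Open Scope classical_set_scope.
Local Open Scope ring_scope.
Set Implicit Arguments.
Unset Strict Implicit.
Unset Printing Implicit Defensive.

(** * Integration over the torus *)

(** An admissible pair [(r, m)] is only known to lie in L^1 and to satisfy the equation in the sense
    of distributions, so neither testing with [phi], which is merely C^{2,1} up to the end times,
    nor computing with the square of [r] is directly allowed. Both obstacles are met by convolving
    in space with kernels of finite rank, sums of products [a j x * b j y] of trigonometric
    polynomials. A convolution is then a finite sum of moments, which depend on time only, times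
    smooth functions of space, and the equation tested with [th t * b x] makes each moment
    absolutely continuous with an explicit derivative.

    The weight [1 / u] in the energy removes the drift: with [h = w / u], twice the equation of [w]
    against [h] minus that of [u] against the square of [h] leaves the flux error times the gradient
    of [h], and a dissipation that absorbs it at the price of a multiple of [omega ^+ 2 / nu] of the
    energy. Since [omega] is chosen after the horizon, the viscosity and the dimension, the maximum
    of the energy over time can be bounded at once. *)

Section borel.
Context {R : realType}.

Lemma mx_ball_measurable d (x : 'rV[R]_d) (e : R) : 0 < e ->
  measurable (ball x e : set 'rV[R]_d).
Proof.
move=> e0.
have -> : (ball x e : set 'rV[R]_d) =
    \bigcap_(i in [set: 'I_d]) ((fun M : 'rV[R]_d => M 0 i) @^-1` ball (x 0 i) e).
  apply/seteqP; split => y /=.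
    by move=> [_ xy] i _; exact: xy.
  by move=> xy; split => // i j; rewrite (ord1 i); exact: xy.
apply: fin_bigcap_measurable => // i _.
rewrite -[X in measurable X]setTI; apply: measurable_mx_entry => //.
exact: measurable_ball.
Qed.

(** The sigma-algebra here is a product, so openness is turned into measurability by hand: an open
    set is a countable union of balls with rational centres and radii [1 / (k + 1)], and a ball of
    the sup norm is a rectangle. *)
Lemma open_measurable_mx_prod d (A : set ('rV[R]_d * R)) : open A ->
  measurable (A : set ('rV[R]_d * measurableTypeR R)).
Proof.
move=> oA.
pose q (k : 'rV[rat]_d * rat * nat) : 'rV[R]_d * R :=
  (map_mx ratr k.1.1, ratr k.1.2).
pose r (k : 'rV[rat]_d * rat * nat) : R := k.2.+1%:R^-1.
pose D := [set k | ball (q k) (r k) `<=` A].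
have -> : A = \bigcup_(k in D) (ball (q k) (r k) : set ('rV[R]_d * R)).
  apply/seteqP; split => [z Az|z [k Dk]]; last exact: Dk.
  have /nbhs_ballP[e /= e0 zeA] : nbhs z A by exact: open_nbhs_nbhs.
  have e20 : 0 < e / 2 by rewrite divr_gt0.
  have [n _ ne] := near_infty_natSinv_lt (PosNum e20).
  have rn0 : (0 : R) < n.+1%:R^-1 by rewrite invr_gt0.
  have qex (a : R) : exists p : rat, `|a - ratr p| < n.+1%:R^-1.
    have an : a - n.+1%:R^-1 < a + n.+1%:R^-1 by rewrite ltrD2l gtrN.
    have [p] := rat_in_itvoo an; rewrite in_itv/= -ltr_distlC => ap.
    by exists p.
  pose p1 : 'rV[rat]_d := \row_i sval (cid (qex (z.1 0 i))).
  pose p2 : rat := sval (cid (qex z.2)).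
  have zk : ball (q (p1, p2, n)) (r (p1, p2, n)) z.
    split => /=.
      split => // i j; rewrite (ord1 i) !mxE; apply: ball_sym.
      exact: (svalP (cid (qex (z.1 0 j)))).
    by apply: ball_sym; exact: (svalP (cid (qex z.2))).
  exists (p1, p2, n) => // y yk; apply: zeA.
  apply: (@le_ball _ _ z (r (p1, p2, n) + r (p1, p2, n))).
    have := ne n (leqnn n) => /=; rewrite /r/=; move: (n.+1%:R^-1 : R) => u; lra.
  by apply: ball_triangle yk; exact: ball_sym.
rewrite bigcup_mkcond; apply: countable_bigcupT_measurable => // k.
case: ifPn => // _.
rewrite (_ : ball _ _ = ball (q k).1 (r k) `*` ball (q k).2 (r k)) //.
apply: measurableX; first by apply: mx_ball_measurable; rewrite invr_gt0.
exact: measurable_ball.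
Qed.

Lemma open_continuous_measurable d (D : set ('rV[R]_d * R)) (f : 'rV[R]_d * R -> R) :
  open D -> {within D, continuous f} ->
  measurable_fun (D : set ('rV[R]_d * measurableTypeR R)) f.
Proof.
move=> oD cf.
apply: (@measurability _ _ _ _ D f (@RGenOpens.G R)).
  exact: RGenOpens.measurableE.
move=> _ [_ [a [b ->]] <-]; apply: open_measurable_mx_prod.
rewrite continuous_open_subspace// in cf.
by apply: (continuous_inP _ oD).1 => //; exact: interval_open.
Qed.

Lemma continuous_mx_measurable d (f : 'rV[R]_d -> R) :
  continuous f -> measurable_fun setT f.
Proof.
move=> cf.
have mf : measurable_fun (setT : set ('rV[R]_d * measurableTypeR R))
    (fun z => f z.1).
  apply: (@open_continuous_measurable d setT (fun z => f z.1)); first exact: openT.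
  apply: continuous_subspaceT => z.
  exact: (@continuous_comp _ _ _ fst f z (@cvg_fst _ _ _ _ _) (cf z.1)).
have := measurableT_comp mf (pair2_measurable (0 : measurableTypeR R)).
exact.
Qed.

End borel.

(** * Translation invariance of the integral over the torus *)

Section cube.
Context {R : realType}.
Local Open Scope ereal_scope.

Lemma mx_consE0 n (z : measurableTypeR R * 'rV[R]_n) : mx_cons z 0%R 0%R = z.1.
Proof. by rewrite mxE unlift_none. Qed.

Lemma mx_consES n (z : measurableTypeR R * 'rV[R]_n) (i : 'I_n) :
  mx_cons z 0%R (lift ord0 i) = z.2 0%R i.
Proof. by rewrite mxE liftK. Qed.

Lemma cube_integralS n (F : 'rV[R]_n.+1 -> \bar R) :
  measurable_fun setT F -> (forall x, 0 <= F x) ->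
  \int[cube_leb n.+1]_x F x =
  \int[leb01]_a \int[cube_leb n]_z F (mx_cons (a, z)).
Proof.
move=> mF F0; rewrite /= ge0_integral_distribution//.
rewrite fubini_tonelli1//; first exact: (measurableT_comp mF (@measurable_mx_cons R n)).
by move=> x; exact: F0.
Qed.

Lemma lebesgue_measure_shift (s : R) (A : set (measurableTypeR R)) : measurable A ->
  lebesgue_measure ((fun x : R => x + s)%R @^-1` A) = @lebesgue_measure R A.
Proof.
move=> mA.
have ms : measurable_fun setT (fun x : measurableTypeR R => (x + s)%R : measurableTypeR R).
  apply: (@measurable_funD _ _ R setT id (cst s)) => //.
pose f : {mfun measurableTypeR R >-> measurableTypeR R} :=
  HB.pack (fun x : measurableTypeR R => (x + s)%R : measurableTypeR R) (isMeasurableFun.Build _ _ _ _ _ ms).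
rewrite -[LHS]/(pushforward (@lebesgue_measure R) f A).
apply/esym/lebesgue_measure_unique => //= _ [[a b]] _ <-.
rewrite /pushforward/=.
have -> : (f @^-1` `]a, b]) = `](a - s)%R, (b - s)%R]%classic.
  apply/seteqP; split => x /=; rewrite !in_itv/= ltrBlDr lerBrDr//.
rewrite !lebesgue_measure_itv/= !lte_fin ltrD2r; case: ifP => // _.
by rewrite -!EFinB; congr EFin; ring.
Qed.

Definition frac (x : R) : R := (x - (Num.floor x)%:~R)%R.

Lemma frac_itv x : (0 <= frac x < 1)%R.
Proof.
rewrite /frac; have := Num.Theory.floor_itv x.
by rewrite subr_ge0 ltrBlDl intrD.
Qed.

Lemma periodic_int (U : Type) (F : R -> U) : (forall x, F (x + 1)%R = F x) ->
  forall x (k : int), F (x + k%:~R)%R = F x.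
Proof.
move=> pF.
have pn n x : F (x + n%:R)%R = F x.
  by elim: n x => [|n IH] x; rewrite ?addr0// -natr1 addrA pF.
move=> x [n|n]; first exact: pn.
by rewrite NegzE mulrNz -(pn n.+1 (x - _)%R) subrK.
Qed.

Lemma periodic_frac (U : Type) (F : R -> U) : (forall x, F (x + 1)%R = F x) ->
  forall x, F (frac x) = F x.
Proof. by move=> pF x; rewrite /frac -mulrNz periodic_int. Qed.

(** A rotation of the circle is two translations glued together: for [s] in [[0, 1)] it sends
    [[0, 1 - s)] to [[s, 1)] and [[1 - s, 1)] to [[0, s)], and Lebesgue measure is invariant under
    each. *)
Lemma leb01_rot (s : R) (F : measurableTypeR R -> \bar R) :
  (forall x, F (x + 1)%R = F x) -> measurable_fun setT F -> (forall x, 0 <= F x) ->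
  \int[leb01]_a F (a + s)%R = \int[leb01]_a F a.
Proof.
move=> pF mF F0.
wlog s01 : s / (0 <= s < 1)%R => [h|].
  rewrite -(h (frac s)); last exact: frac_itv.
  by apply: eq_integral => a _; rewrite /frac addrA -mulrNz periodic_int.
have mshift' r : measurable_fun setT (fun x : measurableTypeR R => (x + r)%R : R).
  exact: (@measurable_funD _ _ R setT id (cst r)).
pose rot a := if (a + s < 1)%R then (a + s)%R else (a + s - 1)%R.
have mshift r : measurable_fun setT (fun x : measurableTypeR R => (x + r)%R : measurableTypeR R).
  exact: (@measurable_funD _ _ R setT id (cst r)).
have mrot : measurable_fun setT (rot : measurableTypeR R -> measurableTypeR R).
  apply: measurable_fun_ifT => //.
  - exact: (measurable_fun_ltr (mshift' s) (@measurable_cst _ _ _ _ _ (1%R : R))).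
  - by under eq_fun do rewrite -addrA; exact: mshift.
have -> : \int[leb01]_a F (a + s)%R = \int[leb01]_a (F \o rot) a.
  apply: eq_integral => a _ /=; rewrite /rot; case: ifPn => // _.
  by rewrite -[in RHS]pF subrK.
rewrite -(@ge0_integral_pushforward _ _ (measurableTypeR R) (measurableTypeR R) R rot mrot leb01 setT F)//.
apply: eq_measure_integral => A mA _.
have [s0 s1] := andP s01.
have mI b c : measurable (`[b, c[ : set (measurableTypeR R)) by exact: measurable_itv.
have msh r B : measurable B ->
    measurable ((fun x : measurableTypeR R => (x + r)%R : measurableTypeR R) @^-1` B).
  by move=> mB; rewrite -[X in measurable X]setTI; exact: mshift.
change (@lebesgue_measure R (rot @^-1` A `&` `[0%R, 1%R[) =
  @lebesgue_measure R (A `&` `[0%R, 1%R[)).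
have -> : rot @^-1` A `&` `[0%R, 1%R[ =
    ((fun x : R => x + s)%R @^-1` (A `&` `[s, 1%R[)) `|`
    ((fun x : R => x + (s - 1))%R @^-1` (A `&` `[0%R, s[)).
  apply/seteqP; split => x; rewrite /rot /= !in_itv/=.
    move=> [+ /andP[x0 x1]]; case: ifPn => [xs Ax|].
      by left; rewrite lerDr x0.
    by rewrite -leNgt => xs Ax; right; rewrite addrA; split => //; lra.
  move=> [[Ax /andP[h1 h2]]|[Ax /andP[h1 h2]]].
    by rewrite h2; split => //; lra.
  rewrite ifF; last by apply/negbTE; rewrite -leNgt; lra.
  by rewrite -addrA; split => //; lra.
have -> : A `&` `[0%R, 1%R[ = (A `&` `[s, 1%R[) `|` (A `&` `[0%R, s[).
  rewrite -setIUr; congr (_ `&` _); rewrite setUC; apply/seteqP; split => x /=;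
    rewrite !in_itv/=; case: (ltP x s) => xs; rewrite ?andbT ?andbF; move=> h; 
    by [left; lra | right; lra | case: h; lra].
rewrite !measureU; try exact: measurableI; try (by apply: msh; exact: measurableI).
- by congr (_ + _); apply: lebesgue_measure_shift; exact: measurableI.
- by apply/seteqP; split => x //=; rewrite !in_itv/=; lra.
- by apply/seteqP; split => x //=; rewrite !in_itv/=; lra.
Qed.

Lemma mx_consD n (a b : R) (z w : 'rV[R]_n) :
  (mx_cons (a, z) + mx_cons (b, w) = mx_cons (a + b, z + w))%R.
Proof. by apply/rowP => j; rewrite !mxE; case: unliftP => [k|] _ /=; rewrite ?mxE. Qed.

Definition mx_tail n (x : 'rV[R]_n.+1) : 'rV[R]_n := (\row_j x 0 (lift ord0 j))%R.

Lemma mx_cons_tail n (x : 'rV[R]_n.+1) : mx_cons (x 0%R 0%R, mx_tail x) = x.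
Proof.
apply/rowP => j; rewrite !mxE; case: unliftP => [k ->|->] //=; rewrite ?mxE//.
Qed.

Lemma measurable_translate n (v : 'rV[R]_n) :
  measurable_fun setT (fun x : 'rV[R]_n => x + v)%R.
Proof.
apply: measurable_fun_mx => i j; under eq_fun do rewrite mxE.
by apply: measurable_funD => //; exact: measurable_mx_entry.
Qed.

Lemma unit_vec0 n : unit_vec ord0 = mx_cons (1%R, 0%R) :> 'rV[R]_n.+1.
Proof.
by apply/rowP => j; rewrite !mxE eqxx/=; case: unliftP => [k ->|->] //=; rewrite ?mxE.
Qed.

Lemma unit_vecS n (i : 'I_n) :
  unit_vec (lift ord0 i) = mx_cons (0%R, unit_vec i) :> 'rV[R]_n.+1.
Proof.
apply/rowP => j; rewrite !mxE eqxx/=; case: unliftP => [k ->|->] //=; rewrite ?mxE//.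
Qed.

(** Induction on the dimension by Tonelli's theorem: the first coordinate is rotated, the tail is
    handled by the induction hypothesis. Nonnegativity replaces integrability. *)
Lemma cube_integral_translate n (F : 'rV[R]_n -> \bar R) (v : 'rV[R]_n) :
  Defs.periodic F -> measurable_fun setT F -> (forall x, 0 <= F x) ->
  \int[cube_leb n]_x F (x + v)%R = \int[cube_leb n]_x F x.
Proof.
elim: n F v => [|n IH] F v pF mF F0.
  by apply: eq_integral => x _; congr F; apply/rowP => -[].
have mFc (a : R) : measurable_fun setT (fun z : 'rV[R]_n => F (mx_cons (a, z))).
  apply: (measurableT_comp mF).
  exact: (measurableT_comp (@measurable_mx_cons R n) (pair1_measurable (a : measurableTypeR R))).
rewrite cube_integralS//; last first.
  by apply: (measurableT_comp mF); exact: measurable_translate.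
transitivity (\int[leb01]_a (fun b => \int[cube_leb n]_z F (mx_cons (b, z))) (a + v 0%R 0%R)%R).
  apply: eq_integral => a _ /=.
  rewrite -[RHS](IH _ (mx_tail v))//.
    by apply: eq_integral => z _; rewrite -[in LHS](mx_cons_tail v) mx_consD.
  by move=> x i; rewrite -[RHS](pF _ (lift ord0 i)) unit_vecS mx_consD addr0.
rewrite (cube_integralS mF)//.
apply: (@leb01_rot _ (fun b => \int[cube_leb n]_z F (mx_cons (b, z)))).
- move=> a; apply: eq_integral => z _.
  by rewrite -[RHS](pF _ ord0) unit_vec0 mx_consD addr0.
- apply: (@measurable_fun_fubini_tonelli_F _ _ (measurableTypeR R) 'rV[R]_n R (cube_leb n) (F \o @mx_cons R n)).
  + exact: (measurableT_comp mF (@measurable_mx_cons R n)).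
  + by move=> x; exact: F0.
- by move=> x; exact: integral_ge0.
Qed.

End cube.

Section Rintegrable.
Context {R : realType} {disp} {T : measurableType disp} {mu : {measure set T -> \bar R}}.
Implicit Types (f g : T -> R) (D : set T).

Lemma RintegrableD D f g : measurable D -> mu.-integrable D (EFin \o f) ->
  mu.-integrable D (EFin \o g) -> mu.-integrable D (EFin \o (fun x => f x + g x)).
Proof.
by move=> mD If Ig; apply: eq_integrable (integrableD mD If Ig).
Qed.

Lemma RintegrableB D f g : measurable D -> mu.-integrable D (EFin \o f) ->
  mu.-integrable D (EFin \o g) -> mu.-integrable D (EFin \o (fun x => f x - g x)).
Proof.
by move=> mD If Ig; apply: eq_integrable (integrableB mD If Ig).
Qed.

Lemma RintegrableZ D (k : R) f : measurable D -> mu.-integrable D (EFin \o f) ->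
  mu.-integrable D (EFin \o (fun x => k * f x)).
Proof.
by move=> mD If; apply: eq_integrable (integrableZl mD k If).
Qed.

Lemma Rintegrable_sum (I : Type) (s : seq I) D (f : I -> T -> R) : measurable D ->
  (forall i, mu.-integrable D (EFin \o f i)) ->
  mu.-integrable D (EFin \o (fun x => \sum_(i <- s) f i x)).
Proof.
move=> mD If; elim: s => [|i s IH].
  apply: eq_integrable (integrable0 mu D) => //= x _.
  by rewrite big_nil.
have := RintegrableD mD (If i) IH; apply: eq_integrable => //= x _.
by rewrite big_cons.
Qed.

Lemma Rintegral_sum (I : Type) (s : seq I) D (f : I -> T -> R) : measurable D ->
  (forall i, mu.-integrable D (EFin \o f i)) ->
  \int[mu]_(x in D) (\sum_(i <- s) f i x) = \sum_(i <- s) \int[mu]_(x in D) f i x.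
Proof.
move=> mD If; elim: s => [|i s IH].
  rewrite big_nil; under eq_Rintegral do rewrite big_nil.
  by rewrite /Rintegral integral0.
rewrite big_cons -IH -RintegralD//; last exact: Rintegrable_sum.
by apply: eq_Rintegral => x _; rewrite big_cons.
Qed.

Lemma RintegrableMb D f g (M : R) : measurable D -> mu.-integrable D (EFin \o f) ->
  measurable_fun D g -> (forall x, D x -> `|g x| <= M) ->
  mu.-integrable D (EFin \o (fun x => f x * g x)).
Proof.
move=> mD If mg gM; have mf : measurable_fun D f by apply/measurable_EFinP; exact: measurable_int If.
have IM := RintegrableZ M mD (integrable_norm If).
apply: le_integrable IM => //.
  by apply/measurable_EFinP; exact: measurable_funM.
move=> x Dx; rewrite lee_fin /= !normrM normr_id mulrC ler_wpM2r//.
exact: le_trans (gM _ Dx) (ler_norm _).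
Qed.

Lemma Rintegrable_le D f g : measurable D -> measurable_fun D f ->
  (forall x, D x -> `|f x| <= g x) -> mu.-integrable D (EFin \o g) ->
  mu.-integrable D (EFin \o f).
Proof.
move=> mD mf fg; apply: le_integrable => //; first exact/measurable_EFinP.
by move=> x Dx; rewrite lee_fin; exact: le_trans (fg _ Dx) (ler_norm _).
Qed.

Lemma Rdominated_cvg D (f_ : nat -> T -> R) f g : measurable D ->
  (forall n, measurable_fun D (f_ n)) -> measurable_fun D f ->
  (forall x, D x -> f_ ^~ x @ \oo --> f x) -> mu.-integrable D (EFin \o g) ->
  (forall x n, D x -> `|f_ n x| <= g x) ->
  (fun n => \int[mu]_(x in D) f_ n x) @ \oo --> \int[mu]_(x in D) f x.
Proof.
move=> mD mf_ mf ff Ig fg.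
have ffE x : D x -> (EFin \o f_ ^~ x) n @[n --> \oo] --> (f x)%:E.
  by move=> Dx; apply: cvg_EFin; [exact: nearW|exact: ff].
have [If _ h] := @dominated_convergence _ T R mu D mD (fun n => EFin \o f_ n) (EFin \o f)
  (EFin \o g) (fun n => proj2 (measurable_EFinP _ _) (mf_ n))
  (proj2 (measurable_EFinP _ _) mf)
  (aeW _ ffE) Ig
  (aeW _ (fun x n Dx => fg x n Dx)).
by apply: fine_cvg; rewrite fineK//; exact: integrable_fin_num.
Qed.

End Rintegrable.

Section cts.
Context {R : realType} {T : topologicalType}.
Implicit Types (f g : T -> R).

Lemma cts_cst (U : topologicalType) (c : U) : continuous (fun _ : T => c).
Proof. exact: cst_continuous. Qed.

Lemma ctsD (W : normedModType R) (f g : T -> W) :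
  continuous f -> continuous g -> continuous (fun x => f x + g x).
Proof. by move=> cf cg x; exact: (cvgD (cf x) (cg x)). Qed.

Lemma ctsB (W : normedModType R) (f g : T -> W) :
  continuous f -> continuous g -> continuous (fun x => f x - g x).
Proof. by move=> cf cg x; exact: (cvgB (cf x) (cg x)). Qed.

Lemma ctsM f g : continuous f -> continuous g -> continuous (fun x => f x * g x).
Proof. by move=> cf cg x; exact: (cvgM (cf x) (cg x)). Qed.

Lemma ctsN f : continuous f -> continuous (fun x => - f x).
Proof. by move=> cf x; exact: (cvgN (cf x)). Qed.

Lemma cts_norm f : continuous f -> continuous (fun x => `|f x|).
Proof. by move=> cf x; exact: (cvg_norm (cf x)). Qed.

Lemma cts_pair (U W : topologicalType) (f : T -> U) (g : T -> W) :
  continuous f -> continuous g -> continuous (fun x => (f x, g x)).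
Proof. by move=> cf cg x; exact: (cvg_pair (cf x) (cg x)). Qed.

Lemma cts_comp (U W : topologicalType) (f : T -> U) (g : U -> W) :
  continuous f -> continuous g -> continuous (fun x => g (f x)).
Proof. by move=> cf cg x; exact: (continuous_comp (cf x) (cg _)). Qed.

Lemma cts_sum (I : Type) (s : seq I) (f : I -> T -> R) :
  (forall i, continuous (f i)) -> continuous (fun x => \sum_(i <- s) f i x).
Proof.
move=> cf; elim: s => [|i s IH].
  by under eq_fun do rewrite big_nil; exact: cts_cst.
by under eq_fun do rewrite big_cons; exact: ctsD.
Qed.

End cts.

Lemma cts_fst (T U : topologicalType) : continuous (@fst T U).
Proof. by move=> x; exact: cvg_fst. Qed.

Lemma cts_snd (T U : topologicalType) : continuous (@snd T U).
Proof. by move=> x; exact: cvg_snd. Qed.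

Lemma cts_id (T : topologicalType) : continuous (fun x : T => x).
Proof. by move=> x. Qed.

Section fderive.
Context {R : realType} {V : normedModType R}.
Implicit Types (f g : V -> R) (x v : V).

Lemma fderive_ext f g x v (l l' : R) : f =1 g -> l = l' ->
  is_derive x v f l -> is_derive x v g l'.
Proof. by move=> /funext <- <-. Qed.

Lemma fderiveD f g x v (a b : R) : is_derive x v f a -> is_derive x v g b ->
  is_derive x v (fun y => f y + g y) (a + b).
Proof. by move=> df dg; exact: (@is_deriveD _ _ _ f g x v _ _ df dg). Qed.

Lemma fderiveB f g x v (a b : R) : is_derive x v f a -> is_derive x v g b ->
  is_derive x v (fun y => f y - g y) (a - b).
Proof. by move=> df dg; exact: (@is_deriveB _ _ _ f g x v _ _ df dg). Qed.

Lemma fderiveN f x v (a : R) : is_derive x v f a -> is_derive x v (fun y => - f y) (- a).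
Proof. by move=> df; exact: (@is_deriveN _ _ _ f x v _ df). Qed.

Lemma fderiveM f g x v (a b : R) : is_derive x v f a -> is_derive x v g b ->
  is_derive x v (fun y => f y * g y) (f x * b + a * g x).
Proof.
move=> df dg; apply: is_derive_eq (@is_deriveM _ _ f g x v _ _ df dg) _.
by rewrite /GRing.scale/= (mulrC a).
Qed.

Lemma fderiveZ f x v (k a : R) : is_derive x v f a ->
  is_derive x v (fun y => k * f y) (k * a).
Proof. by move=> df; exact: (@is_deriveZ _ _ _ f k x v _ df). Qed.

Lemma fderive_sum (I : Type) (s : seq I) (f : I -> V -> R) x v (a : I -> R) :
  (forall i, is_derive x v (f i) (a i)) ->
  is_derive x v (fun y => \sum_(i <- s) f i y) (\sum_(i <- s) a i).
Proof.
move=> df; elim: s => [|i s IH].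
  rewrite big_nil; under eq_fun do rewrite big_nil.
  exact: is_derive_cst.
by rewrite big_cons; under eq_fun do rewrite big_cons; exact: fderiveD.
Qed.

Lemma fderive_cst (k : R) x v : is_derive x v (fun=> k) 0.
Proof. exact: is_derive_cst. Qed.

End fderive.

(** * Integration by parts on the torus *)

Section cube_integral.
Context {R : realType}.

Lemma measurable_box n (B : set R) : measurable B ->
  measurable [set x : 'rV[R]_n | forall i, B (x 0 i)].
Proof.
move=> mB.
have -> : [set x : 'rV[R]_n | forall i, B (x 0 i)] =
    \bigcap_(i in [set: 'I_n]) ((fun M : 'rV[R]_n => M 0 i) @^-1` B).
  by apply/seteqP; split => y /= h i => [_|]; exact: h.
apply: fin_bigcap_measurable => // i _.
by rewrite -[X in measurable X]setTI; apply: measurable_mx_entry.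
Qed.

Lemma cube_box n (B : set (measurableTypeR R)) : measurable B ->
  cube_leb n [set x : 'rV[R]_n | forall i, B (x 0 i)] = (leb01 B ^+ n)%E.
Proof.
move=> mB; elim: n => [|n IH]; rewrite ?expeS /=.
  by rewrite /dirac/= indicE mem_set//= => -[].
rewrite -IH -product_measure1E//; last exact: measurable_box.
congr (product_measure1 _ _ _); apply/seteqP; split => [[a z]/= h|[a z] /= [h1 h2] i].
  split=> [|i] /=; first by have := h ord0; rewrite mx_consE0.
  by have := h (lift ord0 i); rewrite mx_consES.
by case: (unliftP ord0 i) => [k ->|->]; rewrite (mx_consES,mx_consE0).
Qed.

Lemma leb01_itv (q : R) : 0 < q <= 1 -> leb01 `[0, q[ = q%:E.
Proof.
move=> /andP[q0 q1].
transitivity (@lebesgue_measure R (`[0, q[ `&` `[0, 1[)); first by [].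
have -> : `[0, q[ `&` `[0, 1[ = `[0, q[%classic :> set R.
  by apply/seteqP; split => x /=; rewrite !in_itv/=; [case|]; lra.
by rewrite lebesgue_measure_itv/= lte_fin q0 oppr0 adde0.
Qed.

Lemma leb01_set1 (q : R) : leb01 [set q] = 0%E.
Proof.
apply/eqP; rewrite eq_le measure_ge0 andbT.
rewrite -(lebesgue_measure_set1 q); apply: le_measure; rewrite ?inE//.
by apply: measurableI.
Qed.

Lemma cube_leb_small_box n (q : R) : 0 < q <= 1 ->
  (0 < cube_leb n [set x : 'rV[R]_n | forall i, (0 <= x 0 i < q)%R])%E.
Proof.
move=> q01; rewrite (_ : [set x | _] = [set x : 'rV[R]_n | forall i, `[0, q[%classic (x 0 i)]).
  rewrite cube_box//.
  by rewrite leb01_itv// -EFin_expe lte_fin exprn_gt0//; case/andP: q01.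
by apply/seteqP; split => x /= h i; have := h i; rewrite in_itv.
Qed.

Lemma unit_cube_measurable n : measurable (@unit_cube R n).
Proof.
rewrite (_ : unit_cube = [set x : 'rV[R]_n | forall i, `[0, 1[%classic (x 0 i)]).
  by apply: measurable_box; exact: measurable_itv.
by apply/seteqP; split => x /= h i; have := h i; rewrite /= in_itv.
Qed.

Lemma cube_leb_unit n : cube_leb n (@unit_cube R n) = 1%E.
Proof.
rewrite (_ : unit_cube = [set x : 'rV[R]_n | forall i, `[0, 1[%classic (x 0 i)]).
  rewrite cube_box//.
  by rewrite leb01_itv ?ltr01 ?lexx// -EFin_expe expr1n.
by apply/seteqP; split => x /= h i; have := h i; rewrite /= in_itv.
Qed.

Lemma ae_unit_cube n : {ae cube_leb n, forall x, @unit_cube R n x}.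
Proof.
exists (~` unit_cube); split => //; first by apply: measurableC; exact: unit_cube_measurable.
have := probability_setC (cube_leb n) (@unit_cube_measurable n).
by move=> ->; rewrite cube_leb_unit subee.
Qed.

Lemma cube_hyperplane n (i : 'I_n) (q : R) : cube_leb n [set x | x 0 i = q] = 0%E.
Proof.
have mset m (j : 'I_m) : measurable [set x : 'rV[R]_m | x 0 j = q].
  rewrite -[X in measurable X]setTI.
  exact: (measurable_mx_entry 0 j measurableT (measurable_set1 q)).
elim: n i => [[] //|n IH] i /=.
rewrite /distribution /pushforward.
case: (unliftP ord0 i) => [k ->|->].
  rewrite (_ : _ @^-1` _ = setT `*` [set x : 'rV[R]_n | x 0 k = q]).
    have IHk : cube_leb n [set x | x 0 k = q] = 0%E by exact: IH.
    rewrite product_measure1E//.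
    apply: (etrans (congr1 (fun t => leb01 setT * t)%E IHk)); exact: mule0.
    exact: mset.
  by apply/seteqP; split => [[a z]|[a z]] /=; rewrite mx_consES; [|case].
rewrite (_ : _ @^-1` _ = [set q] `*` [set: 'rV[R]_n]).
  rewrite product_measure1E//.
  apply: (etrans (congr1 (fun t => t * cube_leb n setT)%E (leb01_set1 q))); exact: mul0e.
by apply/seteqP; split => [[a z]|[a z]] /=; rewrite mx_consE0; [|case].
Qed.

Lemma cube_integrable n (f : 'rV[R]_n -> R) (M : R) :
  measurable_fun setT f -> (forall x, unit_cube x -> `|f x| <= M) ->
  (cube_leb n).-integrable setT (EFin \o f).
Proof.
move=> mf fM; apply/integrableP; split; first exact/measurable_EFinP.
apply: (@le_lt_trans _ _ (\int[cube_leb n]_x (cst `|M|%:E) x)%E).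
  apply: ae_ge0_le_integral => //=.
    by apply: measurableT_comp => //; exact: measurableT_comp.
  apply: filterS (@ae_unit_cube n) => x xc _ /=; rewrite lee_fin.
  exact: le_trans (fM _ xc) (ler_norm _).
rewrite integral_cst// [X in (_ * X)%E](_ : _ = 1%E) ?mule1 ?ltry//.
exact: probability_setT.
Qed.

Definition IX n (f : 'rV[R]_n -> R) : R := \int[cube_leb n]_x f x.

Lemma periodic_intv n (U : Type) (F : 'rV[R]_n -> U) : Defs.periodic F ->
  forall x (k : 'I_n -> int), F (x + \row_i (k i)%:~R) = F x.
Proof.
move=> pF x k.
have pk y i (j : int) : F (y + j%:~R *: unit_vec i) = F y.
  rewrite -[in RHS](addr0 y) -(scale0r (unit_vec i)) -[in LHS](add0r j%:~R).
  apply: (@periodic_int R U (fun s => F (y + s *: unit_vec i))) => s.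
  by rewrite scalerDl scale1r addrA pF.
have -> : \row_i (k i)%:~R = \sum_i (k i)%:~R *: unit_vec i :> 'rV[R]_n.
  by rewrite [LHS]row_sum_delta; apply: eq_bigr => i _; rewrite mxE.
elim: (index_enum _) x => [|i s IH] x; first by rewrite big_nil addr0.
by rewrite big_cons addrA IH pk.
Qed.

(** Adding the bound [M] makes the integrand nonnegative, which reduces the claim to
    [cube_integral_translate]. *)
Lemma IX_translate n (f : 'rV[R]_n -> R) (v : 'rV[R]_n) (M : R) : Defs.periodic f ->
  measurable_fun setT f -> (forall x, `|f x| <= M) ->
  IX (fun x : 'rV[R]_n => f (x + v)) = IX f.
Proof.
move=> pf mf fM.
have mfv : measurable_fun setT (fun x : 'rV[R]_n => f (x + v)).
  exact: (measurableT_comp mf (measurable_translate v)).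
have I1 : (cube_leb n).-integrable setT (EFin \o f) by exact: (cube_integrable mf).
have I2 : (cube_leb n).-integrable setT (EFin \o (fun x : 'rV[R]_n => f (x + v))).
  exact: (cube_integrable mfv).
have IM : (cube_leb n).-integrable setT (EFin \o (fun=> M)).
  exact: finite_measure_integrable_cst.
suff : IX (fun x : 'rV[R]_n => f (x + v) + M) = IX (fun x => f x + M).
  by rewrite /IX !RintegralD// => /addIr.
rewrite /IX /Rintegral; congr fine.
rewrite -[RHS](@cube_integral_translate R n (fun x => (f x + M)%:E) v)//.
- by move=> x i; rewrite pf.
- by apply/measurable_EFinP; exact: measurable_funD.
- by move=> x; rewrite lee_fin; have := fM x; rewrite ler_norml; lra.
Qed.

Lemma periodic_unit_cube n (U : Type) (F : 'rV[R]_n -> U) (x : 'rV[R]_n) :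
  Defs.periodic F -> exists y, unit_cube y /\ F y = F x.
Proof.
move=> pF; exists (x + \row_i (- Num.floor (x 0 i))%:~R); split.
  by move=> i; rewrite !mxE mulrNz; exact: frac_itv.
exact: (periodic_intv pF).
Qed.

Lemma compact_box n (a b : R) : compact [set x : 'rV[R]_n | forall i, a <= x 0 i <= b].
Proof.
have -> : [set x : 'rV[R]_n | forall i, a <= x 0 i <= b] =
    [set x | forall i, `[a, b]%classic (x ord0 i)].
  by apply/seteqP; split => x /= h i; have := h i; rewrite in_itv.
by apply: (@rV_compact _ _ (fun=> `[a, b]%classic)) => _; exact: segment_compact.
Qed.

Lemma compact_bounded_fun (T : topologicalType) (K : set T) (f : T -> R) :
  compact K -> {within K, continuous f} -> exists M : R, forall x, K x -> `|f x| <= M.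
Proof.
move=> cK cf; have /compact_bounded[M [_ /(_ (M + 1))]] := continuous_compact cf cK.
rewrite ltrDl ltr01 => /(_ isT) fM; exists (M + 1) => x Kx.
by apply: fM; exists x.
Qed.

Lemma periodic_bounded n (f : 'rV[R]_n -> R) :
  Defs.periodic f -> continuous f -> exists M : R, forall x, `|f x| <= M.
Proof.
move=> pf cf.
have [M fM] := compact_bounded_fun (@compact_box n 0 1) (continuous_subspaceT cf).
exists M => x; have [y [yc <-]] := periodic_unit_cube x pf.
by apply: fM => i; have /andP[-> /ltW] := yc i.
Qed.

Lemma is_derive_line (V : normedModType R) (f : V -> R) (x v : V) (s l : R) :
  is_derive (x + s *: v) v f l -> is_derive s 1 (fun s => f (x + s *: v)) l.
Proof.
have E : (fun h : R => h^-1 *: (((fun s => f (x + s *: v)) \o shift s) (h *: 1) - f (x + s *: v))) =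
    (fun h : R => h^-1 *: ((f \o shift (x + s *: v)) (h *: v) - f (x + s *: v))).
  apply/funext => h /=; congr (_ *: (f _ - _)).
  by rewrite scaler1 scalerDl addrCA.
by move=> [d1 d2]; split; [rewrite /derivable E|rewrite /derive E].
Qed.

(** Directional derivatives are reduced to derivatives of functions of one real variable, to which
    the chain rule applies. *)
Lemma is_derive_line_inv (V : normedModType R) (f : V -> R) (x v : V) (l : R) :
  is_derive x v f l <-> is_derive (0 : R) 1 (fun s => f (x + s *: v)) l.
Proof.
split; first by move=> h; apply: is_derive_line; rewrite scale0r addr0.
have E : (fun h : R => h^-1 *: (((fun s => f (x + s *: v)) \o shift 0) (h *: 1) - f (x + 0 *: v))) =
    (fun h : R => h^-1 *: ((f \o shift x) (h *: v) - f x)).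
  apply/funext => h /=; rewrite scale0r !addr0; congr (_ *: (f _ - _)).
  by rewrite scaler1 addrC.
by rewrite /derivable /derive; move=> [d1 d2]; split; move: d1 d2; rewrite /derivable /derive E.
Qed.

Lemma derive_periodic n (u : 'rV[R]_n -> R) (v : 'rV[R]_n) :
  Defs.periodic u -> Defs.periodic (fun x => 'D_v u x).
Proof.
move=> pu x j; rewrite /derive.
have -> // : (fun h : R => h^-1 *: ((u \o shift (x + unit_vec j)) (h *: v) - u (x + unit_vec j)))
  = (fun h : R => h^-1 *: ((u \o shift x) (h *: v) - u x)).
by apply/funext => h /=; rewrite addrA !pu.
Qed.

(** The difference quotients of [u] with step [1 / (k + 1)] have integral zero by translation
    invariance. They are bounded by a bound of [g] (mean value theorem) and converge to [g], so
    dominated convergence concludes without boundary terms. *)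
Lemma IX_partial0 n (i : 'I_n) (u g : 'rV[R]_n -> R) :
  Defs.periodic u -> continuous u -> continuous g ->
  (forall x, is_derive x (unit_vec i) u (g x)) -> IX g = 0.
Proof.
move=> pu cu cg dg.
have pg : Defs.periodic g.
  move=> x j; have /@derive_val <- := dg x; have /@derive_val <- := dg (x + unit_vec j).
  exact: derive_periodic.
have [Mu uM] := periodic_bounded pu cu.
have [Mg gM] := periodic_bounded pg cg.
have mu := continuous_mx_measurable cu; have mg := continuous_mx_measurable cg.
pose q (k : nat) (x : 'rV[R]_n) := k.+1%:R * (u (x + k.+1%:R^-1 *: unit_vec i) - u x).
have muk k : measurable_fun setT (fun x : 'rV[R]_n => u (x + k.+1%:R^-1 *: unit_vec i)).
  exact: (measurableT_comp mu (measurable_translate _)).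
have mq k : measurable_fun setT (q k).
  by apply: measurable_funM => //; exact: measurable_funB.
have Iu : (cube_leb n).-integrable setT (EFin \o u) by exact: (cube_integrable mu).
have Iuk k : (cube_leb n).-integrable setT
    (EFin \o (fun x : 'rV[R]_n => u (x + k.+1%:R^-1 *: unit_vec i))).
  exact: (cube_integrable (muk k)).
have qM k x : `|q k x| <= Mg.
  have k0 : (0 : R) < k.+1%:R^-1 by rewrite invr_gt0.
  have dline (s : R) : is_derive s 1 (fun s : R => u (x + s *: unit_vec i)) (g (x + s *: unit_vec i)).
    exact: is_derive_line.
  have cline : {within `[0, k.+1%:R^-1], continuous (fun s : R => u (x + s *: unit_vec i))}.
    apply: derivable_within_continuous => s _; exact: @ex_derive (dline s).
  have [c _] := MVT k0 (fun s _ => dline s) cline.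
  rewrite scale0r addr0 subr0 /q => ->.
  by rewrite mulrCA mulfV ?mulr1.
have q0 k : IX (q k) = 0.
  rewrite /IX RintegralZl//; last exact: RintegrableB.
  by rewrite RintegralB// -!/(IX _) (IX_translate _ pu mu uM) subrr mulr0.
have qg x : (fun k => q k x) @ \oo --> g x.
  have [/cvg_ex[l dl] du] := dg x.
  have := dl; move: du; rewrite /derive; move/cvg_lim : (dl) => -> // <- {dl} dl.
  have h0 : (fun k : nat => (k.+1%:R^-1 : R)) @ \oo --> (0:R)^'.
    move=> P [e /= e0 Pe]; apply: filterS (near_infty_natSinv_lt (PosNum e0)) => k /= ke.
    have k0 : (0 : R) < k.+1%:R^-1 by rewrite invr_gt0.
    by apply: Pe; rewrite /= ?gt_eqF// sub0r normrN gtr0_norm.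
  have := cvg_comp _ _ h0 dl; rewrite (_ : _ \o _ = q ^~ x)//.
  by apply/funext => k /=; rewrite /q invrK (addrC x).
have h : (fun k => IX (q k)) @ \oo --> IX g.
  apply: (@Rdominated_cvg _ _ _ (cube_leb n) setT q g (cst Mg)) => //.
  exact: finite_measure_integrable_cst.
 apply: (cvg_unique _ h) => //; apply: cvg_near_cst; near=> k; exact: q0.
Unshelve. all: by end_near. Qed.

Lemma IX_by_parts n (i : 'I_n) (u v gu gv : 'rV[R]_n -> R) :
  Defs.periodic u -> continuous u -> continuous gu ->
  (forall x, is_derive x (unit_vec i) u (gu x)) ->
  Defs.periodic v -> continuous v -> continuous gv ->
  (forall x, is_derive x (unit_vec i) v (gv x)) ->
  IX (fun x => u x * gv x) = - IX (fun x => gu x * v x).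
Proof.
move=> pu cu cgu du pv cv cgv dv.
have cM (f g : 'rV[R]_n -> R) : continuous f -> continuous g -> continuous (fun x => f x * g x).
  by move=> cf cg x; exact: (cvgM (cf x) (cg x)).
have Ic (f : 'rV[R]_n -> R) : continuous f -> (cube_leb n).-integrable setT (EFin \o f).
  move=> cf; have [M fM] := compact_bounded_fun (@compact_box n 0 1) (continuous_subspaceT cf).
  apply: (cube_integrable (M := M)); first exact: continuous_mx_measurable.
  by move=> x xc; apply: fM => j; have /andP[-> /ltW] := xc j.
have : IX (fun x => u x * gv x + gu x * v x) = 0.
  apply: (@IX_partial0 n i (fun x => u x * v x)).
  - by move=> x j; rewrite pu pv.
  - exact: cM.
  - by move=> x; exact: (cvgD (cM _ _ cu cgv x) (cM _ _ cgu cv x)).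
  - move=> x; have := @is_deriveM _ _ u v x (unit_vec i) _ _ (du x) (dv x).
    by move=> h; apply: is_derive_eq h _; rewrite /GRing.scale/= (mulrC (v x)).
rewrite /IX RintegralD//; [|by apply: Ic; exact: cM..].
by move/eqP; rewrite addr_eq0 => /eqP.
Qed.

End cube_integral.

(** * Trigonometric kernels *)

Section trig.
Context {R : realType} {n : nat}.
Local Notation V := 'rV[R]_n.

(** The algebra of trigonometric polynomials of period 1, given by generators so that closure under
    derivatives is a structural induction. *)
Inductive trig : (V -> R) -> Prop :=
| trig_cst c : trig (fun=> c)
| trig_cos i : trig (fun x => cos (2 * pi * x 0 i))
| trig_sin i : trig (fun x => sin (2 * pi * x 0 i))
| trig_add f g : trig f -> trig g -> trig (fun x => f x + g x)
| trig_mul f g : trig f -> trig g -> trig (fun x => f x * g x).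

Lemma trig_continuous f : trig f -> continuous f.
Proof.
have ca i : continuous (fun x : V => 2 * pi * x 0 i : R).
  by move=> x; exact: (cvgM (cvg_cst _) (@coord_continuous R 1 n 0 i x)).
elim=> [c|i|i|{}f g _ cf _ cg|{}f g _ cf _ cg] x.
- exact: cst_continuous.
- exact: (continuous_comp (ca i x) (@continuous_cos R _)).
- exact: (continuous_comp (ca i x) (@continuous_sin R _)).
- exact: (cvgD (cf x) (cg x)).
- exact: (cvgM (cf x) (cg x)).
Qed.

Lemma trig_periodic f : trig f -> Defs.periodic f.
Proof.
have E (x : V) (i j : 'I_n) : 2 * pi * (x + unit_vec j) 0 i = 2 * pi * x 0 i + (pi *+ 2) *+ (i == j).
  rewrite !mxE eqxx/= mulrDr; congr (_ + _).
  by case: eqP => _; rewrite ?mulr1 ?mulr0 ?mulr0n// mulr1n mulr_natl.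
elim=> [c|i|i|{}f g _ pf _ pg|{}f g _ pf _ pg] x j //.
- by rewrite E; case: eqP => _; rewrite ?addr0 ?mulr1n ?cosD2pi.
- by rewrite E; case: eqP => _; rewrite ?addr0 ?mulr1n ?sinD2pi.
- by rewrite pf pg.
- by rewrite pf pg.
Qed.

Lemma is_derive_lin (W : normedModType R) (l : W -> R) (x v : W) :
  (forall (h : R) y, l (h *: v + y) = h * l v + l y) -> is_derive x v l (l v).
Proof.
move=> ll.
have E : \forall h \near (0:R)^', h^-1 *: ((l \o shift x) (h *: v) - l x) = l v.
  near=> h; have h0 : h != 0 by near: h; exact: nbhs_dnbhs_neq.
  by rewrite /= ll addrK /GRing.scale/= mulrA mulVf// mul1r.
have c : h^-1 *: ((l \o shift x) (h *: v) - l x) @[h --> (0:R)^'] --> l v.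
  by apply: cvg_near_cst.
by split; [apply/cvg_ex; exists (l v)|rewrite /derive; exact/cvg_lim].
Unshelve. all: by end_near. Qed.

Lemma is_derive_comp1 (W : normedModType R) (f : R -> R) (l : W -> R) (x v : W) (a b : R) :
  is_derive (l x) 1 f a -> is_derive x v l b -> is_derive x v (fun y => f (l y)) (a * b).
Proof.
move=> df /is_derive_line_inv dl; apply/is_derive_line_inv.
have df' : is_derive ((fun s : R => l (x + s *: v)) 0) 1 f a by rewrite scale0r addr0.
exact: (@is_derive1_comp R f (fun s : R => l (x + s *: v)) 0 a b df' dl).
Qed.

Lemma is_derive_coord (x v : V) i : is_derive x v (fun y : V => 2 * pi * y 0 i : R) (2 * pi * v 0 i).
Proof. by apply: (@is_derive_lin _ (fun y : V => 2 * pi * y 0 i : R)) => h y; rewrite !mxE; ring. Qed.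

Lemma trig_derive f v : trig f -> exists g, trig g /\ forall x, is_derive x v f (g x).
Proof.
elim=> [c|i|i|{}f g tf [f' [tf' df]] tg [g' [tg' dg]]|{}f g tf [f' [tf' df]] tg [g' [tg' dg]]].
- by exists (fun=> 0); split; [exact: trig_cst|move=> x; exact: is_derive_cst].
- exists (fun x => (- (2 * pi * v 0 i)) * sin (2 * pi * x 0 i)); split.
    by apply: trig_mul; [exact: (trig_cst (- (2 * pi * v 0 i)))|exact: trig_sin].
  move=> x; have := is_derive_comp1 (is_derive_cos _) (is_derive_coord x v i).
  by move=> h; apply: is_derive_eq h _; ring.
- exists (fun x => (2 * pi * v 0 i) * cos (2 * pi * x 0 i)); split.
    by apply: trig_mul; [exact: (trig_cst (2 * pi * v 0 i))|exact: trig_cos].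
  move=> x; have := is_derive_comp1 (is_derive_sin _) (is_derive_coord x v i).
  by move=> h; apply: is_derive_eq h _; ring.
- exists (fun x => f' x + g' x); split; first exact: trig_add.
  by move=> x; exact: (@is_deriveD _ _ _ f g x v _ _ (df x) (dg x)).
- exists (fun x => f x * g' x + g x * f' x); split.
    by apply: trig_add; exact: trig_mul.
  by move=> x; exact: (@is_deriveM _ _ f g x v _ _ (df x) (dg x)).
Qed.

Lemma trig_is_derive f v x : trig f -> is_derive x v f ('D_v f x).
Proof. by move=> /(@trig_derive _ v)[g [_ /(_ x)[h _]]]; exact: derivableP. Qed.

Lemma trig_D f v : trig f -> trig (fun x => 'D_v f x).
Proof.
move=> /(@trig_derive _ v)[g [tg dg]]; rewrite (_ : (fun x => _) = g)//.
by apply/funext => x; have /@derive_val := dg x.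
Qed.

Lemma trig_sum (I : Type) (s : seq I) (f : I -> V -> R) :
  (forall i, trig (f i)) -> trig (fun x => \sum_(i <- s) f i x).
Proof.
move=> tf; elim: s => [|i s IH].
  by under eq_fun do rewrite big_nil; exact: trig_cst.
by under eq_fun do rewrite big_cons; exact: trig_add.
Qed.

Lemma trig_prod (I : Type) (s : seq I) (f : I -> V -> R) :
  (forall i, trig (f i)) -> trig (fun x => \prod_(i <- s) f i x).
Proof.
move=> tf; elim: s => [|i s IH].
  by under eq_fun do rewrite big_nil; exact: trig_cst.
by under eq_fun do rewrite big_cons; exact: trig_mul.
Qed.

Lemma trig_exp f N : trig f -> trig (fun x => f x ^+ N).
Proof.
move=> tf; elim: N => [|N IH]; first by under eq_fun do rewrite expr0; exact: trig_cst.
by under eq_fun do rewrite exprS; exact: trig_mul.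
Qed.

Lemma trig_bounded f : trig f -> exists M : R, forall x, `|f x| <= M.
Proof. by move=> tf; apply: periodic_bounded; [exact: trig_periodic|exact: trig_continuous]. Qed.

Lemma trig_measurable f : trig f -> measurable_fun setT f.
Proof. by move=> tf; apply: continuous_mx_measurable; exact: trig_continuous. Qed.

(** Kernels of finite rank. They form an algebra, so the case of [bumpn] reduces to the addition
    formula for the cosine. *)
Definition degenerate (k : V -> V -> R) := exists (I : finType) (a b : I -> V -> R),
  [/\ forall j, trig (a j), forall j, trig (b j) &
      forall x y, k x y = \sum_j a j x * b j y].

Lemma degenerate_tensor a b : trig a -> trig b -> degenerate (fun x y => a x * b y).
Proof.
by move=> ta tb; exists unit, (fun=> a), (fun=> b); split => // x y; rewrite big_const card_unit /= addr0.
Qed.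

Lemma degenerate_add k1 k2 : degenerate k1 -> degenerate k2 ->
  degenerate (fun x y => k1 x y + k2 x y).
Proof.
move=> [I [a [b [ta tb kE]]]] [J [a' [b' [ta' tb' kE']]]].
exists (I + J)%type, (fun p => match p with inl i => a i | inr j => a' j end),
  (fun p => match p with inl i => b i | inr j => b' j end); split.
- by case.
- by case.
- by move=> x y; rewrite big_sumType/= kE kE'.
Qed.

Lemma degenerate_mul k1 k2 : degenerate k1 -> degenerate k2 ->
  degenerate (fun x y => k1 x y * k2 x y).
Proof.
move=> [I [a [b [ta tb kE]]]] [J [a' [b' [ta' tb' kE']]]].
exists (I * J)%type, (fun p x => a p.1 x * a' p.2 x), (fun p x => b p.1 x * b' p.2 x); split.
- by move=> p; exact: trig_mul.
- by move=> p; exact: trig_mul.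
- move=> x y; rewrite kE kE' big_distrl/= -(pair_bigA _ (fun i j => a i x * a' j x * (b i y * b' j y)))/=.
  by apply: eq_bigr => i _; rewrite big_distrr/=; apply: eq_bigr => j _; ring.
Qed.

Lemma degenerate_prod (I : Type) (s : seq I) (k : I -> V -> V -> R) :
  (forall i, degenerate (k i)) -> degenerate (fun x y => \prod_(i <- s) k i x y).
Proof.
move=> dk; elim: s => [|i s IH].
  have := degenerate_tensor (trig_cst 1) (trig_cst 1); congr degenerate.
  by apply/funext => x; apply/funext => y; rewrite big_nil mulr1.
have := degenerate_mul (dk i) IH; congr degenerate.
by apply/funext => x; apply/funext => y; rewrite big_cons.
Qed.

(** It takes values in [[0, 1]] and equals 1 exactly on the lattice of integer vectors, so its
    normalized powers concentrate there. It also serves as a substitute for the distance on the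
    torus: [bump (x - y)] close to 1 means that [x] and [y] are close modulo the lattice. *)
Definition bump (z : V) : R := \prod_(i < n) ((1 + cos (2 * pi * z 0 i)) / 2).

(* Normalized powers of [bump] form an approximate identity of trigonometric
   polynomials: [bumpn N (x - y)] is a finite sum of products [a x * b y], so
   convolutions with it only involve finitely many moments. *)
Definition bumpn N (z : V) : R := bump z ^+ N / IX (fun z => bump z ^+ N).

Lemma trig_bump : trig bump.
Proof.
apply: trig_prod => i; apply: trig_mul; last exact: trig_cst.
by apply: trig_add; [exact: trig_cst|exact: trig_cos].
Qed.

Lemma trig_bumpn N : trig (bumpn N).
Proof. by apply: trig_mul; [exact: (trig_exp N trig_bump)|exact: trig_cst]. Qed.

Lemma degenerate_bumpn N : degenerate (fun x y => bumpn N (x - y)).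
Proof.
have dcos i : degenerate (fun x y => cos (2 * pi * (x - y) 0 i)).
  have := degenerate_add (degenerate_tensor (trig_cos i) (trig_cos i))
    (degenerate_tensor (trig_sin i) (trig_sin i)); congr degenerate.
  by apply/funext => x; apply/funext => y; rewrite !mxE mulrBr cosB.
have dbump : degenerate (fun x y => bump (x - y)).
  apply: degenerate_prod => i.
  have := degenerate_add (degenerate_tensor (trig_cst 2^-1) (trig_cst 1))
    (degenerate_mul (degenerate_tensor (trig_cst 2^-1) (trig_cst 1)) (dcos i)).
  by congr degenerate; apply/funext => x; apply/funext => y; ring.
have dpow : degenerate (fun x y => bump (x - y) ^+ N).
  elim: N => [|N IH].
    have := degenerate_tensor (trig_cst 1) (trig_cst 1); congr degenerate.
    by apply/funext => x; apply/funext => y; rewrite mulr1.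
  have := degenerate_mul dbump IH; congr degenerate.
  by apply/funext => x; apply/funext => y; rewrite exprS.
have := degenerate_mul dpow (degenerate_tensor (trig_cst (IX (fun z => bump z ^+ N))^-1) (trig_cst 1)).
by congr degenerate; apply/funext => x; apply/funext => y; rewrite mulr1.
Qed.

Lemma bump_ge0 z : 0 <= bump z.
Proof. by apply: prodr_ge0 => i _; have := cos_geN1 (2 * pi * z 0 i); lra. Qed.

Lemma bump_factor_le1 (z : V) i : 0 <= (1 + cos (2 * pi * z 0 i)) / 2 <= 1.
Proof. by have := cos_geN1 (2 * pi * z 0 i); have := cos_le1 (2 * pi * z 0 i); lra. Qed.

Lemma bump_le1 z : bump z <= 1.
Proof. by apply: prodr_ile1 => i _; exact: bump_factor_le1. Qed.

Lemma bump0 : bump 0 = 1.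
Proof. by rewrite /bump big1// => i _; rewrite mxE mulr0 cos0; lra. Qed.

Lemma bumpN z : bump (- z) = bump z.
Proof. by apply: eq_bigr => i _; rewrite mxE mulrN cosN. Qed.

Lemma bumpnN N z : bumpn N (- z) = bumpn N z.
Proof. by rewrite /bumpn bumpN. Qed.

Lemma bump_le_factor z i : bump z <= (1 + cos (2 * pi * z 0 i)) / 2.
Proof.
rewrite /bump (bigD1 i)//=; have /andP[f0 f1] := bump_factor_le1 z i.
by rewrite ler_piMr//; apply: prodr_ile1 => j _; exact: bump_factor_le1.
Qed.

Lemma bump_pow_integrable N : (cube_leb n).-integrable setT (EFin \o (fun z => bump z ^+ N)).
Proof.
apply: (cube_integrable (M := 1)); first exact: trig_measurable (trig_exp N trig_bump).
move=> x _; rewrite ger0_norm ?exprn_ge0 ?bump_ge0//.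
by rewrite exprn_ile1 ?bump_ge0 ?bump_le1.
Qed.

Lemma bump_gt_measurable (c : R) : measurable [set z | c < bump z].
Proof.
rewrite -[X in measurable X]setTI.
have := trig_measurable trig_bump => /(_ measurableT `]c, +oo[%classic).
rewrite (_ : _ @^-1` _ = [set z | c < bump z]); first by apply; exact: measurable_itv.
by apply/seteqP; split => x /=; rewrite in_itv/= andbT.
Qed.

Lemma bump_near1_pos (c : R) : c < 1 -> (0 < cube_leb n [set z | (c < bump z)%R])%E.
Proof.
move=> c1.
have : nbhs (0 : V) [set z | c < bump z].
  have b0 : bump @ (0 : V) --> bump 0 by exact: (trig_continuous trig_bump).
  apply: (b0 [set y | c < y]); rewrite bump0.
  by apply: open_nbhs_nbhs; split => //; exact: open_gt.
move=> /nbhs_ballP[q /= q0 qz].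
have mq : 0 < Num.min q 1 <= 1 by rewrite lt_min q0 ltr01 ge_min lexx orbT.
apply: lt_le_trans (cube_leb_small_box n mq) _; apply: le_measure.
- rewrite inE (_ : [set x | _] = [set x : V | forall i, `[0, Num.min q 1[%classic (x 0 i)]).
    by apply: measurable_box; exact: measurable_itv.
  by apply/seteqP; split => x /= h i; have := h i; rewrite in_itv.
- by rewrite inE; exact: bump_gt_measurable.
- move=> x /= h; apply: qz; rewrite /ball/=; split => // i j; rewrite (ord1 i).
  have /andP[h0 h1] := h j; rewrite /ball/= mxE sub0r normrN ger0_norm//.
  by rewrite (lt_le_trans h1)// ge_min lexx.
Qed.

Lemma IX_ge0 (f : V -> R) : (forall x, 0 <= f x) -> 0 <= IX f.
Proof. by move=> f0; apply: Rintegral_ge0. Qed.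

Lemma bump_pow_lower (c : R) N : 0 <= c < 1 ->
  c ^+ N * fine (cube_leb n [set z | c < bump z]) <= IX (fun z => bump z ^+ N).
Proof.
move=> /andP[c0 c1].
have mc := bump_gt_measurable c.
rewrite -Rintegral_cst//.
apply: (@le_trans _ _ (\int[cube_leb n]_(x in [set z | c < bump z]) (bump x ^+ N))).
  apply: le_Rintegral => //.
  - exact: finite_measure_integrable_cst.
  - exact: (integrableS measurableT mc _ (bump_pow_integrable N)).
  - by move=> x /= cx; rewrite lerXn2r ?nnegrE ?bump_ge0// ltW.
rewrite /IX Rintegral_mkcond; apply: le_Rintegral => //.
- rewrite -restrict_EFin; apply/integrable_restrict => //; rewrite setTI.
  exact: (integrableS measurableT mc _ (bump_pow_integrable N)).
- exact: bump_pow_integrable.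
- by move=> x _; rewrite patchE; case: ifPn => // _; rewrite exprn_ge0// bump_ge0.
Qed.

Lemma bump_pow_gt0 N : 0 < IX (fun z => bump z ^+ N).
Proof.
apply: (lt_le_trans _ (@bump_pow_lower 2^-1 N _)); last lra.
rewrite mulr_gt0 ?exprn_gt0// fine_gt0// bump_near1_pos; last lra.
by rewrite ltey_eq fin_num_measure//; exact: bump_gt_measurable.
Qed.

Lemma bumpn_ge0 N z : 0 <= bumpn N z.
Proof. by rewrite divr_ge0 ?exprn_ge0 ?bump_ge0// ltW// bump_pow_gt0. Qed.

Lemma IX_bumpn N (y : V) : IX (fun x => bumpn N (x - y)) = 1.
Proof.
have [M bM] := trig_bounded (trig_bumpn N).
rewrite (IX_translate (- y) (trig_periodic (trig_bumpn N)) (trig_measurable (trig_bumpn N)) bM).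
rewrite /IX RintegralZr//; last exact: bump_pow_integrable.
by rewrite divff// gt_eqF// bump_pow_gt0.
Qed.

(** The bound of the kernel [bumpn N] on the set where [bump] is at most [c]. *)
Definition tail (c : R) N := c ^+ N / IX (fun z => bump z ^+ N).

Lemma bumpn_tail (c : R) N z : bump z <= c -> bumpn N z <= tail c N.
Proof.
move=> zc; rewrite /bumpn /tail ler_wpM2r//; first by rewrite invr_ge0 ltW// bump_pow_gt0.
by rewrite lerXn2r ?nnegrE ?bump_ge0// (le_trans (bump_ge0 z)).
Qed.

Lemma tail_ge0 (c : R) N : 0 <= c -> 0 <= tail c N.
Proof. by move=> c0; rewrite divr_ge0 ?exprn_ge0// ltW// bump_pow_gt0. Qed.

(** With [e] halfway between [c] and 1, the normalizing integral is at least [e ^+ N] times the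
    positive measure [mu] of the set where [bump] exceeds [e]. Hence the tail is at most
    [(c / e) ^+ N / mu]. *)
Lemma tail_cvg0 (c : R) : 0 <= c < 1 -> tail c @ \oo --> 0.
Proof.
move=> /andP[c0 c1]; pose e := (1 + c) / 2.
have e01 : 0 <= e < 1 by rewrite /e; lra.
have e0 : 0 < e by rewrite /e; lra.
pose mu := fine (cube_leb n [set z | e < bump z]).
have mu0 : 0 < mu.
  rewrite fine_gt0// bump_near1_pos//; last by case/andP: e01.
  by rewrite ltey_eq fin_num_measure//; exact: bump_gt_measurable.
apply: (@squeeze_cvgr _ _ _ _ (cst 0) (fun N => (c / e) ^+ N * mu^-1)).
- apply: nearW => N; rewrite tail_ge0//= /tail expr_div_n -mulrA -invfM.
  rewrite ler_wpM2l ?exprn_ge0// lef_pV2 ?posrE ?bump_pow_gt0 ?mulr_gt0 ?exprn_gt0//.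
  exact: bump_pow_lower.
- exact: cvg_cst.
- rewrite -[X in _ --> X](mul0r mu^-1); apply: cvgM; last exact: cvg_cst.
  apply: cvg_expr; rewrite ger0_norm; last by rewrite divr_ge0// ltW.
  by rewrite ltr_pdivrMr// mul1r /e; lra.
Qed.

End trig.

(** * Smooth cutoffs *)

Section smooth_functions.
Context {R : realType}.

Section Ck_closure.
Context {V : normedModType R}.
Implicit Types f g : V -> R.

Lemma CkSP k f : Ck k.+1 f <-> continuous f /\
  forall v, exists g, (forall x, is_derive x v f (g x)) /\ Ck k g.
Proof.
rewrite /Ck /= interiorT; split=> -[cf h]; split.
- exact: (continuous_subspace_setT f).2.
- by move=> v; have [g [dg Cg]] := h v; exists g; split => // x; exact: dg.
- exact: (continuous_subspace_setT f).1.
- by move=> v; have [g [dg Cg]] := h v; exists g; split => // x _; exact: dg.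
Qed.

Lemma Ck0P f : Ck 0 f <-> continuous f.
Proof.
rewrite /Ck /=; split => [[cf _]|cf]; first exact: (continuous_subspace_setT f).2.
by split => //; exact: (continuous_subspace_setT f).1.
Qed.

Lemma Ck_continuous k f : Ck k f -> continuous f.
Proof. by case: k => [/Ck0P//|k /CkSP[]]. Qed.

Lemma Ck_le k f : Ck k.+1 f -> Ck k f.
Proof.
elim: k f => [|k IH] f /CkSP[cf h]; first exact/Ck0P.
apply/CkSP; split => // v; have [g [dg Cg]] := h v; exists g; split => //; exact: IH.
Qed.

Lemma Ck_cst k (c : R) : Ck k (fun _ : V => c).
Proof.
elim: k c => [|k IH] c; first by apply/Ck0P => x; exact: cvg_cst.
apply/CkSP; split; first by move=> x; exact: cvg_cst.
by move=> v; exists (fun=> 0); split => // x; exact: is_derive_cst.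
Qed.

Lemma Ck_add k f g : Ck k f -> Ck k g -> Ck k (fun x => f x + g x).
Proof.
elim: k f g => [|k IH] f g.
  by move=> /Ck0P cf /Ck0P cg; apply/Ck0P => x; exact: (cvgD (cf x) (cg x)).
move=> /CkSP[cf hf] /CkSP[cg hg]; apply/CkSP; split.
  by move=> x; exact: (cvgD (cf x) (cg x)).
move=> v; have [f' [df Cf']] := hf v; have [g' [dg Cg']] := hg v.
exists (fun x => f' x + g' x); split; last exact: IH.
by move=> x; exact: (@is_deriveD _ _ _ f g x v _ _ (df x) (dg x)).
Qed.

Lemma Ck_mul k f g : Ck k f -> Ck k g -> Ck k (fun x => f x * g x).
Proof.
elim: k f g => [|k IH] f g.
  by move=> /Ck0P cf /Ck0P cg; apply/Ck0P => x; exact: (cvgM (cf x) (cg x)).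
move=> Cf Cg; move/CkSP : (Cf) => [cf hf]; move/CkSP : (Cg) => [cg hg]; apply/CkSP; split.
  by move=> x; exact: (cvgM (cf x) (cg x)).
move=> v; have [f' [df Cf']] := hf v; have [g' [dg Cg']] := hg v.
exists (fun x => f x * g' x + g x * f' x); split.
  by move=> x; exact: (@is_deriveM _ _ f g x v _ _ (df x) (dg x)).
by apply: Ck_add; apply: IH => //; exact: Ck_le.
Qed.

Lemma is_deriveVr f (x v : V) l : f x != 0 -> is_derive x v f l ->
  is_derive x v (fun y => (f y)^-1) (- (f x ^- 2 * l)).
Proof.
move=> fx0 [df dl]; split; first exact: derivableV.
by rewrite deriveV// dl scaleNr.
Qed.

Lemma Ck_inv k f : (forall x, f x != 0) -> Ck k f -> Ck k (fun x => (f x)^-1).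
Proof.
move=> f0; elim: k => [|k IH].
  by move=> /Ck0P cf; apply/Ck0P => x; exact: (cvgV (f0 x) (cf x)).
move=> Cf; move/CkSP : (Cf) => [cf hf]; apply/CkSP; split.
  by move=> x; exact: (cvgV (f0 x) (cf x)).
move=> v; have [f' [df Cf']] := hf v.
exists (fun x => (-1) * (((f x)^-1 * (f x)^-1) * f' x)); split.
  move=> x; have := is_deriveVr (f0 x) (df x); move=> h; apply: is_derive_eq h _.
  by rewrite mulN1r -expr2 exprVn.
have Cif := IH (Ck_le Cf).
by apply: Ck_mul; [exact: Ck_cst|apply: Ck_mul => //; exact: Ck_mul].
Qed.

(** The map [l] is affine with linear part [l v - l 0]. The sequence [F] lists the successive
    derivatives of a function of one variable. *)
Lemma Ck_comp1 (F : nat -> R -> R) (l : V -> R) k j :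
  (forall i (x : R), is_derive x 1 (F i) (F i.+1 x)) ->
  continuous l -> (forall x v, is_derive x v l (l v - l 0)) ->
  Ck k (fun x => F j (l x)).
Proof.
move=> dF cl dl.
have cF i : continuous (F i).
  move=> x; apply: differentiable_continuous; apply/derivable1_diffP.
  exact: @ex_derive (dF i x).
have cFl i : continuous (fun x => F i (l x)).
  by move=> x; exact: (continuous_comp (cl x) (cF i _)).
elim: k j => [|k IH] j; first exact/Ck0P.
apply/CkSP; split => // v; exists (fun x => F j.+1 (l x) * (l v - l 0)); split.
  by move=> x; exact: is_derive_comp1 (dF j _) (dl x v).
by apply: Ck_mul; [exact: IH|exact: Ck_cst].
Qed.

End Ck_closure.

(* The functions [p(1/x) exp(-1/x)] are stable under differentiation. *)
Definition flat (p : {poly R}) (x : R) : R :=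
  if 0 < x then p.[x^-1] * expR (- x^-1) else 0.

Definition flatD (p : {poly R}) : {poly R} := 'X^2 * (p - p^`()).

(** With [u = 1 / x], the exponential is at most [(N + 1)! / u ^ (N + 1)], one power more than the
    growth of the polynomial. The remaining factor [x] gives continuity and differentiability at
    0. *)
Lemma flat_le (p : {poly R}) : exists C : R, forall x, 0 < x <= 1 -> `|flat p x| <= C * x.
Proof.
pose N := size p.
pose C := (\sum_(i < N) `|p`_i|) * N.+1`!%:R.
exists C => x /andP[x0 x1]; rewrite /flat x0.
have u1 : 1 <= x^-1 by rewrite -invr1 lef_pV2 ?posrE.
have u0 : 0 < x^-1 by rewrite invr_gt0.
have pb : `|p.[x^-1]| <= (\sum_(i < N) `|p`_i|) * x^-1 ^+ N.
  rewrite horner_coef mulr_suml; apply: le_trans (ler_norm_sum _ _ _) _.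
  apply: ler_sum => i _; rewrite normrM ler_wpM2l//.
  rewrite ger0_norm; last by rewrite exprn_ge0// ltW.
  by apply: ler_weXn2l => //; exact: ltnW.
have eb : expR (- x^-1) <= N.+1`!%:R * x * x ^+ N.
  have := @expR_ge1Dxn R x^-1 N (ltW u0); rewrite expRN => h.
  have q0 : 0 < x^-1 ^+ N.+1 / N.+1`!%:R by rewrite divr_gt0 ?exprn_gt0// ltr0n fact_gt0.
  have -> : N.+1`!%:R * x * x ^+ N = (x^-1 ^+ N.+1 / N.+1`!%:R)^-1.
    by rewrite invf_div exprVn invrK exprS mulrA.
  by rewrite lef_pV2 ?posrE ?expR_gt0//; lra.
rewrite normrM (ger0_norm (expR_ge0 _)).
apply: le_trans; first exact: (ler_pM (normr_ge0 _) (expR_ge0 _) pb eb).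
rewrite /C le_eqVlt; apply/orP; left; apply/eqP.
have : x^-1 ^+ N * x ^+ N = 1 by rewrite -exprMn mulVf ?expr1n ?gt_eqF.
set a := \sum_(i < N) _; set b := _ `!%:R; set c := x^-1 ^+ N; set e := x ^+ N => ce.
by transitivity ((a * b * x) * (c * e)); [ring|rewrite ce mulr1].
Qed.

Lemma is_derive_flat p (x : R) : is_derive x 1 (flat p) (flat (flatD p) x).
Proof.
have [x0|x0|->] := ltgtP x 0.
- rewrite [flat (flatD p) x]/flat (lt_gtF x0).
  have E : \forall y \near x, cst 0 y = flat p y.
    by near=> y; rewrite /flat ifF//; apply/negbTE; rewrite -leNgt ltW//; near: y; exact: lt_nbhsl.
  exact: (near_eq_is_derive E (is_derive_cst _ _ _)).
- rewrite [flat (flatD p) x]/flat x0.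
  have E : \forall y \near x, p.[y^-1] * expR (- y^-1) = flat p y.
    by near=> y; rewrite /flat ifT//; near: y; exact: lt_nbhsr.
  apply: (near_eq_is_derive E).
  have xn0 : x != 0 by rewrite gt_eqF.
  have dV : is_derive x 1 (fun y : R => y^-1) (- (x ^- 2)).
    by have := @is_deriveVr R^o id x 1 1 xn0 (is_derive_id _ _); rewrite mulr1.
  have dp : is_derive (x^-1) 1 (fun y => p.[y]) (p^`()).[x^-1] by exact: is_derive_poly.
  have d1 : is_derive x 1 (fun y => p.[y^-1]) ((p^`()).[x^-1] * - (x ^- 2)).
    exact: (@is_derive1_comp R (fun y => p.[y]) (fun y => y^-1) x _ _ dp dV).
  have dN : is_derive x 1 (fun y : R => - y^-1) (x ^- 2).
    by have := is_deriveN dV; rewrite opprK.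
  have d2 : is_derive x 1 (fun y => expR (- y^-1)) (expR (- x^-1) * x ^- 2).
    exact: (@is_derive1_comp R expR (fun y => - y^-1) x _ _ (is_derive_expR _) dN).
  have := @is_deriveM _ _ _ _ x 1 _ _ d1 d2; move=> h; apply: is_derive_eq h _.
  rewrite /flatD hornerM hornerXn hornerD hornerN /GRing.scale/= exprVn; ring.
(* At 0 the difference quotient of [flat p] is [flat ('X * p)], which tends to 0 by the linear
   bound. *)
- have [C fC] := flat_le p; have [C' fC'] := flat_le ('X * p).
  rewrite [flat (flatD p) 0]/flat ltxx.
  have lim0 : h^-1 *: ((flat p \o shift 0) (h *: 1) - flat p 0) @[h --> (0:R)^'] --> (0 : R).
    have E : forall h : R, h != 0 -> h^-1 *: ((flat p \o shift 0) (h *: 1) - flat p 0) = flat ('X * p) h.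
      move=> h h0; rewrite /= addr0 scaler1 {2}/flat ltxx subr0 /flat; case: ifPn => hp.
        by rewrite hornerM hornerX /GRing.scale/= mulrA.
      by rewrite scaler0.
    apply/cvgrPdist_lt => e e0.
    have D0 : 0 < `|C'| + 1 by rewrite ltr_wpDl.
    have ed0 : 0 < Num.min 1 (e / (`|C'| + 1)) by rewrite lt_min ltr01 divr_gt0.
    near=> h.
    have h0 : h != 0 by near: h; exact: nbhs_dnbhs_neq.
    rewrite E// sub0r normrN.
    have : `|h| < Num.min 1 (e / (`|C'| + 1)).
      near: h; apply: nbhs_dnbhs; exists (Num.min 1 (e / (`|C'| + 1))) => //= y.
      by rewrite /= sub0r normrN.
    rewrite lt_min => /andP[h1 he].
    have [hpos|hneg] := ltP 0 h; last by rewrite /flat (ltNge 0 h) hneg/= normr0.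
    rewrite gtr0_norm// in h1 he.
    apply: le_lt_trans (fC' h _) _; first by rewrite hpos ltW.
    rewrite ltr_pdivlMr// in he.
    by apply: le_lt_trans he; rewrite mulrC ler_pM2l//; have := ler_norm C'; lra.
  by split; [apply/cvg_ex; exists 0|rewrite /derive; exact/cvg_lim].
Unshelve. all: by end_near. Qed.

Definition step (x : R) : R := flat 1 x / (flat 1 x + flat 1 (1 - x)).

Lemma flat_ge0 x : 0 <= flat 1 x.
Proof. by rewrite /flat; case: ifP => // _; rewrite hornerC mul1r expR_ge0. Qed.

Lemma flat_gt0 x : (0 < flat 1 x) = (0 < x).
Proof. by rewrite /flat; case: ifP => x0; rewrite ?ltxx// hornerC mul1r expR_gt0. Qed.

Lemma step_den x : flat 1 x + flat 1 (1 - x) != 0.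
Proof.
rewrite gt_eqF//; have [x0|x0] := ltP 0 x.
  by rewrite ltr_pwDl ?flat_ge0// flat_gt0.
by rewrite ltr_wpDl ?flat_ge0// flat_gt0; lra.
Qed.

Lemma step_le0 x : x <= 0 -> step x = 0.
Proof. by move=> x0; rewrite /step {1}/flat ltNge x0 mul0r. Qed.

Lemma step_ge1 x : 1 <= x -> step x = 1.
Proof.
move=> x1; rewrite /step [flat 1 (1 - x)]/flat ifF; last by apply/negbTE; rewrite -leNgt; lra.
by rewrite addr0 divff// gt_eqF// flat_gt0; lra.
Qed.

Lemma step_01 x : 0 <= step x <= 1.
Proof.
have h := step_den x; have h0 : 0 < flat 1 x + flat 1 (1 - x).
  by rewrite lt_neqAle eq_sym h addr_ge0 ?flat_ge0.
apply/andP; split; first by rewrite divr_ge0 ?flat_ge0// ltW.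
by rewrite /step ler_pdivrMr// mul1r lerDl flat_ge0.
Qed.

Lemma smooth_step (V : normedModType R) (l : V -> R) :
  continuous l -> (forall x v, is_derive x v l (l v - l 0)) -> smooth (fun x => step (l x)).
Proof.
move=> cl dl k.
have Cf (l' : V -> R) : continuous l' -> (forall x v, is_derive x v l' (l' v - l' 0)) ->
    Ck k (fun x => flat 1 (l' x)).
  move=> cl' dl'; apply: (@Ck_comp1 V (fun j => flat (iter j flatD 1)) l' k 0) => // i x.
  by rewrite iterS; exact: is_derive_flat.
have C1 := Cf _ cl dl.
have C2 : Ck k (fun x => flat 1 (1 - l x)).
  apply: (Cf (fun x => 1 - l x)).
    by move=> x; exact: (cvgB (cvg_cst _) (cl x)).
  move=> x v; have := @is_deriveB _ _ _ (cst (1:R)) l x v _ _ (is_derive_cst _ _ _) (dl x v).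
  by move=> h; apply: is_derive_eq h _; rewrite sub0r; ring.
apply: Ck_mul => //; apply: Ck_inv; last exact: Ck_add.
by move=> x; exact: step_den.
Qed.

Lemma step_derive : exists (s : R -> R) (C : R), [/\ continuous s,
  forall x : R, is_derive x 1 step (s x), forall x, `|s x| <= C &
  forall x, ~~ (0 < x < 1) -> s x = 0].
Proof.
have sm : smooth step.
  apply: (@smooth_step R id) => //; first by move=> x.
  by move=> x v; rewrite subr0; exact: is_derive_id.
have /CkSP[_ /(_ 1)[s [ds /Ck0P cs]]] := sm 1%N.
have s0 x : ~~ (0 < x < 1) -> s x = 0.
  have out y : (y < 0) || (1 < y) -> s y = 0.
    move=> y01; have /@derive_val <- := ds y.
    case/orP : y01 => y0.
      have E : \forall z \near y, cst 0 z = step z.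
        by near=> z; rewrite step_le0// ltW//; near: z; exact: lt_nbhsl.
      by have /@derive_val := near_eq_is_derive E (is_derive_cst (0:R) y (1:R)).
    have E : \forall z \near y, cst 1 z = step z.
      by near=> z; rewrite step_ge1// ltW//; near: z; exact: lt_nbhsr.
    by have /@derive_val := near_eq_is_derive E (is_derive_cst (1:R) y (1:R)).
  (* The end points 0 and 1 remain: if [s] were nonzero there, it would by continuity be nonzero at
     nearby points outside the interval. *)
  rewrite negb_and -!leNgt => /orP x01; apply/eqP/negP => /negP sx.
  have : \forall y \near x, s y != 0.
    by apply: (cs x [set y | y != 0]); apply: open_nbhs_nbhs; split => //; exact: open_neq.
  move=> /nbhs_ballP[e /= e0 he].
  case: x01 => x01.
    have : s (x - e / 2) != 0.
      by apply: he; rewrite /ball/= opprB addrC subrK ger0_norm ?divr_ge0 ?ltW// ltr_pdivrMr// ltr_pMr// ltr1n.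
    by rewrite out ?eqxx//; apply/orP; left; lra.
  have : s (x + e / 2) != 0.
    apply: he; rewrite /ball/= opprD addrA subrr sub0r normrN.
    by rewrite ger0_norm ?divr_ge0 ?ltW// ltr_pdivrMr// ltr_pMr// ltr1n.
  by rewrite out ?eqxx//; apply/orP; right; lra.
have [C sC] := @compact_bounded_fun R R `[0, 1] s (@segment_compact _ _ _) (continuous_subspaceT cs).
exists s, `|C|; split => // x; have [x01|/negP x01] := boolP (0 <= x <= 1).
  by apply: (le_trans (sC x _)) => //=; exact: ler_norm.
rewrite s0 ?normr0//; apply/negP => /andP[x0 x1]; apply: x01.
by rewrite !ltW.
Unshelve. all: by end_near. Qed.

End smooth_functions.

(** * Convex Hamiltonians *)

Section convex.
Context {R : realType}.

Lemma derive_le_slope (F : R -> R) (l K : R) : is_derive (0 : R) 1 F l ->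
  (forall s, 0 < s < 1 -> F s - F 0 <= s * K) -> l <= K.
Proof.
move=> [dF <-] FK; rewrite leNgt; apply/negP => Kl.
have : h^-1 *: ((F \o shift 0) (h *: 1) - F 0) @[h --> (0:R)^'] --> 'D_1 F 0 by exact: dF.
move=> /(_ [set y | K < y]) /(_ (lt_nbhsr Kl)) [e /= e0 he].
pose h := Num.min (e / 2) (1 / 2).
have h0 : 0 < h by rewrite lt_min !divr_gt0.
have he2 : h < e.
  by rewrite (@le_lt_trans _ _ (e / 2))// ?ge_min ?lexx// ltr_pdivrMr// ltr_pMr// ltr1n.
have h1 : h < 1 by rewrite (@le_lt_trans _ _ (1 / 2)) ?ge_min ?lexx ?orbT//; lra.
have := he h; rewrite /= sub0r normrN gtr0_norm// => /(_ he2); rewrite gt_eqF// => /(_ isT).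
rewrite addr0 scaler1 /GRing.scale/= mulrC ltr_pdivlMr// mulrC ltNge => /negP; apply.
by apply: FK; rewrite h0.
Qed.

Lemma derive_ge_slope (F : R -> R) (l K : R) : is_derive (0 : R) 1 F l ->
  (forall s, 0 < s < 1 -> s * K <= F s - F 0) -> K <= l.
Proof.
move=> dF FK; rewrite -lerN2; have dN := fderiveN dF.
apply: (derive_le_slope dN) => s s01 /=.
rewrite mulrN -opprB opprK addrC lerN2; exact: FK.
Qed.

Context {n : nat}.
Local Notation V := 'rV[R]_n.

Definition convexR (G : V -> R) := forall p q s, 0 <= s <= 1 ->
  G (s *: p + (1 - s) *: q) <= s * G p + (1 - s) * G q.

Variable G : V -> R.
Hypothesis cG : convexR G.

Lemma convex_slope p w s : 0 <= s <= 1 -> G (p + s *: w) - G p <= s * (G (p + w) - G p).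
Proof.
move=> s01; have := cG (p + w) p s01.
have -> : s *: (p + w) + (1 - s) *: p = p + s *: w.
  by apply/rowP => i; rewrite !mxE; ring.
lra.
Qed.

Lemma convex_avg k (v : 'I_k.+1 -> V) :
  G (k.+1%:R^-1 *: \sum_i v i) <= k.+1%:R^-1 * \sum_i G (v i).
Proof.
elim: k v => [|k IH] v; first by rewrite !big_ord1 invr1 scale1r mul1r.
rewrite [\sum_(i < k.+2) v i]big_ord_recr [\sum_(i < k.+2) G (v i)]big_ord_recr /=.
pose s : R := k.+1%:R / k.+2%:R.
have k1 : (0 : R) < k.+1%:R by rewrite ltr0n.
have k2 : (0 : R) < k.+2%:R by rewrite ltr0n.
have kk : k.+2%:R = k.+1%:R + 1 :> R by rewrite -natr1.
have s01 : 0 <= s <= 1.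
  apply/andP; split; first by rewrite divr_ge0// ltW.
  by rewrite /s ler_pdivrMr// mul1r kk; lra.
have s1 : 1 - s = k.+2%:R^-1.
  have k2n : (k.+2%:R : R) != 0 by rewrite gt_eqF.
  by apply: (mulIf k2n); rewrite mulrBl mul1r /s divfK// mulVf// kk; ring.
have := cG (k.+1%:R^-1 *: \sum_(i < k.+1) v (widen_ord (leqnSn k.+1) i)) (v ord_max) s01.
have -> : s *: (k.+1%:R^-1 *: \sum_(i < k.+1) v (widen_ord (leqnSn k.+1) i)) + (1 - s) *: v ord_max
  = k.+2%:R^-1 *: (\sum_(i < k.+1) v (widen_ord (leqnSn k.+1) i) + v ord_max).
  by rewrite s1 scalerA scalerDr /s mulrAC mulfV ?gt_eqF// mul1r.
move=> /le_trans; apply; rewrite s1 mulrDr lerD2r.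
apply: (@le_trans _ _ (s * (k.+1%:R^-1 * \sum_(i < k.+1) G (v (widen_ord (leqnSn k.+1) i))))).
  by apply: ler_wpM2l; [case/andP: s01|exact: IH].
by rewrite /s [_ / _]mulrC -mulrA mulVKf ?gt_eqF.
Qed.

End convex.

Section convex_gradient.
Context {R : realType} {n : nat}.
Local Notation V := 'rV[R]_n.+1.
Variable G : V -> R.
Hypothesis cG : convexR G.

(** The point [p + w] is the average of the [n + 1] points obtained from [p] by moving [n + 1] times
    each coordinate of [w] separately. A convex function is thus controlled by its values along the
    axes, where partial derivatives give information. *)
Lemma convex_avg_coord p (w : V) :
  G (p + w) <= n.+1%:R^-1 * \sum_i G (p + (n.+1%:R * w 0 i) *: unit_vec i).
Proof.
have N0 : (n.+1%:R : R) != 0 by rewrite pnatr_eq0.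
have := convex_avg cG (fun i => p + (n.+1%:R * w 0 i) *: unit_vec i).
have -> : \sum_i (p + (n.+1%:R * w 0 i) *: unit_vec i) = n.+1%:R *: (p + w).
  rewrite big_split/= sumr_const card_ord scalerDr scaler_nat; congr (_ + _).
  rewrite {2}[w]row_sum_delta scaler_sumr; apply: eq_bigr => i _.
  by rewrite scalerA.
by rewrite scalerA mulVf// scale1r.
Qed.

(** Only partial derivatives are available, so the supporting hyperplane is not obtained by
    differentiating along [q - p]. Instead [F s] dominates [G] at [p - s w] and has a derivative at
    0 computed from the partial derivatives, while convexity along the line bounds [G] from below at
    [p - s w] by means of [G p] and [G q]. *)
Lemma convex_gradient p q : (forall i, derivable G p (unit_vec i)) ->
  G p + dot (q - p) (grad G p) <= G q.
Proof.
move=> dG; set w := q - p.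
have N0 : (n.+1%:R : R) != 0 by rewrite pnatr_eq0.
pose c i := - (n.+1%:R * w 0 i).
pose F (s : R) := n.+1%:R^-1 * \sum_i G (p + (s * c i) *: unit_vec i).
have dF : is_derive (0 : R) 1 F (n.+1%:R^-1 * \sum_i (c i * partial i G p)).
  have dFi i : is_derive (0 : R) 1 (fun s : R => G (p + (s * c i) *: unit_vec i)) (c i * partial i G p).
    have d1 : is_derive (0 * c i : R) 1 (fun s : R => G (p + s *: unit_vec i)) (partial i G p).
      by apply: is_derive_line; rewrite mul0r scale0r addr0; exact: derivableP.
    have d2 : is_derive (0 : R) 1 (fun s : R => s * c i) (c i).
      have := fderiveM (is_derive_id (0 : R) 1) (fderive_cst (c i) (0 : R) 1).
      by move=> h; apply: is_derive_eq h _; rewrite mul0r add0r mul1r.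
    have := @is_derive1_comp R (fun s : R => G (p + s *: unit_vec i)) (fun s => s * c i) 0 _ _ d1 d2.
    by rewrite mulrC.
  exact: (fderiveZ (n.+1%:R^-1) (fderive_sum _ dFi)).
have F0 : F 0 = G p.
  rewrite /F (eq_bigr (fun=> G p)) => [|i _]; last by rewrite mul0r scale0r addr0.
  by rewrite sumr_const card_ord -(mulr_natl (G p)) mulrA mulVf// mul1r.
have : - (G q - G p) <= n.+1%:R^-1 * \sum_i (c i * partial i G p).
  apply: (derive_ge_slope dF) => s /andP[s0 s1]; rewrite F0.
  have h1 : G (p + s *: (- w)) <= F s.
    have := convex_avg_coord p (s *: (- w)); move=> /le_trans; apply.
    rewrite /F ler_pM2l ?invr_gt0 ?ltr0n//; apply: ler_sum => i _.
    by rewrite [(s *: - w) 0 i]mxE [(- w) 0 i]mxE /c !mulrN mulrCA.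
  (* The point [p] lies between [p - s w] and [q = p + w], at the fraction [s / (1 + s)] of the
     way. *)
  have := convex_slope cG (p + s *: (- w)) ((1 + s) *: w) (_ : 0 <= s / (1 + s) <= 1).
  have s1n : 1 + s != 0 by rewrite gt_eqF//; lra.
  rewrite (_ : p + s *: - w + (s / (1 + s)) *: ((1 + s) *: w) = p); last first.
    by rewrite scalerA divfK// scalerN subrK.
  rewrite (_ : p + s *: - w + (1 + s) *: w = q); last first.
    by rewrite scalerDl scale1r scalerN addrACA addNr addr0 /w addrC subrK.
  have s01 : 0 <= s / (1 + s) <= 1.
    by apply/andP; split; [rewrite divr_ge0//; lra|rewrite ler_pdivrMr; lra].
  move=> /(_ s01).
  set A := G (p + s *: - w) in h1 *; move=> h2.
  have : (G p - A) * (1 + s) <= s * (G q - A).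
    by move: h2; rewrite mulrAC ler_pdivlMr//; lra.
  move=> h3; apply: le_trans (_ : A - G p <= _); last by rewrite lerD2r.
  lra.
rewrite (_ : _ * _ = - dot w (grad G p)); first lra.
rewrite /dot -sumrN mulr_sumr; apply: eq_bigr => i _.
by rewrite /c [grad _ _ 0 i]mxE mulNr mulrN mulrA mulrA mulVf// mul1r.
Qed.

Lemma convex_partial_bound p i (s : R) : derivable G p (unit_vec i) ->
  s * partial i G p <= G (p + s *: unit_vec i) - G p.
Proof.
move=> dG; rewrite -[leLHS]mul1r.
have d1 : is_derive (0 * s : R) 1 (fun h : R => G (p + h *: unit_vec i)) (partial i G p).
  by apply: is_derive_line; rewrite mul0r scale0r addr0; exact: derivableP.
have d2 : is_derive (0 : R) 1 (fun h : R => h * s) s.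
  have := fderiveM (is_derive_id (0 : R) 1) (fderive_cst s (0 : R) 1).
  by move=> h; apply: is_derive_eq h _; rewrite mul0r add0r mul1r.
have dF := @is_derive1_comp R (fun h : R => G (p + h *: unit_vec i)) (fun h => h * s) 0 _ _ d1 d2.
rewrite mul1r mulrC; apply: (derive_le_slope dF) => h /andP[h0 h1] /=.
rewrite mul0r scale0r addr0.
have := convex_slope cG p (s *: unit_vec i) (_ : 0 <= h <= 1).
by rewrite scalerA => -> //; rewrite !ltW.
Qed.

End convex_gradient.

(** * Joint continuity of the Hamiltonian and of its momentum gradient *)

Section hamiltonian_regularity.
Context {R : realType} {n : nat}.
Local Notation V := 'rV[R]_n.+1.
Variable H : V -> V -> R.
Hypothesis cvxH : forall x, convexR (H x).
Hypothesis cH : forall p, continuous (H ^~ p).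

Lemma row_coord_le (p : V) i : `|p 0 i| <= `|p|.
Proof.
rewrite [leRHS]/Num.norm /= mx_normrE; apply/bigmax_geP; right => /=.
by exists (0, i).
Qed.

(** An upper bound built from finitely many momenta, hence continuous in [x]. *)
Let M (r : R) (x : V) : R := \sum_i (`|H x (r *: unit_vec i)| + `|H x ((- r) *: unit_vec i)|).

Lemma M_continuous r : continuous (M r).
Proof.
by apply: cts_sum => i; apply: ctsD; apply: cts_norm; exact: cH.
Qed.

(** By [convex_avg_coord] it suffices to bound [H x] on the axes, where the multiple [(n + 1) p_i]
    of a unit vector is a convex combination of the end points with coefficients plus and minus
    [(n + 1) r]. The weight [s] is that of the combination. *)
Lemma hamiltonian_ub (r : R) x p : `|p| <= r -> H x p <= M (n.+1%:R * r) x.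
Proof.
have N0 : (0 : R) < n.+1%:R by rewrite ltr0n.
have [r0|r0] := ltP 0 r; last first.
  move=> pr; have p0 : p = 0 by apply/normr0_eq0/eqP; rewrite eq_le normr_ge0 (le_trans pr).
  have r00 : r = 0 by apply/eqP; rewrite eq_le r0 (le_trans _ pr).
  rewrite /M p0 r00 mulr0 (bigD1 ord0)//= oppr0 scale0r.
  rewrite (le_trans (ler_norm _))// -addrA lerDl addr_ge0// sumr_ge0// => i _.
move=> pr; have := convex_avg_coord (cvxH x) 0 p; rewrite add0r => /le_trans; apply.
rewrite ler_pdivrMl//; apply: (@le_trans _ _ (M (n.+1%:R * r) x)); last first.
  have M0 : 0 <= M (n.+1%:R * r) x by apply: sumr_ge0 => i _; rewrite addr_ge0.
  by rewrite ler_peMl// ler1n.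
apply: ler_sum => i _; rewrite add0r.
have pi := le_trans (row_coord_le p i) pr; rewrite ler_norml in pi.
pose s := (p 0 i + r) / (2 * r).
have s01 : 0 <= s <= 1.
  apply/andP; split; first by rewrite divr_ge0//; lra.
  by rewrite /s ler_pdivrMr; lra.
have := cvxH x ((n.+1%:R * r) *: unit_vec i) ((- (n.+1%:R * r)) *: unit_vec i) s01.
have -> : s *: ((n.+1%:R * r) *: unit_vec i) + (1 - s) *: (- (n.+1%:R * r) *: unit_vec i)
    = (n.+1%:R * p 0 i) *: unit_vec i :> V.
  rewrite !scalerA -scalerDl; congr (_ *: _); rewrite /s; field.
  by rewrite gt_eqF.
move=> /le_trans; apply; apply: lerD.
  by apply: le_trans (ler_norm _) _; rewrite normrM ler_piMl// ger0_norm; lra.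
by apply: le_trans (ler_norm _) _; rewrite normrM ler_piMl// ger0_norm; lra.
Qed.

(** Since 0 is the midpoint of [p] and [- p], an upper bound at [- p] and the value at 0 give a
    lower bound at [p]. *)
Lemma hamiltonian_abs_le (r : R) x p : `|p| <= r ->
  `|H x p| <= M (n.+1%:R * r) x + 2 * `|H x 0|.
Proof.
move=> pr; have h1 := hamiltonian_ub x pr; have := @hamiltonian_ub r x (- p).
rewrite normrN => /(_ pr) h2.
have := cvxH x p (- p) (_ : 0 <= 2^-1 <= 1).
rewrite (_ : _ *: p + _ *: - p = 0); last by apply/rowP => i; rewrite !mxE; field.
have half : 0 <= (2^-1 : R) <= 1 by lra.
move=> /(_ half) h3.
have := ler_norm (H x 0); have := ler_norm (- H x 0); rewrite normrN => h4 h5.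
by rewrite ler_norml; apply/andP; split; lra.
Qed.

(* [H] is only assumed continuous in [x] for each [p]; convexity in [p] bounds it
   by finitely many of its values locally, hence the joint continuity. *)
Lemma hamiltonian_continuous : continuous (fun z : V * V => H z.1 z.2).
Proof.
move=> [x0 p0]; apply/cvgrPdist_lt => e e0 /=.
(* One unit of room for a momentum [p] near [p0], and one more for prolonging the segment from [p0]
   to [p] by a unit vector. *)
pose r := `|p0| + 2.
pose B := M (n.+1%:R * r) x0 + 2 * `|H x0 0| + 1.
have B0 : 0 < B.
  have M0 : 0 <= M (n.+1%:R * r) x0 by apply: sumr_ge0 => i _; rewrite addr_ge0.
  by rewrite /B; have := normr_ge0 (H x0 0); lra.
have nearB : \forall x \near x0, M (n.+1%:R * r) x + 2 * `|H x 0| < B.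
  have cB : M (n.+1%:R * r) x + 2 * `|H x 0| @[x --> x0] --> M (n.+1%:R * r) x0 + 2 * `|H x0 0|.
    have cM : continuous (fun x => M (n.+1%:R * r) x + 2 * `|H x 0|).
      apply: ctsD; first exact: M_continuous.
      by apply: ctsM; [exact: cts_cst|apply: cts_norm; exact: cH].
    exact: cM.
  by apply: (cB [set y | y < B]); apply: lt_nbhsl; rewrite ltrDl.
have nearH : \forall x \near x0, `|H x0 p0 - H x p0| < e / 2.
  by have /cvgrPdist_lt := @cH p0 x0; apply; rewrite divr_gt0.
have nearp : \forall p \near p0, `|p0 - p| < Num.min 1 (e / (4 * B)).
  have m0 : 0 < Num.min 1 (e / (4 * B)) by rewrite lt_min ltr01 divr_gt0 ?mulr_gt0.
  by have := near_ball p0 _ m0; rewrite -ball_normE.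
have F1 : \forall z \near (x0, p0), M (n.+1%:R * r) z.1 + 2 * `|H z.1 0| < B.
  exact: (@cts_fst V V (x0, p0) _ nearB).
have F2 : \forall z \near (x0, p0), `|H x0 p0 - H z.1 p0| < e / 2.
  exact: (@cts_fst V V (x0, p0) _ nearH).
have F3 : \forall z \near (x0, p0), `|p0 - z.2| < Num.min 1 (e / (4 * B)).
  exact: (@cts_snd V V (x0, p0) _ nearp).
suff : \forall z \near (x0, p0), `|H x0 p0 - H z.1 z.2| < e by [].
near=> z.
have : M (n.+1%:R * r) z.1 + 2 * `|H z.1 0| < B by near: z; exact: F1.
have : `|H x0 p0 - H z.1 p0| < e / 2 by near: z; exact: F2.
have : `|p0 - z.2| < Num.min 1 (e / (4 * B)) by near: z; exact: F3.
move: z.1 z.2 => x p + xH xB.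
rewrite lt_min => /andP[p1 pe].
have Hb q : `|q| <= r -> `|H x q| <= B.
  by move=> qr; apply: le_trans (hamiltonian_abs_le x qr) (ltW xB).
(* A convex function bounded by [B] is Lipschitz with constant [2 B] one unit inside the domain of
   the bound: compare the slope between [p0] and [p] with the slopes over unit vectors issued from
   [p0] and from [p]. *)
have lip : `|H x p0 - H x p| <= 2 * B * `|p0 - p|.
  have [->|pp] := eqVneq p p0; first by rewrite !subrr !normr0 mulr0.
  set h := `|p0 - p|; have h0 : 0 < h by rewrite normr_gt0 subr_eq0 eq_sym.
  have h1 : h <= 1 by exact: ltW.
  pose u := h^-1 *: (p - p0).
  have u1 : `|u| = 1 by rewrite normrZ distrC -/h ger0_norm ?invr_ge0 ?ltW// mulVf// gt_eqF.
  have hu : h *: u = p - p0 by rewrite scalerA mulfV ?scale1r// gt_eqF.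
  have pr : `|p| <= `|p0| + 1.
    by rewrite -[p](subrK p0) addrC (le_trans (ler_normD _ _))// lerD2l distrC.
  have h01 : 0 <= h <= 1 by rewrite ltW.
  have := convex_slope (cvxH x) p0 u h01; rewrite hu (addrC p0) subrK => s1.
  have := convex_slope (cvxH x) p (- u) h01; rewrite scalerN hu opprB (addrC p) subrK => s2.
  have b1 : `|H x (p0 + u)| <= B.
    by apply: Hb; rewrite (le_trans (ler_normD _ _))// u1 /r; lra.
  have b2 : `|H x (p - u)| <= B.
    by apply: Hb; rewrite (le_trans (ler_normB _ _))// u1 /r; lra.
  have b3 : `|H x p0| <= B by apply: Hb; rewrite /r; lra.
  have b4 : `|H x p| <= B by apply: Hb; rewrite /r; lra.
  move: b1 b2 b3 b4; rewrite !ler_norml => /andP[b11 b12] /andP[b21 b22] /andP[b31 b32] /andP[b41 b42].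
  have hB1 : h * (H x (p0 + u) - H x p0) <= h * (2 * B) by rewrite ler_pM2l//; lra.
  have hB2 : h * (H x (p - u) - H x p) <= h * (2 * B) by rewrite ler_pM2l//; lra.
  by rewrite mulrC; apply/andP; split; lra.
rewrite (_ : _ - _ = (H x0 p0 - H x p0) + (H x p0 - H x p)); last by rewrite addrA subrK.
apply: le_lt_trans (ler_normD _ _) _.
have : 2 * B * `|p0 - p| < e / 2.
  by rewrite -ltr_pdivlMl ?mulr_gt0//; apply: lt_le_trans pe _; rewrite le_eqVlt; apply/orP; left; apply/eqP; field; rewrite gt_eqF.
lra.
Unshelve. all: by end_near. Qed.

Hypothesis dH : forall x p i, derivable (H x) p (unit_vec i).

(** By convexity the difference quotient [q s] lies above the partial derivative for positive [s]
    and below it for negative [s]. Each quotient is jointly continuous, and both are close to the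
    derivative at the base point when [s] is small, so the derivative is squeezed nearby. *)
Lemma DpH_continuous i : continuous (fun z : V * V => partial i (H z.1) z.2).
Proof.
move=> [x0 p0]; apply/cvgrPdist_lt => e e0 /=.
pose q (s : R) (z : V * V) := s^-1 * (H z.1 (z.2 + s *: unit_vec i) - H z.1 z.2).
have cq s : continuous (q s).
  apply: ctsM; first exact: cts_cst.
  apply: ctsB; last exact: hamiltonian_continuous.
  apply: (@cts_comp _ _ _ (fun z : V * V => (z.1, z.2 + s *: unit_vec i))
    (fun z : V * V => H z.1 z.2)); last exact: hamiltonian_continuous.
  by apply: cts_pair; [exact: cts_fst|apply: ctsD; [exact: cts_snd|exact: cts_cst]].
have qub (s : R) z : 0 < s -> partial i (H z.1) z.2 <= q s z.
  move=> s0; rewrite /q ler_pdivlMl//.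
  by have := convex_partial_bound (cvxH z.1) s (@dH z.1 z.2 i).
have qlb (s : R) z : 0 < s -> q (- s) z <= partial i (H z.1) z.2.
  move=> s0; rewrite /q invrN mulNr -mulrN ler_pdivrMl//.
  by have := convex_partial_bound (cvxH z.1) (- s) (@dH z.1 z.2 i); rewrite mulNr; lra.
have lim0 : q s (x0, p0) @[s --> (0:R)^'] --> partial i (H x0) p0.
  have [d1 d2] := derivableP (@dH x0 p0 i).
  have : h^-1 *: ((H x0 \o shift p0) (h *: unit_vec i) - H x0 p0) @[h --> (0:R)^'] --> partial i (H x0) p0 by exact: d1.
  by rewrite (_ : (fun h => _) = q ^~ (x0, p0))//; apply/funext => s; rewrite /q/= (addrC p0).
have /cvgrPdist_lt/(_ (e / 2)) := lim0; rewrite divr_gt0// => /(_ isT)[s /= s0 hs].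
pose t := s / 2; have t0 : 0 < t by rewrite divr_gt0.
have ts : t < s by rewrite ltr_pdivrMr// ltr_pMr// ltr1n.
have h1 : `|partial i (H x0) p0 - q t (x0, p0)| < e / 2.
  by apply: hs; rewrite ?gt_eqF//= sub0r normrN gtr0_norm.
have h2 : `|partial i (H x0) p0 - q (- t) (x0, p0)| < e / 2.
  by apply: hs; rewrite ?lt_eqF ?oppr_lt0//= sub0r opprK gtr0_norm.
near=> z.
have z1 : `|q t (x0, p0) - q t z| < e / 2.
  by near: z; have /cvgrPdist_lt := @cq t (x0, p0); apply; rewrite divr_gt0.
have z2 : `|q (- t) (x0, p0) - q (- t) z| < e / 2.
  by near: z; have /cvgrPdist_lt := @cq (- t) (x0, p0); apply; rewrite divr_gt0.
have := qub t z t0; have := qlb t z t0.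
move: h1 h2 z1 z2; rewrite !ltr_norml => /andP[? ?] /andP[? ?] /andP[? ?] /andP[? ?] ? ?.
by apply/andP; split; lra.
Unshelve. all: by end_near. Qed.

End hamiltonian_regularity.

(** * Space-time integrals and absolutely continuous functions *)

Section fubini_Rintegral.
Context {d1 : measure_display} {X : measurableType d1} {R : realType}.

Lemma integrable_fine (mu : {measure set X -> \bar R}) (G : X -> \bar R) :
  mu.-integrable setT G ->
  mu.-integrable setT (EFin \o (fine \o G)) /\ (\int[mu]_x (fine (G x))%:E = \int[mu]_x G x)%E.
Proof.
move=> IG; have mG := measurable_int _ IG.
have mfG : measurable_fun setT (EFin \o (fine \o G)).
  by apply/measurable_EFinP; apply: measurableT_comp => //; exact: fine_measurable.
have E : ae_eq mu setT G (EFin \o (fine \o G)).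
  apply: filterS (integrable_ae measurableT IG) => t h _ /=.
  by rewrite fineK//; exact: h.
split; last by apply/esym/ae_eq_integral.
by apply/integrableP; split => //; have /integrableP[_] := IG; rewrite (ae_eq_integral (abse \o G) (abse \o (EFin \o (fine \o G))))//;
 [exact: measurableT_comp|exact: measurableT_comp|apply: filterS E => t h /h /= ->].
Qed.

End fubini_Rintegral.

Section fubini_Rintegral_product.
Context {d1 d2 : measure_display} {X : measurableType d1} {Y : measurableType d2} {R : realType}.
Variables (m1 : {sigma_finite_measure set X -> \bar R}) (m2 : {sigma_finite_measure set Y -> \bar R}).

Lemma fubini_Rintegral (f : X * Y -> R) :
  (m1 \x m2)%E.-integrable setT (EFin \o f) ->
  [/\ m1.-integrable setT (EFin \o (fun x => \int[m2]_y f (x, y))),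
     m2.-integrable setT (EFin \o (fun y => \int[m1]_x f (x, y))) &
   \int[m1]_x (\int[m2]_y f (x, y)) = \int[(m1 \x m2)%E]_z f z /\
   \int[m2]_y (\int[m1]_x f (x, y)) = \int[(m1 \x m2)%E]_z f z].
Proof.
move=> If; have IF := integrable_fubini_F If.
have IG : m2.-integrable setT (fubini_G m1 (EFin \o f)).
  have mf := measurable_int _ If.
  apply/integrableP; split; first exact: (measurable_fubini_G If).
  apply: (le_lt_trans _ ((integrable21ltyP m1 m2 mf).1 If)); apply: ge0_le_integral => //.
  - by apply: measurableT_comp => //; exact: (measurable_fubini_G If).
  - apply: (@measurable_fun_fubini_tonelli_G _ _ _ _ R m1 (abse \o (EFin \o f))).
      exact: (measurableT_comp (@abse_measurable _ _) mf).
    by move=> x; exact: (@abse_ge0 R (EFin (f x))).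
  - move=> t _; apply: le_abse_integral => //.
    exact: (measurableT_comp mf (pair2_measurable t)).
have [IF1 E1] := integrable_fine IF; have [IG1 E2] := integrable_fine IG.
split; [exact: IF1|exact: IG1|split].
  by rewrite /Rintegral; congr fine; rewrite -(integral12_prod_meas1 If) -E1.
by rewrite /Rintegral; congr fine; rewrite -(integral21_prod_meas1 If) -E2.
Qed.

End fubini_Rintegral_product.

(** * Fubini's theorem on the space-time cylinder *)

Section spacetime.
Context {R : realType} {d : nat}.
Local Notation V := 'rV[R]_d.
Local Notation Q := ('rV[R]_d * measurableTypeR R)%type.
Local Notation leb := (@lebesgue_measure R).
Local Notation st := (@space_time_leb R d).

Lemma QT_open (T : R) : open (@QT R d T).
Proof.
rewrite (_ : QT T = snd @^-1` `]0, T[%classic).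
  by apply: open_comp; [move=> z _; exact: cts_snd|exact: interval_open].
by apply/seteqP; split => z /=; rewrite in_itv.
Qed.

Lemma QT_measurable (T : R) : measurable (@QT R d T : set Q).
Proof. by apply: open_measurable_mx_prod; exact: QT_open. Qed.

Lemma QT_sub (t T : R) : t <= T -> @QT R d t `<=` QT T.
Proof.
by move=> tT z /andP[z0 zt]; apply/andP; split=> //; exact: lt_le_trans tT.
Qed.

Lemma QT_setX (T : R) : (@QT R d T : set Q) = setT `*` `]0, T[%classic.
Proof. by apply/seteqP; split => z /=; rewrite in_itv/= ; [|case]. Qed.

Lemma itvoo_measure (T : R) : 0 <= T -> leb `]0, T[ = T%:E.
Proof.
by move=> T0; rewrite lebesgue_measure_itv/= lte_fin; case: ltgtP T0 => // [T0 _|<- _];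
  rewrite ?oppr0 ?adde0.
Qed.

Lemma QT_measure (T : R) : 0 <= T -> st (QT T) = T%:E.
Proof.
move=> T0; rewrite QT_setX.
have := @product_measure1E _ _ _ _ R (cube_leb d) leb setT `]0, T[%classic measurableT (measurable_itv _).
move=> h; apply: (etrans h); rewrite -[RHS]mul1e.
exact: (congr2 mule (@probability_setT _ _ _ (cube_leb d)) (itvoo_measure T0)).
Qed.

Lemma QT_finite (T : R) : (st (QT T) < +oo)%E.
Proof.
have [T0|T0] := leP 0 T; first by rewrite QT_measure// ltry.
by rewrite (_ : QT T = set0) ?measure0// -subset0 => z /= /andP[z0 /(lt_trans z0) /(lt_trans T0)]; rewrite ltxx.
Qed.

Lemma fubini_QT (T : R) (F : V * R -> R) :
  st.-integrable (QT T) (EFin \o F) ->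
  leb.-integrable `]0, T[ (EFin \o (fun t => IX (fun x => F (x, t)))) /\
  \int[st]_(z in QT T) F z = \int[leb]_(t in `]0, T[) IX (fun x => F (x, t)).
Proof.
move=> IF.
pose f : Q -> R := F \_ (QT T).
have If : (cube_leb d \x leb)%E.-integrable setT (EFin \o f).
  by rewrite /f -restrict_EFin; apply/integrable_restrict => //; [exact: QT_measurable|rewrite setTI].
have [_ J [_ K]] := fubini_Rintegral If.
have G : (fun t => \int[cube_leb d]_x f (x, t)) = (fun t => IX (fun x => F (x, t))) \_ `]0, T[.
  apply/funext => t; rewrite patchE; case: ifPn => tT.
    apply: eq_Rintegral => x _; rewrite /f patchE mem_set//=.
    by move: tT; rewrite inE/= in_itv.
  transitivity (\int[cube_leb d]_(r in setT) (cst (0:R) r)); last by rewrite Rintegral_cst// mul0r.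
  apply: eq_Rintegral => x _; rewrite /f patchE memNset//= => h.
  by move/negP: tT; apply; rewrite inE/= in_itv.
rewrite G in J K.
have mI : measurable (`]0, T[%classic : set (measurableTypeR R)) by exact: measurable_itv.
split; first by move: J; rewrite -restrict_EFin => /integrable_restrict; rewrite setTI; apply.
rewrite [LHS]Rintegral_mkcond -/f; apply: (etrans (esym K)).
by rewrite -Rintegral_mkcond.
Qed.

Lemma fubini_QT_ae (T : R) (F : V * R -> R) :
  st.-integrable (QT T) (EFin \o F) ->
  {ae leb, forall t : measurableTypeR R, 0 < (t : R) < T -> (cube_leb d).-integrable setT (EFin \o (fun x => F (x, t)))}.
Proof.
move=> IF; pose f : Q -> \bar R := (EFin \o F) \_ (QT T).
have If : (cube_leb d \x leb)%E.-integrable setT f.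
  by apply/integrable_restrict => //; [exact: QT_measurable|rewrite setTI].
apply: filterS (ae_integrable2 If) => t It tT.
by apply: eq_integrable It => // x _; rewrite /f patchE mem_set.
Qed.

Lemma fubini_QT_mul (T : R) (th : R -> R) (M : R) (F : V * R -> R) :
  st.-integrable (QT T) (EFin \o F) -> measurable_fun `]0, T[ th ->
  (forall t, 0 < t < T -> `|th t| <= M) ->
  \int[st]_(z in QT T) (th z.2 * F z) = \int[leb]_(t in `]0, T[) (th t * IX (fun x => F (x, t))).
Proof.
move=> IF mth thM.
have mth2 : measurable_fun (QT T : set Q) (fun z => th z.2).
  rewrite QT_setX; apply: (@measurable_comp _ _ _ _ _ _ `]0, T[%classic th _ snd) => //.
    by move=> _ [z [_ ?] <-].
  by apply: measurable_funTS; exact: measurable_snd.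
have Im : st.-integrable (QT T) (EFin \o (fun z => th z.2 * F z)).
  have : st.-integrable (QT T) (EFin \o (fun z => F z * th z.2)).
    by apply: (RintegrableMb (M := M)) => //; [exact: QT_measurable|move=> z zT; exact: thM].
  by apply: eq_integrable; [exact: QT_measurable|move=> z _ /=; rewrite mulrC].
have [I1 ->] := fubini_QT Im.
have [I2 _] := fubini_QT IF.
(* A factor depending on time leaves the space integral only where the slice is integrable, that is
   for almost every time. *)
have E : ae_eq leb `]0, T[%classic (EFin \o (fun t => IX (fun x => th t * F (x, t))))
    (EFin \o (fun t => th t * IX (fun x => F (x, t)))).
  apply: filterS (fubini_QT_ae IF) => t It; rewrite /= in_itv/= => /It {}It.
  by rewrite /IX /= RintegralZl.
rewrite /Rintegral; congr fine; apply: ae_eq_integral E => //.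
- exact: measurable_int I1.
- by apply/measurable_EFinP; apply: measurable_funM => //; apply/measurable_EFinP; exact: measurable_int I2.
Qed.

End spacetime.

(** * Integration by parts for absolutely continuous functions *)

Section absolutely_continuous.
Context {R : realType}.
Local Notation leb := (@lebesgue_measure R).

(** The square [(0, T) x (0, T)] is cut along its diagonal, and the double integral of [A s * C r]
    is computed by Fubini on each of the two triangles, integrating first over the variable that
    ranges up to the other. *)
Lemma integral_triangle (T : R) (A C : R -> R) (M : R) : 0 <= T ->
  leb.-integrable `]0, T[ (EFin \o A) ->
  leb.-integrable `]0, T[ (EFin \o C) -> (forall t, 0 < t < T -> `|C t| <= M) ->
  [/\ leb.-integrable `]0, T[ (EFin \o (fun s => A s * \int[leb]_(r in `]0, s[) C r)),
      leb.-integrable `]0, T[ (EFin \o (fun r => (\int[leb]_(s in `]0, r[) A s) * C r)) &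
      \int[leb]_(s in `]0, T[) (A s * \int[leb]_(r in `]0, s[) C r) +
      \int[leb]_(r in `]0, T[) ((\int[leb]_(s in `]0, r[) A s) * C r) =
      (\int[leb]_(s in `]0, T[) A s) * (\int[leb]_(r in `]0, T[) C r)].
Proof.
move=> T0 IA IC CM.
have mI t : measurable (`]0, t[%classic : set (measurableTypeR R)) by exact: measurable_itv.
pose A' := A \_ `]0, T[; pose C' := C \_ `]0, T[.
have IA' : leb.-integrable setT (EFin \o A').
  by rewrite /A' -restrict_EFin; apply/integrable_restrict => //; rewrite setTI.
have IC' : leb.-integrable setT (EFin \o C').
  by rewrite /C' -restrict_EFin; apply/integrable_restrict => //; rewrite setTI.
pose lo (z : measurableTypeR R * measurableTypeR R) : R := (z.2 < z.1)%R%:R.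
pose f z : R := A' z.1 * C' z.2.
have mA' : measurable_fun setT A' by apply/measurable_EFinP; exact: measurable_int IA'.
have mC' : measurable_fun setT C' by apply/measurable_EFinP; exact: measurable_int IC'.
have mf : measurable_fun (setT : set (measurableTypeR R * measurableTypeR R)) f.
  apply: measurable_funM; [exact: (measurableT_comp mA' measurable_fst)|].
  exact: (measurableT_comp mC' measurable_snd).
have If : (leb \x leb)%E.-integrable setT (EFin \o f).
  have mef : measurable_fun setT (EFin \o f) by exact/measurable_EFinP.
  apply: (proj2 (integrable12ltyP leb leb mef)).
  have -> : (fun x => \int[leb]_y `|(EFin \o f) (x, y)|)%E =
      (fun x => `|A' x|%:E * (\int[leb]_y `|C' y|%:E))%E.
    apply/funext => x; rewrite -ge0_integralZl_EFin//.
      by apply: eq_integral => y _; rewrite /f/= normrM EFinM.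
    by apply/measurable_EFinP; exact: measurableT_comp.
  have /integrableP[_ hA] := IA'; have /integrableP[_ hC] := IC'.
  rewrite ge0_integralZr//.
  - apply: lte_mul_pinfty => //; first by apply: integral_ge0.
    by rewrite ge0_fin_numE// integral_ge0.
  - by apply/measurable_EFinP; exact: measurableT_comp.
  - exact: integral_ge0.
have mlo : measurable_fun (setT : set (measurableTypeR R * measurableTypeR R)) lo.
  rewrite (_ : lo = \1_[set z : measurableTypeR R * measurableTypeR R | ((z.2 : R) < (z.1 : R))%R]).
    apply: measurable_indic.
    have := @measurable_fun_ltr _ _ R setT (fun z : measurableTypeR R * measurableTypeR R => z.2) (fun z => z.1)
      measurable_snd measurable_fst measurableT [set true] _.
    rewrite setTI; apply => //.
  apply/funext => z; rewrite indicE /lo; have [h|h] := boolP (z.2 < z.1)%R; first by rewrite mem_set.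
    by rewrite memNset//=; exact/negP.
have If1 : (leb \x leb)%E.-integrable setT (EFin \o (fun z => f z * lo z)).
  apply: (RintegrableMb (M := 1)) => // z _; rewrite /lo; case: (_ < _); rewrite ?normr1 ?normr0//.
have If2 : (leb \x leb)%E.-integrable setT (EFin \o (fun z => f z * (1 - lo z))).
  apply: (RintegrableMb (M := 1)) => //; first by apply: measurable_funB.
  by move=> z _; rewrite /lo; case: (_ < _); rewrite ?subrr ?subr0 ?normr1 ?normr0.
have E1 s : `]0, T[%classic s -> (\int[leb]_r (f (s, r) * lo (s, r)) = A s * \int[leb]_(r in `]0, s[) C r).
  move=> sT; rewrite [X in _ = _ * X]Rintegral_mkcond -RintegralZl//; last first.
    rewrite -restrict_EFin; apply/integrable_restrict => //; rewrite setTI.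
    apply: integrableS IC => // r /=; rewrite !in_itv/= => /andP[-> rs].
    by move: sT; rewrite /= in_itv/= => /andP[_ /(lt_trans rs)].
  apply: eq_Rintegral => r _; rewrite /f /lo /= /A' /C' !patchE mem_set//.
  case: ifPn => rT; last first.
    rewrite ifN ?mulr0 ?mul0r//; apply: contra rT; rewrite !inE /= !in_itv/= => /andP[-> rs].
    by move: sT; rewrite /= in_itv/= => /andP[_ /(lt_trans rs)].
  case: ifPn => rs.
    by move: rs; rewrite inE /= in_itv/= => /andP[_ ->]; rewrite mulr1.
  have -> : (r < s)%R = false.
    by apply: contraNF rs => rs; rewrite inE/= in_itv/= rs andbT; move: rT; rewrite inE/= in_itv/= => /andP[].
  by apply: etrans (mulr0 _) (esym (mulr0 _)).
have E1' s : ~ `]0, T[%classic s -> \int[leb]_r (f (s, r) * lo (s, r)) = 0.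
  move=> sT; transitivity (\int[leb]_(r in setT) (cst (0:R) r)); last by rewrite Rintegral_cst// mul0r.
  by apply: eq_Rintegral => r _; rewrite /f/= /A' patchE memNset// !mul0r.
have E2 r : `]0, T[%classic r -> \int[leb]_s (f (s, r) * (1 - lo (s, r))) = (\int[leb]_(s in `]0, r[) A s) * C r.
  move=> rT.
  have mr : measurable (`]0, r]%classic : set (measurableTypeR R)) by exact: measurable_itv.
  have sub : `]0, r]%classic `<=` `]0, T[%classic.
    move=> s /=; rewrite !in_itv/= => /andP[-> sr].
    by move: rT; rewrite /= in_itv/= => /andP[_]; exact: le_lt_trans.
  have IAr : leb.-integrable `]0, r] (EFin \o A) by exact: integrableS IA.
  have -> : \int[leb]_(s in `]0, r[) A s = \int[leb]_(s in `]0, r]) A s.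
    rewrite -Rintegral_itv_bndo_bndc//.
    by apply: integrableS IAr => // s /=; rewrite !in_itv/= => /andP[-> /ltW].
  rewrite [in RHS]Rintegral_mkcond [RHS]mulrC -RintegralZl//; last first.
    by rewrite -restrict_EFin; apply/integrable_restrict => //; rewrite setTI.
  apply: eq_Rintegral => s _; rewrite /f /lo /= /A' /C' !patchE [r \in _]mem_set//.
  case: (ltP r s) => rs; rewrite ?subrr ?subr0 ?mulr0 ?mulr1.
    have -> : (s \in (`]0, r]%classic : set R)) = false.
      by apply/negP => /set_mem /=; rewrite in_itv/= leNgt rs andbF.
    exact: (esym (mulr0 _)).
  have [sT|sT] := boolP (s \in (`]0, r]%classic : set R)).
    by rewrite mem_set 1?mulrC//; apply: sub; exact: set_mem.
  rewrite memNset; last first.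
    move=> /=; rewrite in_itv/= => /andP[s0 _]; move/negP: sT; apply.
    by apply/mem_set; rewrite /= in_itv/= s0 rs.
  exact: etrans (mul0r _) (esym (mulr0 _)).
have E2' r : ~ `]0, T[%classic r -> \int[leb]_s (f (s, r) * (1 - lo (s, r))) = 0.
  move=> rT; transitivity (\int[leb]_(s in setT) (cst (0:R) s)); last by rewrite Rintegral_cst// mul0r.
  by apply: eq_Rintegral => s _; rewrite /f/= /C' patchE memNset// mulr0 mul0r.
have [J1 _ [K1 _]] := fubini_Rintegral If1.
have [_ J2 [_ K2]] := fubini_Rintegral If2.
have [_ _ [K _]] := fubini_Rintegral If.
have G1 : (fun s => \int[leb]_r (f (s, r) * lo (s, r))) = (fun s => A s * \int[leb]_(r in `]0, s[) C r) \_ `]0, T[.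
  apply/funext => s; rewrite patchE; case: ifPn => sT; first by rewrite E1//; exact: set_mem.
  by rewrite E1'//; apply: contraNnot sT => sT; exact: mem_set.
have G2 : (fun r => \int[leb]_s (f (s, r) * (1 - lo (s, r)))) = (fun r => (\int[leb]_(s in `]0, r[) A s) * C r) \_ `]0, T[.
  apply/funext => r; rewrite patchE; case: ifPn => rT; first by rewrite E2//; exact: set_mem.
  by rewrite E2'//; apply: contraNnot rT => rT; exact: mem_set.
rewrite G1 in J1 K1; rewrite G2 in J2 K2.
split.
- by move: J1; rewrite -restrict_EFin => /integrable_restrict; rewrite setTI; apply.
- by move: J2; rewrite -restrict_EFin => /integrable_restrict; rewrite setTI; apply.
rewrite Rintegral_mkcond K1 [X in _ + X]Rintegral_mkcond.
apply: (etrans (congr1 (fun u => _ + u) K2)); rewrite -RintegralD//.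
transitivity (\int[(leb \x leb)%E]_x f x).
  by apply: eq_Rintegral => z _; ring.
have -> : \int[leb]_(s in `]0, T[) A s = \int[leb]_s A' s by rewrite Rintegral_mkcond.
have -> : \int[leb]_(s in `]0, T[) C s = \int[leb]_s C' s by rewrite Rintegral_mkcond.
rewrite -K; transitivity (\int[leb]_x (A' x * \int[leb]_y C' y)).
  by apply: eq_Rintegral => x _; rewrite -RintegralZl.
by rewrite RintegralZr.
Qed.

(** Replacing [a t] and [c t] by their initial values plus the integrals of [A] and [C] reduces the
    product rule to [integral_triangle]. *)
Lemma AC_product (T : R) (a c A C : R -> R) (M : R) : 0 <= T ->
  leb.-integrable `]0, T[ (EFin \o A) ->
  leb.-integrable `]0, T[ (EFin \o C) -> (forall t, 0 < t < T -> `|C t| <= M) ->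
  (forall t, 0 <= t <= T -> a t - a 0 = \int[leb]_(s in `]0, t[) A s) ->
  (forall t, 0 <= t <= T -> c t - c 0 = \int[leb]_(s in `]0, t[) C s) ->
  [/\ leb.-integrable `]0, T[ (EFin \o (fun t => c t * A t)),
     leb.-integrable `]0, T[ (EFin \o (fun t => a t * C t)) &
  a T * c T - a 0 * c 0 = \int[leb]_(t in `]0, T[) (c t * A t) + \int[leb]_(t in `]0, T[) (a t * C t)].
Proof.
move=> T0 IA IC CM aA cC.
have [I1 I2 I3] := integral_triangle T0 IA IC CM.
have E1 : forall t, t \in (`]0, T[%classic : set R) -> c t * A t = A t * (\int[leb]_(r in `]0, t[) C r) + c 0 * A t.
  move=> t /set_mem; rewrite /= in_itv/= => /andP[t0 tT].
  by rewrite -cC ?ltW// ?t0//; ring.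
have E2 : forall t, t \in (`]0, T[%classic : set R) -> a t * C t = (\int[leb]_(s in `]0, t[) A s) * C t + a 0 * C t.
  move=> t /set_mem; rewrite /= in_itv/= => /andP[t0 tT].
  by rewrite -aA ?ltW// ?t0//; ring.
have mI : measurable (`]0, T[%classic : set (measurableTypeR R)) by exact: measurable_itv.
have J1 := RintegrableZ (c 0) mI IA.
have J2 := RintegrableZ (a 0) mI IC.
have K1 := RintegrableD mI I1 J1.
have K2 := RintegrableD mI I2 J2.
split.
- by apply: eq_integrable K1 => // t /E1 /= ->.
- by apply: eq_integrable K2 => // t /E2 /= ->.
rewrite (@eq_Rintegral _ _ _ leb _ _ _ E1) (@eq_Rintegral _ _ _ leb _ _ _ E2) !RintegralD// !RintegralZl//.
have cT := cC T; rewrite lexx T0 in cT; have aT := aA T; rewrite lexx T0 in aT.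
rewrite addrACA I3 -cT// -aT//; ring.
Qed.

End absolutely_continuous.

Lemma bounded_integrable {R : realType} {disp} {X : measurableType disp}
    (mu : {measure set X -> \bar R}) (D : set X) (f : X -> R) (M : R) :
  measurable D -> (mu D < +oo)%E -> measurable_fun D f ->
  (forall x, D x -> `|f x| <= M) -> mu.-integrable D (EFin \o f).
Proof.
move=> mD Dfin mf fM; apply: measurable_bounded_integrable => //.
by exists M; split; [exact: num_real|move=> N MN x /= Dx; exact: le_trans (fM _ Dx) (ltW MN)].
Qed.

(** * Functions of time and weak derivatives *)

Section time_interval.
Context {R : realType}.
Local Notation leb := (@lebesgue_measure R).

Lemma itvoo_measurable (T : R) : measurable (`]0, T[%classic : set (measurableTypeR R)).
Proof. exact: measurable_itv. Qed.
Hint Resolve itvoo_measurable : core.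

Lemma itvoo_finite (T : R) : (leb `]0%R, T[%classic < +oo)%E.
Proof.
have [T0|/ltW T0] := leP 0 T; first by rewrite itvoo_measure// ltry.
by rewrite set_itv_ge ?measure0// -leNgt bnd_simp.
Qed.

Lemma within_itv_measurable (T : R) (f : R -> R) :
  {within `[0, T], continuous f} -> measurable_fun `]0, T[ f.
Proof.
move=> cf; apply: (measurable_funS (E := `[0, T]%classic)) => //.
  by move=> x /=; rewrite !in_itv/= => /andP[/ltW -> /ltW ->].
by apply: subspace_continuous_measurable_fun => //; exact: measurable_itv.
Qed.

Lemma within_itv_bounded (T : R) (f : R -> R) :
  {within `[0, T], continuous f} -> exists M : R, forall t, 0 <= t <= T -> `|f t| <= M.
Proof.
move=> cf; have [M hM] := compact_bounded_fun (@segment_compact R 0 T) cf.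
by exists M => t tT; apply: hM; rewrite /= in_itv.
Qed.

Lemma within_itv_integrable (T : R) (f : R -> R) :
  {within `[0, T], continuous f} -> leb.-integrable `]0, T[ (EFin \o f).
Proof.
move=> cf; have [M hM] := within_itv_bounded cf.
apply: (bounded_integrable (M := M)) => //; [exact: itvoo_finite|exact: within_itv_measurable|].
by move=> x /=; rewrite in_itv/= => /andP[/ltW x0 /ltW xT]; apply: hM; rewrite x0.
Qed.

Lemma FTC_itvoo (T : R) (F f : R -> R) : 0 < T ->
  {within `[0, T], continuous F} -> {within `[0, T], continuous f} ->
  (forall t, 0 < t < T -> is_derive t 1 F (f t)) ->
  \int[leb]_(t in `]0, T[) f t = F T - F 0.
Proof.
move=> T0 cF cf dF.
have /(continuous_within_itvP _ T0)[_ F0 FT] := cF.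
have If := continuous_compact_integrable (@segment_compact R 0 T) cf.
have D : derivable_oo_LRcontinuous F 0 T.
  by split => // t; rewrite in_itv/= => /dF h; exact: ex_derive.
have E : {in `]0, T[, derive1 F =1 f}.
  by move=> t; rewrite in_itv/= => /dF h; rewrite derive1E; exact: derive_val.
have := continuous_FTC2 T0 cf D E => h.
have {h} : \int[leb]_(t in `[0, T]) f t = F T - F 0 by rewrite /Rintegral h.
move=> <-; rewrite -[in RHS]Rintegral_itv_obnd_cbnd; last first.
  by apply: integrableS If => //; move=> x /=; rewrite !in_itv/= => /andP[/ltW ->].
by rewrite Rintegral_itv_bndo_bndc//; exact: within_itv_integrable.
Qed.

(** A weight of integral one, carried by [(l, u)] and of size at most [C / (u - l)], has L^1 norm at
    most [C]. It need not be nonnegative, which is why the constant multiplies the oscillation of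
    [a]. *)
Lemma average_close (T l u C e a0 : R) (w a : R -> R) : 0 < T -> 0 <= l -> l < u -> u <= T -> 0 <= e ->
  {within `[0, T], continuous w} -> {within `[0, T], continuous a} ->
  (forall s, ~~ (l < s < u) -> w s = 0) -> (forall s, `|w s| <= C / (u - l)) ->
  (forall s, l < s < u -> `|a s - a0| <= e) ->
  \int[leb]_(s in `]0, T[) w s = 1 ->
  `|\int[leb]_(s in `]0, T[) (w s * a s) - a0| <= C * e.
Proof.
move=> T0 l0 lu uT e0 cw ca w0 wC aa w1.
have [Ma hMa] := within_itv_bounded ca.
have Iw := within_itv_integrable cw.
have Iwa : leb.-integrable `]0, T[ (EFin \o (fun s => w s * a s)).
  apply: (RintegrableMb (M := Ma)) => //; first exact: within_itv_measurable.
  by move=> x /=; rewrite in_itv/= => /andP[/ltW x0 /ltW xT]; apply: hMa; rewrite x0.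
have C0 : 0 <= C / (u - l) by apply: le_trans (wC 0).
have Iwa0 := RintegrableZ a0 (itvoo_measurable T) Iw.
have -> : \int[leb]_(s in `]0, T[) (w s * a s) - a0 = \int[leb]_(s in `]0, T[) (w s * a s - a0 * w s).
  by rewrite RintegralB// RintegralZl// w1 mulr1.
have I2 := RintegrableB (itvoo_measurable T) Iwa Iwa0.
apply: le_trans (le_normr_Rintegral _ I2) _ => //.
have mlu : measurable (`]l, u[%classic : set (measurableTypeR R)) by exact: measurable_itv.
have fin : leb `]l, u[ = (u - l)%:E by rewrite lebesgue_measure_itv/= lte_fin lu EFinB.
pose g : R -> R := fun s => (C / (u - l) * e) * \1_(`]l, u[%classic) s.
have Ig : leb.-integrable `]0, T[ (EFin \o g).
  apply: (bounded_integrable (M := C / (u - l) * e)) => //; first exact: itvoo_finite.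
    by apply: measurable_funM => //; exact: measurable_indic.
  move=> x _; rewrite /g indicE; have K0 : 0 <= C / (u - l) * e by rewrite mulr_ge0.
  by case: (_ \in _); rewrite ?mulr1 ?mulr0 ?normr0// ger0_norm.
apply: (@le_trans _ _ (\int[leb]_(s in `]0, T[) g s)).
  apply: le_Rintegral => //.
    exact: (integrable_abse I2).
  move=> s _; rewrite /g indicE; have [slu|slu] := boolP (s \in `]l, u[%classic).
    have {}slu : l < s < u by move: slu; rewrite inE/= in_itv.
    rewrite mulr1 [a0 * _]mulrC -mulrBr normrM ler_pM//; exact: aa.
  rewrite w0 ?mul0r ?mulr0 ?subr0 ?normr0//; apply: contraNN slu => slu.
  by rewrite inE/= in_itv.
rewrite RintegralZl//; last first.
  apply: (bounded_integrable (M := 1)) => //; first exact: itvoo_finite.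
  by move=> x _; rewrite indicE; case: (_ \in _); rewrite ?normr1 ?normr0.
rewrite /Rintegral integral_indic//= (_ : _ `&` _ = `]l, u[%classic).
  by rewrite fin /= le_eqVlt; apply/orP; left; apply/eqP; field; rewrite subr_eq0 gt_eqF.
apply/seteqP; split => x /=; rewrite !in_itv/=; first by case.
by move=> /andP[lx xu]; split; [rewrite lx|rewrite (le_lt_trans l0 lx) (lt_le_trans xu uT)].
Qed.

Lemma within_itv_dist (T c e : R) (f : R -> R) : {within `[0, T], continuous f} ->
  0 <= c <= T -> 0 < e ->
  exists2 dl : R, 0 < dl & forall s, 0 <= s <= T -> `|s - c| < dl -> `|f s - f c| <= e.
Proof.
move=> /subspace_continuousP cf cT e0.
have cI : `[0, T]%classic c by rewrite /= in_itv.
have /cvgrPdist_le/(_ e e0) := cf c cI.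
move=> /nbhs_ballP[dl /= dl0 h]; exists dl => // s sT sc.
by rewrite distrC; apply: h; rewrite /ball/= ?in_itv//= distrC.
Qed.

Definition compact_cutoff (T : R) (th : R -> R) := smooth th /\
  exists a b, [/\ 0 < a, b < T & forall t, th t != 0 -> a <= t <= b].

(* The du Bois-Reymond lemma. *)
Lemma weak_derivative_AC (T : R) (a A : R -> R) : 0 < T ->
  {within `[0, T], continuous a} -> leb.-integrable `]0, T[ (EFin \o A) ->
  (forall th th', compact_cutoff T th -> continuous th' -> (forall t : R, is_derive t 1 th (th' t)) ->
    \int[leb]_(t in `]0, T[) (th' t * a t) + \int[leb]_(t in `]0, T[) (th t * A t) = 0) ->
  forall t, 0 <= t <= T -> a t - a 0 = \int[leb]_(s in `]0, t[) A s.
Proof.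
move=> T0 ca IA weak t /andP[]; rewrite le_eqVlt => /orP[/eqP<- _|t0 tT].
  by rewrite subrr set_itv_ge ?Rintegral_set0// -leNgt bnd_simp.
have [s [C [cs ds sC s0]]] := @step_derive R.
(* The cutoff [th k] rises on [[dl, 2 dl]], falls on [[t - 2 dl, t - dl]] and tends to the indicator
   of [(0, t)]. The denominator [k + 3] ensures [3 dl <= t], which keeps both ramps inside [(0, t)]
   and makes the rise end before the fall is over. *)
pose dl (k : nat) : R := t / k.+3%:R.
have dl0 k : 0 < dl k by rewrite divr_gt0.
have dl3 k : 3 * dl k <= t.
  by rewrite /dl mulrCA ger_pMr// ler_pdivrMr ?ltr0n// mul1r ler_nat.
pose l1 k x := (x - dl k) / dl k; pose l2 k x := (x - (t - 2 * dl k)) / dl k.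
have cl1 k : continuous (l1 k).
  by apply: ctsM; [apply: ctsB; [exact: cts_id|exact: cts_cst]|exact: cts_cst].
have cl2 k : continuous (l2 k).
  by apply: ctsM; [apply: ctsB; [exact: cts_id|exact: cts_cst]|exact: cts_cst].
have dlin c k (x v : R) : is_derive x v (fun x => (x - c) / dl k) (v / dl k).
  have h1 : is_derive x v (fun y : R => y * (dl k)^-1 : R) (v / dl k).
    apply: (@is_derive_lin R R^o (fun y : R => y * (dl k)^-1)) => h y.
    by rewrite mulrDl -mulrA.
  have h2 := fderiveB h1 (fderive_cst (c / dl k) x v).
  by apply: fderive_ext h2; [move=> y; rewrite mulrBl|rewrite subr0].
pose th k x := step (l1 k x) - step (l2 k x).
pose w1 k x := s (l1 k x) * (dl k)^-1; pose w2 k x := s (l2 k x) * (dl k)^-1.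
have dth1 k (x : R) : is_derive x 1 (fun x => step (l1 k x)) (w1 k x).
  by apply: is_derive_comp1 => //; apply: fderive_ext (dlin (dl k) k x 1) => //; rewrite mul1r.
have dth2 k (x : R) : is_derive x 1 (fun x => step (l2 k x)) (w2 k x).
  by apply: is_derive_comp1 => //; apply: fderive_ext (dlin (t - 2 * dl k) k x 1) => //; rewrite mul1r.
have le2 k x : (l2 k x <= 0) = (x <= t - 2 * dl k) by rewrite /l2 ler_pdivrMr// mul0r subr_le0.
have ge2 k x : (1 <= l2 k x) = (t - dl k <= x) by rewrite /l2 ler_pdivlMr// mul1r; apply/idP/idP; lra.
have le1 k x : (l1 k x <= 0) = (x <= dl k) by rewrite /l1 ler_pdivrMr// mul0r subr_le0.
have ge1 k x : (1 <= l1 k x) = (2 * dl k <= x) by rewrite /l1 ler_pdivlMr// mul1r; apply/idP/idP; lra.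
have dl1 k (x v : R) : is_derive x v (l1 k) (l1 k v - l1 k 0).
  have -> : l1 k v - l1 k 0 = v / dl k by rewrite /l1 -mulrBl; congr (_ / _); ring.
  exact: dlin.
have dl2 k (x v : R) : is_derive x v (l2 k) (l2 k v - l2 k 0).
  have -> : l2 k v - l2 k 0 = v / dl k by rewrite /l2 -mulrBl; congr (_ / _); ring.
  exact: dlin.
have smth k : compact_cutoff T (th k).
  split.
    move=> j; apply: (Ck_add (g := fun x => - step (l2 k x))).
      exact: (smooth_step (@cl1 k) (dl1 k)).
    rewrite (_ : (fun x => - step (l2 k x)) = (fun x => -1 * step (l2 k x))); last first.
      by apply/funext => x; rewrite mulN1r.
    apply: Ck_mul; first exact: Ck_cst.
    exact: (smooth_step (@cl2 k) (dl2 k)).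
  exists (dl k), (t - dl k); split => //; first by have := dl0 k; lra.
  move=> x; apply: contraNT; rewrite negb_and -!ltNge => /orP[] h.
    rewrite /th step_le0 ?le1 1?ltW// step_le0 ?subrr// le2.
    by have := dl3 k; have := dl0 k; lra.
  rewrite /th step_ge1; last by rewrite ge1; have := dl3 k; lra.
  by rewrite step_ge1 ?subrr// ge2 ltW.
have cw1 k : continuous (w1 k) by apply: ctsM; [exact: cts_comp|exact: cts_cst].
have cw2 k : continuous (w2 k) by apply: ctsM; [exact: cts_comp|exact: cts_cst].
have cst1 k : continuous (fun x => step (l1 k x)).
  move=> x; apply: differentiable_continuous; apply/derivable1_diffP; apply: ex_derive; exact: dth1.
have cst2 k : continuous (fun x => step (l2 k x)).
  move=> x; apply: differentiable_continuous; apply/derivable1_diffP; apply: ex_derive; exact: dth2.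
have w11 k : \int[leb]_(x in `]0, T[) w1 k x = 1.
  rewrite (FTC_itvoo (F := fun x => step (l1 k x)))//; first last.
  - exact: continuous_subspaceT.
  - exact: continuous_subspaceT.
  rewrite step_ge1; last by rewrite ge1; have := dl3 k; have := dl0 k; lra.
  by rewrite step_le0 ?subr0// le1 ltW.
have w21 k : \int[leb]_(x in `]0, T[) w2 k x = 1.
  rewrite (FTC_itvoo (F := fun x => step (l2 k x)))//; first last.
  - exact: continuous_subspaceT.
  - exact: continuous_subspaceT.
  rewrite step_ge1; last by rewrite ge2; have := dl0 k; lra.
  by rewrite step_le0 ?subr0// le2; have := dl3 k; have := dl0 k; lra.
have w10 k x : ~~ (dl k < x < 2 * dl k) -> w1 k x = 0.
  by move=> h; rewrite /w1 s0 ?mul0r//; apply: contra h; rewrite !ltNge le1 ge1.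
have w20 k x : ~~ (t - 2 * dl k < x < t - dl k) -> w2 k x = 0.
  by move=> h; rewrite /w2 s0 ?mul0r//; apply: contra h; rewrite !ltNge le2 ge2.
have wb k x : `|s x * (dl k)^-1| <= C / dl k.
  have i0 : 0 <= (dl k)^-1 by rewrite invr_ge0 ltW.
  by rewrite normrM (ger0_norm i0) ler_wpM2r.
have C0 : 0 <= C by apply: le_trans (sC 0).
have dlsmall e : 0 < e -> \forall k \near \oo, 2 * dl k < e.
  move=> e0; near=> k.
  rewrite /dl mulrA ltr_pdivrMr ?ltr0n// [e * _]mulrC -ltr_pdivrMr//.
  apply: (@lt_trans _ _ k%:R); last by rewrite ltr_nat !ltnS -addn2 leq_addr.
  by near: k; exact: nbhs_infty_gtr.
(* The derivative of the rising ramp is a weight of integral one that concentrates at 0. Continuity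
   of [a] up to the end of the interval identifies the limit as the initial value. *)
have J1 : (fun k => \int[leb]_(x in `]0, T[) (w1 k x * a x)) @ \oo --> a 0.
  apply/cvgrPdist_le => e e0.
  have e'0 : 0 < e / (C + 1) by rewrite divr_gt0// ltr_wpDl.
  have [|dd dd0 hd] := within_itv_dist (c := 0) ca _ e'0; first by rewrite lexx ltW.
  near=> k; rewrite distrC.
  have hk : 2 * dl k < dd by near: k; exact: dlsmall.
  have D0 := dl0 k; have D3 := dl3 k.
  apply: (@le_trans _ _ (C * (e / (C + 1)))).
    apply: (@average_close T (dl k) (2 * dl k)) => //; [lra|lra|lra|exact: ltW| |exact: w10| |].
    - exact: continuous_subspaceT.
    - by move=> x; rewrite [_ - _](_ : _ = dl k) ?wb//; ring.
    - move=> x /andP[x1 x2]; apply: hd; first by apply/andP; split; lra.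
      by rewrite subr0 gtr0_norm; lra.
  by rewrite mulrCA ger_pMr// ler_pdivrMr ?ltr_wpDl// mul1r lerDl.
have J2 : (fun k => \int[leb]_(x in `]0, T[) (w2 k x * a x)) @ \oo --> a t.
  apply/cvgrPdist_le => e e0.
  have e'0 : 0 < e / (C + 1) by rewrite divr_gt0// ltr_wpDl.
  have [|dd dd0 hd] := within_itv_dist (c := t) ca _ e'0; first by rewrite tT ltW.
  near=> k; rewrite distrC.
  have hk : 2 * dl k < dd by near: k; exact: dlsmall.
  have D0 := dl0 k; have D3 := dl3 k.
  apply: (@le_trans _ _ (C * (e / (C + 1)))).
    apply: (@average_close T (t - 2 * dl k) (t - dl k)) => //; [lra|lra|lra|exact: ltW| |exact: w20| |].
    - exact: continuous_subspaceT.
    - by move=> x; rewrite [_ - (t - _)](_ : _ = dl k) ?wb//; ring.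
    - move=> x /andP[x1 x2]; apply: hd; first by apply/andP; split; lra.
      by rewrite ltr_norml; apply/andP; split; lra.
  by rewrite mulrCA ger_pMr// ler_pdivrMr ?ltr_wpDl// mul1r lerDl.
have th1 k x : `|th k x| <= 1.
  have /andP[p1 p2] := step_01 (l1 k x); have /andP[p3 p4] := step_01 (l2 k x).
  by rewrite /th ler_norml; apply/andP; split; lra.
have cth k : continuous (th k) by apply: ctsB.
have J3 : (fun k => \int[leb]_(x in `]0, T[) (th k x * A x)) @ \oo -->
    \int[leb]_(x in `]0, T[) (\1_(`]0, t[%classic) x * A x).
  apply: (@Rdominated_cvg R _ _ leb `]0, T[%classic (fun k x => th k x * A x)
    (fun x => \1_(`]0, t[%classic) x * A x) (fun x => `|A x|)) => //.
  - move=> k; apply: measurable_funM; first by apply: within_itv_measurable; exact: continuous_subspaceT.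
    by apply/measurable_EFinP; exact: measurable_int IA.
  - apply: measurable_funM; first exact: measurable_indic.
    by apply/measurable_EFinP; exact: measurable_int IA.
  - move=> x; rewrite /= in_itv/= => /andP[x0 xT].
    have [xt|xt] := ltP x t; last first.
      rewrite indicE memNset; last by move=> /=; rewrite in_itv/= => /andP[_ xt']; move: xt; rewrite leNgt xt'.
      apply: cvg_near_cst; near=> k; rewrite mul0r /th.
      have D0 := dl0 k; have D3 := dl3 k.
      by rewrite !step_ge1 ?subrr ?mul0r// ?ge1 ?ge2; lra.
    rewrite indicE mem_set; last by rewrite /= in_itv/= x0.
    apply: cvg_near_cst; near=> k; rewrite mul1r /th.
    have D0 := dl0 k; have D3 := dl3 k.
    have k1 : 2 * dl k < x by near: k; exact: dlsmall.
    have k2 : 2 * dl k < t - x by near: k; apply: dlsmall; rewrite subr_gt0.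
    rewrite step_ge1 ?ge1 1?ltW// step_le0 ?subr0 ?mul1r// le2; lra.
  - by apply: integrable_abse IA.
  - by move=> x k _; rewrite normrM ler_piMl.
have E k : \int[leb]_(x in `]0, T[) (th k x * A x) =
    \int[leb]_(x in `]0, T[) (w2 k x * a x) - \int[leb]_(x in `]0, T[) (w1 k x * a x).
  have Iwa (w : R -> R) : continuous w -> leb.-integrable `]0, T[ (EFin \o (fun x => w x * a x)).
    move=> cw; have [Ma hMa] := within_itv_bounded ca.
    apply: (RintegrableMb (M := Ma)) => //.
    - by apply: within_itv_integrable; exact: continuous_subspaceT.
    - exact: within_itv_measurable.
    by move=> x /=; rewrite in_itv/= => /andP[/ltW x0 /ltW xT]; apply: hMa; rewrite x0.
  have := weak (th k) (fun x => w1 k x - w2 k x) (smth k) (ctsB (@cw1 k) (@cw2 k)) (fun x => fderiveB (dth1 k x) (dth2 k x)).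
  have -> : \int[leb]_(x in `]0, T[) ((w1 k x - w2 k x) * a x) =
      \int[leb]_(x in `]0, T[) (w1 k x * a x) - \int[leb]_(x in `]0, T[) (w2 k x * a x).
    rewrite -(RintegralB _ (Iwa _ (@cw1 k)) (Iwa _ (@cw2 k)))//.
    by apply: eq_Rintegral => x _; rewrite mulrBl.
  by move=> h; lra.
have JJ : (fun k => \int[leb]_(x in `]0, T[) (th k x * A x)) @ \oo --> a t - a 0.
  by under eq_fun do rewrite E; exact: (cvgB J2 J1).
have <- := cvg_unique _ J3 JJ => //.
rewrite [RHS]Rintegral_mkcond Rintegral_mkcond; apply: eq_Rintegral => x _.
rewrite !patchE indicE; case: ifPn => xT; case: ifPn => xt; rewrite ?mul1r ?mul0r//.
by exfalso; move/negP: xT; apply; move: xt; rewrite !inE/= !in_itv/= => /andP[-> /lt_le_trans]; apply.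
Unshelve. all: by end_near.
Qed.

End time_interval.

(** * Compactness modulo the lattice *)

Section compactness.
Context {R : realType}.

Lemma compact_pos_lb (W : topologicalType) (K : set W) (f : W -> R) :
  compact K -> {within K, continuous f} -> (forall w, K w -> 0 < f w) ->
  exists2 dl : R, 0 < dl & forall w, K w -> dl <= f w.
Proof.
move=> cK cf f0; have /compact_closed cl := continuous_compact cf cK.
have : nbhs (0 : R) (~` (f @` K)).
  apply: open_nbhs_nbhs; split; first by apply: closed_openC; apply: cl; exact: Rhausdorff.
  by move=> [w Kw fw]; have := f0 w Kw; rewrite fw ltxx.
move=> /nbhs_ballP[dl /= dl0 h]; exists dl => // w Kw.
rewrite leNgt; apply/negP => fdl; apply: (h (f w)); last by exists w.
by rewrite /ball/= sub0r normrN gtr0_norm ?f0.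
Qed.

(** Every factor of [bump] must be 1, so the cosine is 1 at the fractional part [y] of each
    coordinate. Then the sine of [pi y] vanishes, which forces [y = 0] in [[0, 1)]. *)
Lemma bump_eq1 n (z : 'rV[R]_n) : bump z = 1 -> forall i, exists k : int, z 0 i = k%:~R.
Proof.
move=> z1 i; have := bump_le_factor z i; rewrite z1 => h.
have c1 : cos (2 * pi * z 0 i) = 1.
  by have := cos_le1 (2 * pi * z 0 i); lra.
have P : forall x : R, cos (2 * pi * (x + 1)) = cos (2 * pi * x).
  move=> x; have -> : 2 * pi * (x + 1) = 2 * pi * x + pi *+ 2 :> R by ring.
  by rewrite cosD cos2pi sin2pi mulr1 mulr0 subr0.
have cy := periodic_frac (F := fun x => cos (2 * pi * x)) P (z 0 i).
have := frac_itv (z 0 i); set y := frac _ in cy *; move=> y01.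
rewrite c1 in cy.
exists (Num.floor (z 0 i)); apply/eqP; rewrite -subr_eq0 -/(frac _) -/y.
rewrite eq_le; have /andP[-> y1] := y01; rewrite andbT leNgt; apply/negP => y0.
have pi0 := pi_gt0 R.
have s0 : sin (pi * y) = 0.
  have := cy; rewrite -mulrA [2 * _]mulrC mulr_natr mulr2n cosD -!expr2 cos2sin2 => e.
  have : sin (pi * y) ^+ 2 = 0 by lra.
  by move=> /eqP; rewrite sqrf_eq0 => /eqP.
have : 0 < sin (pi * y) by apply: sin_gt0_pi; apply/andP; split; nra.
by rewrite s0 ltxx.
Qed.

Lemma bump_continuous n : continuous (@bump R n).
Proof. exact: trig_continuous (@trig_bump R n). Qed.

(* By compactness, points whose difference nearly maximizes [bump] are close
   modulo the lattice; stated for a function [Phi] vanishing when the difference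
   is a lattice vector. *)
Lemma bump_separation n (W : topologicalType) (K : set W) (p : W -> 'rV[R]_n) (Phi : W -> R) (e : R) :
  compact K -> continuous p -> {within K, continuous Phi} -> 0 < e ->
  (forall w, K w -> (forall i, exists k : int, p w 0 i = k%:~R) -> Phi w < e) ->
  exists2 c, 0 <= c < 1 & forall w, K w -> c < bump (p w) -> Phi w < e.
Proof.
move=> cK cp cPhi e0 hPhi.
have cb : continuous (fun w => bump (p w)) by apply: cts_comp => //; exact: bump_continuous.
(* The function [1 - bump] plus twice the positive part of [e - Phi] is positive on [K]: where the
   first term vanishes, the hypothesis gives [Phi < e]. Its lower bound [dl] yields the threshold
   [1 - dl]. *)
have [|w Kw|dl dl0 hd] := @compact_pos_lb W K (fun w => (1 - bump (p w)) + ((e - Phi w) + `|e - Phi w|)) cK.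
- apply: ctsD; first by apply: ctsB; [exact: cts_cst|exact: continuous_subspaceT].
  have cP : {within K, continuous (fun w => e - Phi w)} by apply: ctsB; [exact: cts_cst|exact: cPhi].
  by apply: ctsD => //; exact: cts_norm.
- have b1 := bump_le1 (p w); have a0 := ler_norm (- (e - Phi w)); rewrite normrN in a0.
  have [bw|bw] := eqVneq (bump (p w)) 1.
    by have := hPhi w Kw (bump_eq1 bw); have := normr_ge0 (e - Phi w); lra.
  have b2 : bump (p w) < 1 by rewrite lt_neqAle bw.
  lra.
exists (Num.max 0 (1 - dl)).
  by rewrite le_max lexx/= gt_max ltr01/=; lra.
move=> w Kw; rewrite gt_max => /andP[_ h]; have := hd w Kw.
have [m0|m0] := leP (e - Phi w) 0; last lra.
by rewrite ler0_norm//; lra.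
Qed.

End compactness.

(** * Functions continuous on the closed cylinder *)

Section QTbar.
Context {R : realType} {d : nat}.
Local Notation V := 'rV[R]_d.
Local Notation Q := ('rV[R]_d * measurableTypeR R)%type.
Local Notation leb := (@lebesgue_measure R).
Local Notation st := (@space_time_leb R d).
Implicit Types (g : V -> R -> R) (T t s : R).

Definition box_QT T : set (V * R) := [set x : V | forall i, 0 <= x 0 i <= 1] `*` `[0, T]%classic.

Lemma compact_box_QT T : compact (box_QT T).
Proof. by apply: compact_setX; [exact: compact_box|exact: segment_compact]. Qed.

Lemma box_QT_sub T : box_QT T `<=` QTbar T.
Proof. by move=> [x t] [_ /=]; rewrite in_itv. Qed.

Lemma cont_QTbar_slice T g t : cont_QTbar T g -> 0 <= t <= T -> continuous (g ^~ t).
Proof.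
move=> /subspace_continuousP cg tT x.
have c : continuous (fun y : V => (y, t)) by apply: cts_pair; [exact: cts_id|exact: cts_cst].
move=> P gP; have hP : nbhs (x, t) (fun z : V * R => QTbar T z -> P (g z.1 z.2)) := cg (x, t) tT P gP.
exact: (@filterS V (nbhs (x : V)) (nbhs_filter (x : V)) _ _ (fun y h => h tT) (c x _ hP)).
Qed.

Lemma cont_QTbar_time T g x : cont_QTbar T g -> {within `[0, T], continuous (g x)}.
Proof.
move=> /subspace_continuousP cg; apply/subspace_continuousP => t /=; rewrite in_itv/= => tT.
have /cvgrPdist_le h := cg (x, t) tT.
apply/cvgrPdist_le => e e0; have [dl /= dl0 hd] := iffLR (nbhs_ballP _ _) (h e e0).
apply/nbhs_ballP; exists dl => //= y xy; rewrite in_itv/= => yT; apply: (hd (x, y)) => //.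
by split => //=; exact: ballxx.
Qed.

Lemma cont_QTbar_box T g : cont_QTbar T g -> {within box_QT T, continuous (fun z => g z.1 z.2)}.
Proof. by apply: continuous_subspaceW; exact: box_QT_sub. Qed.

Lemma cont_QTbar_measurable T g : cont_QTbar T g ->
  measurable_fun (QT T : set Q) (fun z => g z.1 z.2).
Proof.
move=> cg; apply: open_continuous_measurable; first exact: QT_open.
by apply: continuous_subspaceW cg => z /andP[/ltW z0 /ltW zT]; apply/andP.
Qed.

Lemma QTbar_bounded T g : cont_QTbar T g ->
  exists M : R, forall x t, unit_cube x -> 0 <= t <= T -> `|g x t| <= M.
Proof.
move=> cg; have [M hM] := compact_bounded_fun (@compact_box_QT T) (cont_QTbar_box cg).
exists M => x t xc tT; apply: (hM (x, t)); split => /=; last by rewrite in_itv.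
by move=> i; have /andP[-> /ltW] := xc i.
Qed.

(** Uniformity in [x] comes from compactness: the sum of [|t - s|] and twice the positive part of
    [e - |g x t - g x s|] never vanishes on the closed box, so it has a positive lower bound. *)
Lemma QTbar_equicontinuous T g s (e : R) : cont_QTbar T g -> 0 <= s <= T -> 0 < e ->
  exists2 dl : R, 0 < dl & forall x t, unit_cube x -> 0 <= t <= T -> `|t - s| < dl -> `|g x t - g x s| < e.
Proof.
move=> cg sT e0; have cs := cont_QTbar_slice cg sT.
have cPhi : {within box_QT T, continuous (fun z => e - `|g z.1 z.2 - g z.1 s|)}.
  apply: ctsB; first exact: cts_cst.
  apply: cts_norm; apply: ctsB; first exact: cont_QTbar_box.
  apply: continuous_subspaceT => z.
  by apply: (@cts_comp _ _ _ fst (g ^~ s)) => //; exact: cts_fst.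
have [||dl dl0 hd] := @compact_pos_lb R _ (box_QT T) (fun z => `|z.2 - s| + ((e - `|g z.1 z.2 - g z.1 s|) + `|e - `|g z.1 z.2 - g z.1 s| |)) (@compact_box_QT T).
- apply: ctsD; last by apply: ctsD => //; exact: cts_norm.
  apply: cts_norm; apply: ctsB; last exact: cts_cst.
  by apply: continuous_subspaceT; exact: cts_snd.
- move=> [x t] _ /=; have a0 := ler_norm (- (e - `|g x t - g x s|)); rewrite normrN in a0.
  have [->|ts] := eqVneq t s; first by rewrite !subrr !normr0 subr0; have := ler_norm e; lra.
  have : 0 < `|t - s| by rewrite normr_gt0 subr_eq0.
  by lra.
exists dl => // x t xc tT ts.
have := hd (x, t); rewrite /box_QT/= in_itv/= => /(_ _)/wrap[].
  by split=> // i; have /andP[-> /ltW] := xc i.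
move=> h; rewrite ltNge; apply/negP => ge; move: h.
by rewrite (@ler0_norm _ (e - _)) ?subr_le0//; lra.
Qed.

End QTbar.

(** * The continuity equation tested with trigonometric polynomials *)

Section smooth_composition.
Context {R : realType}.

Lemma is_derive_comp_linear (W U : normedModType R) (L : W -> U) (f : U -> R) (z v : W) (l : R) :
  (forall (s : R) z v, L (z + s *: v) = L z + s *: L v) ->
  is_derive (L z) (L v) f l -> is_derive z v (fun y => f (L y)) l.
Proof.
move=> lL /(is_derive_line_inv _ _ _ _).1 h; apply: (is_derive_line_inv _ _ _ _).2.
by apply: fderive_ext h => // s; rewrite lL.
Qed.

Lemma Ck_comp_linear (W U : normedModType R) (L : W -> U) (f : U -> R) k :
  (forall (s : R) z v, L (z + s *: v) = L z + s *: L v) -> continuous L ->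
  Ck k f -> Ck k (fun z => f (L z)).
Proof.
move=> lL cL; elim: k f => [|k IH] f.
  by rewrite !Ck0P => cf; apply: cts_comp.
move=> /CkSP[cf df]; apply/CkSP; split; first exact: cts_comp.
move=> v; have [g [dg /IH Cg]] := df (L v).
by exists (fun z => g (L z)); split => // x; apply: is_derive_comp_linear.
Qed.

Lemma trig_Ck n (f : 'rV[R]_n -> R) k : trig f -> Ck k f.
Proof.
elim: k f => [|k IH] f tf; first by apply/Ck0P; exact: trig_continuous.
apply/CkSP; split; first exact: trig_continuous.
by move=> v; have [g [tg dg]] := trig_derive v tf; exists g; split => //; exact: IH.
Qed.

End smooth_composition.

Section weak_solution.
Context {R : realType} {d : nat}.
Local Notation V := 'rV[R]_d.
Local Notation Q := ('rV[R]_d * measurableTypeR R)%type.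
Local Notation leb := (@lebesgue_measure R).
Local Notation st := (@space_time_leb R d).

Lemma density_integrable (g : V -> R) : is_density g ->
  (cube_leb d).-integrable setT (EFin \o g) /\ IX g = 1.
Proof.
move=> [_ mg g0 g1]; split; last by rewrite /IX /Rintegral g1.
apply/integrableP; split; first exact/measurable_EFinP.
under eq_integral do rewrite /= ger0_norm//.
by rewrite g1 ltry.
Qed.

Lemma vanishing_closure (T : R) (f : R -> R) : 0 < T -> {within `[0, T], continuous f} ->
  (forall t, 0 < t < T -> f t = 0) -> forall t, 0 <= t <= T -> f t = 0.
Proof.
move=> T0 cf f0 t tT; apply/eqP/negPn/negP => ft.
have e0 : 0 < `|f t| / 2 by rewrite divr_gt0// normr_gt0.
have [dl dl0 hd] := within_itv_dist cf tT e0.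
pose s := if t < T / 2 then t + Num.min dl (T / 2) / 2 else t - Num.min dl (T / 2) / 2.
have m0 : 0 < Num.min dl (T / 2) by rewrite lt_min dl0 divr_gt0.
have m1 : Num.min dl (T / 2) <= dl by rewrite ge_min lexx.
have m2 : Num.min dl (T / 2) <= T / 2 by rewrite ge_min lexx orbT.
have [sT st] : 0 < s < T /\ `|s - t| < dl.
  move: tT => /andP[t0 t1]; rewrite /s; case: ifPn => tT2; rewrite -?leNgt in tT2.
    split; first by apply/andP; split; lra.
    by rewrite ltr_norml; apply/andP; split; lra.
  split; first by apply/andP; split; lra.
  by rewrite ltr_norml; apply/andP; split; lra.
have /andP[s0 s1] := sT.
have := hd s _ st; rewrite (f0 _ sT) sub0r normrN => /(_ _)/wrap[]; first by rewrite !ltW.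
lra.
Qed.

(** Derivatives are prescribed at interior times only. Their continuous extensions inherit
    periodicity at the end times in this way. *)
Lemma periodic_closure (T : R) (g : V -> R -> R) : 0 < T -> cont_QTbar T g ->
  (forall t, 0 < t < T -> Defs.periodic (g ^~ t)) ->
  forall t, 0 <= t <= T -> Defs.periodic (g ^~ t).
Proof.
move=> T0 cg pg t tT x i; apply/eqP; rewrite -subr_eq0; apply/eqP.
apply: (@vanishing_closure T (fun t => g (x + unit_vec i) t - g x t)) => //.
  by apply: ctsB; exact: cont_QTbar_time.
by move=> s sT; rewrite (pg s sT) subrr.
Qed.

Lemma QTbar_bounded_periodic (T : R) (g : V -> R -> R) : cont_QTbar T g ->
  (forall t, 0 <= t <= T -> Defs.periodic (g ^~ t)) ->
  exists M : R, forall x t, 0 <= t <= T -> `|g x t| <= M.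
Proof.
move=> cg pg; have [M hM] := QTbar_bounded cg; exists M => x t tT.
by have [y [yc <-]] := periodic_unit_cube x (pg t tT); exact: hM.
Qed.

Lemma QTbar_equicontinuous_periodic (T : R) (g : V -> R -> R) s (e : R) : cont_QTbar T g ->
  (forall t, 0 <= t <= T -> Defs.periodic (g ^~ t)) -> 0 <= s <= T -> 0 < e ->
  exists2 dl : R, 0 < dl & forall x t, 0 <= t <= T -> `|t - s| < dl -> `|g x t - g x s| < e.
Proof.
move=> cg pg sT e0; have [dl dl0 hd] := QTbar_equicontinuous cg sT e0.
exists dl => // x t tT ts.
have pp : Defs.periodic (fun x => (g x t, g x s)) by move=> y i; rewrite (pg t tT) (pg s sT).
by have [y [yc [<- <-]]] := periodic_unit_cube x pp; exact: hd.
Qed.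

Lemma half_ratio (M e : R) : 0 <= M -> 0 <= e -> M * (e / (2 * (M + 1))) <= e / 2.
Proof.
move=> M0 e0; have M1 : M + 1 != 0 by rewrite gt_eqF// ltr_wpDl.
have -> : M * (e / (2 * (M + 1))) = e / 2 * (M / (M + 1)) by field.
by rewrite ler_piMr ?divr_ge0// ler_pdivrMr ?ltr_wpDl// mul1r lerDl.
Qed.

(** The increment is split into [(r t - r s) * g t], small because [g] is bounded, and
    [r s * (g t - g s)], small because [g] is equicontinuous in time uniformly in space. *)
Lemma L1_IX_continuous (T : R) (r g : V -> R -> R) :
  (forall t, 0 <= t <= T -> (cube_leb d).-integrable setT (EFin \o r ^~ t)) ->
  (forall s, 0 <= s <= T ->
        (fun t => \int[cube_leb d]_x `|r x t - r x s|%:E)%E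
          @ within `[0, T] (nbhs s) --> 0%E) ->
  cont_QTbar T g -> (forall t, 0 <= t <= T -> Defs.periodic (g ^~ t)) ->
  {within `[0, T], continuous (fun t => IX (fun x => r x t * g x t))}.
Proof.
move=> Ir L1 cg pg; apply/subspace_continuousP => s /=; rewrite in_itv/= => sT.
have [M hM] := QTbar_bounded_periodic cg pg.
have M0 : 0 <= M by apply: le_trans (hM 0 s sT).
have mg t : 0 <= t <= T -> measurable_fun setT (g ^~ t).
  by move=> tT; apply: continuous_mx_measurable; exact: cont_QTbar_slice tT.
have Irg t t' : 0 <= t <= T -> 0 <= t' <= T -> (cube_leb d).-integrable setT (EFin \o (fun x => r x t * g x t')).
  by move=> tT t'T; apply: (RintegrableMb (M := M)) => //; [exact: Ir|exact: mg|move=> x _; exact: hM].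
pose N := IX (fun x => `|r x s|).
have N0 : 0 <= N by apply: IX_ge0.
apply/cvgrPdist_le => e e0.
have e1 : 0 < e / (2 * (M + 1)) by rewrite divr_gt0// mulr_gt0// ltr_wpDl.
have e2 : 0 < e / (2 * (N + 1)) by rewrite divr_gt0// mulr_gt0// ltr_wpDl.
have [dl dl0 hd] := QTbar_equicontinuous_periodic cg pg sT e2.
have /fine_cvgP[_] := L1 s sT; move=> /cvgrPdist_lt/(_ _ e1) near1.
near=> t.
have tT : 0 <= t <= T.
  have : `[0, T]%classic t by near: t; exact: withinT.
  by rewrite /= in_itv.
have ts : `|t - s| < dl.
  near: t; apply: cvg_within; apply/nbhs_ballP; exists dl => //= t.
  by rewrite /ball/= distrC.
have Id : (cube_leb d).-integrable setT (EFin \o (fun x => r x t - r x s)).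
  by apply: RintegrableB => //; exact: Ir.
have Iad : (cube_leb d).-integrable setT (EFin \o (fun x => `|r x t - r x s|)) by exact: (integrable_abse Id).
have h1 : IX (fun x => `|r x t - r x s|) < e / (2 * (M + 1)).
  have : `|0 - fine (\int[cube_leb d]_x `|r x t - r x s|%:E)%E| < e / (2 * (M + 1)) by near: t.
  by rewrite sub0r normrN ger0_norm//; apply: IX_ge0.
have Ias : (cube_leb d).-integrable setT (EFin \o (fun x => `|r x s|)) by exact: (integrable_abse (Ir s sT)).
have -> : IX (fun x => r x s * g x s) - IX (fun x => r x t * g x t) =
   - (IX (fun x => (r x t - r x s) * g x t) + IX (fun x => r x s * (g x t - g x s))).
  rewrite /IX -[\int[_]_x ((r x t - r x s) * g x t)](_ : \int[cube_leb d]_x (r x t * g x t - r x s * g x t) = _); last first.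
    by apply: eq_Rintegral => x _; rewrite mulrBl.
  rewrite -[\int[_]_x (r x s * (g x t - g x s))](_ : \int[cube_leb d]_x (r x s * g x t - r x s * g x s) = _); last first.
    by apply: eq_Rintegral => x _; rewrite mulrBr.
  by rewrite !RintegralB ?Irg//; ring.
rewrite normrN; apply: le_trans (ler_normD _ _) _.
have Ip1 : (cube_leb d).-integrable setT (EFin \o (fun x => (r x t - r x s) * g x t)).
  by apply: (RintegrableMb (M := M)) => //; [exact: mg|move=> x _; exact: hM].
have Ip2 : (cube_leb d).-integrable setT (EFin \o (fun x => r x s * (g x t - g x s))).
  apply: (RintegrableMb (M := e / (2 * (N + 1)))) => //; [exact: Ir|by apply: measurable_funB; exact: mg|].
  by move=> x _; apply: ltW; exact: hd.
have b1 : `|IX (fun x => (r x t - r x s) * g x t)| <= M * IX (fun x => `|r x t - r x s|).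
  apply: le_trans (le_normr_Rintegral _ Ip1) _ => //.
  rewrite /IX -RintegralZl//; apply: le_Rintegral => //.
  - exact: (integrable_abse Ip1).
  - exact: (RintegrableZ M measurableT Iad).
  - by move=> x _; rewrite normrM mulrC ler_wpM2r// hM.
have b2 : `|IX (fun x => r x s * (g x t - g x s))| <= e / (2 * (N + 1)) * N.
  apply: le_trans (le_normr_Rintegral _ Ip2) _ => //.
  rewrite /N /IX -RintegralZl//; apply: le_Rintegral => //.
  - exact: (integrable_abse Ip2).
  - exact: (RintegrableZ _ measurableT Ias).
  - by move=> x _; rewrite normrM mulrC ler_wpM2r// ltW// hd.
have c1 : M * IX (fun x => `|r x t - r x s|) <= e / 2.
  apply: (@le_trans _ _ (M * (e / (2 * (M + 1))))); first by rewrite ler_wpM2l// ltW.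
  by apply: half_ratio; rewrite // ltW.
have c2 : e / (2 * (N + 1)) * N <= e / 2.
  by rewrite mulrC; apply: half_ratio; rewrite // ltW.
apply: le_trans (lerD b1 b2) _.
by apply: le_trans (lerD c1 c2) _; lra.
Unshelve. all: by end_near.
Qed.


Lemma integrable_time_mul (T : R) (f : R -> R) (M : R) (F : V * R -> R) :
  st.-integrable (QT T) (EFin \o F) ->
  measurable_fun `]0, T[ f -> (forall t, 0 < t < T -> `|f t| <= M) ->
  st.-integrable (QT T) (EFin \o (fun z => f z.2 * F z)).
Proof.
move=> IF mf fM.
have mf2 : measurable_fun (QT T : set Q) (fun z => f z.2).
  rewrite QT_setX; apply: (@measurable_comp _ _ _ _ _ _ `]0, T[%classic f _ snd) => //.
    by move=> _ [z [_ ?] <-].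
  by apply: measurable_funTS; exact: measurable_snd.
have : st.-integrable (QT T) (EFin \o (fun z => F z * f z.2)).
  by apply: (RintegrableMb (M := M)) => //; [exact: QT_measurable|move=> z zT; exact: fM].
by apply: eq_integrable; [exact: QT_measurable|move=> z _ /=; rewrite mulrC].
Qed.

Section admissible_pairs.
Variables (D : mfg_data R d) (r : V -> R -> R) (m : V -> R -> V).
Local Notation T := (horizon D).
Local Notation nu := (viscosity D).
Hypothesis T0 : 0 < T.
Hypothesis adm : admissible D r m.

Lemma admissible_density t : 0 <= t <= T -> is_density (r ^~ t).
Proof. by have [[h _] _ _ _ _] := adm; exact: h. Qed.

Lemma admissible_measurable : measurable_fun (QT T : set Q) (fun z => r z.1 z.2).
Proof. by have [[_ h] _ _ _ _] := adm. Qed.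

(** Every time slice has mass one, so by Tonelli's theorem the integral is at most the length of the
    time interval. *)
Lemma admissible_integrable : st.-integrable (QT T) (EFin \o (fun z => r z.1 z.2)).
Proof.
have mr := admissible_measurable.
apply/integrableP; split; first exact/measurable_EFinP.
pose f : Q -> \bar R := (fun z => `|r z.1 z.2|%:E) \_ (QT T).
have mf : measurable_fun setT f.
  apply/(measurable_restrictT _ (QT_measurable T)).
  by apply/measurable_EFinP; apply: measurableT_comp.
have f0 z : (0 <= f z)%E by rewrite /f patchE; case: ifP => // _; rewrite lee_fin.
rewrite (_ : (\int[st]_(z in QT T) `|(EFin \o (fun z => r z.1 z.2)) z|)%E = (\int[(cube_leb d \x leb)%E]_z f z)%E); last first.
  by rewrite [LHS]integral_mkcond.
rewrite fubini_tonelli2//.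
have X : (\int[leb]_t (\1_(`]0%R, T[%classic : set (measurableTypeR R)) t)%:E < +oo)%E.
  by rewrite integral_indic// setIT; exact: itvoo_finite.
apply: (le_lt_trans _ X).
apply: ge0_le_integral => //.
- by move=> t _; apply: integral_ge0.
- exact: measurable_fun_fubini_tonelli_G.
- exact/measurable_EFinP/measurable_indic.
move=> t _; rewrite indicE; have [tT|tT] := boolP (t \in _); last first.
  rewrite /fubini_G integral0_eq// => x _; rewrite /f patchE memNset//= => h.
  by move/negP: tT; apply; rewrite inE/= in_itv.
have {}tT : 0 < t < T by move: tT; rewrite inE/= in_itv.
have [|_ _ r0 <-] := @admissible_density t; first by case/andP: tT => /ltW -> /ltW.
rewrite /fubini_G le_eqVlt; apply/orP; left; apply/eqP; apply: eq_integral => x _.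
by rewrite /f patchE mem_set//= ger0_norm.
Qed.

Lemma admissible_continuous (g : V -> R -> R) :
  cont_QTbar T g -> (forall t, 0 <= t <= T -> Defs.periodic (g ^~ t)) ->
  {within `[0, T], continuous (fun t => IX (fun x => r x t * g x t))}.
Proof.
apply: L1_IX_continuous; last by have [_ h _ _ _] := adm.
by move=> t tT; apply: (density_integrable (admissible_density tT)).1.
Qed.

Lemma admissible_momentum i : st.-integrable (QT T) (EFin \o (fun z => m z.1 z.2 0 i)).
Proof. by have [_ _ [_ h] _ _] := adm; exact: h. Qed.

(** Its space integral is the weak time derivative of the moment of [r] against [b]. *)
Definition trig_flux (b : V -> R) (z : V * R) : R :=
  r z.1 z.2 * (nu * laplacian b z.1) + dot (m z.1 z.2) (grad b z.1).

Lemma measurable_space (f : V -> R) : continuous f ->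
  measurable_fun (QT T : set Q) (fun z => f z.1).
Proof.
move=> cf; apply: measurable_funTS.
exact: (measurableT_comp (continuous_mx_measurable cf) measurable_fst).
Qed.

Lemma trig_laplacian (b : V -> R) : trig b -> trig (laplacian b).
Proof. by move=> tb; apply: trig_sum => i; apply: trig_D; exact: trig_D. Qed.

Lemma trig_flux_integrable b : trig b -> st.-integrable (QT T) (EFin \o trig_flux b).
Proof.
move=> tb; apply: RintegrableD; first exact: QT_measurable.
  have [M hM] := trig_bounded (trig_laplacian tb).
  apply: (RintegrableMb (M := `|nu| * M)); [exact: QT_measurable|exact: admissible_integrable| |].
    by apply: measurable_funM => //; apply: measurable_space; exact: trig_continuous (trig_laplacian tb).
  by move=> z _; rewrite normrM ler_wpM2l.
apply: Rintegrable_sum => [|i]; first exact: QT_measurable.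
have [M hM] := trig_bounded (trig_D (unit_vec i) tb).
apply: (RintegrableMb (M := M)); [exact: QT_measurable|exact: admissible_momentum| |].
  have -> : (fun z : Q => grad b z.1 0 i) = (fun z => 'D_(unit_vec i) b z.1).
    by apply/funext => z; rewrite mxE.
  by apply: (@measurable_space (fun x => 'D_(unit_vec i) b x)); exact: trig_continuous (trig_D _ tb).
by move=> z _; rewrite mxE; exact: hM.
Qed.

Lemma tensor_test (th : R -> R) (b : V -> R) : compact_cutoff T th -> trig b ->
  test_function D (fun x t => th t * b x).
Proof.
move=> [sth [a0 [b0 [a00 b0T hab]]]] tb; split.
- by move=> t x i; rewrite (trig_periodic tb).
- move=> k; apply: (@Ck_mul _ _ k (fun z : V * R => th z.2) (fun z => b z.1)).
    by apply: (@Ck_comp_linear _ _ _ snd th k) => //; exact: cts_snd.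
  by apply: (@Ck_comp_linear _ _ _ fst b k) => //; [exact: cts_fst|exact: trig_Ck].
- exists a0, b0; split => // x t; rewrite mulf_eq0 negb_or => /andP[h _]; exact: hab.
Qed.

(** Testing with [th t * b x] leaves a scalar weak equation for the moment, to which the du
    Bois-Reymond lemma applies. Continuity of [r] in L^1 makes the moment continuous, so that the
    formula holds up to both end times. *)
Lemma admissible_trig_AC b : trig b -> forall t, 0 <= t <= T ->
  IX (fun x => r x t * b x) - IX (fun x => r x 0 * b x) =
  \int[leb]_(s in `]0, t[) IX (fun x => trig_flux b (x, s)).
Proof.
move=> tb; have IF := trig_flux_integrable tb.
have [IA _] := fubini_QT IF.
apply: (weak_derivative_AC (a := fun t => IX (fun x => r x t * b x)) T0 _ IA).
  apply: (admissible_continuous (g := fun x _ => b x)); last by move=> t _; exact: trig_periodic.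
  apply: continuous_subspaceT => z; apply: (@cts_comp _ _ _ fst b); first exact: cts_fst.
  exact: trig_continuous.
move=> th th' cth cth' dth.
have [_ _ _ _ /(_ _ (tensor_test cth tb)) E] := adm.
have [Mb hMb] := trig_bounded tb.
have mth : {within `[0, T], continuous th}.
  apply: continuous_subspaceT => x; apply: differentiable_continuous.
  by apply/derivable1_diffP; apply: ex_derive; exact: dth.
have mth' : {within `[0, T], continuous th'} by exact: continuous_subspaceT.
have [M1 hM1] := within_itv_bounded mth; have [M2 hM2] := within_itv_bounded mth'.
have Irb : st.-integrable (QT T) (EFin \o (fun z => r z.1 z.2 * b z.1)).
  apply: (RintegrableMb (M := Mb)) => //; [exact: QT_measurable|exact: admissible_integrable|].
  by apply: measurable_space; exact: trig_continuous.
have oc t : 0 < t < T -> 0 <= t <= T by case/andP=> /ltW -> /ltW.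
have E1 := @fubini_QT_mul R d T th' M2 _ Irb (within_itv_measurable mth') (fun t tT => hM2 t (oc t tT)).
have E2 := @fubini_QT_mul R d T th M1 _ IF (within_itv_measurable mth) (fun t tT => hM1 t (oc t tT)).
have time_mul (f : R -> R) (M : R) (F : V * R -> R) : st.-integrable (QT T) (EFin \o F) ->
    measurable_fun `]0, T[ f -> (forall t, 0 <= t <= T -> `|f t| <= M) ->
    st.-integrable (QT T) (EFin \o (fun z => f z.2 * F z)).
  move=> IF' mf fM; apply: (integrable_time_mul (M := M)) => // t tT; exact: fM (oc t tT).
have J1 := time_mul th' M2 _ Irb (within_itv_measurable mth') hM2.
have J2 := time_mul th M1 _ IF (within_itv_measurable mth) hM1.
rewrite -E1 -E2 -(RintegralD (QT_measurable T) J1 J2).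
rewrite [RHS](_ : 0 = fine 0%E)// -[in RHS]E /Rintegral; congr fine.
apply: eq_integral => z _; congr (_%:E).
have Et : time_deriv (fun x t => th t * b x) z.1 z.2 = th' z.2 * b z.1.
  apply: derive_val; have := fderiveM (dth z.2) (fderive_cst (b z.1) z.2 1).
  by rewrite mulr0 add0r.
have Ex i x t : is_derive x (unit_vec i) (fun y => th t * b y) (th t * 'D_(unit_vec i) b x).
  by apply: fderiveZ; exact: trig_is_derive.
have Exx i x t : is_derive x (unit_vec i) (fun y => th t * 'D_(unit_vec i) b y) (th t * 'D_(unit_vec i) (fun y => 'D_(unit_vec i) b y) x).
  by apply: fderiveZ; apply: trig_is_derive; exact: trig_D.
have Eg i t : partial i (fun y => th t * b y) = (fun x => th t * 'D_(unit_vec i) b x).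
  by apply/funext => x; apply: derive_val; exact: Ex.
have El : laplacian (fun x => th z.2 * b x) z.1 = th z.2 * laplacian b z.1.
  rewrite /laplacian mulr_sumr; apply: eq_bigr => i _.
  by rewrite Eg; apply: derive_val; exact: Exx.
have Ed : dot (m z.1 z.2) (grad (fun x => th z.2 * b x) z.1) = th z.2 * dot (m z.1 z.2) (grad b z.1).
  rewrite /dot mulr_sumr; apply: eq_bigr => i _; rewrite !mxE Eg /partial; ring.
by rewrite Et El Ed /trig_flux; ring.
Qed.

End admissible_pairs.
End weak_solution.

Section IX_linear.
Context {R : realType} {n : nat}.
Implicit Types f g : 'rV[R]_n -> R.

Lemma IXD f g : (cube_leb n).-integrable setT (EFin \o f) ->
  (cube_leb n).-integrable setT (EFin \o g) -> IX (fun x => f x + g x) = IX f + IX g.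
Proof. by move=> If Ig; rewrite /IX RintegralD. Qed.

Lemma IXB f g : (cube_leb n).-integrable setT (EFin \o f) ->
  (cube_leb n).-integrable setT (EFin \o g) -> IX (fun x => f x - g x) = IX f - IX g.
Proof. by move=> If Ig; rewrite /IX RintegralB. Qed.

Lemma IXZ (k : R) f : (cube_leb n).-integrable setT (EFin \o f) ->
  IX (fun x => k * f x) = k * IX f.
Proof. by move=> If; rewrite /IX RintegralZl. Qed.

Lemma IX_sum (I : Type) (s : seq I) (f : I -> 'rV[R]_n -> R) :
  (forall i, (cube_leb n).-integrable setT (EFin \o f i)) ->
  IX (fun x => \sum_(i <- s) f i x) = \sum_(i <- s) IX (f i).
Proof. by move=> If; rewrite /IX Rintegral_sum. Qed.

Lemma IX_cst (k : R) : IX (fun _ : 'rV[R]_n => k) = k.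
Proof.
rewrite /IX Rintegral_cst// [fine _](_ : _ = 1) ?mulr1//.
exact: (congr1 fine (@probability_setT _ _ _ (cube_leb n))).
Qed.

Lemma cube_integrable_cst (k : R) : (cube_leb n).-integrable setT (EFin \o (fun _ : 'rV[R]_n => k)).
Proof. exact: finite_measure_integrable_cst. Qed.

Lemma eq_IX f g : f =1 g -> IX f = IX g.
Proof. by move=> fg; congr IX; exact/funext. Qed.

End IX_linear.

(** * Mollification by kernels of finite rank *)

Section mollifier.
Context {R : realType} {n : nat}.
Local Notation V := 'rV[R]_n.
Implicit Types (K g : V -> R) (v x y : V).

(** The factors are kept explicit: the [a j] define moments and the [b j] carry the dependence on
    the point. *)
Definition tensor K (I : finType) (a b : I -> V -> R) :=
  [/\ forall j, trig (a j), forall j, trig (b j) & forall x y, K (x - y) = \sum_j a j x * b j y].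

Lemma tensor_bumpn N : exists (I : finType) (a b : I -> V -> R), tensor (bumpn N) a b.
Proof. by have [I [a [b [ta tb E]]]] := @degenerate_bumpn R n N; exists I, a, b. Qed.

(** The kernel [K (x - y)] may be differentiated in [x], which acts on the factors [a j], or in [y],
    which acts on the [b j] and changes the sign. This is how derivatives travel from one family to
    the other. *)
Lemma tensor_derive K (I : finType) (a b : I -> V -> R) v : trig K -> tensor K a b ->
  tensor (fun z => 'D_v K z) (fun j x => 'D_v (a j) x) b /\
  tensor (fun z => - 'D_v K z) a (fun j y => 'D_v (b j) y).
Proof.
move=> tK [ta tb E]; split; split => //; try by move=> j; exact: trig_D.
  move=> x y.
  have h1 : is_derive x v (fun x => K (x - y)) ('D_v K (x - y)).
    apply: (is_derive_line_inv _ _ _ _).2.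
    have := (is_derive_line_inv _ _ _ _).1 (trig_is_derive v (x - y) tK).
    by apply: fderive_ext => // s; rewrite addrAC.
  have h2 : is_derive x v (fun x => \sum_j a j x * b j y) (\sum_j 'D_v (a j) x * b j y).
    apply: fderive_sum => j; have := fderiveM (trig_is_derive v x (ta j)) (fderive_cst (b j y) x v).
    by rewrite mulr0 add0r.
  rewrite -(derive_val (is_derive := h1)) -(derive_val (is_derive := h2)).
  by congr ('D_v _ x); apply/funext => z; exact: E.
move=> x y.
have h1 : is_derive y v (fun y => K (x - y)) (- 'D_v K (x - y)).
  apply: (is_derive_line_inv _ _ _ _).2.
  have h := (is_derive_line_inv _ _ _ _).1 (trig_is_derive v (x - y) tK).
  have hN : is_derive (0 : R) 1 (fun s : R => - s) (- 1) by apply: fderiveN; exact: is_derive_id.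
  have h' : is_derive (- (0 : R)) 1 (fun s => K (x - y + s *: v)) ('D_v K (x - y)) by rewrite oppr0.
  have := is_derive_comp1 h' hN; apply: fderive_ext; last by rewrite mulrN1.
  by move=> s; congr K; rewrite scaleNr opprD addrA.
have h2 : is_derive y v (fun y => \sum_j a j x * b j y) (\sum_j a j x * 'D_v (b j) y).
  by apply: fderive_sum => j; apply: fderiveZ; exact: trig_is_derive.
rewrite -(derive_val (is_derive := h1)) -(derive_val (is_derive := h2)).
by congr ('D_v _ y); apply/funext => z; exact: E.
Qed.

(** Convolution with the reflected kernel, which is the usual convolution for the even kernel
    [bumpn N]. *)
Definition cv K g y : R := IX (fun x => K (x - y) * g x).

Lemma cv_tensor K (I : finType) (a b : I -> V -> R) g y : tensor K a b ->
  (cube_leb n).-integrable setT (EFin \o g) ->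
  cv K g y = \sum_j IX (fun x => g x * a j x) * b j y.
Proof.
move=> [ta tb E] Ig.
have Iga j : (cube_leb n).-integrable setT (EFin \o (fun x => g x * a j x)).
  have [M hM] := trig_bounded (ta j).
  by apply: (RintegrableMb (M := M)) => //; exact: trig_measurable.
transitivity (IX (fun x => \sum_j b j y * (g x * a j x))).
  by apply: eq_IX => x; rewrite E mulr_suml; apply: eq_bigr => j _; ring.
rewrite IX_sum; last by move=> j; exact: (RintegrableZ _ measurableT (Iga j)).
by apply: eq_bigr => j _; rewrite IXZ// mulrC.
Qed.

Lemma cv_trig K g : (exists (I : finType) (a b : I -> V -> R), tensor K a b) ->
  (cube_leb n).-integrable setT (EFin \o g) -> trig (cv K g).
Proof.
move=> [I [a [b Kab]]] Ig.
have -> : cv K g = (fun y => \sum_j IX (fun x => g x * a j x) * b j y).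
  by apply/funext => y; exact: cv_tensor.
by apply: trig_sum => j; apply: trig_mul; [exact: trig_cst|case: Kab].
Qed.

Lemma cv_by_parts K g gi i y : trig K -> Defs.periodic g -> continuous g -> continuous gi ->
  (forall x, is_derive x (unit_vec i) g (gi x)) ->
  cv (fun z => 'D_(unit_vec i) K z) g y = - cv K gi y.
Proof.
move=> tK pg cg cgi dg; rewrite /cv.
have sh (f : V -> R) : continuous f -> continuous (fun x => f (x - y)).
  by move=> cf; apply: cts_comp => //; apply: ctsB; [exact: cts_id|exact: cts_cst].
have dK x : is_derive x (unit_vec i) (fun x => K (x - y)) ('D_(unit_vec i) K (x - y)).
  apply: (is_derive_line_inv _ _ _ _).2.
  have := (is_derive_line_inv _ _ _ _).1 (trig_is_derive (unit_vec i) (x - y) tK).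
  by apply: fderive_ext => // s; rewrite addrAC.
rewrite -[LHS]opprK; congr (- _); apply/esym.
apply: (IX_by_parts (u := fun x => K (x - y)) (gu := fun x => 'D_(unit_vec i) K (x - y))) dg => //.
- by move=> x j; rewrite addrAC (trig_periodic tK).
- exact/sh/trig_continuous.
- by apply: (sh (fun z => 'D_(unit_vec i) K z)); exact: trig_continuous (trig_D _ tK).
Qed.

Lemma IX_restrict_cube g : measurable_fun setT g -> IX g = IX (g \_ unit_cube).
Proof.
move=> mg; rewrite /IX /Rintegral; congr fine; apply: ae_eq_integral => //.
- exact/measurable_EFinP.
- apply/measurable_EFinP; rewrite patch_indic; apply: measurable_funM => //.
  by apply: measurable_indic; exact: unit_cube_measurable.
- apply: filterS (@ae_unit_cube R n) => x xc _ /=.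
  by rewrite patchE mem_set.
Qed.

Lemma IX_le_cube g h : (cube_leb n).-integrable setT (EFin \o g) ->
  (cube_leb n).-integrable setT (EFin \o h) -> (forall x, unit_cube x -> g x <= h x) -> IX g <= IX h.
Proof.
move=> Ig Ih gh.
have mg : measurable_fun setT g by apply/measurable_EFinP; exact: measurable_int Ig.
have mh : measurable_fun setT h by apply/measurable_EFinP; exact: measurable_int Ih.
rewrite (IX_restrict_cube mg) (IX_restrict_cube mh); apply: le_Rintegral => //.
- rewrite -restrict_EFin; apply/integrable_restrict => //; first exact: unit_cube_measurable.
  by rewrite setTI; apply: integrableS Ig => //; exact: unit_cube_measurable.
- rewrite -restrict_EFin; apply/integrable_restrict => //; first exact: unit_cube_measurable.
  by rewrite setTI; apply: integrableS Ih => //; exact: unit_cube_measurable.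
by move=> x _; rewrite !patchE; case: ifPn => // /set_mem; exact: gh.
Qed.

Lemma bumpn_shift_integrable N y : (cube_leb n).-integrable setT (EFin \o (fun x => bumpn N (x - y))).
Proof.
have [M hM] := trig_bounded (@trig_bumpn R n N).
apply: (cube_integrable (M := M)) => //.
apply: continuous_mx_measurable; apply: cts_comp; last exact: trig_continuous (trig_bumpn N).
by apply: ctsB; [exact: cts_id|exact: cts_cst].
Qed.

Lemma bumpn_mul_integrable N y g : (cube_leb n).-integrable setT (EFin \o g) ->
  (cube_leb n).-integrable setT (EFin \o (fun x => bumpn N (x - y) * g x)).
Proof.
move=> Ig; have [M hM] := trig_bounded (@trig_bumpn R n N).
have : (cube_leb n).-integrable setT (EFin \o (fun x => g x * bumpn N (x - y))).
  apply: (RintegrableMb (M := M)) => //.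
  apply: continuous_mx_measurable; apply: cts_comp; last exact: trig_continuous (trig_bumpn N).
  by apply: ctsB; [exact: cts_id|exact: cts_cst].
by apply: eq_integrable => // x _ /=; rewrite mulrC.
Qed.

(** The kernel has mass one, so the error is an average of [g x - g y]. Where [bump (x - y)] exceeds
    [c] the increment is at most [e]; elsewhere it is at most [2 M] and the kernel is at most its
    tail, on a cube of measure one. *)
Lemma cv_close N g y (M e c : R) : measurable_fun setT g -> (forall x, `|g x| <= M) -> 0 <= c -> 0 <= e ->
  (forall x, unit_cube x -> c < bump (x - y) -> `|g x - g y| <= e) ->
  `|cv (bumpn N) g y - g y| <= e + 2 * M * @tail R n c N.
Proof.
move=> mg gM c0 e0 near.
have Ig : (cube_leb n).-integrable setT (EFin \o g) by exact: (cube_integrable (M := M)).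
have M0 : 0 <= M by apply: le_trans (gM 0).
have t0 : 0 <= @tail R n c N by exact: tail_ge0.
have IK := bumpn_shift_integrable N y.
have IKg := bumpn_mul_integrable N y Ig.
have IKgy := RintegrableZ (g y) measurableT IK.
have Icst (k : R) : (cube_leb n).-integrable setT (EFin \o (fun _ : V => k)) by exact: finite_measure_integrable_cst.
have -> : cv (bumpn N) g y - g y = IX (fun x => bumpn N (x - y) * g x - g y * bumpn N (x - y)).
  by rewrite IXB// IXZ// IX_bumpn mulr1.
apply: le_trans (le_normr_Rintegral _ (RintegrableB measurableT IKg IKgy)) _ => //.
have -> : e + 2 * M * @tail R n c N = IX (fun x => e * bumpn N (x - y) + 2 * M * @tail R n c N).
  by rewrite IXD ?IXZ ?IX_bumpn ?mulr1 ?IX_cst//; exact: (RintegrableZ e measurableT IK).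
apply: IX_le_cube.
- exact: (integrable_abse (RintegrableB measurableT IKg IKgy)).
- by apply: RintegrableD => //; exact: (RintegrableZ e measurableT IK).
move=> x xc; rewrite [g y * _]mulrC -mulrBr normrM ger0_norm ?bumpn_ge0//.
have [cb|bc] := ltP c (bump (x - y)).
  rewrite mulrC; apply: (@le_trans _ _ (e * bumpn N (x - y))).
    by rewrite ler_wpM2r ?bumpn_ge0//; exact: near.
  by rewrite lerDl mulr_ge0// mulr_ge0.
apply: (@le_trans _ _ (2 * M * @tail R n c N)); last by rewrite lerDr mulr_ge0// bumpn_ge0.
rewrite mulrC; apply: ler_pM => //; [exact: bumpn_ge0| |exact: bumpn_tail].
by apply: le_trans (ler_normB _ _) _; have := gM x; have := gM y; lra.
Qed.

Lemma cv_bound N g (M : R) y : measurable_fun setT g -> (forall x, `|g x| <= M) ->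
  `|cv (bumpn N) g y| <= M.
Proof.
move=> mg gM.
have Ig : (cube_leb n).-integrable setT (EFin \o g) by exact: (cube_integrable (M := M)).
have IKg := bumpn_mul_integrable N y Ig.
apply: le_trans (le_normr_Rintegral _ IKg) _ => //.
have -> : M = IX (fun x => M * bumpn N (x - y)).
  by rewrite IXZ ?IX_bumpn ?mulr1//; exact: bumpn_shift_integrable.
apply: le_Rintegral => //.
- exact: (integrable_abse IKg).
- exact: (RintegrableZ M measurableT (bumpn_shift_integrable N y)).
by move=> x _; rewrite normrM ger0_norm ?bumpn_ge0// mulrC ler_wpM2r ?bumpn_ge0.
Qed.

End mollifier.

Section equicontinuity.
Context {R : realType} {d : nat}.
Local Notation V := 'rV[R]_d.

Lemma within_comp (W U X : topologicalType) (A : set W) (B : set U) (L : W -> U) (f : U -> X) :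
  {within B, continuous f} -> continuous L -> (forall w, A w -> B (L w)) ->
  {within A, continuous (fun w => f (L w))}.
Proof.
move=> /subspace_continuousP cf cL AB; apply/subspace_continuousP => w Aw P hP.
have h : nbhs (L w) (fun z => B z -> P (f z)) := cf (L w) (AB w Aw) P hP.
exact: (@filterS W (nbhs w) (nbhs_filter w) _ _ (fun y k Ay => k (AB y Ay)) (cL w _ h)).
Qed.

(** A modulus of continuity measured by [bump] instead of a distance: it is blind to lattice
    translations and matches the region where the kernel is concentrated. *)
Lemma QTbar_bump_modulus (T e : R) (g : V -> R -> R) : cont_QTbar T g ->
  (forall t, 0 <= t <= T -> Defs.periodic (g ^~ t)) -> 0 < e ->
  exists2 c : R, 0 <= c < 1 & forall x y t, 0 <= t <= T -> c < bump (x - y) -> `|g x t - g y t| < e.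
Proof.
move=> cg pg e0.
pose B : set V := [set x | forall i, 0 <= x 0 i <= 1].
pose K : set ((V * V) * R) := (B `*` B) `*` `[0, T]%classic.
have cK : compact K.
  by apply: compact_setX; [apply: compact_setX; exact: compact_box|exact: segment_compact].
have KT w : K w -> 0 <= w.2 <= T by move=> [_ /=]; rewrite in_itv.
have [||w Kw hw|c c01 hc] := @bump_separation R d _ K (fun w => w.1.1 - w.1.2) (fun w => `|g w.1.1 w.2 - g w.1.2 w.2|) e cK _ _ e0.
- have c1 : continuous (fun w : (V * V) * R => w.1) by exact: cts_fst.
  by apply: ctsB; apply: (cts_comp c1); [exact: cts_fst|exact: cts_snd].
- have c1 : continuous (fun w : (V * V) * R => w.1) by exact: cts_fst.
  apply: cts_norm; apply: ctsB.
    apply: (@within_comp _ _ _ K (QTbar T) (fun w => (w.1.1, w.2)) (fun z => g z.1 z.2)) => //.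
    by apply: cts_pair; [apply: (cts_comp c1); exact: cts_fst|exact: cts_snd].
  apply: (@within_comp _ _ _ K (QTbar T) (fun w => (w.1.2, w.2)) (fun z => g z.1 z.2)) => //.
  by apply: cts_pair; [apply: (cts_comp c1); exact: cts_snd|exact: cts_snd].
- have tT := KT w Kw.
  suff -> : g w.1.1 w.2 = g w.1.2 w.2 by rewrite subrr normr0.
  have [k hk] := choice hw.
  rewrite -(periodic_intv (pg _ tT) w.1.2 k); congr (g _ _).
  by apply/rowP => i; rewrite !mxE -hk !mxE; ring.
exists c => // x y t tT.
have P1 : Defs.periodic (fun x => (bump (x - y), g x t)).
  by move=> z i; rewrite (pg t tT) addrAC (trig_periodic (trig_bump)).
have [x' [xc [<- <-]]] := periodic_unit_cube x P1.
have P2 : Defs.periodic (fun y => (bump (x' - y), g y t)).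
  move=> z i; rewrite (pg t tT) -(trig_periodic (@trig_bump R d) (x' - (z + unit_vec i)) i).
  by rewrite opprD addrA addrNK.
have [y' [yc [<- <-]]] := periodic_unit_cube y P2.
apply: (hc ((x', y'), t)); split => /=; last by rewrite in_itv.
by split => i; [have /andP[-> /ltW] := xc i|have /andP[-> /ltW] := yc i].
Qed.

End equicontinuity.

(** * Classical solutions and duality *)

Section c21.
Context {R : realType} {d : nat}.
Local Notation V := 'rV[R]_d.

(** The derivatives are functions continuous on the closed cylinder, required to be derivatives
    inside it only. Of the second space derivatives only those entering the Laplacian are
    recorded. *)
Record c21 (T : R) (u ut : V -> R -> R) (ux uxx : 'I_d -> V -> R -> R) : Prop := C21fun {
  c21_per : forall t, 0 <= t <= T -> Defs.periodic (u ^~ t);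
  c21_cont : cont_QTbar T u;
  c21_cont_t : cont_QTbar T ut;
  c21_cont_x : forall i, cont_QTbar T (ux i);
  c21_cont_xx : forall i, cont_QTbar T (uxx i);
  c21_dt : forall x t, 0 < t < T -> is_derive t 1 (u x) (ut x t);
  c21_dx : forall i x t, 0 < t < T -> is_derive x (unit_vec i) (u ^~ t) (ux i x t);
  c21_dxx : forall i x t, 0 < t < T -> is_derive x (unit_vec i) (ux i ^~ t) (uxx i x t) }.

End c21.
Arguments c21_cont {R d T u ut ux uxx} _.
Arguments c21_cont_t {R d T u ut ux uxx} _.
Arguments c21_cont_x {R d T u ut ux uxx} _ i.
Arguments c21_cont_xx {R d T u ut ux uxx} _ i.
Arguments c21_dx {R d T u ut ux uxx} _ i x t.
Arguments c21_dxx {R d T u ut ux uxx} _ i x t.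
Arguments c21_dt {R d T u ut ux uxx} _ x t.

(** * Duality identity for classical solutions *)

Section classical.
Context {R : realType} {d : nat}.
Local Notation V := 'rV[R]_d.
Local Notation Q := ('rV[R]_d * measurableTypeR R)%type.
Local Notation leb := (@lebesgue_measure R).
Local Notation st := (@space_time_leb R d).
Implicit Types (u v g : V -> R -> R) (T t s : R).

Lemma fubini_QT_space T (F : V * R -> R) : st.-integrable (QT T) (EFin \o F) ->
  \int[st]_(z in QT T) F z = IX (fun x => \int[leb]_(t in `]0, T[) F (x, t)).
Proof.
move=> IF; pose f : Q -> R := F \_ (QT T).
have If : (cube_leb d \x leb)%E.-integrable setT (EFin \o f).
  by rewrite /f -restrict_EFin; apply/integrable_restrict => //; [exact: QT_measurable|rewrite setTI].
have [_ _ [K _]] := fubini_Rintegral If.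
rewrite [LHS]Rintegral_mkcond -/f; apply: (etrans (esym K)).
apply: eq_Rintegral => x _; rewrite [RHS]Rintegral_mkcond.
apply: eq_Rintegral => t _; rewrite /f !patchE; congr (if _ then _ else _).
Qed.

Lemma QT_bounded_integrable T g : 0 < T -> cont_QTbar T g ->
  (forall t, 0 <= t <= T -> Defs.periodic (g ^~ t)) ->
  st.-integrable (QT T) (EFin \o (fun z => g z.1 z.2)).
Proof.
move=> T0 cg pg; have [M hM] := QTbar_bounded_periodic cg pg.
apply: (bounded_integrable (M := M)); [exact: QT_measurable|exact: QT_finite|exact: cont_QTbar_measurable|].
by move=> z /andP[/ltW z0 /ltW zT]; apply: hM; rewrite z0.
Qed.

Lemma cont_periodic_integrable (f : V -> R) : continuous f -> Defs.periodic f ->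
  (cube_leb d).-integrable setT (EFin \o f).
Proof.
move=> cf pf; have [M hM] := periodic_bounded pf cf.
by apply: (cube_integrable (M := M)) => //; exact: continuous_mx_measurable.
Qed.

Lemma cont_QTbarW T t g : t <= T -> cont_QTbar T g -> cont_QTbar t g.
Proof.
move=> tT; apply: continuous_subspaceW => z /andP[z0 zt].
by apply/andP; split => //; exact: le_trans tT.
Qed.

Lemma IX_time_FTC T g gt : 0 < T -> cont_QTbar T g -> cont_QTbar T gt ->
  (forall t, 0 <= t <= T -> Defs.periodic (g ^~ t)) ->
  (forall t, 0 <= t <= T -> Defs.periodic (gt ^~ t)) ->
  (forall x t, 0 < t < T -> is_derive t 1 (g x) (gt x t)) ->
  forall t, 0 <= t <= T -> IX (g ^~ t) - IX (g ^~ 0) = \int[leb]_(s in `]0, t[) IX (gt ^~ s).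
Proof.
move=> T0 cg cgt pg pgt dg t /andP[]; rewrite le_eqVlt => /orP[/eqP<- _|t0 tT].
  by rewrite subrr set_itv_ge ?Rintegral_set0// -leNgt bnd_simp.
have W s : 0 <= s <= t -> 0 <= s <= T by move=> /andP[-> st]; exact: le_trans tT.
have I1 : st.-integrable (QT t) (EFin \o (fun z => gt z.1 z.2)).
  by apply: QT_bounded_integrable => //; [exact: cont_QTbarW cgt|move=> s st; apply: pgt; exact: W].
have [_ E1] := fubini_QT I1; rewrite -E1 (fubini_QT_space I1) /=.
have t_in : 0 <= t <= T by rewrite ltW.
have z_in : 0 <= (0 : R) <= T by rewrite lexx ltW.
rewrite -IXB; last 2 first.
- by apply: cont_periodic_integrable; [exact: cont_QTbar_slice t_in|exact: pg].
- by apply: cont_periodic_integrable; [exact: cont_QTbar_slice z_in|exact: pg].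
apply: eq_IX => x; apply: esym; apply: (FTC_itvoo (F := g x)) => //.
- exact: cont_QTbar_time (cont_QTbarW tT cg).
- exact: cont_QTbar_time (cont_QTbarW tT cgt).
- by move=> s /andP[s0 st]; apply: dg; rewrite s0 (lt_le_trans st).
Qed.

Lemma is_derive_periodic (f f' : V -> R) (v : V) : Defs.periodic f ->
  (forall x, is_derive x v f (f' x)) -> Defs.periodic f'.
Proof.
move=> pf df x i.
have E y : f' y = 'D_v f y by apply/esym; apply: derive_val; exact: df.
by rewrite !E (derive_periodic v pf).
Qed.

Section c21_periodicity.
Variables (T : R) (u ut : V -> R -> R) (ux uxx : 'I_d -> V -> R -> R).
Hypotheses (T0 : 0 < T) (hu : c21 T u ut ux uxx).

Lemma c21_per_t t : 0 <= t <= T -> Defs.periodic (ut ^~ t).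
Proof.
move: t; apply: periodic_closure => //; first exact: c21_cont_t hu.
move=> t tT x i; rewrite -(derive_val (is_derive := c21_dt hu (x + unit_vec i) _ tT)).
rewrite -(derive_val (is_derive := c21_dt hu x _ tT)).
apply: near_eq_derive.
have [e /= e0 he] : \forall s \near t, 0 < s < T.
  have : open (`]0, T[%classic : set R) by exact: interval_open.
  by rewrite openE => /(_ t); rewrite /= in_itv/= => /(_ tT); apply: filterS => s; rewrite /= in_itv.
exists e => // s /he /andP[s0 sT].
by apply: (c21_per hu); rewrite !ltW.
Qed.

Lemma c21_per_x i t : 0 <= t <= T -> Defs.periodic (ux i ^~ t).
Proof.
move: t; apply: periodic_closure => //; first exact: c21_cont_x hu i.
move=> t tT; apply: (is_derive_periodic (f := u ^~ t)); last by move=> x; exact: (c21_dx hu).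
by apply: (c21_per hu); case/andP: tT => /ltW -> /ltW.
Qed.

Lemma c21_per_xx i t : 0 <= t <= T -> Defs.periodic (uxx i ^~ t).
Proof.
move: t; apply: periodic_closure => //; first exact: c21_cont_xx hu i.
move=> t tT; apply: (is_derive_periodic (f := ux i ^~ t)); last by move=> x; exact: (c21_dxx hu).
by apply: c21_per_x; case/andP: tT => /ltW -> /ltW.
Qed.

End c21_periodicity.

Lemma c21_mul T u ut ux uxx v vt vx vxx : c21 T u ut ux uxx -> c21 T v vt vx vxx ->
  c21 T (fun x t => u x t * v x t) (fun x t => u x t * vt x t + ut x t * v x t)
    (fun i x t => u x t * vx i x t + ux i x t * v x t)
    (fun i x t => (u x t * vxx i x t + ux i x t * vx i x t) + (ux i x t * vx i x t + uxx i x t * v x t)).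
Proof.
move=> [pu cu cut cux cuxx dtu dxu dxxu] [pv cv cvt cvx cvxx dtv dxv dxxv]; split.
- by move=> t tT x i; rewrite pu// pv.
- by apply: ctsM.
- by apply: ctsD; apply: ctsM.
- by move=> i; apply: ctsD; apply: ctsM => //; [exact: cvx|exact: cux].
- move=> i; apply: ctsD; apply: ctsD; apply: ctsM => //;
   [exact: cvxx|exact: cux|exact: cvx|exact: cux|exact: cvx|exact: cuxx].
- by move=> x t tT; apply: fderiveM; [exact: dtu|exact: dtv].
- by move=> i x t tT; apply: (@fderiveM _ _ (u^~ t) (v^~ t)); [exact: dxu|exact: dxv].
- move=> i x t tT; apply: fderiveD.
    by apply: (@fderiveM _ _ (u^~ t) (vx i ^~ t)); [exact: dxu|exact: dxxv].
  by apply: (@fderiveM _ _ (ux i ^~ t) (v^~ t)); [exact: dxxu|exact: dxv].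
Qed.

Lemma within_ctsV (W : topologicalType) (A : set W) (f : W -> R) :
  (forall w, A w -> f w != 0) -> {within A, continuous f} -> {within A, continuous (fun w => (f w)^-1)}.
Proof.
move=> f0 /subspace_continuousP cf; apply/subspace_continuousP => w Aw.
by apply: cvgV; [exact: f0|exact: cf].
Qed.

Lemma c21_inv T u ut ux uxx : (forall x t, 0 <= t <= T -> u x t != 0) -> c21 T u ut ux uxx ->
  c21 T (fun x t => (u x t)^-1) (fun x t => - ((u x t)^-1 * (u x t)^-1 * ut x t))
    (fun i x t => - ((u x t)^-1 * (u x t)^-1 * ux i x t))
    (fun i x t => - ((u x t)^-1 * (u x t)^-1 * uxx i x t +
       ((u x t)^-1 * - ((u x t)^-1 * (u x t)^-1 * ux i x t) +
        - ((u x t)^-1 * (u x t)^-1 * ux i x t) * (u x t)^-1) * ux i x t)).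
Proof.
move=> u0 [pu cu cut cux cuxx dtu dxu dxxu].
have oc t : 0 < t < T -> 0 <= t <= T by case/andP=> /ltW -> /ltW.
have cV : cont_QTbar T (fun x t => (u x t)^-1) by apply: within_ctsV => // z zT; exact: u0.
have dxV i x t : 0 < t < T -> is_derive x (unit_vec i) (fun x => (u x t)^-1) (- ((u x t)^-1 * (u x t)^-1 * ux i x t)).
  move=> tT; have := is_deriveVr (u0 x t (oc t tT)) (dxu i x t tT); apply: fderive_ext => //.
  by rewrite -exprVn expr2.
split => //.
- by move=> t tT x i; rewrite pu.
- by apply: ctsN; apply: ctsM => //; apply: ctsM.
- by move=> i; apply: ctsN; apply: ctsM; [apply: ctsM|exact: cux].
- have c1 i : cont_QTbar T (fun x t => - ((u x t)^-1 * (u x t)^-1 * ux i x t)).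
    by apply: ctsN; apply: ctsM; [apply: ctsM|exact: cux].
  move=> i; apply: ctsN; apply: ctsD; first by apply: ctsM; [apply: ctsM|exact: cuxx].
  apply: ctsM; last exact: cux.
  by apply: ctsD; apply: ctsM => //; exact: c1.
- move=> x t tT; have := is_deriveVr (u0 x t (oc t tT)) (dtu x t tT); apply: fderive_ext => //.
  by rewrite -exprVn expr2.
- move=> i x t tT; apply: fderiveN.
  apply: (@fderiveM _ _ (fun x => (u x t)^-1 * (u x t)^-1) (ux i ^~ t)); last exact: dxxu.
  by apply: (@fderiveM _ _ (fun x => (u x t)^-1) (fun x => (u x t)^-1)); exact: dxV.
Qed.

(** The equation of [u] is in divergence form with flux [F]. Differentiating the integral of [u * v]
    in time and integrating by parts on the torus, twice for the Laplacian and once for the flux,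
    moves all space derivatives to [v]. It serves with [v] equal to 1, to a test function, and to
    [w / u] and its square. *)
Lemma classical_identity T (nu : R) u ut ux uxx v vt vx vxx (F G : 'I_d -> V -> R -> R) :
  0 < T -> c21 T u ut ux uxx -> c21 T v vt vx vxx ->
  (forall i t, 0 < t < T -> [/\ Defs.periodic (F i ^~ t), continuous (F i ^~ t),
     continuous (G i ^~ t) & forall x, is_derive x (unit_vec i) (F i ^~ t) (G i x t)]) ->
  (forall x t, 0 < t < T -> ut x t = nu * (\sum_i uxx i x t) - \sum_i G i x t) ->
  forall t, 0 <= t <= T -> IX (fun x => u x t * v x t) - IX (fun x => u x 0 * v x 0) =
   \int[leb]_(s in `]0, t[) IX (fun x => u x s * (vt x s + nu * \sum_i vxx i x s) + \sum_i F i x s * vx i x s).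
Proof.
move=> T0 hu hv hF E t tT.
have hw := c21_mul hu hv.
rewrite (IX_time_FTC T0 (c21_cont hw) (c21_cont_t hw) (c21_per hw) (@c21_per_t _ _ _ _ _ T0 hw) (c21_dt hw))//.
apply: eq_Rintegral => s; rewrite inE/= in_itv/= => /andP[s0 st].
have sT : 0 < s < T by rewrite s0 (lt_le_trans st)//; case/andP: tT.
have sT' : 0 <= s <= T by case/andP: sT => /ltW -> /ltW.
have [cu cv] := (cont_QTbar_slice (c21_cont hu) sT', cont_QTbar_slice (c21_cont hv) sT').
have cut := cont_QTbar_slice (c21_cont_t hu) sT'; have cvt := cont_QTbar_slice (c21_cont_t hv) sT'.
have cux i := cont_QTbar_slice (c21_cont_x hu i) sT'; have cvx i := cont_QTbar_slice (c21_cont_x hv i) sT'.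
have cuxx i := cont_QTbar_slice (c21_cont_xx hu i) sT'; have cvxx i := cont_QTbar_slice (c21_cont_xx hv i) sT'.
have pu := c21_per hu sT'; have pv := c21_per hv sT'.
have put := c21_per_t T0 hu sT'; have pvt := c21_per_t T0 hv sT'.
have pux i := c21_per_x T0 hu i sT'; have pvx i := c21_per_x T0 hv i sT'.
have puxx i := c21_per_xx T0 hu i sT'; have pvxx i := c21_per_xx T0 hv i sT'.
have II (f g : V -> R) : continuous f -> Defs.periodic f -> continuous g -> Defs.periodic g ->
    (cube_leb d).-integrable setT (EFin \o (fun x => f x * g x)).
  by move=> cf pf cg pg; apply: cont_periodic_integrable; [exact: ctsM|move=> x i; rewrite pf pg].
have pG i : Defs.periodic (G i ^~ s).
  by have [pF _ _ dF] := hF i s sT; exact: is_derive_periodic pF dF.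
have bp1 i : IX (fun x => uxx i x s * v x s) = IX (fun x => u x s * vxx i x s).
  have h1 := IX_by_parts pv cv (cvx i) (fun x => c21_dx hv i x _ sT) (pux i) (cux i) (cuxx i) (fun x => c21_dxx hu i x _ sT).
  have h2 := IX_by_parts (pvx i) (cvx i) (cvxx i) (fun x => c21_dxx hv i x _ sT) pu cu (cux i) (fun x => c21_dx hu i x _ sT).
  transitivity (IX (fun x => v x s * uxx i x s)); first by apply: eq_IX => x; rewrite mulrC.
  rewrite h1 h2 opprK; by apply: eq_IX => x; rewrite mulrC.
have bp2 i : IX (fun x => G i x s * v x s) = - IX (fun x => F i x s * vx i x s).
  have [pF cF cG dF] := hF i s sT.
  have h1 := IX_by_parts pv cv (cvx i) (fun x => c21_dx hv i x _ sT) pF cF cG dF.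
  transitivity (IX (fun x => v x s * G i x s)); first by apply: eq_IX => x; rewrite mulrC.
  by rewrite h1; congr (- _); apply: eq_IX => x; rewrite mulrC.
have Iuvt := II _ _ cu pu cvt pvt.
have Iuxxv i := II _ _ (cuxx i) (puxx i) cv pv.
have Iuvxx i := II _ _ cu pu (cvxx i) (pvxx i).
have IGv i : (cube_leb d).-integrable setT (EFin \o (fun x => G i x s * v x s)).
  by have [pF cF cG dF] := hF i s sT; apply: II.
have IFv i : (cube_leb d).-integrable setT (EFin \o (fun x => F i x s * vx i x s)).
  by have [pF cF cG dF] := hF i s sT; apply: II.
transitivity (IX (fun x => u x s * vt x s + (nu * (\sum_i uxx i x s * v x s) - \sum_i G i x s * v x s))).
  by apply: eq_IX => x; rewrite E// mulrBl -mulrA !mulr_suml.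
have mT := @measurableT _ V.
rewrite IXD//; last first.
  by apply: RintegrableB => //; [apply: RintegrableZ => //; exact: Rintegrable_sum|exact: Rintegrable_sum].
rewrite IXB//; [|by apply: RintegrableZ => //; exact: Rintegrable_sum|exact: Rintegrable_sum].
rewrite IXZ ?IX_sum//; last exact: Rintegrable_sum.
transitivity (IX (fun x => (u x s * vt x s + nu * \sum_i u x s * vxx i x s) + \sum_i F i x s * vx i x s)); last first.
  by apply: eq_IX => x; rewrite mulrDr; congr (_ + _ + _); rewrite [RHS]mulrCA; congr (_ * _); rewrite mulr_sumr.
rewrite IXD; [|by apply: RintegrableD => //; apply: RintegrableZ => //; exact: Rintegrable_sum|exact: Rintegrable_sum].
rewrite IXD//; last by apply: RintegrableZ => //; exact: Rintegrable_sum.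
rewrite IXZ ?IX_sum//; last exact: Rintegrable_sum.
rewrite -addrA; congr (_ + (nu * _ + _)); first by apply: eq_bigr => i _; exact: bp1.
by rewrite -sumrN; apply: eq_bigr => i _; rewrite bp2 opprK.
Qed.

End classical.

Section mollified_function.
Context {R : realType} {d : nat}.
Local Notation V := 'rV[R]_d.
Local Notation Q := ('rV[R]_d * measurableTypeR R)%type.
Local Notation leb := (@lebesgue_measure R).
Local Notation st := (@space_time_leb R d).
Implicit Types (g : V -> R -> R) (T t s : R).

Lemma QTbar_IX_continuous T g : cont_QTbar T g ->
  (forall t, 0 <= t <= T -> Defs.periodic (g ^~ t)) ->
  {within `[0, T], continuous (fun t => IX (g ^~ t))}.
Proof.
move=> cg pg.
have := @L1_IX_continuous R d T (fun _ _ => 1) g.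
rewrite (_ : (fun t => IX (fun x => 1 * g x t)) = (fun t => IX (g ^~ t))); last first.
  by apply/funext => t; apply: eq_IX => x; rewrite mul1r.
apply => //; first by move=> t _; exact: cube_integrable_cst.
move=> s sT; rewrite (_ : (fun t : R => _) = cst 0%E); first exact: cvg_cst.
by apply/funext => t; rewrite integral0_eq// => x _; rewrite subrr normr0.
Qed.

Lemma QTbar_mul_space T g (b : V -> R) : cont_QTbar T g -> continuous b ->
  cont_QTbar T (fun x t => g x t * b x).
Proof.
move=> cg cb; apply: ctsM => //; apply: continuous_subspaceT => z.
by apply: (@cts_comp _ _ _ fst b) => //; exact: cts_fst.
Qed.

Lemma cv_cvg (g : V -> R) y : continuous g -> Defs.periodic g ->
  cv (bumpn N) g y @[N --> \oo] --> g y.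
Proof.
move=> cg pg; have [M hM] := periodic_bounded pg cg.
have M0 : 0 <= M by apply: le_trans (hM 0).
apply/cvgrPdist_le => e e0; have e2 : 0 < e / 2 by rewrite divr_gt0.
have cg' : cont_QTbar 0 (fun x _ => g x).
  by apply: continuous_subspaceT => z; apply: (@cts_comp _ _ _ fst g) => //; exact: cts_fst.
have [c c01 hc] := QTbar_bump_modulus cg' (fun t _ => pg) e2.
have c0 : 0 <= c by case/andP: c01.
have := @tail_cvg0 R d c c01 => /cvgrPdist_le.
have e4 : 0 < e / (2 * (2 * M + 1)) by rewrite divr_gt0// mulr_gt0// ltr_wpDl// mulr_ge0.
move=> /(_ _ e4) nt; near=> N; rewrite distrC.
have ht : `|0 - @tail R d c N| <= e / (2 * (2 * M + 1)) by near: N.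
rewrite sub0r normrN ger0_norm ?tail_ge0// in ht.
apply: le_trans (cv_close _ (M := M) (e := e / 2) (c := c) _ _ c0 (ltW e2) _) _ => //.
- exact: continuous_mx_measurable.
- by move=> x _ h; apply: ltW; apply: (hc x y 0) => //; rewrite lexx.
apply: (@le_trans _ _ (e / 2 + 2 * M * (e / (2 * (2 * M + 1))))).
  by rewrite lerD2l ler_wpM2l// mulr_ge0.
have h : 2 * M * (e / (2 * (2 * M + 1))) <= e / 2 by apply: half_ratio; [rewrite mulr_ge0|exact: ltW].
by apply: le_trans (lerD (lexx _) h) _; lra.
Unshelve. all: by end_near.
Qed.

Lemma cvgr_sum (I : Type) (l : seq I) (F : I -> nat -> R) (a : I -> R) :
  (forall i, F i N @[N --> \oo] --> a i) -> \sum_(i <- l) F i N @[N --> \oo] --> \sum_(i <- l) a i.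
Proof.
move=> h; elim: l => [|i l IH].
  by rewrite big_nil (_ : (fun N => _) = cst 0); [exact: cvg_cst|apply/funext => N; rewrite big_nil].
rewrite big_cons (_ : (fun N => _) = (fun N => F i N + \sum_(j <- l) F j N)); first exact: cvgD.
by apply/funext => N; rewrite big_cons.
Qed.

Lemma oo_cc T t : 0 < t < T -> 0 <= t <= T.
Proof. by case/andP=> /ltW -> /ltW. Qed.

Section one_function.
Variables (T : R) (g : V -> R -> R).
Hypotheses (T0 : 0 < T) (cg : cont_QTbar T g) (pg : forall t, 0 <= t <= T -> Defs.periodic (g ^~ t)).

Definition molli N (z : V * R) : R := cv (bumpn N) (g ^~ z.2) z.1.

Lemma slice_integrable t : 0 <= t <= T -> (cube_leb d).-integrable setT (EFin \o g ^~ t).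
Proof. by move=> tT; apply: cont_periodic_integrable; [exact: cont_QTbar_slice tT|exact: pg]. Qed.

Lemma molli_measurable N : measurable_fun (QT T : set Q) (molli N).
Proof.
have [I [a [b Kab]]] := @tensor_bumpn R d N; have [ta tb _] := Kab.
pose f : Q -> R := fun z => \sum_j IX (fun x => g x z.2 * a j x) * b j z.1.
apply: (@eq_measurable_fun _ _ _ _ _ f).
  by move=> z /set_mem zT; rewrite /f /molli (cv_tensor _ Kab)//; apply: slice_integrable; exact: oo_cc.
apply: measurable_sum => j; apply: measurable_funM; last first.
  by apply: measurable_funTS; apply: (measurableT_comp _ measurable_fst); exact: trig_measurable.
have cgj : cont_QTbar T (fun x t => g x t * a j x).
  by apply: QTbar_mul_space => //; exact: trig_continuous.
have cc : {within `[0, T], continuous (fun t => IX (fun x => g x t * a j x))}.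
  by apply: (QTbar_IX_continuous cgj) => t tT x i; rewrite pg// (trig_periodic (ta j)).
rewrite QT_setX; apply: (@measurable_comp _ _ _ _ _ _ `]0, T[%classic (fun t => IX (fun x => g x t * a j x)) _ snd) => //.
- by move=> _ [z [_ ?] <-].
- exact: within_itv_measurable.
- by apply: measurable_funTS; exact: measurable_snd.
Qed.

Lemma molli_bounded : exists2 M : R, 0 <= M & forall N z, 0 <= z.2 <= T -> `|molli N z| <= M.
Proof.
have [M hM] := QTbar_bounded_periodic cg pg.
exists M => [|N z zT]; first by apply: le_trans (hM 0 0 _); rewrite // lexx ltW.
by apply: cv_bound => [|x]; [apply: continuous_mx_measurable; exact: cont_QTbar_slice zT|exact: hM].
Qed.

Lemma molli_cvg z : 0 <= z.2 <= T -> molli N z @[N --> \oo] --> g z.1 z.2.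
Proof. by move=> zT; apply: cv_cvg; [exact: cont_QTbar_slice zT|exact: pg]. Qed.

End one_function.

Lemma cvN (K g : V -> R) y : trig K -> (cube_leb d).-integrable setT (EFin \o g) ->
  cv (fun z => - K z) g y = - cv K g y.
Proof.
move=> tK Ig; rewrite /cv -[RHS]mulN1r -IXZ; first by apply: eq_IX => x; ring.
have [M hM] := trig_bounded tK.
have : (cube_leb d).-integrable setT (EFin \o (fun x => g x * K (x - y))).
  apply: (RintegrableMb (M := M)) => //.
  apply: continuous_mx_measurable; apply: cts_comp; last exact: trig_continuous tK.
  by apply: ctsB; [exact: cts_id|exact: cts_cst].
by apply: eq_integrable => // x _ /=; rewrite mulrC.
Qed.

End mollified_function.

(** * The weak equation for test functions of class C^{2,1} *)

Section weak_identity.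
Context {R : realType} {d : nat}.
Local Notation V := 'rV[R]_d.
Local Notation Q := ('rV[R]_d * measurableTypeR R)%type.
Local Notation leb := (@lebesgue_measure R).
Local Notation st := (@space_time_leb R d).
Variables (D : mfg_data R d) (r : V -> R -> R) (m : V -> R -> V).
Local Notation T := (horizon D).
Local Notation nu := (viscosity D).
Hypothesis T0 : 0 < T.
Hypothesis adm : admissible D r m.

(** For a product [c t * b x] this is the product rule for the two absolutely continuous functions
    [c] and the moment of [r] against [b]. Since [c] need not vanish at the end times, boundary
    terms appear. *)
Lemma weak_identity_tensor (b : V -> R) (c c' : R -> R) : trig b ->
  {within `[0, T], continuous c} -> {within `[0, T], continuous c'} ->
  (forall t, 0 <= t <= T -> c t - c 0 = \int[leb]_(s in `]0, t[) c' s) ->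
  st.-integrable (QT T) (EFin \o (fun z => c' z.2 * (r z.1 z.2 * b z.1) + c z.2 * trig_flux D r m b z)) /\
  IX (fun x => r x T * b x) * c T - IX (fun x => r x 0 * b x) * c 0 =
  \int[st]_(z in QT T) (c' z.2 * (r z.1 z.2 * b z.1) + c z.2 * trig_flux D r m b z).
Proof.
move=> tb cc cc' hc.
have [M1 hM1] := within_itv_bounded cc; have [M2 hM2] := within_itv_bounded cc'.
have IF := trig_flux_integrable adm tb; have [IA _] := fubini_QT IF.
have [Mb hMb] := trig_bounded tb.
have Irb : st.-integrable (QT T) (EFin \o (fun z => r z.1 z.2 * b z.1)).
  apply: (RintegrableMb (M := Mb)) => //; [exact: QT_measurable|exact: admissible_integrable adm|].
  by apply: measurable_space; exact: trig_continuous.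
have M1' t : 0 < t < T -> `|c t| <= M1 by move=> /oo_cc; exact: hM1.
have M2' t : 0 < t < T -> `|c' t| <= M2 by move=> /oo_cc; exact: hM2.
have mc := within_itv_measurable cc; have mc' := within_itv_measurable cc'.
have [_ _ ->] := AC_product (ltW T0) IA (within_itv_integrable cc') M2' (admissible_trig_AC T0 adm tb) hc.
have J1 := integrable_time_mul IF mc M1'.
have J2 := integrable_time_mul Irb mc' M2'.
split; first exact: (RintegrableD (QT_measurable T) J2 J1).
rewrite (RintegralD (QT_measurable T) J2 J1) addrC; congr (_ + _).
  rewrite (fubini_QT_mul Irb mc' M2'); apply: eq_Rintegral => t _.
  by rewrite mulrC.
by rewrite (fubini_QT_mul IF mc M1').
Qed.


Section one_test.
Variables (psi pt : V -> R -> R) (px pxx : 'I_d -> V -> R -> R).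
Hypothesis hpsi : c21 T psi pt px pxx.

(** The derivatives of the test function are arguments, so that the same expression covers [psi] and
    its mollifications. *)
Definition weak_integrand (p' : V * R -> R) (pL : 'I_d -> V * R -> R) (pG : 'I_d -> V * R -> R) (z : V * R) : R :=
  r z.1 z.2 * (p' z + nu * \sum_i pL i z) + \sum_i m z.1 z.2 0 i * pG i z.

(** Mollified in space, [psi] is a finite sum of products [c j t * b j y], each covered by
    [weak_identity_tensor]. The rest of the proof shows that the derivatives of this sum are the
    mollified derivatives of [psi]. *)
Lemma weak_identity_molli N :
  IX (fun x => r x T * molli psi N (x, T)) - IX (fun x => r x 0 * molli psi N (x, 0)) =
  \int[st]_(z in QT T) weak_integrand (molli pt N) (fun i => molli (pxx i) N) (fun i => molli (px i) N) z.
Proof.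
have [I [a [b Kab]]] := @tensor_bumpn R d N; have [ta tb _] := Kab.
have tK := @trig_bumpn R d N.
have ppt := @c21_per_t _ _ _ _ _ _ _ T0 hpsi.
have ppx i := @c21_per_x _ _ _ _ _ _ _ T0 hpsi i.
have ppxx i := @c21_per_xx _ _ _ _ _ _ _ T0 hpsi i.
pose c j t := IX (fun x => psi x t * a j x); pose c' j t := IX (fun x => pt x t * a j x).
have cta g j : cont_QTbar T g -> cont_QTbar T (fun x t => g x t * a j x).
  by move=> cg; apply: QTbar_mul_space => //; exact: trig_continuous.
have pta g j : (forall t, 0 <= t <= T -> Defs.periodic (g ^~ t)) ->
    forall t, 0 <= t <= T -> Defs.periodic (fun x => g x t * a j x).
  by move=> pg t tT x i; rewrite pg// (trig_periodic (ta j)).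
have cc j : {within `[0, T], continuous (c j)}.
  exact: QTbar_IX_continuous (cta _ _ (c21_cont hpsi)) (pta _ _ (c21_per hpsi)).
have cc' j : {within `[0, T], continuous (c' j)}.
  exact: QTbar_IX_continuous (cta _ _ (c21_cont_t hpsi)) (pta _ _ ppt).
have hc j t : 0 <= t <= T -> c j t - c j 0 = \int[leb]_(s in `]0, t[) c' j s.
  apply: (IX_time_FTC T0 (cta _ _ (c21_cont hpsi)) (cta _ _ (c21_cont_t hpsi)) (pta _ _ (c21_per hpsi)) (pta _ _ ppt)).
  move=> x s sT; have := fderiveM (c21_dt hpsi x s sT) (fderive_cst (a j x) s 1).
  by rewrite mulr0 add0r.
have W j := weak_identity_tensor (tb j) (cc j) (cc' j) (@hc j).
have cvE g t y : (forall t, 0 <= t <= T -> Defs.periodic (g ^~ t)) -> cont_QTbar T g -> 0 <= t <= T ->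
    molli g N (y, t) = \sum_j IX (fun x => g x t * a j x) * b j y.
  by move=> pg cg tT; rewrite /molli (cv_tensor _ Kab)//; exact: slice_integrable cg pg _ tT.
have LE t : 0 <= t <= T -> IX (fun x => r x t * molli psi N (x, t)) = \sum_j IX (fun x => r x t * b j x) * c j t.
  move=> tT; have [Ir _] := density_integrable (admissible_density adm tT).
  have Irb j : (cube_leb d).-integrable setT (EFin \o (fun x => r x t * b j x)).
    have [M hM] := trig_bounded (tb j).
    by apply: (RintegrableMb (M := M)) => //; exact: trig_measurable.
  transitivity (IX (fun x => \sum_j c j t * (r x t * b j x))).
    apply: eq_IX => x; rewrite cvE ?mulr_sumr//; [|exact: c21_per hpsi|exact: c21_cont hpsi].
    by apply: eq_bigr => j _; rewrite /c; ring.
  rewrite IX_sum; last by move=> j; exact: (RintegrableZ _ measurableT (Irb j)).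
  by apply: eq_bigr => j _; rewrite IXZ// mulrC.
have Tin : 0 <= T <= T by rewrite lexx ltW.
have zin : 0 <= (0 : R) <= T by rewrite lexx ltW.
rewrite !LE// -sumrB (eq_bigr _ (fun j _ => (W j).2)) -Rintegral_sum; last 2 first.
- exact: QT_measurable.
- by move=> j; exact: (W j).1.
apply: eq_Rintegral => -[y t] /set_mem /= zT; have tT := oo_cc zT.
rewrite /weak_integrand /trig_flux /=.
have E1 : molli pt N (y, t) = \sum_j c' j t * b j y by apply: cvE => //; exact: c21_cont_t hpsi.
have Ipsi : (cube_leb d).-integrable setT (EFin \o psi ^~ t) by exact: slice_integrable (c21_cont hpsi) (c21_per hpsi) _ tT.
have [cpsi cpx cpxx] : [/\ continuous (psi ^~ t), forall i, continuous (px i ^~ t) & forall i, continuous (pxx i ^~ t)].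
  split=> [|i|i]; first exact: cont_QTbar_slice (c21_cont hpsi) tT.
    exact: cont_QTbar_slice (c21_cont_x hpsi i) tT.
  exact: cont_QTbar_slice (c21_cont_xx hpsi i) tT.
have Ipx i : (cube_leb d).-integrable setT (EFin \o px i ^~ t) by exact: slice_integrable (c21_cont_x hpsi i) (ppx i) _ tT.
have tDK (i : 'I_d) := trig_D (unit_vec i) tK.
have tK' (i : 'I_d) : trig (fun z : V => - 'D_(unit_vec i) (bumpn N) z).
  have -> : (fun z => - 'D_(unit_vec i) (bumpn N) z) = (fun z : V => (fun=> -1) z * 'D_(unit_vec i) (bumpn N) z).
    by apply/funext => z; rewrite mulN1r.
  by apply: trig_mul => //; exact: trig_cst.
(* A derivative of the factors [b j] is a derivative of the kernel with the sign reversed, and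
   integration by parts passes it on to [psi] with a second sign. The Laplacian repeats this once
   more. *)
have Kab' i := (tensor_derive (unit_vec i) tK Kab).2.
have Kab'' i := (tensor_derive (unit_vec i) (tK' i) (Kab' i)).2.
have G1 (i : 'I_d) (g gi : V -> R) : Defs.periodic g -> continuous g -> continuous gi -> Defs.periodic gi ->
    (forall x, is_derive x (unit_vec i) g (gi x)) ->
    cv (fun z => - 'D_(unit_vec i) (bumpn N) z) g y = cv (bumpn N) gi y.
  move=> pg cg cgi pgi dg; rewrite cvN//; last exact: cont_periodic_integrable.
  by rewrite (cv_by_parts _ tK pg cg cgi dg) opprK.
have E2 i : molli (px i) N (y, t) = \sum_j c j t * 'D_(unit_vec i) (b j) y.
  rewrite -(cv_tensor _ (Kab' i) Ipsi) /molli /=; apply/esym; apply: G1 => //.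
  - exact: c21_per hpsi _ tT.
  - exact: ppx.
  - by move=> x; exact: c21_dx hpsi i x t zT.
have E3 i : molli (pxx i) N (y, t) = \sum_j c j t * 'D_(unit_vec i) (fun x => 'D_(unit_vec i) (b j) x) y.
  rewrite -(cv_tensor _ (Kab'' i) Ipsi) /molli /=.
  rewrite cvN; [|exact: trig_D|exact: Ipsi].
  rewrite (cv_by_parts _ (tK' i) (c21_per hpsi tT) cpsi (cpx i) (fun x => c21_dx hpsi i x t zT)) opprK.
  apply/esym; apply: G1 => //; [exact: ppx|exact: ppxx|].
  by move=> x; exact: c21_dxx hpsi i x t zT.
rewrite big_split/= E1 (eq_bigr _ (fun i _ => E3 i)) (eq_bigr _ (fun i _ => congr1 (fun u => m y t 0 i * u) (E2 i))).
have A1 : \sum_j c' j t * (r y t * b j y) = r y t * \sum_j c' j t * b j y.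
  by rewrite mulr_sumr; apply: eq_bigr => j _; ring.
have A2 : \sum_j c j t * (r y t * (nu * laplacian (b j) y) + dot (m y t) (grad (b j) y)) =
    r y t * (nu * \sum_i \sum_j c j t * 'D_(unit_vec i) (fun x => 'D_(unit_vec i) (b j) x) y) +
    \sum_i m y t 0 i * \sum_j c j t * 'D_(unit_vec i) (b j) y.
  rewrite exchange_big/= !mulr_sumr.
  rewrite (eq_bigr (fun i => \sum_j m y t 0 i * (c j t * 'D_(unit_vec i) (b j) y))); last first.
    by move=> i _; rewrite mulr_sumr.
  rewrite exchange_big/= -big_split/=; apply: eq_bigr => j _.
  rewrite mulrDr /laplacian /dot !mulr_sumr; congr (_ + _).
    by apply: eq_bigr => i _; rewrite /partial; ring.
  by apply: eq_bigr => i _; rewrite mxE /partial; ring.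
by rewrite A1 A2; ring.
Qed.

(** Limit of the mollified identities. The mollified derivatives are bounded uniformly in [N] and
    converge pointwise, so [|r|] and the [|m_i|] times these bounds give an integrable majorant. *)
Lemma weak_identity :
  st.-integrable (QT T) (EFin \o weak_integrand (fun z => pt z.1 z.2) (fun i z => pxx i z.1 z.2) (fun i z => px i z.1 z.2)) /\
  IX (fun x => r x T * psi x T) - IX (fun x => r x 0 * psi x 0) =
  \int[st]_(z in QT T) weak_integrand (fun z => pt z.1 z.2) (fun i z => pxx i z.1 z.2) (fun i z => px i z.1 z.2) z.
Proof.
have ppt := @c21_per_t _ _ _ _ _ _ _ T0 hpsi.
have ppx i := @c21_per_x _ _ _ _ _ _ _ T0 hpsi i.
have ppxx i := @c21_per_xx _ _ _ _ _ _ _ T0 hpsi i.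
have cp := c21_cont hpsi; have cpt := c21_cont_t hpsi; have cpx := c21_cont_x hpsi; have cpxx := c21_cont_xx hpsi.
have [Mp Mp0 hMp] := molli_bounded T0 cp (c21_per hpsi).
have [Mt Mt0 hMt] := molli_bounded T0 cpt ppt.
have [Mx hMx] := choice (fun i => let: ex_intro2 M M0 h := molli_bounded T0 (cpx i) (ppx i) in ex_intro _ M (conj M0 h)).
have [Mxx hMxx] := choice (fun i => let: ex_intro2 M M0 h := molli_bounded T0 (cpxx i) (ppxx i) in ex_intro _ M (conj M0 h)).
have mQ := @QT_measurable R d T.
have Ir := admissible_integrable adm.
have mr := admissible_measurable adm.
have mm i : measurable_fun (QT T : set Q) (fun z => m z.1 z.2 0 i).
  by apply/measurable_EFinP; exact: measurable_int (admissible_momentum adm i).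
pose dom (z : V * R) := `|r z.1 z.2| * (Mt + `|nu| * \sum_i Mxx i) + \sum_i `|m z.1 z.2 0 i| * Mx i.
have Idom : st.-integrable (QT T) (EFin \o dom).
  apply: (RintegrableD mQ).
    apply: (RintegrableMb (M := `|Mt + `|nu| * \sum_i Mxx i|)) => //.
    exact: (integrable_abse Ir).
  apply: (Rintegrable_sum _ mQ) => i.
  apply: (RintegrableMb (M := `|Mx i|)) => //.
  exact: (integrable_abse (admissible_momentum adm i)).
have measW (p' : V * R -> R) pL pG : measurable_fun (QT T : set Q) p' ->
    (forall i : 'I_d, measurable_fun (QT T : set Q) (pL i)) -> (forall i : 'I_d, measurable_fun (QT T : set Q) (pG i)) ->
    measurable_fun (QT T : set Q) (weak_integrand p' pL pG).
  move=> m1 m2 m3; apply: measurable_funD.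
    apply: measurable_funM => //; apply: measurable_funD => //; apply: measurable_funM => //.
    by apply: measurable_sum => i; exact: m2.
  by apply: measurable_sum => i; apply: measurable_funM; [exact: mm|exact: m3].
have domW (p' : V * R -> R) pL pG z : `|p' z| <= Mt -> (forall i : 'I_d, `|pL i z| <= Mxx i) ->
    (forall i : 'I_d, `|pG i z| <= Mx i) -> `|weak_integrand p' pL pG z| <= dom z.
  move=> h1 h2 h3; rewrite /weak_integrand /dom; apply: le_trans (ler_normD _ _) _; apply: lerD.
    rewrite normrM ler_wpM2l//; apply: le_trans (ler_normD _ _) _; apply: lerD => //.
    rewrite normrM ler_wpM2l//; apply: le_trans (ler_norm_sum _ _ _) _.
    by apply: ler_sum => i _; exact: h2.
  apply: le_trans (ler_norm_sum _ _ _) _; apply: ler_sum => i _.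
  by rewrite normrM ler_wpM2l.
have mW := measW (fun z => pt z.1 z.2) (fun i z => pxx i z.1 z.2) (fun i z => px i z.1 z.2)
   (cont_QTbar_measurable cpt) (fun i => cont_QTbar_measurable (cpxx i)) (fun i => cont_QTbar_measurable (cpx i)).
have cvW z : QT T z -> weak_integrand (molli pt N) (fun i => molli (pxx i) N) (fun i => molli (px i) N) z @[N --> \oo] -->
    weak_integrand (fun z => pt z.1 z.2) (fun i z => pxx i z.1 z.2) (fun i z => px i z.1 z.2) z.
  move=> zT; have zT' := oo_cc zT; apply: cvgD.
    apply: cvgM; first exact: cvg_cst.
    apply: cvgD; first exact: molli_cvg cpt ppt _ zT'.
    apply: cvgM; first exact: cvg_cst.
    by apply: cvgr_sum => i; exact: molli_cvg (cpxx i) (ppxx i) _ zT'.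
  apply: cvgr_sum => i; apply: cvgM; first exact: cvg_cst.
  exact: molli_cvg (cpx i) (ppx i) _ zT'.
have dW z N : QT T z -> `|weak_integrand (molli pt N) (fun i => molli (pxx i) N) (fun i => molli (px i) N) z| <= dom z.
  move=> zT; have zT' := oo_cc zT; apply: domW; [exact: hMt|by move=> i; apply: (hMxx i).2|by move=> i; apply: (hMx i).2].
have IW : st.-integrable (QT T) (EFin \o weak_integrand (fun z => pt z.1 z.2) (fun i z => pxx i z.1 z.2) (fun i z => px i z.1 z.2)).
  apply: (Rintegrable_le mQ mW _ Idom) => z zT.
  apply: (cvgr_to_le (cvg_norm (cvW z zT))); apply: nearW => N; exact: dW.
split => //.
have C1 := Rdominated_cvg mQ (fun N => measW _ _ _ (molli_measurable cpt ppt N) (fun i => molli_measurable (cpxx i) (ppxx i) N) (fun i => molli_measurable (cpx i) (ppx i) N)) mW cvW Idom dW.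
have Lcv t : 0 <= t <= T -> IX (fun x => r x t * molli psi N (x, t)) @[N --> \oo] --> IX (fun x => r x t * psi x t).
  move=> tT; have [Irt _] := density_integrable (admissible_density adm tT).
  have mrt : measurable_fun setT (r ^~ t) by apply/measurable_EFinP; exact: measurable_int Irt.
  apply: (@Rdominated_cvg R _ _ (cube_leb d) setT (fun N x => r x t * molli psi N (x, t)) (fun x => r x t * psi x t) (fun x => `|r x t| * Mp)) => //.
  - move=> N; apply: measurable_funM => //; apply: trig_measurable.
    apply: (@cv_trig R d (bumpn N) (psi ^~ t)); first exact: tensor_bumpn.
    exact: slice_integrable cp (c21_per hpsi) _ tT.
  - by apply: measurable_funM => //; apply: continuous_mx_measurable; exact: cont_QTbar_slice cp tT.
  - by move=> x _; apply: cvgM; [exact: cvg_cst|exact: molli_cvg cp (c21_per hpsi) (x, t) tT].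
  - apply: (RintegrableMb (M := `|Mp|)) => //; exact: (integrable_abse Irt).
  - by move=> x N _; rewrite normrM ler_wpM2l//; exact: hMp.
have Tin : 0 <= T <= T by rewrite lexx ltW.
have zin : 0 <= (0 : R) <= T by rewrite lexx ltW.
have C2 : (IX (fun x => r x T * molli psi N (x, T)) - IX (fun x => r x 0 * molli psi N (x, 0))) @[N --> \oo] -->
    IX (fun x => r x T * psi x T) - IX (fun x => r x 0 * psi x 0).
  by apply: cvgB; exact: Lcv.
move: C2; under eq_fun do rewrite weak_identity_molli; move=> C2.
by apply: (cvg_unique _ C2 C1).
Qed.

End one_test.
End weak_identity.

(** * Kinetic cost and verification *)

Section rational_sup.
Context {R : realType} {n : nat}.
Local Notation V := 'rV[R]_n.

(* The supremum defining the Lagrangian may be taken over a countable set of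
   momenta, which makes the kinetic cost measurable. *)
Definition rational_vec (k : nat) : V := map_mx ratr (odflt 0 (unpickle k) : 'rV[rat]_n).

Lemma rational_vec_dense (p : V) (e : R) : 0 < e -> exists k, ball p e (rational_vec k).
Proof.
move=> e0; have h i : exists q : rat, p 0 i < ratr q < p 0 i + e.
  have [|q] := @rat_in_itvoo R (p 0 i) (p 0 i + e); first by rewrite ltrDl.
  by rewrite in_itv/= => hq; exists q.
have [q hq] := choice h.
exists (pickle (\row_i q i)); rewrite /rational_vec pickleK/=.
split => // i j; rewrite (ord1 i) !mxE /ball/=.
by have /andP[q1 q2] := hq j; rewrite ltr_norml; apply/andP; split; lra.
Qed.

Lemma sup_rational (g : V -> R) p : continuous g ->
  ((g p)%:E <= ereal_sup (range (fun k => (g (rational_vec k))%:E)))%E.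
Proof.
move=> cg; apply/lee_addgt0Pr => e e0.
have /cvgrPdist_lt/(_ e e0)/nbhs_ballP[dl /= dl0 hd] : g x @[x --> nbhs (p : V)] --> g p by exact: cg.
have [k hk] := rational_vec_dense p dl0.
apply: (@le_trans _ _ ((g (rational_vec k))%:E + e%:E)%E).
  rewrite -EFinD lee_fin; have := hd _ hk; rewrite /= ltr_norml; lra.
by apply: leeD => //; apply: ereal_sup_ubound; exists k.
Qed.

End rational_sup.

Section kinetic.
Context {R : realType} {n : nat}.
Local Notation V := 'rV[R]_n.+1.
Local Notation Q := ('rV[R]_n.+1 * measurableTypeR R)%type.
Variable D : mfg_data R n.+1.
Local Notation H := (hamiltonian D).
Hypothesis cvxH : forall x, convexR (H x).
Hypothesis cH : forall p, continuous (H ^~ p).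
Hypothesis cpH : forall x, continuous (H x).
Hypothesis dH : forall x p i, derivable (H x) p (unit_vec i).

Lemma dotC (u v : V) : dot u v = dot v u.
Proof. by rewrite /dot; apply: eq_bigr => i _; rewrite mulrC. Qed.

Lemma dotZ (k : R) (u v : V) : dot u (k *: v) = k * dot u v.
Proof. by rewrite /dot mulr_sumr; apply: eq_bigr => i _; rewrite !mxE; ring. Qed.

Lemma dotN (u v : V) : dot u (- v) = - dot u v.
Proof. by rewrite -scaleN1r dotZ mulN1r. Qed.

Lemma dotBl (u v w : V) : dot (u - v) w = dot u w - dot v w.
Proof. by rewrite /dot -sumrB; apply: eq_bigr => i _; rewrite !mxE; ring. Qed.

Lemma dot_gt0 (u : V) : u != 0 -> 0 < dot u u.
Proof.
move=> u0; rewrite lt_neqAle; apply/andP; split; last first.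
  by apply: sumr_ge0 => i _; rewrite -expr2 sqr_ge0.
apply: contraNN u0 => /eqP/esym/psumr_eq0P h; apply/eqP/rowP => i; rewrite mxE.
have /eqP : u 0 i * u 0 i = 0 by apply: h => // j _; rewrite -expr2 sqr_ge0.
by rewrite mulf_eq0 orbb => /eqP.
Qed.

(** The quantity [r (- <p, w / r> - H x p)] multiplied out, which remains meaningful at [r = 0]. *)
Definition legendre x (r : R) (w p : V) : R := - dot p w - r * H x p.

Lemma legendre_continuous x r w : continuous (legendre x r w).
Proof.
apply: ctsB; last by apply: ctsM; [exact: cts_cst|exact: cpH].
apply: ctsN; rewrite /dot.
apply: cts_sum => i; apply: ctsM; last exact: cts_cst.
by move=> p; exact: coord_continuous.
Qed.

Lemma kinetic_ge x (r : R) (w p : V) : 0 <= r -> ((legendre x r w p)%:E <= kinetic D x r w)%E.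
Proof.
rewrite le_eqVlt /kinetic eq_sym => /orP[/eqP->|r0].
  rewrite eqxx /legendre mul0r subr0; case: eqVneq => [->|w0]; last by rewrite leey.
  by rewrite /dot big1 ?oppr0// => i _; rewrite mxE mulr0.
rewrite gt_eqF// -lee_pdivrMl//.
apply: ereal_sup_ubound; exists p => //; rewrite -EFinM; congr EFin.
by rewrite /legendre dotZ; field; rewrite gt_eqF.
Qed.

(** For positive [r] the factor is taken inside the supremum. At [r = 0] the supremum of [- <p, w>]
    is 0 if [w = 0] and infinite otherwise, in agreement with the conventions in [kinetic]. *)
Lemma kinetic_sup x (r : R) (w : V) : 0 <= r ->
  kinetic D x r w = ereal_sup (range (fun k => (legendre x r w (rational_vec k))%:E)).
Proof.
move=> r0; apply/eqP; rewrite eq_le; apply/andP; split; last first.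
  by apply: ub_ereal_sup => _ [k _ <-]; exact: kinetic_ge.
have hS p := sup_rational p (legendre_continuous (x := x) (r := r) (w := w)).
set S := ereal_sup _ in hS *.
rewrite /kinetic; have [re|rn] := eqVneq r 0.
  rewrite re in hS; case: eqVneq => [we|w0].
    have := hS 0; rewrite /legendre we /dot big1; first by rewrite oppr0 mul0r subr0.
    by move=> i _; rewrite mxE mul0r.
  rewrite leye_eq; apply/eqP/eqyP => M M0.
  (* At this momentum [- <p, w>] equals [M]. *)
  have := hS (- (M / dot w w) *: w); apply: le_trans.
  rewrite lee_fin /legendre mul0r subr0 dotC dotZ mulNr opprK divfK//.
  by rewrite gt_eqF// dot_gt0.
have rp : 0 < r by rewrite lt_neqAle eq_sym rn.
rewrite -lee_pdivlMl//.
apply: ub_ereal_sup => _ [p _ <-]; rewrite lee_pdivlMl//.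
apply: le_trans (hS p); rewrite -EFinM lee_fin /legendre dotZ le_eqVlt; apply/orP; left; apply/eqP.
by field; rewrite gt_eqF.
Qed.

Lemma kinetic_eq x (r : R) (w p : V) : 0 <= r -> w = - (r *: DpH D x p) ->
  kinetic D x r w = (legendre x r w p)%:E.
Proof.
move=> r0 we; apply/eqP; rewrite eq_le (kinetic_ge _ _ _ r0) andbT kinetic_sup//.
apply: ub_ereal_sup => _ [k _ <-]; rewrite lee_fin /legendre we !dotN !opprK !dotZ -!mulrBr ler_wpM2l//.
have := convex_gradient (cvxH x) (rational_vec k) (fun i => @dH x p i).
by rewrite dotBl /DpH; lra.
Qed.

(** Equality makes [p] a maximum point of [legendre x r w], so the partial derivatives
    [- w_i - r d_i H (x, p)] vanish there. *)
Lemma kinetic_eq_inv x (r : R) (w p : V) : 0 <= r ->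
  kinetic D x r w = (legendre x r w p)%:E -> w = - (r *: DpH D x p).
Proof.
move=> r0 ke; apply/rowP => i; rewrite !mxE.
have h q : legendre x r w q <= legendre x r w p by rewrite -lee_fin -ke kinetic_ge.
have dp : is_derive p (unit_vec i) (H x) (partial i (H x) p) by exact/derivableP/dH.
have dot_unit : dot (unit_vec i) w = w 0 i.
  rewrite /dot (bigD1 i)//= big1 ?addr0; first by rewrite mxE !eqxx mul1r.
  by move=> j ji; rewrite mxE (negbTE ji) andbF mul0r.
have dd : is_derive p (unit_vec i) (dot ^~ w) (w 0 i).
  rewrite -dot_unit; apply: (@is_derive_lin R V (dot ^~ w)) => s q.
  by rewrite /dot mulr_sumr -big_split/=; apply: eq_bigr => j _; rewrite !mxE; ring.
have dl : is_derive p (unit_vec i) (legendre x r w) (- w 0 i - r * partial i (H x) p).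
  exact: (fderiveB (fderiveN dd) (fderiveZ r dp)).
have dF := (is_derive_line_inv _ _ _ _).1 dl.
set l := - w 0 i - _ in dF.
have l0 : l <= 0.
  apply: (derive_le_slope dF) => s _; rewrite mulr0 scale0r addr0 subr_le0; exact: h.
have l1 : 0 <= l.
  have hN : is_derive (0 : R) 1 (fun s : R => - s) (- 1) by apply: fderiveN; exact: is_derive_id.
  have dF' : is_derive (- (0 : R)) 1 (fun s => legendre x r w (p + s *: unit_vec i)) l by rewrite oppr0.
  have dN := is_derive_comp1 dF' hN; rewrite mulrN1 in dN.
  rewrite -oppr_le0; apply: (derive_le_slope dN) => s _; rewrite mulr0 oppr0 scale0r addr0 subr_le0; exact: h.
by move: l0 l1; rewrite /l /DpH /grad; lra.
Qed.

Lemma kinetic_measurable (A : set Q) (r : Q -> R) (m : Q -> V) : measurable A ->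
  (forall z, A z -> 0 <= r z) -> measurable_fun A r -> (forall i, measurable_fun A (fun z => m z 0 i)) ->
  measurable_fun A (fun z => kinetic D z.1 (r z) (m z)).
Proof.
move=> mA r0 mr mm.
pose f k (z : Q) := (legendre z.1 (r z) (m z) (rational_vec k))%:E.
apply: (@eq_measurable_fun _ _ _ _ _ (fun z => esups (f ^~ z) 0)).
  move=> z /set_mem zA; rewrite (kinetic_sup _ _ (r0 z zA)) /esups/=; congr ereal_sup.
  by apply/seteqP; split => y [k _ <-]; exists k.
apply: measurable_fun_esups => k; apply/measurable_EFinP; apply: measurable_funB.
  apply: measurableT_comp => //; apply: measurable_sum => i; apply: measurable_funM => //.
apply: measurable_funM => //; apply: measurable_funTS.
exact: (measurableT_comp (continuous_mx_measurable (@cH (rational_vec k))) measurable_fst).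
Qed.

End kinetic.

Section integral_lower_bound.
Context {R : realType} {disp} {X : measurableType disp}.
Variable mu : {measure set X -> \bar R}.

(** The function [k] may fail to be integrable, as the kinetic cost may be infinite. The minorant
    makes its negative part integrable, so in that case the integral is [+oo] and both sides of the
    equivalence fail. *)
Lemma integral_integrable_minorant (D : set X) (k : X -> \bar R) (l : X -> R) :
  measurable D -> measurable_fun D k -> mu.-integrable D (EFin \o l) ->
  (forall x, D x -> ((l x)%:E <= k x)%E) ->
  ((\int[mu]_(x in D) l x)%:E <= \int[mu]_(x in D) k x)%E /\
  ((\int[mu]_(x in D) k x = (\int[mu]_(x in D) l x)%:E)%E <-> ae_eq mu D k (EFin \o l)).
Proof.
move=> mD mk Il lk; have ml := measurable_int _ Il.
have fl : (\int[mu]_(x in D) (l x)%:E)%E \is a fin_num by exact: integrable_fin_num.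
have lE : (\int[mu]_(x in D) l x)%:E = (\int[mu]_(x in D) (l x)%:E)%E by rewrite /Rintegral fineK.
rewrite lE.
have back : ae_eq mu D k (EFin \o l) -> (\int[mu]_(x in D) k x = \int[mu]_(x in D) (l x)%:E)%E.
  by move=> h; apply: ae_eq_integral.
have [Ik|nIk] := boolP (mu.-integrable D k).
  split; first by apply: le_integral => // x /set_mem; exact: lk.
  split => // E.
  have Ikl := integrableB mD Ik Il.
  have : (\int[mu]_(x in D) (k \- (EFin \o l)) x = 0)%E by rewrite integralB// E subee.
  have -> : (\int[mu]_(x in D) (k \- (EFin \o l)) x = \int[mu]_(x in D) `|(k \- (EFin \o l)) x|)%E.
    by apply: eq_integral => x /set_mem Dx; rewrite gee0_abs// sube_ge0//; exact: lk.
  move/ae_eq_integral_abs => /(_ mD (measurable_int _ Ikl)); apply: filterS => x h Dx.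
  have := h Dx; rewrite /=; case: (k x) => [y| |] //= [] /eqP.
  by rewrite subr_eq0 => /eqP ->.
have koo : (\int[mu]_(x in D) k x = +oo)%E.
  have nk : (\int[mu]_(x in D) k^\- x < +oo)%E.
    have /integrableP[_ fin] := Il; apply: le_lt_trans fin; apply: ge0_le_integral => //.
    - exact: measurable_funeneg.
    - exact: measurableT_comp.
    - move=> x Dx; rewrite funenegE ge_max abse_ge0 andbT.
      have := lk x Dx; case: (k x) => [y| |] //=; rewrite ?lee_fin ?leNye// => h.
      by apply: le_trans (_ : - l x <= _); [rewrite lerN2|rewrite -normrN ler_norm].
  have pk : (\int[mu]_(x in D) k^\+ x = +oo)%E.
    apply/eqP; rewrite -leye_eq leNgt; apply/negP => pk; move/negP: nIk; apply.
    apply/integrableP; split => //.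
    rewrite -[X in (X < _)%E]/(\int[mu]_(x in D) (abse \o k) x)%E fune_abse.
    rewrite ge0_integralD//; [exact: lte_add_pinfty|exact: measurable_funepos|exact: measurable_funeneg].
  rewrite integralE pk; have : (0 <= \int[mu]_(x in D) k^\- x)%E by apply: integral_ge0.
  by move: nk; case: (\int[mu]_(x in D) k^\- x)%E.
rewrite koo leey; split => //; split => [E|/back <-//].
by move: fl; rewrite -E.
Qed.

End integral_lower_bound.

Section C21_c21.
Context {R : realType} {d : nat}.
Local Notation V := 'rV[R]_d.

Lemma C21_c21 (T : R) (u : V -> R -> R) : 0 < T ->
  (forall t, 0 <= t <= T -> Defs.periodic (u ^~ t)) -> C21 T u ->
  exists ut ux uxx, [/\ c21 T u ut ux uxx,
    forall x t, 0 < t < T -> ut x t = time_deriv u x t,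
    forall i x t, 0 < t < T -> ux i x t = partial i (u ^~ t) x &
    forall i x t, 0 < t < T -> uxx i x t = partial i (partial i (u ^~ t)) x].
Proof.
move=> T0 pu [cu dt dx dxx [[ut [cut Eut]] hx hxx]].
have [ux hux] := choice hx.
have [uxx huxx] := choice (fun i => hxx i i).
exists ut, ux, uxx; split.
- split => //.
  + by move=> i; have [] := hux i.
  + by move=> i; have [] := huxx i.
  + by move=> x t tT; rewrite (Eut x t tT); apply/derivableP/dt.
  + by move=> i x t tT; rewrite ((hux i).2 x t tT); apply/derivableP/dx.
  + move=> i x t tT; rewrite ((huxx i).2 x t tT).
    have -> : ux i ^~ t = partial i (u ^~ t) by apply/funext => y; exact: (hux i).2.
    by apply/derivableP/dxx.
- exact: Eut.
- by move=> i; exact: (hux i).2.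
- by move=> i; exact: (huxx i).2.
Qed.

End C21_c21.

(** * Verification for a solution of the backward equation *)

Section data.
Context {R : realType} {n : nat}.
Local Notation V := 'rV[R]_n.+1.
Local Notation Q := ('rV[R]_n.+1 * measurableTypeR R)%type.
Local Notation leb := (@lebesgue_measure R).
Local Notation st := (@space_time_leb R n.+1).
Variable D : mfg_data R n.+1.
Hypothesis hD : standing_assumptions D.
Local Notation H := (hamiltonian D).
Local Notation T := (horizon D).
Local Notation nu := (viscosity D).
Local Notation rho0 := (init_density D).

Lemma data_horizon : 0 < T. Proof. by have [[]] := hD. Qed.
Lemma data_viscosity : 0 < nu. Proof. by have [[]] := hD. Qed.

Lemma data_convex x : convexR (H x).
Proof.
have [_ _ [_ _ hc _] _ _] := hD => p q s /andP[s0 s1].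
have [->|pq] := eqVneq p q; first by rewrite -scalerDl subrKC scale1r -mulrDl subrKC mul1r.
move: s0 s1; rewrite !le_eqVlt => /orP[/eqP<- _|s0 /orP[/eqP->|s1]].
- by rewrite scale0r add0r subr0 scale1r mul0r add0r mul1r eqxx.
- by rewrite subrr scale0r addr0 scale1r mul0r addr0 mul1r eqxx.
- by rewrite hc ?s0 ?orbT.
Qed.

Lemma data_periodic p : Defs.periodic (H ^~ p).
Proof. by have [_ _ [h _ _ _] _ _] := hD; have [] := h p. Qed.

Lemma data_continuous_x p : continuous (H ^~ p).
Proof. by have [_ _ [h _ _ _] _ _] := hD; have [_ /Ck_continuous] := h p. Qed.

Lemma data_continuous_p x : continuous (H x).
Proof. by have [_ _ [_ h _ _] _ _] := hD; apply: (@Ck_continuous _ _ 0); exact: h. Qed.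

Lemma data_derivable x p i : derivable (H x) p (unit_vec i).
Proof.
have [_ _ [_ h _ _] _ _] := hD; have /CkSP[_ /(_ (unit_vec i))[g [dg _]]] := h x 1%N.
by have [] := dg p.
Qed.

Lemma cts_row (W : topologicalType) (f : 'I_n.+1 -> W -> R) :
  (forall i, continuous (f i)) -> continuous (fun w => \row_i f i w : V).
Proof.
move=> cf.
have -> : (fun w => \row_i f i w : V) = (fun w => \sum_i f i w *: unit_vec i).
  apply/funext => w; rewrite [LHS]row_sum_delta; apply: eq_bigr => i _.
  by rewrite mxE.
elim: (index_enum _) => [|i l IH].
  by under eq_fun do rewrite big_nil; exact: cts_cst.
under eq_fun do rewrite big_cons.
by apply: ctsD => // w; apply: cvgZl; exact: cf.
Qed.

Section gradient.
Variables (phi phit : V -> R -> R) (phix phixx : 'I_n.+1 -> V -> R -> R).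
Hypothesis hphi : c21 T phi phit phix phixx.

(** The gradient of [phi] extended continuously to the end times, where [grad] is not controlled. *)
Definition pgrad (x : V) (t : R) : V := \row_i phix i x t.

Definition hphi_H (x : V) (t : R) : R := H x (pgrad x t).
Definition hphi_b i (x : V) (t : R) : R := partial i (H x) (pgrad x t).

Lemma pgrad_periodic t : 0 <= t <= T -> Defs.periodic (pgrad ^~ t).
Proof.
move=> tT x i; apply/rowP => j; rewrite !mxE.
exact: (c21_per_x data_horizon hphi j tT).
Qed.

Lemma cont_pair_pgrad : {within QTbar T, continuous (fun z : V * R => (z.1, pgrad z.1 z.2))}.
Proof.
apply: cts_pair; first by apply: continuous_subspaceT; exact: cts_fst.
by apply: cts_row => i; exact: c21_cont_x hphi i.
Qed.

Lemma cont_hphi_H : cont_QTbar T hphi_H.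
Proof.
exact: (cts_comp cont_pair_pgrad (hamiltonian_continuous data_convex data_continuous_x)).
Qed.

Lemma cont_hphi_b i : cont_QTbar T (hphi_b i).
Proof.
exact: (cts_comp cont_pair_pgrad (@DpH_continuous _ _ _ data_convex data_continuous_x data_derivable i)).
Qed.

Lemma H_shift x i : H (x + unit_vec i) = H x.
Proof. by apply/funext => p; exact: data_periodic. Qed.

Lemma per_hphi_H t : 0 <= t <= T -> Defs.periodic (hphi_H ^~ t).
Proof. by move=> tT x i; rewrite /hphi_H H_shift (pgrad_periodic tT). Qed.

Lemma per_hphi_b j t : 0 <= t <= T -> Defs.periodic (hphi_b j ^~ t).
Proof. by move=> tT x i; rewrite /hphi_b H_shift (pgrad_periodic tT). Qed.


Section verification.
Variable rho : V -> R -> R.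
Hypothesis hrun : forall x t, 0 < t < T ->
  - phit x t - nu * (\sum_i phixx i x t) + hphi_H x t = cost (running_cost D) x (rho ^~ t).
Hypothesis hter : forall x, phi x T = cost (terminal_cost D) x (rho ^~ T).
Variables (r : V -> R -> R) (m : V -> R -> V).
Hypothesis adm : admissible D r m.
Let T0 := data_horizon.

Definition value : R := IX (fun x => rho0 x * phi x 0).

Let W := weak_integrand D r m (fun z => phit z.1 z.2) (fun i z => phixx i z.1 z.2) (fun i z => phix i z.1 z.2).
Let l (z : V * R) : R := legendre D z.1 (r z.1 z.2) (m z.1 z.2) (pgrad z.1 z.2).

Let Il : st.-integrable (QT T) (EFin \o l).
Proof.
have mQ := @QT_measurable R n.+1 T.
have Ir := admissible_integrable adm.
apply: (RintegrableB mQ); last first.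
  have [M hM] := QTbar_bounded_periodic cont_hphi_H per_hphi_H.
  by apply: (RintegrableMb (M := M) mQ Ir (cont_QTbar_measurable cont_hphi_H)) => z /oo_cc; exact: hM.
have : st.-integrable (QT T) (EFin \o (fun z => -1 * dot (pgrad z.1 z.2) (m z.1 z.2))).
  apply: (RintegrableZ _ mQ); rewrite /dot; apply: (Rintegrable_sum _ mQ) => i.
  have [M hM] := QTbar_bounded_periodic (c21_cont_x hphi i) (fun t tT => c21_per_x T0 hphi i tT).
  have := RintegrableMb (M := M) mQ (admissible_momentum adm i) (cont_QTbar_measurable (c21_cont_x hphi i)) (fun z zT => hM _ _ (oo_cc zT)).
  by apply: (eq_integrable mQ) => z _ /=; rewrite mxE mulrC.
by apply: (eq_integrable mQ) => z _ /=; rewrite mulN1r.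
Qed.

(** The backward equation and its terminal condition express both couplings through [phi], and the
    weak identity tested with [phi] evaluates them. The excess of the cost over [value] is then the
    integral of [kinetic] minus that of its affine minorant [l]. *)
Lemma total_cost_excess :
  total_cost D rho r m = (dynamic_cost D r m + (value - \int[st]_(z in QT T) l z)%:E)%E.
Proof.
have mQ := @QT_measurable R n.+1 T.
have [IW WE] := weak_identity T0 adm hphi.
(* Pointwise, [- l - W] is [r] times the left side of the backward equation, hence the running cost:
   the two products of [m] with the gradient cancel. *)
have Ic : st.-integrable (QT T) (EFin \o (fun z => - l z - W z)).
  have : st.-integrable (QT T) (EFin \o (fun z => -1 * l z - W z)).
    by apply: (RintegrableB mQ) => //; exact: RintegrableZ.
  by apply: (eq_integrable mQ) => z _ /=; rewrite mulN1r.
have runE : (\int[st]_(z in QT T) (cost (running_cost D) z.1 (rho ^~ z.2) * r z.1 z.2)%:E =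
    ((- (\int[st]_(z in QT T) l z) - \int[st]_(z in QT T) W z)%R)%:E)%E.
  rewrite -[RHS](_ : (\int[st]_(z in QT T) (- l z - W z))%:E = _)%R; last first.
    have -> : \int[st]_(z in QT T) (- l z - W z) = \int[st]_(z in QT T) (-1 * l z - W z).
      by apply: eq_Rintegral => z _; rewrite mulN1r.
    by rewrite (RintegralB mQ (RintegrableZ (-1) mQ Il) IW) RintegralZl// mulN1r.
  rewrite /Rintegral fineK; last exact: (integrable_fin_num mQ Ic).
  apply: eq_integral => z /set_mem zT; congr EFin.
  rewrite -hrun// /l /W /legendre /weak_integrand /hphi_H /dot.
  have -> : \sum_i pgrad z.1 z.2 0 i * m z.1 z.2 0 i = \sum_i m z.1 z.2 0 i * phix i z.1 z.2.
    by apply: eq_bigr => i _; rewrite mxE mulrC.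
  ring.
have Tin : 0 <= T <= T by rewrite lexx ltW.
have zin : 0 <= (0 : R) <= T by rewrite lexx ltW.
have Ird t : 0 <= t <= T -> (cube_leb n.+1).-integrable setT (EFin \o (fun x => r x t * phi x t)).
  move=> tT; have [M hM] := QTbar_bounded_periodic (c21_cont hphi) (c21_per hphi).
  apply: (RintegrableMb (M := M)) => //; first by have [] := density_integrable (admissible_density adm tT).
    by apply: continuous_mx_measurable; exact: cont_QTbar_slice (c21_cont hphi) tT.
  by move=> x _; exact: hM.
have terE : (\int[cube_leb n.+1]_x (cost (terminal_cost D) x (rho ^~ T) * r x T)%:E =
    (IX (fun x => r x T * phi x T))%:E)%E.
  rewrite /IX /Rintegral fineK; last exact: (integrable_fin_num measurableT (Ird T Tin)).
  by apply: eq_integral => x _; rewrite -hter mulrC.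
have valE : value = IX (fun x => r x 0 * phi x 0).
  have [_ _ _ r0 _] := adm; rewrite /value /IX /Rintegral; congr fine.
  apply: ae_eq_integral => //.
  - apply/measurable_EFinP; apply: measurable_funM.
      by have [_ [[_ m0 _ _] _ _] _ _ _] := hD.
    by apply: continuous_mx_measurable; exact: cont_QTbar_slice (c21_cont hphi) zin.
  - exact: measurable_int (Ird 0 zin).
  - by apply: filterS r0 => x -> _.
rewrite /total_cost runE terE -addeA -EFinD; congr (_ + _%:E)%E.
have aux (a b c d : R) : a - b = c -> - d - c + a = b - d by move=> <-; ring.
by rewrite valE; apply: aux; exact: WE.
Qed.

Lemma verification :
  (value%:E <= total_cost D rho r m)%E /\
  (total_cost D rho r m = value%:E <->
   {ae st, forall z : Q, QT T z -> m z.1 z.2 = - (r z.1 z.2 *: DpH D z.1 (pgrad z.1 z.2))}).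
Proof.
have mQ := @QT_measurable R n.+1 T.
have r0 z : QT T z -> 0 <= r z.1 z.2.
  by move=> /oo_cc zT; have [_ _ h _] := admissible_density adm zT; exact: h.
have mm i : measurable_fun (QT T : set Q) (fun z => m z.1 z.2 0 i).
  by apply/measurable_EFinP; exact: measurable_int (admissible_momentum adm i).
have mk := @kinetic_measurable R n D data_continuous_x data_continuous_p (QT T) (fun z => r z.1 z.2) (fun z => m z.1 z.2) mQ r0 (admissible_measurable adm) mm.
have [le eq] := integral_integrable_minorant mQ mk Il (fun z zT => kinetic_ge _ _ _ _ (r0 z zT)).
rewrite total_cost_excess; set L := \int[st]_(z in QT T) l z in le eq *.
split.
  rewrite -(_ : (L%:E + (value - L)%:E = value%:E)%E); last by rewrite -EFinD; congr EFin; ring.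
  exact: leeD.
have -> : (dynamic_cost D r m + (value - L)%:E = value%:E)%E <-> dynamic_cost D r m = L%:E.
  split=> [|->]; last by rewrite -EFinD; congr EFin; ring.
  case: (dynamic_cost D r m) => [x| |] //=; rewrite -EFinD => -[h]; congr EFin; lra.
rewrite /dynamic_cost eq; split; apply: filterS => z h zT.
  have := h zT; apply: (kinetic_eq_inv data_derivable); exact: r0.
by apply: (kinetic_eq data_convex) => //; [exact: data_continuous_p|exact: data_derivable|exact: r0|exact: h].
Qed.

End verification.
End gradient.
End data.

(** * The classical forward equation *)

Section fokker_planck.
Context {R : realType} {n : nat}.
Local Notation V := 'rV[R]_n.+1.
Local Notation Q := ('rV[R]_n.+1 * measurableTypeR R)%type.
Local Notation leb := (@lebesgue_measure R).
Local Notation st := (@space_time_leb R n.+1).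
Variable D : mfg_data R n.+1.
Hypothesis hD : standing_assumptions D.
Local Notation H := (hamiltonian D).
Local Notation T := (horizon D).
Local Notation nu := (viscosity D).
Local Notation rho0 := (init_density D).
Variables (phi phit : V -> R -> R) (phix phixx : 'I_n.+1 -> V -> R -> R).
Hypothesis hphi : c21 T phi phit phix phixx.
Hypothesis phixE : forall i x t, 0 < t < T -> phix i x t = partial i (phi ^~ t) x.
Variables (r rt : V -> R -> R) (rx rxx : 'I_n.+1 -> V -> R -> R).
Hypothesis hr : c21 T r rt rx rxx.
Hypothesis rtE : forall x t, 0 < t < T -> rt x t = time_deriv r x t.
Hypothesis rxxE : forall i x t, 0 < t < T -> rxx i x t = partial i (partial i (r ^~ t)) x.
Hypothesis FP : solves_FP D phi r.
Hypothesis r_gt0 : forall x t, 0 <= t <= T -> 0 < r x t.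
Let T0 := data_horizon hD.
Local Notation b := (hphi_b D phix).

(** The momentum [- r D_p H] in the form needed by [classical_identity]; being built on [pgrad], it
    is defined and continuous up to the end times. *)
Definition FP_flux (i : 'I_n.+1) (x : V) (t : R) : R := - (r x t * b i x t).
Definition FP_flux_div (i : 'I_n.+1) (x : V) (t : R) : R :=
  - partial i (fun y => drift_flux D r phi y t 0 i) x.

Lemma grad_pgrad x t : 0 < t < T -> grad (phi ^~ t) x = pgrad phix x t.
Proof. by move=> tT; apply/rowP => i; rewrite !mxE phixE. Qed.

Lemma drift_FP_flux i x t : 0 < t < T -> drift_flux D r phi x t 0 i = - FP_flux i x t.
Proof. by move=> tT; rewrite /drift_flux /FP_flux opprK !mxE grad_pgrad. Qed.

Lemma cont_FP_flux i : cont_QTbar T (FP_flux i).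
Proof.
by apply: ctsN; apply: ctsM; [exact: c21_cont hr|exact: cont_hphi_b hD _ _ _ _ hphi i].
Qed.

Lemma per_FP_flux i t : 0 <= t <= T -> Defs.periodic (FP_flux i ^~ t).
Proof. by move=> tT x j; rewrite /FP_flux (c21_per hr tT) (per_hphi_b hD hphi i tT). Qed.

Lemma FP_flux_regular i t : 0 < t < T -> [/\ Defs.periodic (FP_flux i ^~ t), continuous (FP_flux i ^~ t),
     continuous (FP_flux_div i ^~ t) & forall x, is_derive x (unit_vec i) (FP_flux i ^~ t) (FP_flux_div i x t)].
Proof.
move=> tT; have tT' := oo_cc tT.
have [_ _ /(_ i)[dF cF] _ _] := FP.
split; [exact: per_FP_flux|exact: cont_QTbar_slice (@cont_FP_flux i) tT'| |].
  apply: ctsN; apply/continuous_subspace_setT.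
  apply: (@within_comp _ _ _ setT (QT T) (fun x : V => (x, t)) (fun z => partial i (fun y => drift_flux D r phi y z.2 0 i) z.1)) => //.
  by apply: cts_pair; [exact: cts_id|exact: cts_cst].
move=> x; rewrite /FP_flux_div.
have -> : FP_flux i ^~ t = (fun y => - drift_flux D r phi y t 0 i).
  by apply/funext => y; rewrite drift_FP_flux// opprK.
by apply: fderiveN; apply/derivableP/dF.
Qed.

Lemma FP_equation x t : 0 < t < T -> rt x t = nu * (\sum_i rxx i x t) - \sum_i FP_flux_div i x t.
Proof.
move=> tT; have [_ _ _ /(_ x t tT) e _] := FP.
rewrite rtE// (eq_bigr (fun i => partial i (partial i (r ^~ t)) x)); last by move=> i _; exact: rxxE.
rewrite sumrN opprK; move: e; rewrite /laplacian /divergence.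
set a := time_deriv _ _ _; set s1 := \sum_i partial i (partial i _) x; set s2 := \sum_i _.
by move=> e; lra.
Qed.

Lemma c21_cst (k : R) : c21 T (fun (_ : V) _ => k) (fun _ _ => 0) (fun _ _ _ => 0) (fun _ _ _ => 0).
Proof.
by split => //; do ?[move=> i|move=> x t tT|move=> *]; rewrite /cont_QTbar; try exact: fderive_cst; exact: cts_cst.
Qed.

(** Duality with the constant function 1, whose derivatives all vanish, shows that the mass is
    conserved. *)
Lemma FP_mass t : 0 <= t <= T -> IX (r ^~ t) = 1.
Proof.
move=> tT; have := classical_identity T0 hr (c21_cst 1) FP_flux_regular FP_equation tT.
set I := (X in _ = X); have -> : I = \int[leb]_(s in `]0, t[) (cst (0 : R) s).
  apply: eq_Rintegral => s _; rewrite -[RHS](@IX_cst R n.+1); apply: eq_IX => x.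
  by rewrite big1// mulr0 addr0 mulr0 add0r big1// => i _; exact: mulr0.
rewrite (@Rintegral_cst _ _ _ leb _ (itvoo_measurable t) 0).
rewrite mul0r => /eqP; rewrite subr_eq0 => /eqP.
rewrite (eq_IX (g := r ^~ t)); last by move=> x; rewrite mulr1.
move=> ->; have [_ _ _ _ r0] := FP.
have [_ [hrho _ _] _ _ _] := hD; have [_ h1] := density_integrable hrho.
by rewrite -[RHS]h1; apply: eq_IX => x; rewrite mulr1 r0.
Qed.

Lemma FP_density t : 0 <= t <= T -> is_density (r ^~ t).
Proof.
move=> tT; have cr := cont_QTbar_slice (c21_cont hr) tT; have pr := c21_per hr tT.
split => //; first exact: continuous_mx_measurable.
  by move=> x; apply: ltW; exact: r_gt0.
have I := cont_periodic_integrable cr pr.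
by rewrite -(fineK (integrable_fin_num measurableT I)); congr EFin; exact: FP_mass.
Qed.

Lemma FP_L1 s : 0 <= s <= T ->
  (fun t => \int[cube_leb n.+1]_x `|r x t - r x s|%:E)%E @ within `[0, T] (nbhs s) --> 0%E.
Proof.
move=> sT; have cr := c21_cont hr; have pr := c21_per hr.
have I t : 0 <= t <= T -> (cube_leb n.+1).-integrable setT (EFin \o (fun x => r x t - r x s)).
  move=> tT; apply: cont_periodic_integrable.
    by apply: ctsB; [exact: cont_QTbar_slice cr tT|exact: cont_QTbar_slice cr sT].
  by move=> x i; rewrite (pr t tT) (pr s sT).
apply/fine_cvgP; split.
  near=> t; have tT : 0 <= t <= T.
    have : `[0, T]%classic t by near: t; exact: withinT.
    by rewrite /= in_itv.
  exact: (integrable_fin_num measurableT (integrable_abse (I t tT))).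
apply/cvgrPdist_le => e e0.
have [dl dl0 hd] := QTbar_equicontinuous_periodic cr pr sT e0.
near=> t.
have tT : 0 <= t <= T.
  have : `[0, T]%classic t by near: t; exact: withinT.
  by rewrite /= in_itv.
have ts : `|t - s| < dl.
  near: t; apply: cvg_within; apply/nbhs_ballP; exists dl => //= t.
  by rewrite /ball/= distrC.
rewrite sub0r normrN ger0_norm; last by apply: fine_ge0; exact: integral_ge0.
rewrite -[X in _ <= X](@IX_cst R n.+1); apply: le_Rintegral => //.
- exact: (integrable_abse (I t tT)).
- exact: cube_integrable_cst.
- by move=> x _; apply: ltW; exact: hd.
Unshelve. all: by end_near.
Qed.

Lemma test_c21 (psi : V -> R -> R) : test_function D psi ->
  exists pt px pxx, c21 T psi pt px pxx /\
   (forall x t, 0 < t < T -> pt x t = time_deriv psi x t) /\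
   (forall i x t, 0 < t < T -> px i x t = partial i (psi ^~ t) x) /\
   (forall i x t, 0 < t < T -> pxx i x t = partial i (partial i (psi ^~ t)) x).
Proof.
move=> [ppsi spsi _].
have /CkSP[cpsi dpsi] := spsi 2%N.
have [gt [dgt /Ck_continuous cgt]] := dpsi (0, 1).
have [gx hgx] := choice (fun i => dpsi (unit_vec i, 0)).
have [gxx hgxx] := choice (fun i => ((CkSP _ _).1 (hgx i).2).2 (unit_vec i, 0)).
have space (f g : V * R -> R) i : (forall z : V * R, is_derive z (unit_vec i, 0) f (g z)) ->
    forall x t, is_derive x (unit_vec i) (fun y => f (y, t)) (g (x, t)).
  move=> df x t; apply: (is_derive_line_inv _ _ _ _).2.
  have := (is_derive_line_inv _ _ _ _).1 (df (x, t)); apply: fderive_ext => // s.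
  by congr f; rewrite /GRing.add/= /add_pair/= scaler0 addr0.
have time (f g : V * R -> R) : (forall z : V * R, is_derive z ((0 : V), (1 : R)) f (g z)) ->
    forall (x : V) (t : R), is_derive t (1 : R) (fun s : R => f (x, s)) (g (x, t)).
  move=> df x t; apply: (is_derive_line_inv _ _ _ _).2.
  have := (is_derive_line_inv _ _ _ _).1 (df (x, t)); apply: fderive_ext => // s.
  by congr f; rewrite /GRing.add/= /add_pair/= scaler0 addr0.
have cpair (f : V * R -> R) : continuous f -> cont_QTbar T (fun x t => f (x, t)).
  move=> cf; apply: continuous_subspaceT.
  by rewrite (_ : (fun z => f (z.1, z.2)) = f)//; apply/funext => -[].
have dx i := space _ _ i (hgx i).1.
have dxx i := space _ _ i (hgxx i).1.
have dt := time _ _ dgt.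
exists (fun x t => gt (x, t)), (fun i x t => gx i (x, t)), (fun i x t => gxx i (x, t)).
have Ex i t : partial i (psi ^~ t) = (fun x => gx i (x, t)).
  by apply/funext => x; apply: derive_val; exact: dx.
split; last split; last split.
- split.
  + by move=> t _; exact: ppsi.
  + exact: (cpair (fun z => psi z.1 z.2)).
  + exact: cpair.
  + by move=> i; apply: cpair; exact: Ck_continuous (hgx i).2.
  + by move=> i; apply: cpair; exact: Ck_continuous (hgxx i).2.
  + by move=> x t _; exact: dt.
  + by move=> i x t _; exact: dx.
  + by move=> i x t _; exact: dxx.
- by move=> x t _; apply/esym; apply: derive_val; exact: dt.
- by move=> i x t _; rewrite Ex.
- by move=> i x t _; rewrite Ex; apply/esym; apply: derive_val; exact: dxx.
Qed.

Lemma FP_continuity_equation : continuity_equation D r (fun x t => - drift_flux D r phi x t).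
Proof.
move=> psi tpsi; have [pt [px [pxx [hpsi [ptE [pxE pxxE]]]]]] := test_c21 tpsi.
have [_ _ [a0 [b0 [a00 b0T hab]]]] := tpsi.
have Tin : 0 <= T <= T by rewrite lexx ltW.
have E := classical_identity T0 hr hpsi FP_flux_regular FP_equation Tin.
have psi0 x t : ~~ (0 < t < T) -> psi x t = 0.
  move=> h; apply/eqP; apply: contraNT h => /hab/andP[h1 h2].
  by rewrite (lt_le_trans a00 h1) (le_lt_trans h2 b0T).
rewrite (eq_IX (g := fun=> 0)) in E; last by move=> x; rewrite psi0 ?mulr0// ltxx andbF.
rewrite (eq_IX (f := fun x => r x 0 * psi x 0) (g := fun=> 0)) in E; last by move=> x; rewrite psi0 ?mulr0// ltxx.
rewrite IX_cst subrr in E.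
pose g x t := r x t * (pt x t + nu * \sum_i pxx i x t) + \sum_i FP_flux i x t * px i x t.
have csum (f : 'I_n.+1 -> V -> R -> R) : (forall i, cont_QTbar T (f i)) -> cont_QTbar T (fun x t => \sum_i f i x t).
  by move=> cf; apply: cts_sum => i; exact: cf.
have cg : cont_QTbar T g.
  apply: ctsD.
    apply: ctsM; first exact: c21_cont hr.
    apply: ctsD; first exact: c21_cont_t hpsi.
    by apply: ctsM; [exact: cts_cst|apply: csum => i; exact: c21_cont_xx hpsi i].
  by apply: (csum (fun i x t => FP_flux i x t * px i x t)) => i; apply: ctsM; [exact: (@cont_FP_flux i)|exact: c21_cont_x hpsi i].
have pg t : 0 <= t <= T -> Defs.periodic (g ^~ t).
  move=> tT x i; rewrite /g (c21_per hr tT) (c21_per_t T0 hpsi tT).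
  congr (_ * (_ + _ * _) + _); apply: eq_bigr => j _; first exact: c21_per_xx T0 hpsi j t tT x i.
  by rewrite (per_FP_flux j tT) (c21_per_x T0 hpsi j tT).
have Ig := QT_bounded_integrable T0 cg pg.
have [_ F] := fubini_QT Ig.
have mQ := @QT_measurable R n.+1 T.
transitivity ((\int[st]_(z in QT T) g z.1 z.2)%:E); last by rewrite F -E.
rewrite /Rintegral fineK; last exact: (integrable_fin_num mQ Ig).
apply: eq_integral => z /set_mem zT; congr EFin; rewrite /g ptE//; congr (_ * (_ + _ * _) + _).
  by apply: eq_bigr => i _; rewrite pxxE.
by apply: eq_bigr => i _; rewrite !mxE pxE// -[RHS](congr1 (fun u => u * _) (opprK _)) -drift_FP_flux// !mxE.
Qed.

Lemma FP_admissible : admissible D r (fun x t => - drift_flux D r phi x t).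
Proof.
split.
- by split; [exact: FP_density|exact: cont_QTbar_measurable (c21_cont hr)].
- exact: FP_L1.
- split.
    move=> t tT x i; apply/rowP => j.
    have E y : (- drift_flux D r phi y t) 0 j = FP_flux j y t by rewrite mxE (drift_FP_flux j y tT) opprK.
    exact: (etrans (E _) (etrans (per_FP_flux j (oo_cc tT) x i) (esym (E x)))).
  move=> i; have := QT_bounded_integrable T0 (@cont_FP_flux i) (@per_FP_flux i).
  apply: eq_integrable; first exact: QT_measurable.
  by move=> z /set_mem zT /=; rewrite [in RHS]mxE drift_FP_flux// opprK.
- by have [_ _ _ _ r0] := FP; exact: nearW.
- exact: FP_continuity_equation.
Qed.

End fokker_planck.

(** * Uniqueness of the weak solution with a given drift *)

Section tensor_calculus.
Context {R : realType} {n : nat}.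
Local Notation V := 'rV[R]_n.

Lemma tensor_swap (K : V -> R) (I : finType) (a b : I -> V -> R) v x y : trig K -> tensor K a b ->
  \sum_j 'D_v (a j) x * b j y = - \sum_j a j x * 'D_v (b j) y.
Proof.
move=> tK Kab; have [[_ _ E1] [_ _ E2]] := tensor_derive v tK Kab.
by rewrite -E1 -E2 opprK.
Qed.

Lemma tensor_swap2 (K : V -> R) (I : finType) (a b : I -> V -> R) v x y : trig K -> tensor K a b ->
  \sum_j 'D_v (fun x => 'D_v (a j) x) x * b j y = \sum_j a j x * 'D_v (fun x => 'D_v (b j) x) y.
Proof.
move=> tK Kab; have [K1 K2] := tensor_derive v tK Kab.
have tK2 : trig (fun z : V => - 'D_v K z).
  rewrite (_ : (fun z => - 'D_v K z) = (fun z : V => (fun=> -1) z * 'D_v K z)); last first.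
    by apply/funext => z; rewrite mulN1r.
  by apply: trig_mul; [exact: trig_cst|exact: trig_D].
rewrite (tensor_swap v x y (trig_D v tK) K1).
by apply/eqP; rewrite eqr_oppLR; apply/eqP; exact: (tensor_swap v x y tK2 K2).
Qed.

Lemma sum_IX (I : finType) (g : V -> R) (A : I -> V -> R) (c : I -> R) :
  (cube_leb n).-integrable setT (EFin \o g) -> (forall j, trig (A j)) ->
  \sum_j IX (fun x => g x * A j x) * c j = IX (fun x => g x * \sum_j A j x * c j).
Proof.
move=> Ig tA.
have IgA j : (cube_leb n).-integrable setT (EFin \o (fun x => g x * A j x)).
  have [M hM] := trig_bounded (tA j).
  by apply: (RintegrableMb (M := M)) => //; exact: trig_measurable.
transitivity (IX (fun x => \sum_j c j * (g x * A j x))).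
  rewrite IX_sum; last by move=> j; exact: (RintegrableZ _ measurableT (IgA j)).
  by apply: eq_bigr => j _; rewrite IXZ// mulrC.
by apply: eq_IX => x; rewrite mulr_sumr; apply: eq_bigr => j _; ring.
Qed.

(** Convolution with an even kernel is symmetric. With a kernel of finite rank, Fubini's theorem
    becomes an exchange of finite sums. *)
Lemma cv_duality N (g be : V -> R) : (cube_leb n).-integrable setT (EFin \o g) ->
  continuous be -> Defs.periodic be ->
  IX (fun y => cv (bumpn N) g y * be y) = IX (fun x => g x * cv (bumpn N) be x).
Proof.
move=> Ig cb pb; have [I [a [b Kab]]] := @tensor_bumpn R n N; have [ta tb E] := Kab.
have Ib := cont_periodic_integrable cb pb.
transitivity (\sum_j IX (fun x => g x * a j x) * IX (fun y => be y * b j y)).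
  transitivity (IX (fun y => be y * \sum_j b j y * IX (fun x => g x * a j x))).
    apply: eq_IX => y; rewrite (cv_tensor _ Kab)// mulrC; congr (_ * _).
    by apply: eq_bigr => j _; rewrite mulrC.
  by rewrite -sum_IX//; apply: eq_bigr => j _; rewrite mulrC.
rewrite sum_IX//; apply: eq_IX => x; congr (_ * _).
transitivity (IX (fun y => be y * \sum_j b j y * a j x)).
  by rewrite -sum_IX//; apply: eq_bigr => j _; rewrite mulrC.
apply: eq_IX => y; rewrite mulrC; congr (_ * _).
rewrite -bumpnN opprB E; by apply: eq_bigr => j _; rewrite mulrC.
Qed.

Lemma IX_cv N (g : V -> R) : (cube_leb n).-integrable setT (EFin \o g) ->
  IX (cv (bumpn N) g) = IX g.
Proof.
move=> Ig.
transitivity (IX (fun y => cv (bumpn N) g y * (fun=> 1) y)); first by apply: eq_IX => y; rewrite mulr1.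
rewrite cv_duality//; last by exact: cts_cst.
apply: eq_IX => x; rewrite -[RHS]mulr1; congr (_ * _).
by rewrite /cv -[RHS](@IX_bumpn R n N x); apply: eq_IX => y; rewrite mulr1.
Qed.

End tensor_calculus.

Section primitive.
Context {R : realType}.
Local Notation leb := (@lebesgue_measure R).

Lemma is_derive_primitive (T : R) (F f : R -> R) t : {within `[0, T], continuous f} ->
  (forall t, 0 <= t <= T -> F t - F 0 = \int[leb]_(s in `]0, t[) f s) -> 0 < t < T ->
  is_derive t 1 F (f t).
Proof.
move=> cf hF /andP[t0 tT].
have T0 : 0 < T by exact: lt_trans tT.
have If := continuous_compact_integrable (@segment_compact R 0 T) cf.
have ct : {for t, continuous f}.
  by have /(continuous_within_itvP _ T0)[h _ _] := cf; apply: h; rewrite in_itv/= t0.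
have [d1 d2] := continuous_FTC1_closed tT If t0 ct.
have dG : is_derive t 1 (fun x => \int[leb]_(s in `[0, x]) f s) (f t).
  by rewrite -d2 derive1E; exact/derivableP.
have dF : is_derive t 1 (fun x => F 0 + \int[leb]_(s in `[0, x]) f s) (f t).
  by have := fderiveD (fderive_cst (F 0) t 1) dG; rewrite add0r.
apply: near_eq_is_derive dF.
have [e /= e0 he] : \forall s \near t, 0 < s < T.
  have : open (`]0, T[%classic : set R) by exact: interval_open.
  by rewrite openE => /(_ t); rewrite /= in_itv/= t0 tT => /(_ isT); apply: filterS => s; rewrite /= in_itv.
exists e => // s /he /andP[s0 sT].
have sub : `[0, s]%classic `<=` (`[0, T]%classic : set R).
  by move=> u /=; rewrite !in_itv/= => /andP[-> us]; exact: le_trans us (ltW sT).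
have Is : leb.-integrable `[0, s] (EFin \o f) by apply: integrableS If => //; exact: measurable_itv.
rewrite -Rintegral_itv_obnd_cbnd -?Rintegral_itv_bndo_bndc.
- by rewrite -hF ?addrNK ?subrKC// ltW//= ltW.
- by apply: integrableS Is => // u /=; rewrite !in_itv/= => /andP[/ltW -> /ltW ->].
- by apply: integrableS Is => // u /=; rewrite !in_itv/= => /andP[/ltW -> ->].
Qed.

End primitive.

Lemma weighted_sum_exchange (R : comPzRingType) (I J : finType) (k : R) (A B : I -> J -> R) (c : J -> R) :
  k * (\sum_i \sum_j A i j * c j) - \sum_i \sum_j B i j * c j =
  \sum_j (k * (\sum_i A i j) - \sum_i B i j) * c j.
Proof.
rewrite exchange_big [X in _ - X]exchange_big mulr_sumr -sumrB; apply: eq_bigr => j _.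
by rewrite -!mulr_suml mulrA mulrBl.
Qed.

(** * The equation satisfied by a mollified weak solution *)

Section weak_drift.
Context {R : realType} {n : nat}.
Local Notation V := 'rV[R]_n.+1.
Local Notation Q := ('rV[R]_n.+1 * measurableTypeR R)%type.
Local Notation leb := (@lebesgue_measure R).
Local Notation st := (@space_time_leb R n.+1).
Variable D : mfg_data R n.+1.
Local Notation T := (horizon D).
Local Notation nu := (viscosity D).
Hypothesis T0 : 0 < T.
Variable b : 'I_n.+1 -> V -> R -> R.
Hypothesis cb : forall i, cont_QTbar T (b i).
Hypothesis pb : forall i t, 0 <= t <= T -> Defs.periodic (b i ^~ t).
Variables (r : V -> R -> R) (m : V -> R -> V).
Hypothesis adm : admissible D r m.
Hypothesis hm : {ae st, forall z : Q, QT T z -> forall i, m z.1 z.2 0 i = - (r z.1 z.2 * b i z.1 z.2)}.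

Definition moment (a : V -> R) t : R := IX (fun x => r x t * a x).
(* The generator dual to the forward equation with drift [- b]. *)
Definition dual_gen (a : V -> R) (x : V) (t : R) : R :=
  nu * laplacian a x - \sum_i b i x t * 'D_(unit_vec i) a x.

Lemma cont_space (a : V -> R) : continuous a -> cont_QTbar T (fun x _ => a x).
Proof.
by move=> ca; apply: continuous_subspaceT => z; apply: (@cts_comp _ _ _ fst a) => //; exact: cts_fst.
Qed.

Lemma cont_dual_gen a : trig a -> cont_QTbar T (dual_gen a).
Proof.
move=> ta; apply: ctsB.
  apply: (cont_space (a := fun x => nu * laplacian a x)); apply: ctsM; first exact: cts_cst.
  exact: trig_continuous (trig_laplacian ta).
apply: cts_sum => i; apply: ctsM; first exact: (@cb i).
by apply: (cont_space (a := fun x => 'D_(unit_vec i) a x)); exact: trig_continuous (trig_D _ ta).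
Qed.

Lemma per_dual_gen a t : trig a -> 0 <= t <= T -> Defs.periodic (dual_gen a ^~ t).
Proof.
move=> ta tT x i; rewrite /dual_gen (trig_periodic (trig_laplacian ta)); congr (_ - _).
by apply: eq_bigr => j _; rewrite (pb j tT) (trig_periodic (trig_D _ ta)).
Qed.

Lemma cont_moment a : trig a -> {within `[0, T], continuous (moment a)}.
Proof.
move=> ta; apply: (admissible_continuous adm (g := fun x _ => a x)).
  exact: cont_space (trig_continuous ta).
by move=> t _; exact: trig_periodic.
Qed.

Lemma cont_moment_gen a : trig a ->
  {within `[0, T], continuous (fun t => IX (fun x => r x t * dual_gen a x t))}.
Proof.
move=> ta; apply: (admissible_continuous adm); first exact: cont_dual_gen.
by move=> t tT; exact: per_dual_gen.
Qed.

(** Once [m = - r b] is substituted, the integrand is the pairing of [r] with the continuous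
    function [dual_gen a]. It is therefore continuous in time and the moments become continuously
    differentiable inside the interval. *)
Lemma moment_AC a : trig a -> forall t, 0 <= t <= T ->
  moment a t - moment a 0 = \int[leb]_(s in `]0, t[) IX (fun x => r x s * dual_gen a x s).
Proof.
move=> ta t tT; rewrite (admissible_trig_AC T0 adm ta tT).
have tT' : t <= T by case/andP: tT.
have mQ := @QT_measurable R n.+1 t.
have sub := @QT_sub R n.+1 _ _ tT'.
have I1 : st.-integrable (QT t) (EFin \o trig_flux D r m a).
  by apply: integrableS (trig_flux_integrable adm ta) => //; exact: QT_measurable.
have I2T : st.-integrable (QT T) (EFin \o (fun z => r z.1 z.2 * dual_gen a z.1 z.2)).
  have [M hM] := QTbar_bounded_periodic (cont_dual_gen ta) (fun t tT => per_dual_gen ta tT).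
  apply: (RintegrableMb (M := M)); [exact: QT_measurable|exact: admissible_integrable adm| |].
    exact: cont_QTbar_measurable (cont_dual_gen ta).
  by move=> z /oo_cc; exact: hM.
have I2 : st.-integrable (QT t) (EFin \o (fun z => r z.1 z.2 * dual_gen a z.1 z.2)).
  by apply: integrableS I2T => //; exact: QT_measurable.
have [_ <-] := fubini_QT I1; have [_ <-] := fubini_QT I2.
rewrite /Rintegral; congr fine; apply: ae_eq_integral => //; [exact: measurable_int I1|exact: measurable_int I2|].
apply: filterS hm => z h zt /=; congr EFin; have {}h := h (sub _ zt).
rewrite /trig_flux /dual_gen mulrBr; congr (_ + _); rewrite /dot mulr_sumr -sumrN; apply: eq_bigr => i _.
by rewrite h mxE /partial; ring.
Qed.

Lemma is_derive_moment a t : trig a -> 0 < t < T ->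
  is_derive t 1 (moment a) (IX (fun x => r x t * dual_gen a x t)).
Proof.
by move=> ta tT; apply: (is_derive_primitive (cont_moment_gen ta) (moment_AC ta) tT).
Qed.

Section smoothed.
Variables (N : nat) (I : finType) (a be : I -> V -> R).
Hypothesis Kab : tensor (bumpn N) a be.
Let ta j : trig (a j). Proof. by case: Kab. Qed.
Let tb j : trig (be j). Proof. by case: Kab. Qed.
Let tK := @trig_bumpn R n.+1 N.

(** The mollification of [r], its derivatives, and the mollification [sm_flux] of [- r b] with its
    divergence terms, all as finite sums of moments times trigonometric polynomials. This makes
    regularity immediate although [r] is only in L^1. *)
Definition sm (y : V) (t : R) : R := \sum_j moment (a j) t * be j y.
Definition sm_t (y : V) (t : R) : R := \sum_j IX (fun x => r x t * dual_gen (a j) x t) * be j y.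
Definition sm_x i (y : V) (t : R) : R := \sum_j moment (a j) t * 'D_(unit_vec i) (be j) y.
Definition sm_xx i (y : V) (t : R) : R :=
  \sum_j moment (a j) t * 'D_(unit_vec i) (fun x => 'D_(unit_vec i) (be j) x) y.
Definition bmoment i j t : R := IX (fun x => r x t * b i x t * a j x).
Definition sm_flux i (y : V) (t : R) : R := - \sum_j bmoment i j t * be j y.
Definition sm_flux_div i (y : V) (t : R) : R := - \sum_j bmoment i j t * 'D_(unit_vec i) (be j) y.

Lemma r_integrable t : 0 <= t <= T -> (cube_leb n.+1).-integrable setT (EFin \o r ^~ t).
Proof. by move=> tT; have [] := density_integrable (admissible_density adm tT). Qed.

Lemma rb_integrable i t : 0 <= t <= T -> (cube_leb n.+1).-integrable setT (EFin \o (fun x => r x t * b i x t)).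
Proof.
move=> tT; have [M hM] := QTbar_bounded_periodic (@cb i) (@pb i).
apply: (RintegrableMb (M := M)) => //; first exact: r_integrable.
  by apply: continuous_mx_measurable; exact: cont_QTbar_slice (@cb i) tT.
by move=> x _; exact: hM.
Qed.

Lemma smE y t : 0 <= t <= T -> sm y t = cv (bumpn N) (r ^~ t) y.
Proof. by move=> tT; rewrite (cv_tensor _ Kab)//; exact: r_integrable. Qed.

Lemma cont_time_space (f : R -> R) (c : V -> R) : {within `[0, T], continuous f} -> continuous c ->
  cont_QTbar T (fun x t => f t * c x).
Proof.
move=> cf cc; apply: ctsM; last exact: cont_space.
by apply: (@within_comp _ _ _ (QTbar T) `[0, T]%classic snd f) => //; exact: cts_snd.
Qed.

Lemma c21_sm : c21 T sm sm_t sm_x sm_xx.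
Proof.
split.
- by move=> t tT x i; apply: eq_bigr => j _; rewrite (trig_periodic (tb j)).
- by apply: cts_sum => j; apply: (cont_time_space (cont_moment (ta j))); exact: trig_continuous (tb j).
- apply: cts_sum => j; apply: (cont_time_space (cont_moment_gen (ta j))); exact: trig_continuous (tb j).
- move=> i; apply: cts_sum => j; apply: (cont_time_space (c := fun y => 'D_(unit_vec i) (be j) y) (cont_moment (ta j))).
  exact: trig_continuous (trig_D _ (tb j)).
- move=> i; apply: cts_sum => j; apply: (cont_time_space (c := fun y => 'D_(unit_vec i) (fun x => 'D_(unit_vec i) (be j) x) y) (cont_moment (ta j))).
  exact: trig_continuous (trig_D _ (trig_D _ (tb j))).
- move=> x t tT; apply: fderive_sum => j.
  by have := fderiveM (is_derive_moment (ta j) tT) (fderive_cst (be j x) t 1); rewrite mulr0 add0r.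
- move=> i x t tT; apply: fderive_sum => j; apply: fderiveZ; exact: trig_is_derive.
- move=> i x t tT; apply: fderive_sum => j; apply: fderiveZ; apply: trig_is_derive; exact: trig_D.
Qed.

Lemma sm_flux_regular i t : 0 < t < T -> [/\ Defs.periodic (sm_flux i ^~ t), continuous (sm_flux i ^~ t),
     continuous (sm_flux_div i ^~ t) & forall x, is_derive x (unit_vec i) (sm_flux i ^~ t) (sm_flux_div i x t)].
Proof.
move=> tT; split.
- by move=> x j; congr (- _); apply: eq_bigr => k _; rewrite (trig_periodic (tb k)).
- by apply: ctsN; apply: cts_sum => j; apply: ctsM; [exact: cts_cst|exact: trig_continuous (tb j)].
- apply: ctsN; apply: cts_sum => j; apply: ctsM; [exact: cts_cst|exact: trig_continuous (trig_D _ (tb j))].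
- by move=> x; apply: fderiveN; apply: fderive_sum => j; apply: fderiveZ; exact: trig_is_derive.
Qed.

(** In [sm_t] the space derivatives fall on the factors [a j], in the right side on the [be j]. The
    swap rules for [bumpn N (x - y)] exchange them: no sign for the Laplacian, one sign for the
    divergence. *)
Lemma sm_equation y t : 0 < t < T -> sm_t y t = nu * (\sum_i sm_xx i y t) - \sum_i sm_flux_div i y t.
Proof.
move=> /oo_cc tT; have Ir := r_integrable tT.
have tDa i j : trig (fun x => 'D_(unit_vec i) (a j) x) by exact: trig_D.
have tDDa i j : trig (fun x => 'D_(unit_vec i) (fun x => 'D_(unit_vec i) (a j) x) x) by exact: (trig_D _ (tDa i j)).
have E1 i : sm_xx i y t = \sum_j IX (fun x => r x t * 'D_(unit_vec i) (fun x => 'D_(unit_vec i) (a j) x) x) * be j y.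
  rewrite /sm_xx (sum_IX _ Ir ta) (sum_IX _ Ir (tDDa i)); apply: eq_IX => x; congr (_ * _).
  by rewrite (tensor_swap2 _ _ _ tK Kab).
have E2 i : sm_flux_div i y t = \sum_j IX (fun x => r x t * b i x t * 'D_(unit_vec i) (a j) x) * be j y.
  rewrite /sm_flux_div (sum_IX _ (rb_integrable i tT) ta) (sum_IX _ (rb_integrable i tT) (tDa i)).
  rewrite -[LHS]mulN1r -IXZ.
    by apply: eq_IX => x; rewrite (tensor_swap _ _ _ tK Kab); ring.
  have tS : trig (fun x => \sum_j a j x * 'D_(unit_vec i) (be j) y).
    by apply: trig_sum => j; apply: trig_mul; [exact: ta|exact: trig_cst].
  have [M hM] := trig_bounded tS.
  by apply: (RintegrableMb (M := M) _ (rb_integrable i tT)) => //; exact: trig_measurable.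
pose A i j : R := IX (fun x => r x t * 'D_(unit_vec i) (fun x => 'D_(unit_vec i) (a j) x) x).
pose B i j : R := IX (fun x => r x t * b i x t * 'D_(unit_vec i) (a j) x).
have X1 : \sum_i sm_xx i y t = \sum_i \sum_j A i j * be j y by apply: eq_bigr => i _; exact: E1.
have X2 : \sum_i sm_flux_div i y t = \sum_i \sum_j B i j * be j y by apply: eq_bigr => i _; exact: E2.
rewrite X1 X2 weighted_sum_exchange; apply: eq_bigr => j _; congr (_ * _).
have Ip (f : V -> R) (g : V -> R) : (cube_leb n.+1).-integrable setT (EFin \o g) -> trig f -> (cube_leb n.+1).-integrable setT (EFin \o (fun x => g x * f x)).
  move=> Ig tf; have [M hM] := trig_bounded tf.
  by apply: (RintegrableMb (M := M)) => //; exact: trig_measurable.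
have J1 i := Ip _ _ Ir (tDDa i j); have J2 i := Ip _ _ (rb_integrable i tT) (tDa i j).
have mT := @measurableT _ V.
have K1 := Rintegrable_sum (index_enum _) mT J1.
have K2 := Rintegrable_sum (index_enum _) mT J2.
have SA : IX (fun x => \sum_i r x t * 'D_(unit_vec i) (fun x => 'D_(unit_vec i) (a j) x) x) = \sum_i A i j := IX_sum _ J1.
have SB : IX (fun x => \sum_i r x t * b i x t * 'D_(unit_vec i) (a j) x) = \sum_i B i j := IX_sum _ J2.
apply: etrans (congr2 (fun p q => nu * p - q) SA SB).
rewrite -(IXZ _ K1) -(IXB (RintegrableZ _ mT K1) K2).
apply: eq_IX => x; rewrite /dual_gen mulrBr; congr (_ - _).
  by rewrite mulrCA /laplacian mulr_sumr.
by rewrite mulr_sumr; apply: eq_bigr => i _; rewrite mulrA.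
Qed.

Lemma sm_ge0 y t : 0 <= t <= T -> 0 <= sm y t.
Proof.
move=> tT; rewrite smE//; apply: IX_ge0 => x; rewrite mulr_ge0 ?bumpn_ge0//.
by have [_ _ h _] := admissible_density adm tT.
Qed.

(* The commutator of multiplication by [b] and convolution: [b] oscillates by at
   most [om] where [bump > c], and the kernel is at most [tail c N] elsewhere. *)
Lemma sm_flux_gap (om B c : R) i y t : 0 <= t <= T -> 0 <= c -> 0 <= om ->
  (forall x t, 0 <= t <= T -> `|b i x t| <= B) ->
  (forall x, c < bump (x - y) -> `|b i x t - b i y t| <= om) ->
  `|sm_flux i y t + b i y t * sm y t| <= om * sm y t + 2 * B * @tail R n.+1 c N.
Proof.
move=> tT c0 om0 hB hom.
have B0 : 0 <= B by apply: le_trans (hB y t tT).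
have tl0 : 0 <= @tail R n.+1 c N by exact: tail_ge0.
have Ir := r_integrable tT; have Irb := rb_integrable i tT.
have r0 x : 0 <= r x t by have [_ _ h _] := admissible_density adm tT.
have IKr := bumpn_mul_integrable N y Ir; have IKrb := bumpn_mul_integrable N y Irb.
have E1 : sm_flux i y t = - cv (bumpn N) (fun x => r x t * b i x t) y by rewrite (cv_tensor _ Kab).
rewrite E1 smE// addrC /cv -IXZ// -IXB//; last exact: RintegrableZ.
have Ig := RintegrableB measurableT (RintegrableZ (b i y t) measurableT IKr) IKrb.
apply: le_trans (le_normr_Rintegral _ Ig) _ => //.
have [_ r1] := density_integrable (admissible_density adm tT).
have -> : 2 * B * @tail R n.+1 c N = 2 * B * @tail R n.+1 c N * IX (r ^~ t) by rewrite r1 mulr1.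
rewrite -!IXZ// -IXD; [|exact: RintegrableZ|exact: RintegrableZ].
apply: le_Rintegral => //.
- exact: (integrable_abse Ig).
- by apply: RintegrableD => //; exact: RintegrableZ.
move=> x _; have -> : b i y t * (bumpn N (x - y) * r x t) - bumpn N (x - y) * (r x t * b i x t) =
   (b i y t - b i x t) * (bumpn N (x - y) * r x t) by ring.
rewrite normrM (ger0_norm (mulr_ge0 (bumpn_ge0 _ _) (r0 x))).
have [cb'|bc] := ltP c (bump (x - y)).
  apply: (@le_trans _ _ (om * (bumpn N (x - y) * r x t))).
    by apply: ler_wpM2r; [rewrite mulr_ge0 ?bumpn_ge0|rewrite distrC; exact: hom].
  by rewrite lerDl; do ?apply: mulr_ge0 => //; exact: r0.
apply: (@le_trans _ _ (2 * B * @tail R n.+1 c N * r x t)); last by rewrite lerDr mulr_ge0// mulr_ge0 ?bumpn_ge0.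
rewrite mulrA ler_wpM2r//; apply: ler_pM => //; [exact: bumpn_ge0| |exact: bumpn_tail].
by apply: le_trans (ler_normB _ _) _; have := hB x t tT; have := hB y t tT; lra.
Qed.

End smoothed.
End weak_drift.

(** * The relative energy estimate *)

Section energy_estimate.
Context {R : realType} {n : nat}.
Local Notation V := 'rV[R]_n.+1.
Local Notation leb := (@lebesgue_measure R).

(** The pointwise computation behind the estimate, with [w = r * h]. Terms with [ht] and [hxx]
    cancel, and what is left is the flux gap [M + b w] against the gradient of [h], minus the
    dissipation. *)
Lemma energy_algebra (I : finType) (r h ht nu : R) (hx hxx M b : I -> R) :
  2 * (r * h * (ht + nu * \sum_i hxx i) + \sum_i M i * hx i) -
  (r * (h * ht + ht * h + nu * \sum_i ((h * hxx i + hx i * hx i) + (hx i * hx i + hxx i * h))) +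
   \sum_i (- (r * b i)) * (h * hx i + hx i * h)) =
  \sum_i (2 * (M i + b i * (r * h)) * hx i - 2 * (nu * r) * (hx i * hx i)).
Proof.
have -> : \sum_i ((h * hxx i + hx i * hx i) + (hx i * hx i + hxx i * h)) =
    2 * h * (\sum_i hxx i) + 2 * \sum_i hx i * hx i.
  by rewrite !mulr_sumr -big_split; apply: eq_bigr => i _ /=; ring.
have -> : \sum_i (- (r * b i)) * (h * hx i + hx i * h) = - (2 * r * h * \sum_i b i * hx i).
  by rewrite mulr_sumr -sumrN; apply: eq_bigr => i _; ring.
have -> : \sum_i (2 * (M i + b i * (r * h)) * hx i - 2 * (nu * r) * (hx i * hx i)) =
    2 * (\sum_i M i * hx i) + 2 * r * h * (\sum_i b i * hx i) - 2 * (nu * r) * (\sum_i hx i * hx i).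
  by rewrite !mulr_sumr -big_split -sumrB; apply: eq_bigr => i _ /=; ring.
ring.
Qed.

Lemma young (G q a : R) : 0 < a -> 2 * G * q - 2 * a * (q * q) <= G ^+ 2 / (2 * a).
Proof.
move=> a0; rewrite ler_pdivlMr ?mulr_gt0//.
by have := sqr_ge0 (G - 2 * a * q); nra.
Qed.

Variables (T nu : R).
Hypotheses (T0 : 0 < T) (nu0 : 0 < nu).
Variables (b : 'I_n.+1 -> V -> R -> R) (r rt : V -> R -> R) (rx rxx Fd : 'I_n.+1 -> V -> R -> R).
Hypothesis cb : forall i, cont_QTbar T (b i).
Hypothesis pb : forall i t, 0 <= t <= T -> Defs.periodic (b i ^~ t).
Hypothesis hr : c21 T r rt rx rxx.
Hypothesis r_gt0 : forall x t, 0 <= t <= T -> 0 < r x t.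
Let F i (x : V) t := - (r x t * b i x t).
Hypothesis hF : forall i t, 0 < t < T -> [/\ Defs.periodic (F i ^~ t), continuous (F i ^~ t),
     continuous (Fd i ^~ t) & forall x, is_derive x (unit_vec i) (F i ^~ t) (Fd i x t)].
Hypothesis eqr : forall x t, 0 < t < T -> rt x t = nu * (\sum_i rxx i x t) - \sum_i Fd i x t.
Variables (w wt : V -> R -> R) (wx wxx M Md : 'I_n.+1 -> V -> R -> R).
Hypothesis hw : c21 T w wt wx wxx.
Hypothesis cM : forall i, cont_QTbar T (M i).
Hypothesis pM : forall i t, 0 <= t <= T -> Defs.periodic (M i ^~ t).
Hypothesis hM : forall i t, 0 < t < T -> [/\ Defs.periodic (M i ^~ t), continuous (M i ^~ t),
     continuous (Md i ^~ t) & forall x, is_derive x (unit_vec i) (M i ^~ t) (Md i x t)].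
Hypothesis eqw : forall x t, 0 < t < T -> wt x t = nu * (\sum_i wxx i x t) - \sum_i Md i x t.
Hypothesis w_ge0 : forall x t, 0 <= t <= T -> 0 <= w x t.
Variables (om ka rmin : R).
Hypotheses (om0 : 0 <= om) (ka0 : 0 <= ka) (rmin0 : 0 < rmin).
Hypothesis r_ge : forall x t, 0 <= t <= T -> rmin <= r x t.
Hypothesis gap : forall i x t, 0 < t < T -> `|M i x t + b i x t * w x t| <= om * w x t + ka.

Definition energy t := IX (fun x => w x t * (w x t * (r x t)^-1)).
(** Young's inequality with coefficient [nu * r] turns the gap [om * w + ka] into
    [(om ^+ 2 * w ^+ 2 + ka ^+ 2) / (nu * r)] in each of the [n + 1] directions. The first part is a
    multiple of the energy density, the second is bounded through [rmin]. *)
Let C1 : R := n.+1%:R * (om ^+ 2 / nu).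
Let C2 : R := n.+1%:R * (ka ^+ 2 / (nu * rmin)).

Let rneq0 x t : 0 <= t <= T -> r x t != 0.
Proof. by move=> tT; rewrite gt_eqF// r_gt0. Qed.

Lemma energy_integrand x t (h ht : R) (hx hxx : 'I_n.+1 -> R) : 0 < t < T -> h = w x t * (r x t)^-1 ->
  2 * (w x t * (ht + nu * \sum_i hxx i) + \sum_i M i x t * hx i) -
  (r x t * (h * ht + ht * h + nu * \sum_i ((h * hxx i + hx i * hx i) + (hx i * hx i + hxx i * h))) +
   \sum_i F i x t * (h * hx i + hx i * h)) <= C1 * (w x t * h) + C2.
Proof.
move=> tT hE; have tT' := oo_cc tT; have rp := r_gt0 x tT'; have wp := w_ge0 x tT'.
have rh : w x t = r x t * h by rewrite hE mulrCA divff ?mulr1// rneq0.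
rewrite [X in 2 * (X * _ + _)]rh energy_algebra -rh.
have -> : C1 * (w x t * h) + C2 = \sum_(i < n.+1) (om ^+ 2 / nu * (w x t * h) + ka ^+ 2 / (nu * rmin)).
  by rewrite sumr_const card_ord /C1 /C2 -[RHS]mulr_natl; ring.
apply: ler_sum => i _.
apply: le_trans (young _ _ (mulr_gt0 nu0 rp)) _.
have g2 : (M i x t + b i x t * w x t) ^+ 2 <= 2 * om ^+ 2 * (w x t * w x t) + 2 * ka ^+ 2.
  have := gap i x tT; rewrite -[X in X <= _]ger0_norm// -real_normK ?num_real// => g.
  apply: (@le_trans _ _ ((om * w x t + ka) ^+ 2)).
    by rewrite lerXn2r ?nnegrE// ?addr_ge0 ?mulr_ge0//; move: g; rewrite normr_id.
  by have := sqr_ge0 (om * w x t - ka); nra.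
apply: (@le_trans _ _ ((2 * om ^+ 2 * (w x t * w x t) + 2 * ka ^+ 2) / (2 * (nu * r x t)))).
  by rewrite ler_wpM2r// invr_ge0 !mulr_ge0// ltW.
have -> : (2 * om ^+ 2 * (w x t * w x t) + 2 * ka ^+ 2) / (2 * (nu * r x t)) =
   om ^+ 2 / nu * (w x t * h) + ka ^+ 2 * (nu * r x t)^-1.
  by rewrite hE; field; rewrite (rneq0 x tT') gt_eqF.
rewrite lerD2l ler_wpM2l ?sqr_ge0// lef_pV2 ?posrE ?mulr_gt0// ler_pM2l//; exact: r_ge.
Qed.

Lemma energy_ge0 t : 0 <= t <= T -> 0 <= energy t.
Proof.
by move=> tT; apply: IX_ge0 => x; rewrite !mulr_ge0 ?w_ge0// invr_ge0 ltW// r_gt0.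
Qed.

Lemma energy_cont : {within `[0, T], continuous energy}.
Proof.
have hh := c21_mul hw (c21_mul hw (c21_inv rneq0 hr)).
by apply: QTbar_IX_continuous; [exact: c21_cont hh|exact: c21_per hh].
Qed.

(* Twice the duality identity of [w] against [h = w / r], minus that of [r]
   against [h^2]. *)
Lemma energy_increment t : 0 <= t <= T ->
  energy t - energy 0 <= \int[leb]_(s in `]0, t[) (C1 * energy s + C2).
Proof.
move=> tT; pose h (x : V) t := w x t * (r x t)^-1.
have [ht [hx [hxx hh]]] : exists ht hx hxx, c21 T h ht hx hxx.
  by do 3!eexists; exact: (c21_mul hw (c21_inv rneq0 hr)).
have h2 := c21_mul hh hh; have T0' : 0 <= (0 : R) <= T by rewrite lexx ltW.
pose gA x s := w x s * (ht x s + nu * \sum_i hxx i x s) + \sum_i M i x s * hx i x s.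
pose gB x s := r x s * ((h x s * ht x s + ht x s * h x s) + nu * \sum_i ((h x s * hxx i x s + hx i x s * hx i x s) + (hx i x s * hx i x s + hxx i x s * h x s))) + \sum_i F i x s * (h x s * hx i x s + hx i x s * h x s).
have I1 : energy t - energy 0 = \int[leb]_(s in `]0, t[) IX (gA ^~ s) := classical_identity T0 hw hh hM eqw tT.
have rh s : 0 <= s <= T -> IX (fun x => r x s * (h x s * h x s)) = energy s.
  move=> sT; apply: eq_IX => x; rewrite mulrA; have -> : r x s * h x s = w x s by rewrite /h mulrCA divff ?mulr1// rneq0.
  by [].
have I2 : energy t - energy 0 = \int[leb]_(s in `]0, t[) IX (gB ^~ s).
  transitivity (IX (fun x => r x t * (h x t * h x t)) - IX (fun x => r x 0 * (h x 0 * h x 0))).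
    by rewrite (rh t tT) (rh 0 T0').
  exact: (classical_identity T0 hr h2 hF eqr tT).
have [[[ch cht] chx] chxx] := (c21_cont hh, c21_cont_t hh, c21_cont_x hh, c21_cont_xx hh).
have [cw cr] := (c21_cont hw, c21_cont hr).
have cst' (k : R) : @cont_QTbar R n.+1 T (fun _ _ => k) by exact: cts_cst.
have cA : cont_QTbar T gA.
  apply: ctsD; last by apply: cts_sum => i; apply: ctsM; [exact: cM|exact: chx].
  by apply: ctsM => //; apply: ctsD => //; apply: ctsM; [exact: cst'|apply: cts_sum => i; exact: chxx].
have cB : cont_QTbar T gB.
  apply: ctsD; last first.
    by apply: cts_sum => i; apply: ctsM; [apply: ctsN; apply: ctsM => //; exact: cb|apply: ctsD; apply: ctsM => //; exact: chx].
  apply: ctsM => //; apply: ctsD; first by apply: ctsD; exact: ctsM.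
  apply: ctsM; first exact: cst'.
  by apply: cts_sum => i; apply: ctsD; apply: ctsD; apply: ctsM => //; (exact: chx || exact: chxx).
have P s (sT : 0 <= s <= T) := (c21_per hh sT, c21_per_t T0 hh sT, c21_per hw sT, c21_per hr sT).
have pA s : 0 <= s <= T -> Defs.periodic (gA ^~ s).
  move=> sT x i; rewrite /gA !(P s sT); congr (_ * (_ + _ * _) + _); apply: eq_bigr => j _.
    by rewrite (c21_per_xx T0 hh j sT).
  by rewrite (c21_per_x T0 hh j sT) (pM _ sT).
have pB s : 0 <= s <= T -> Defs.periodic (gB ^~ s).
  move=> sT x i; rewrite /gB !(P s sT); congr (_ * (_ + _ * _) + _); apply: eq_bigr => j _.
    by rewrite (c21_per_xx T0 hh j sT) (c21_per_x T0 hh j sT).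
  by rewrite /F ?(P s sT) (c21_per_x T0 hh j sT) (pb _ sT).
have sub : `]0, t[ `<=` `]0%R, T[%classic.
  by move=> s /=; rewrite !in_itv/= => /andP[-> st]; case/andP: tT => _; exact: lt_le_trans.
have It (f : R -> R) : {within `[0, T], continuous f} -> leb.-integrable `]0, t[ (EFin \o f).
  move=> cf; apply: integrableS (within_itv_integrable cf) => //; exact: itvoo_measurable.
have IA := It _ (QTbar_IX_continuous cA pA).
have IB := It _ (QTbar_IX_continuous cB pB).
have IE := It _ energy_cont.
have mt := itvoo_measurable t.
have -> : energy t - energy 0 = \int[leb]_(s in `]0, t[) (2 * IX (gA ^~ s) - IX (gB ^~ s)).
  rewrite RintegralB//; last exact: RintegrableZ.
  by rewrite RintegralZl// -I1 -I2; ring.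
have I2A := RintegrableZ 2 mt IA.
apply: le_Rintegral => //.
- exact: RintegrableB.
- apply: RintegrableD => //; first exact: RintegrableZ.
  by apply: It; exact: cts_cst.
move=> s /sub/=; rewrite in_itv/= => sT; have sT' := oo_cc sT.
have XA := cont_periodic_integrable (cont_QTbar_slice cA sT') (pA s sT').
have XB := cont_periodic_integrable (cont_QTbar_slice cB sT') (pB s sT').
have hE := c21_mul hw hh.
have XE := cont_periodic_integrable (cont_QTbar_slice (c21_cont hE) sT') (c21_per hE sT').
have mT := @measurableT _ V.
rewrite -IXZ// -IXB//; last exact: RintegrableZ.
rewrite -[C2](@IX_cst R n.+1) -IXZ// -IXD; [|exact: RintegrableZ|exact: cube_integrable_cst].
apply: le_Rintegral => //.
- by apply: RintegrableB => //; exact: RintegrableZ.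
- by apply: RintegrableD => //; [exact: RintegrableZ|exact: cube_integrable_cst].
move=> x _; exact: (energy_integrand (x := x) (h := h x s) (ht x s) (fun i => hx i x s) (fun i => hxx i x s) sT).
Qed.

(** The increment estimate is applied at a maximum point [s] of the energy, where the integrand is
    at most [C1 * energy s + C2]. For [T * C1 <= 1] the energy term is moved to the left side. *)
Lemma energy_bound t : T * C1 <= 1 -> 0 <= t <= T -> (1 - T * C1) * energy t <= energy 0 + T * C2.
Proof.
move=> TC tT; have [s /[!in_itv]/= sT smax] := EVT_max (ltW T0) energy_cont.
have C10 : 0 <= C1 by rewrite mulr_ge0// divr_ge0 ?sqr_ge0// ltW.
have C20 : 0 <= C2 by rewrite mulr_ge0// divr_ge0 ?sqr_ge0// mulr_ge0// ltW.
have K0 : 0 <= C1 * energy s + C2 by rewrite addr_ge0// mulr_ge0// energy_ge0.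
have le_s u : 0 <= u <= T -> energy u <= energy s by move=> uT; apply: smax; rewrite in_itv.
have ms := itvoo_measurable s.
have [s0 sT'] : 0 <= s /\ s <= T by apply/andP.
have sub : `]0, s[ `<=` `]0%R, T[%classic.
  by move=> u /=; rewrite !in_itv/= => /andP[-> us]; exact: lt_le_trans sT'.
have It (f : R -> R) : {within `[0, T], continuous f} -> leb.-integrable `]0, s[ (EFin \o f).
  by move=> cf; apply: integrableS (within_itv_integrable cf) => //; exact: itvoo_measurable.
have Es : energy s - energy 0 <= T * (C1 * energy s + C2).
  apply: le_trans (energy_increment sT) _.
  apply: (@le_trans _ _ (\int[leb]_(u in `]0, s[) cst (C1 * energy s + C2) u)).
    apply: le_Rintegral => //.
    - by apply: It; apply: ctsD; [apply: ctsM; [exact: cts_cst|exact: energy_cont]|exact: cts_cst].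
    - by apply: It; exact: cts_cst.
    move=> u /sub/=; rewrite in_itv/= => /oo_cc uT.
    by rewrite lerD2r ler_wpM2l// le_s.
  rewrite (@Rintegral_cst _ _ _ leb _ ms) mulrC ler_wpM2r//.
  have -> : fine (leb `]0%R, s[%classic) = s by exact: (congr1 fine (itvoo_measure s0)).
  by [].
have h1 : (1 - T * C1) * energy t <= (1 - T * C1) * energy s by rewrite ler_wpM2l ?subr_ge0// le_s.
by apply: (le_trans h1); nra.
Qed.
End energy_estimate.

(** * Vanishing of the relative energy gap *)

Section weak_uniqueness.
Context {R : realType} {n : nat}.
Local Notation V := 'rV[R]_n.+1.
Local Notation Q := ('rV[R]_n.+1 * measurableTypeR R)%type.
Local Notation leb := (@lebesgue_measure R).
Local Notation st := (@space_time_leb R n.+1).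
Local Notation cube := (cube_leb n.+1).

Lemma ae_eq_IX (f g : V -> R) : measurable_fun setT f -> measurable_fun setT g ->
  {ae cube, forall x, f x = g x} -> IX f = IX g.
Proof.
move=> mf mg h; rewrite /IX /Rintegral; congr fine; apply: ae_eq_integral => //.
- exact/measurable_EFinP.
- exact/measurable_EFinP.
- by apply: filterS h => x e _ /=; rewrite e.
Qed.

Variable D : mfg_data R n.+1.
Local Notation T := (horizon D).
Local Notation nu := (viscosity D).
Local Notation rho0 := (init_density D).
Hypotheses (T0 : 0 < T) (nu0 : 0 < nu).
Variables (b : 'I_n.+1 -> V -> R -> R) (u ut : V -> R -> R) (ux uxx Fd : 'I_n.+1 -> V -> R -> R).
Hypothesis cb : forall i, cont_QTbar T (b i).
Hypothesis pb : forall i t, 0 <= t <= T -> Defs.periodic (b i ^~ t).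
Hypothesis hu : c21 T u ut ux uxx.
Hypothesis u_gt0 : forall x t, 0 <= t <= T -> 0 < u x t.
Let F i (x : V) t := - (u x t * b i x t).
Hypothesis hF : forall i t, 0 < t < T -> [/\ Defs.periodic (F i ^~ t), continuous (F i ^~ t),
     continuous (Fd i ^~ t) & forall x, is_derive x (unit_vec i) (F i ^~ t) (Fd i x t)].
Hypothesis equ : forall x t, 0 < t < T -> ut x t = nu * (\sum_i uxx i x t) - \sum_i Fd i x t.
Hypothesis u_mass : forall t, 0 <= t <= T -> IX (u ^~ t) = 1.
Hypothesis u_init : forall x, u x 0 = rho0 x.
Variables (r : V -> R -> R) (m : V -> R -> V).
Hypothesis adm : admissible D r m.
Hypothesis hm : {ae st, forall z : Q, QT T z -> forall i, m z.1 z.2 0 i = - (r z.1 z.2 * b i z.1 z.2)}.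

Definition cv_energy N t := IX (fun x => cv (bumpn N) (r ^~ t) x * (cv (bumpn N) (r ^~ t) x * (u x t)^-1)).

Let uneq0 x t : 0 <= t <= T -> u x t != 0.
Proof. by move=> tT; rewrite gt_eqF// u_gt0. Qed.

Let uV := c21_inv uneq0 hu.

Lemma c21_lower_bound : exists2 k : R, 0 < k & forall x t, 0 <= t <= T -> k <= u x t.
Proof.
have [M hM] := QTbar_bounded_periodic (c21_cont uV) (c21_per uV).
have T00 : 0 <= (0 : R) <= T by rewrite lexx ltW.
have M0 : 0 < M.
  by apply: lt_le_trans (hM 0 0 T00); rewrite normr_gt0 invr_eq0 uneq0.
exists M^-1; first by rewrite invr_gt0.
move=> x t tT; rewrite -[leRHS]invrK lef_pV2 ?posrE ?invr_gt0 ?u_gt0//.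
by apply: le_trans (hM x t tT); exact: ler_norm.
Qed.

Lemma drift_bound : exists2 B : R, 0 <= B & forall i x t, 0 <= t <= T -> `|b i x t| <= B.
Proof.
have /choice[M hM] i := QTbar_bounded_periodic (@cb i) (@pb i).
exists (\sum_i `|M i|); first by apply: sumr_ge0.
move=> i x t tT; apply: (le_trans (hM i x t tT)); apply: (le_trans (ler_norm _)).
by rewrite (bigD1 i)//= lerDl sumr_ge0.
Qed.

Lemma drift_modulus (om : R) : 0 < om -> exists2 c : R, 0 <= c < 1 &
  forall i x y t, 0 <= t <= T -> c < bump (x - y) -> `|b i x t - b i y t| <= om.
Proof.
move=> om0; have h i : exists c : R, [/\ 0 <= c, c < 1 &
    forall x y t, 0 <= t <= T -> c < bump (x - y) -> `|b i x t - b i y t| < om].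
  by have [c /andP[c0 c1] hc] := QTbar_bump_modulus (@cb i) (@pb i) om0; exists c.
have /choice[c hc] := h.
exists (\big[Num.max/0]_i c i).
  rewrite bigmax_ge_id/=; apply/bigmax_ltP; split=> // i _; by have [] := hc i.
move=> i x y t tT cb'; have [_ _ h'] := hc i; apply/ltW/h' => //.
by apply: le_lt_trans cb'; exact: le_bigmax.
Qed.

Lemma cv_energy_bound (N : nat) (om B c k : R) t : 0 <= om -> 0 <= B -> 0 <= c -> 0 < k ->
  (forall x t, 0 <= t <= T -> k <= u x t) ->
  (forall i x t, 0 <= t <= T -> `|b i x t| <= B) ->
  (forall i x y t, 0 <= t <= T -> c < bump (x - y) -> `|b i x t - b i y t| <= om) ->
  T * (n.+1%:R * (om ^+ 2 / nu)) <= 1 -> 0 <= t <= T ->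
  (1 - T * (n.+1%:R * (om ^+ 2 / nu))) * cv_energy N t <=
  cv_energy N 0 + T * (n.+1%:R * ((2 * B * @tail R n.+1 c N) ^+ 2 / (nu * k))).
Proof.
move=> om0 B0 c0 k0 uk hB hom TC tT.
have [I [a [be Kab]]] := @tensor_bumpn R n.+1 N.
have ta j : trig (a j) by case: Kab.
have tb j : trig (be j) by case: Kab.
have ka0 : 0 <= 2 * B * @tail R n.+1 c N by apply: mulr_ge0; [rewrite mulr_ge0|exact: tail_ge0].
have cM i : cont_QTbar T (sm_flux b r a be i).
  apply: ctsN; apply: cts_sum => j; apply: (cont_time_space (D := D)); last exact: trig_continuous (tb j).
  have cba : cont_QTbar T (fun x t => b i x t * a j x).
    by apply: ctsM; [exact: cb|exact: (cont_space (D := D) (trig_continuous (ta j)))].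
  have pba t' : 0 <= t' <= T -> Defs.periodic (fun x => b i x t' * a j x).
    by move=> tT' x l; rewrite (pb i tT') (trig_periodic (ta j)).
  have -> : bmoment b r a i j = (fun t => IX (fun x => r x t * (b i x t * a j x))).
    by apply/funext => s; apply: eq_IX => x; rewrite mulrA.
  exact: (admissible_continuous adm cba pba).
have pM i t' : 0 <= t' <= T -> Defs.periodic (sm_flux b r a be i ^~ t').
  by move=> _ x l; congr (- _); apply: eq_bigr => j _; rewrite (trig_periodic (tb j)).
have E s : 0 <= s <= T -> energy u (sm r a be) s = cv_energy N s.
  by move=> sT; apply: eq_IX => x; rewrite (smE adm Kab x sT).
have T00 : 0 <= (0 : R) <= T by rewrite lexx ltW.
rewrite -!E//.
apply: (energy_bound T0 nu0 cb pb hu u_gt0 hF equ (c21_sm T0 cb pb adm hm Kab) cM pM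
  (sm_flux_regular b r Kab) (sm_equation cb pb adm Kab) (sm_ge0 adm Kab) om0 ka0 k0 uk _ TC tT).
move=> i x s /oo_cc sT; apply: (sm_flux_gap cb pb adm Kab sT c0 om0 (hB i)).
by move=> y; exact: hom.
Qed.

(** Initially [r] and [u] agree almost everywhere, so they have the same mollifications. These
    converge boundedly to the continuous function [u], and the limit is the integral of
    [u ^+ 2 / u], the mass of [u]. *)
Lemma cv_energy0_cvg : cv_energy N 0 @[N --> \oo] --> (1 : R).
Proof.
have T00 : 0 <= (0 : R) <= T by rewrite lexx ltW.
have [_ _ _ r0E _] := adm.
have cu := cont_QTbar_slice (c21_cont hu) T00; have pu := c21_per hu T00.
have Iu := cont_periodic_integrable cu pu.
have cuV := cont_QTbar_slice (c21_cont uV) T00; have puV := c21_per uV T00.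
have Ir := r_integrable adm T00.
have E N x : cv (bumpn N) (r ^~ 0) x = cv (bumpn N) (u ^~ 0) x.
  apply: ae_eq_IX.
  - by apply/measurable_EFinP; exact: measurable_int (bumpn_mul_integrable N x Ir).
  - by apply/measurable_EFinP; exact: measurable_int (bumpn_mul_integrable N x Iu).
  - by apply: filterS r0E => y /= ->; rewrite u_init.
have [M hM] := periodic_bounded pu cu.
have [M' hM'] := periodic_bounded puV cuV.
have M0 : 0 <= M by apply: le_trans (hM 0).
have mcv N : measurable_fun setT (cv (bumpn N) (u ^~ 0)).
  by apply: trig_measurable; apply: cv_trig => //; exact: tensor_bumpn.
have muV : measurable_fun setT (fun x : V => (u x 0)^-1) by exact: continuous_mx_measurable.
have mu : measurable_fun setT (u ^~ 0) by exact: continuous_mx_measurable.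
have <- : IX (fun x => u x 0 * (u x 0 * (u x 0)^-1)) = 1.
  by rewrite -[RHS](u_mass T00); apply: eq_IX => x; rewrite divff ?mulr1// uneq0.
rewrite (_ : (fun N => cv_energy N 0) = fun N => IX (fun x => cv (bumpn N) (u ^~ 0) x * (cv (bumpn N) (u ^~ 0) x * (u x 0)^-1))); last first.
  by apply/funext => N; apply: eq_IX => x; rewrite E.
apply: (@Rdominated_cvg R _ _ cube setT (fun N x => cv (bumpn N) (u ^~ 0) x * (cv (bumpn N) (u ^~ 0) x * (u x 0)^-1))
  (fun x => u x 0 * (u x 0 * (u x 0)^-1)) (fun _ => M * (M * M'))) => //.
- by move=> N; apply: measurable_funM => //; exact: measurable_funM.
- by apply: measurable_funM => //; exact: measurable_funM.
- by move=> x _; apply: cvgM; [exact: cv_cvg|apply: cvgM; [exact: cv_cvg|exact: cvg_cst]].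
- exact: cube_integrable_cst.
- move=> x N _; rewrite !normrM; apply: ler_pM; rewrite ?mulr_ge0//; first exact: cv_bound.
  by apply: ler_pM => //; exact: cv_bound.
Qed.

Lemma cv_energy_limit t (e : R) : 0 <= t <= T -> 0 < e -> \forall N \near \oo, cv_energy N t <= 1 + e.
Proof.
move=> tT e0.
have [k k0 uk] := c21_lower_bound.
have [B B0 hB] := drift_bound.
(* The value given to [T * C1] through the choice of [om]. From [eta <= 1 / 2] and [eta <= e / 4]
   follows [(1 - eta) * (1 + e) >= 1 + e / 4], which leaves room for the two errors [e / 8]. *)
pose eta : R := Num.min (1 / 2) (e / 4).
have eta0 : 0 < eta by rewrite /eta lt_min; apply/andP; split; lra.
have eta1 : eta <= 1 / 2 by rewrite /eta ge_min lexx.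
have eta2 : eta <= e / 4 by rewrite /eta ge_min lexx orbT.
have n0 : 0 < n.+1%:R :> R by rewrite ltr0n.
pose om : R := Num.sqrt (eta * nu / (T * n.+1%:R)).
have om2 : om ^+ 2 = eta * nu / (T * n.+1%:R) by rewrite sqr_sqrtr// divr_ge0// mulr_ge0// ltW.
have om0 : 0 < om by rewrite sqrtr_gt0 divr_gt0// mulr_gt0.
have C1E : T * (n.+1%:R * (om ^+ 2 / nu)) = eta by rewrite om2; field; rewrite !gt_eqF.
have [c c01 hc] := drift_modulus om0.
have c0 : 0 <= c by case/andP: c01.
have TC : T * (n.+1%:R * (om ^+ 2 / nu)) <= 1 by rewrite C1E; lra.
have l2 : T * (n.+1%:R * ((2 * B * @tail R n.+1 c N) ^+ 2 / (nu * k))) @[N --> \oo] --> (0 : R).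
  have -> : (0 : R) = T * (n.+1%:R * ((2 * B * 0) ^+ 2 / (nu * k))) by rewrite mulr0 expr0n mul0r !mulr0.
  apply: cvgM; first exact: cvg_cst.
  apply: cvgM; first exact: cvg_cst.
  apply: cvgM; last exact: cvg_cst.
  have hh : 2 * B * @tail R n.+1 c N @[N --> \oo] --> 2 * B * 0.
    by apply: cvgM; [exact: cvg_cst|exact: tail_cvg0].
  exact: (cvgM hh hh).
have e8 : 0 < e / 8 by rewrite divr_gt0.
move: l2 => /cvgrPdist_le /(_ _ e8) l2.
have := cv_energy0_cvg => /cvgrPdist_le /(_ _ e8) l1.
near=> N.
have h1 : `|1 - cv_energy N 0| <= e / 8 by near: N.
have h2 : `|0 - T * (n.+1%:R * ((2 * B * @tail R n.+1 c N) ^+ 2 / (nu * k)))| <= e / 8 by near: N.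
have := @cv_energy_bound N _ _ _ _ _ (ltW om0) B0 c0 k0 uk hB hc TC tT; rewrite C1E.
move: h1 h2; rewrite !ler_norml; set X := T * _ => /andP[h1 h1'] /andP[h2 h2'].
set E0 := cv_energy N 0 in h1 h1' *; set Et := cv_energy N t => h.
have h3 : (1 - eta) * Et <= (1 - eta) * (1 + e) by apply: (le_trans h); nra.
by rewrite ler_pM2l in h3 => //; lra.
Unshelve. all: by end_near.
Qed.

(** Since [w N] and [u] have mass one, the integral of [(w N - u) ^+ 2 / u] is the energy minus 1,
    which is eventually below any positive bound. This forces [w N] to approach [u] in L^1, while by
    symmetry of the convolution [w N] tested with [be] tends to [r] tested with [be]. *)
Theorem weak_uniqueness t (be : V -> R) : 0 <= t <= T -> trig be ->
  IX (fun x => r x t * be x) = IX (fun x => u x t * be x).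
Proof.
move=> tT tb.
have Ir := r_integrable adm tT.
have cu := cont_QTbar_slice (c21_cont hu) tT; have pu := c21_per hu tT.
have cuV := cont_QTbar_slice (c21_cont uV) tT; have puV := c21_per uV tT.
have Iu := cont_periodic_integrable cu pu.
have [Mb hMb] := trig_bounded tb.
have Mb0 : 0 <= Mb by apply: le_trans (hMb 0).
have pbe := trig_periodic tb; have cbe := trig_continuous tb.
have mb := trig_measurable tb.
pose w N := cv (bumpn N) (r ^~ t).
have tw N : trig (w N) by apply: cv_trig => //; exact: tensor_bumpn.
have cw N := trig_continuous (tw N); have pw N := trig_periodic (tw N).
have Iw N := cont_periodic_integrable (cw N) (pw N).
have mass N : IX (w N) = 1.
  by rewrite (IX_cv N Ir); have [_ ->] := density_integrable (admissible_density adm tT).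
have mT := @measurableT _ V.
have lim : IX (fun x => w N x * be x) @[N --> \oo] --> IX (fun x => r x t * be x).
  rewrite (_ : (fun N => _) = fun N => IX (fun x => r x t * cv (bumpn N) be x)); last first.
    by apply/funext => N; exact: cv_duality.
  have mr : measurable_fun setT (r ^~ t) by apply/measurable_EFinP; exact: measurable_int Ir.
  have mcv N : measurable_fun setT (cv (bumpn N) be).
    by apply: trig_measurable; apply: cv_trig; [exact: tensor_bumpn|exact: cont_periodic_integrable].
  apply: (@Rdominated_cvg R _ _ cube setT (fun N x => r x t * cv (bumpn N) be x) (fun x => r x t * be x) (fun x => r x t * Mb)) => //.
  - by move=> N; exact: measurable_funM.
  - exact: measurable_funM.
  - by move=> x _; apply: cvgM; [exact: cvg_cst|exact: cv_cvg].
  - by apply: (RintegrableMb (M := Mb)) => //; move=> x _; rewrite ger0_norm.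
  - move=> x N _; have [_ _ r0 _] := admissible_density adm tT.
    by rewrite normrM ger0_norm// ler_wpM2l//; exact: cv_bound.
(* A weighted inequality [2 |w - u| <= la u + (w - u) ^+ 2 / (la u)] is integrated. With the energy
   at most [1 + la ^+ 2], each of the two terms contributes at most [la]. *)
have key (la : R) : 0 < la -> \forall N \near \oo,
    `|IX (fun x => w N x * be x) - IX (fun x => u x t * be x)| <= Mb * la.
  move=> la0; have := cv_energy_limit tT (exprn_gt0 2 la0); apply: filterS => N hE.
  have Iwb : cube.-integrable setT (EFin \o (fun x => w N x * be x)) by exact: (RintegrableMb (M := Mb)).
  have Iub : cube.-integrable setT (EFin \o (fun x => u x t * be x)) by exact: (RintegrableMb (M := Mb)).
  rewrite -IXB//; apply: le_trans (le_normr_Rintegral _ (RintegrableB mT Iwb Iub)) _ => //.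
  have Iq : cube.-integrable setT (EFin \o (fun x => w N x * (w N x * (u x t)^-1))).
    apply: cont_periodic_integrable; first by apply: ctsM => //; apply: ctsM.
    by move=> x i; rewrite pw puV.
  have Is : cube.-integrable setT (EFin \o (fun x => w N x * (w N x * (u x t)^-1) - 2 * w N x + u x t)).
    by apply: RintegrableD => //; apply: RintegrableB => //; exact: RintegrableZ.
  have Ist : cube.-integrable setT (EFin \o (fun x => la * u x t + la^-1 * (w N x * (w N x * (u x t)^-1) - 2 * w N x + u x t))).
    by apply: RintegrableD => //; exact: RintegrableZ.
  apply: (@le_trans _ _ (IX (fun x => (Mb / 2) * (la * u x t + la^-1 * (w N x * (w N x * (u x t)^-1) - 2 * w N x + u x t))))).
    apply: le_Rintegral => //; [exact: integrable_abse (RintegrableB mT Iwb Iub)|exact: RintegrableZ|].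
    move=> x _; have ux0 := u_gt0 x tT.
    have -> : w N x * (w N x * (u x t)^-1) - 2 * w N x + u x t = (w N x - u x t) ^+ 2 / u x t.
      by field; rewrite gt_eqF.
    rewrite -mulrBl normrM mulrC -mulrA; apply: ler_pM => //.
    rewrite mulrC ler_pdivlMr//; set q := w N x - u x t.
    have -> : la * u x t + la^-1 * (q ^+ 2 / u x t) = ((la * u x t) ^+ 2 + `|q| ^+ 2) / (la * u x t).
      by rewrite real_normK ?num_real//; field; rewrite !gt_eqF.
    rewrite ler_pdivlMr ?mulr_gt0//.
    by have := sqr_ge0 (la * u x t - `|q|); nra.
  rewrite IXZ// IXD; [|exact: RintegrableZ|exact: RintegrableZ].
  rewrite !IXZ// IXD//; last by apply: RintegrableB => //; exact: RintegrableZ.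
  rewrite IXB//; last exact: RintegrableZ.
  rewrite IXZ// mass (u_mass tT) -/(cv_energy N t).
  rewrite -mulrA ler_wpM2l// mulr1.
  have h : la^-1 * (cv_energy N t - 2 * 1 + 1) <= la.
    by rewrite mulrC ler_pdivrMr// -expr2; lra.
  by move: h; set X := la^-1 * _ => h; lra.
apply/eqP; rewrite -subr_eq0 -normr_le0; apply/ler_addgt0Pr => e e0; rewrite add0r.
have la0 : 0 < e / (Mb + 1) by rewrite divr_gt0// ltr_wpDl.
have lim' : `|IX (fun x => w N x * be x) - IX (fun x => u x t * be x)| @[N --> \oo] -->
    `|IX (fun x => r x t * be x) - IX (fun x => u x t * be x)|.
  by apply: cvg_norm; apply: cvgB => //; exact: cvg_cst.
apply: (@le_trans _ _ (Mb * (e / (Mb + 1)))).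
  rewrite -(cvg_lim _ lim')//; apply: limr_le; [exact: cvgP lim'|exact: key].
by rewrite mulrA ler_pdivrMr ?ltr_wpDl// mulrDr mulr1 mulrC lerDl ltW.
Qed.

End weak_uniqueness.

(** * Separation of densities by trigonometric polynomials *)

Section separation.
Import HBNNSimple.
Context {R : realType} {n : nat}.
Local Notation V := 'rV[R]_n.+1.
Local Notation cube := (cube_leb n.+1 : {measure set 'rV[R]_n.+1 -> \bar R}).

Lemma ae_dominated_IX (f_ : nat -> V -> R) (f h : V -> R) : (forall N, measurable_fun setT (f_ N)) ->
  measurable_fun setT f -> cube.-integrable setT (EFin \o h) ->
  {ae cube, forall x, f_ N x @[N --> \oo] --> f x} -> (forall x N, `|f_ N x| <= h x) ->
  IX (f_ N) @[N --> \oo] --> IX f.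
Proof.
move=> mf_ mf Ih [A [mA A0 subA]] hb.
have mI : measurable_fun setT (\1_(~` A) : V -> R) by apply: measurable_indic; exact: measurableC.
have E (g : V -> R) : measurable_fun setT g -> IX g = IX (fun x => g x * \1_(~` A) x).
  move=> mg; apply: ae_eq_IX => //; first exact: measurable_funM.
  exists A; split => // x hx; apply: contrapT => nA; apply: hx.
  by rewrite /= indicE mem_set ?mulr1.
rewrite E//; rewrite (_ : (fun N => _) = fun N => IX (fun x => f_ N x * \1_(~` A) x)); last first.
  by apply/funext => N; exact: E.
apply: (@Rdominated_cvg R _ _ cube setT (fun N x => f_ N x * \1_(~` A) x) (fun x => f x * \1_(~` A) x) h) => //.
- by move=> N; exact: measurable_funM.
- exact: measurable_funM.
- move=> x _; rewrite indicE; case: (boolP (x \in ~` A)) => [|_].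
    rewrite inE => nA; apply: cvgM; last exact: cvg_cst.
    by apply: contrapT => h'; apply: nA; apply: subA.
  by rewrite mulr0 (_ : (fun _ => _) = fun=> 0); [exact: cvg_cst|apply/funext => N; rewrite mulr0].
- move=> x N _; apply: le_trans (hb x N); rewrite normrM ler_piMr// indicE.
  by case: (_ \in _); rewrite ?normr1 ?normr0.
Qed.

(** These sets form a family stable under intersection that generates the Borel sets, so a finite
    measure is determined by its values on them. Their indicators become trigonometric polynomials
    after mollification. *)
Definition orthant (q : V) : set V := [set x | forall i, x 0 i < q 0 i].

Lemma orthant_measurable q : measurable (orthant q).
Proof.
rewrite (_ : orthant q = \bigcap_(i in [set: 'I_n.+1]) [set x : V | x 0 i < q 0 i]); last first.
  by apply/seteqP; split => [x h i _|x h i]; exact: h.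
apply: fin_bigcap_measurable => //= i _.
have := @measurable_mx_entry _ (measurableTypeR R) 1 n.+1 0 i measurableT `]-oo, q 0 i[%classic.
rewrite setTI (_ : _ @^-1` _ = [set x : V | x 0 i < q 0 i]); first by apply; exact: measurable_itv.
by apply/seteqP; split => x /=; rewrite in_itv.
Qed.

(** The indicator is not periodic, so closeness modulo the lattice must be turned into closeness in
    the cube: an interior point [y] of the cube differs from a point of the closed cube by an
    integer vector only if they coincide. Off the faces of the orthant, closeness within [e] then
    preserves membership. *)
Lemma orthant_bump (q y : V) : (forall i, 0 < y 0 i < 1) -> (forall i, y 0 i != q 0 i) ->
  exists2 c : R, 0 <= c < 1 &
  forall x, unit_cube x -> c < bump (x - y) -> \1_(orthant q) x = \1_(orthant q) y :> R.
Proof.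
move=> y01 yq; pose e : R := \big[Num.min/1]_i `|y 0 i - q 0 i|.
have e0 : 0 < e.
  by apply/bigmin_gtP; split => // i _; rewrite normr_gt0 subr_eq0.
have cP : continuous (fun x : V => \sum_i `|x 0 i - y 0 i|).
  apply: cts_sum => i; apply: cts_norm; apply: ctsB; last exact: cts_cst.
  exact: coord_continuous.
have cS : continuous (fun x : V => x - y) by apply: ctsB; [exact: cts_id|exact: cts_cst].
have [] := bump_separation (@compact_box R n.+1 0 1) cS (continuous_subspaceT cP) e0.
  move=> x x01 xy; rewrite big1// => i _; have [k] := xy i; rewrite !mxE => hk.
  have := x01 i; have := y01 i => /andP[y0 y1] /andP[x0 x1].
  have k1 : -1 < k%:~R :> R by rewrite -hk; lra.
  have k2 : k%:~R < 1 :> R by rewrite -hk; lra.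
  have : k = 0 by move: k1 k2; rewrite -[-1]/((-1)%:~R) -[1]/(1%:~R) !ltr_int; lia.
  by rewrite hk => ->; rewrite normr0.
move=> c c01 hc; exists c => // x xc cb.
have {}hc : \sum_i `|x 0 i - y 0 i| < e.
  by apply: hc cb => i; have /andP[-> /ltW] := xc i.
have near i : `|x 0 i - y 0 i| < `|y 0 i - q 0 i|.
  apply: (@lt_le_trans _ _ e); last exact: bigmin_le.
  by apply: le_lt_trans hc; rewrite (bigD1 i)//= lerDl sumr_ge0.
have same i : (x 0 i < q 0 i) = (y 0 i < q 0 i).
  have := near i; case: (ltrgtP (y 0 i) (q 0 i)) (yq i) => // h _.
    by rewrite ltr_norml => /andP[? ?]; apply/idP; lra.
  by rewrite ltr_norml => /andP[? ?]; apply/negbTE; rewrite -leNgt; lra.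
rewrite !indicE; congr (nat_of_bool _)%:R; apply/idP/idP => /set_mem h; apply/mem_set => i.
  by rewrite -same; exact: h.
by rewrite same; exact: h.
Qed.

Lemma orthant_cv_cvg q : {ae cube, forall y,
  cv (bumpn N) (\1_(orthant q) : V -> R) y @[N --> \oo] --> (\1_(orthant q) y : R)}.
Proof.
have hyp (i : 'I_n.+1) (p : R) : {ae cube, forall x : V, x 0 i != p}.
  exists [set x : V | x 0 i = p]; split.
  - rewrite -[X in measurable X]setTI.
    exact: (measurable_mx_entry 0 i measurableT (measurable_set1 p)).
  - exact: cube_hyperplane.
  - by move=> x /= /negP; rewrite negbK => /eqP.
have h0 := @filter_forall _ _ _ (almost_everywhere cube) (ae_filter_ringOfSetsType cube) (fun i : 'I_n.+1 => hyp i 0).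
have hq := @filter_forall _ _ _ (almost_everywhere cube) (ae_filter_ringOfSetsType cube) (fun i : 'I_n.+1 => hyp i (q 0 i)).
apply: filterS3 (@ae_unit_cube R n.+1) h0 hq => y yc y0 yq.
have y01 i : 0 < y 0 i < 1.
  by have /andP[h ->] := yc i; rewrite andbT lt_neqAle h eq_sym y0.
have [c c01 hc] := orthant_bump y01 yq.
have c0 : 0 <= c by case/andP: c01.
apply/cvgrPdist_le => e e0.
have := @tail_cvg0 R n.+1 c c01 => /cvgrPdist_le /(_ (e / 2)).
rewrite divr_gt0// => /(_ isT); apply: filterS => N.
rewrite sub0r normrN ger0_norm ?tail_ge0// => hN; rewrite distrC.
(* The oscillation bound is 0 because the indicator is constant where [bump (x - y)] exceeds [c], so
   only the tail remains. *)
have := @cv_close R n.+1 N (\1_(orthant q)) y 1 0 c (measurable_indic (orthant_measurable q)) _ c0 (lexx 0).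
have b1 x : `|\1_(orthant q) x : R| <= 1 by rewrite indicE; case: (_ \in _); rewrite ?normr1 ?normr0.
move=> /(_ b1) h; apply: le_trans (h _) _; last lra.
by move=> x xc cb; rewrite (hc x xc cb) subrr normr0.
Qed.

Lemma orthant_IX (f g : V -> R) q : cube.-integrable setT (EFin \o f) -> cube.-integrable setT (EFin \o g) ->
  (forall be, trig be -> IX (fun x => f x * be x) = IX (fun x => g x * be x)) ->
  IX (fun x => f x * \1_(orthant q) x) = IX (fun x => g x * \1_(orthant q) x).
Proof.
move=> If Ig fg.
have mI : measurable_fun setT (\1_(orthant q) : V -> R) by apply: measurable_indic; exact: orthant_measurable.
have b1 x : `|\1_(orthant q) x : R| <= 1 by rewrite indicE; case: (_ \in _); rewrite ?normr1 ?normr0.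
have tcv N : trig (cv (bumpn N) (\1_(orthant q) : V -> R)).
  apply: cv_trig; first exact: tensor_bumpn.
  exact: (cube_integrable (M := 1)).
have lim (h : V -> R) : cube.-integrable setT (EFin \o h) ->
    IX (fun x => h x * cv (bumpn N) (\1_(orthant q) : V -> R) x) @[N --> \oo] --> IX (fun x => h x * \1_(orthant q) x).
  move=> Ih; have mh : measurable_fun setT h by apply/measurable_EFinP; exact: measurable_int Ih.
  apply: (@ae_dominated_IX (fun N x => h x * cv (bumpn N) (\1_(orthant q) : V -> R) x) (fun x => h x * \1_(orthant q) x) (fun x => `|h x|)).
  - by move=> N; apply: measurable_funM => //; exact: trig_measurable.
  - exact: measurable_funM.
  - exact: integrable_abse Ih.
  - by apply: filterS (orthant_cv_cvg q) => x hx; apply: cvgM => //; exact: cvg_cst.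
  - by move=> x N; rewrite normrM ler_piMr//; exact: cv_bound.
have l1 := lim f If; have l2 := lim g Ig.
have E : (fun N => IX (fun x => f x * cv (bumpn N) (\1_(orthant q) : V -> R) x)) =
   (fun N => IX (fun x => g x * cv (bumpn N) (\1_(orthant q) : V -> R) x)).
  by apply/funext => N; exact: fg.
by rewrite E in l1; exact: (cvg_unique _ l1 l2).
Qed.

Lemma orthant_generates (A : set V) : measurable A -> <<s range orthant >> A.
Proof.
move=> mA; pose U := g_sigma_algebraType (range orthant).
have mid : measurable_fun setT (fun x : U => x : V).
  apply: (@measurable_fun_mx _ (measurableTypeR R) 1 n.+1) => i j.
  apply: (measurability _ (RGenInftyO.measurableE R)) => //.
  move=> _ [_ [a ->] <-]; rewrite setTI.
  (* The half space of points whose coordinate [j] is below [a] is the union of the orthants whose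
     other bounds are integers [k]. *)
  pose p k : V := \row_l (if l == j then a else k%:R).
  rewrite (_ : _ @^-1` _ = \bigcup_k orthant (p k)); last first.
    apply/seteqP; split => x /=; rewrite in_itv/=.
      rewrite (ord1 i) => xa; pose K := \sum_l `|x 0 l|.
      exists (Num.truncn K).+1 => // l; rewrite mxE; case: eqP => [->//|_].
      apply: (@le_lt_trans _ _ K).
        by apply: (le_trans (ler_norm _)); rewrite /K (bigD1 l)//= lerDl sumr_ge0.
      by rewrite truncnS_gt.
    by move=> [k _ /(_ j)]; rewrite (ord1 i) mxE eqxx.
  apply: bigcup_measurable => k _; apply: sub_sigma_algebra; by exists (p k).
by have := mid measurableT A mA; rewrite setTI.
Qed.

(* [A] need not be measurable: [law] is a record containing a function on all
   sets, and the equality of laws below is an equality of such functions. *)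
Lemma ge0_integral_subset (A : set V) (f g : V -> R) : (forall x, 0 <= f x) -> (forall x, 0 <= g x) ->
  {ae cube, forall x, f x = g x} ->
  (\int[cube]_(x in A) (f x)%:E <= \int[cube]_(x in A) (g x)%:E)%E.
Proof.
move=> f0 g0 [N [mN N0 subN]].
rewrite !ge0_integralE; [|by move=> x _; rewrite lee_fin|by move=> x _; rewrite lee_fin].
apply: ub_ereal_sup => _ [h hf <-].
(* A simple function below [f] on [A] is set to 0 on the null set [N]; its integral is unchanged and
   it now lies below [g]. The integral is a supremum over simple functions, so nothing is asked of
   [A]. *)
pose h' := mul_nnsfun h (indic_nnsfun R (measurableC mN)).
have Eh (k : {nnsfun V >-> R}) : sintegral cube k = (\int[cube]_x (k x)%:E)%E.
  by rewrite integral_nnsfun// patch_setT.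
have /= -> : sintegral cube (h : {nnsfun V >-> R}) = sintegral cube h'.
  rewrite !Eh; apply: ae_eq_integral => //.
  - by apply/measurable_EFinP; exact: measurable_funPT.
  - by apply/measurable_EFinP; exact: measurable_funPT.
  exists N; split => // x hx; apply: contrapT => nx; apply: hx => _ /=.
  by rewrite /mindic indicE mem_set ?mulr1.
apply: ereal_sup_ubound; exists h' => //= x; rewrite /= /mindic indicE.
case: (boolP (x \in ~` N)) => [|_]; last first.
  by rewrite mulr0 patchE; case: ifP => _//; rewrite lee_fin.
rewrite inE => nx; rewrite mulr1; apply: le_trans (hf x) _.
rewrite !patchE; case: ifP => // _.
suff -> : f x = g x by [].
by apply: contrapT => ne; apply: nx; apply: subN.
Qed.

Lemma ge0_ae_integral_subset (A : set V) (f g : V -> R) : (forall x, 0 <= f x) -> (forall x, 0 <= g x) ->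
  {ae cube, forall x, f x = g x} ->
  (\int[cube]_(x in A) (f x)%:E = \int[cube]_(x in A) (g x)%:E)%E.
Proof.
move=> f0 g0 fg; apply/eqP; rewrite eq_le !ge0_integral_subset//.
by apply: filterS fg => x ->.
Qed.

(** Equality against trigonometric polynomials passes to indicators of orthants, hence to all Borel
    sets by uniqueness of measures, and densities with equal integrals over all Borel sets agree
    almost everywhere. *)
Theorem density_separation (f g : V -> R) : is_density f -> is_density g ->
  (forall be, trig be -> IX (fun x => f x * be x) = IX (fun x => g x * be x)) ->
  {ae cube, forall x, f x = g x}.
Proof.
move=> df dg fg.
have [If _] := density_integrable df; have [Ig _] := density_integrable dg.
have key (A : set V) : measurable A -> density_prob df A = density_prob dg A.
  move=> mA; have := orthant_generates mA.
  apply: (@g_sigma_algebra_measure_unique _ R V (range orthant) _ (fun k => orthant (const_mx k%:R))).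
  - by move=> _ [q _ <-]; exact: orthant_measurable.
  - by move=> k; exists (const_mx k%:R).
  - apply/seteqP; split => // x _; pose K := \sum_l `|x 0 l|.
    exists (Num.truncn K).+1 => // l; rewrite mxE; apply: (@le_lt_trans _ _ K).
      by apply: (le_trans (ler_norm _)); rewrite /K (bigD1 l)//= lerDl sumr_ge0.
    by rewrite truncnS_gt.
  - move=> _ _ [p _ <-] [q _ <-]; exists (\row_i Num.min (p 0 i) (q 0 i)) => //.
    apply/seteqP; split => x /=.
      by move=> h; split => i; have := h i; rewrite mxE lt_min => /andP[].
    by move=> [h1 h2] i; rewrite mxE lt_min h1 h2.
  - move=> _ [q _ <-]; rewrite /density_prob/= /density_measure.
    have mq := orthant_measurable q.
    have Eq (h : V -> R) : cube.-integrable setT (EFin \o h) ->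
        (\int[cube]_(x in orthant q) (h x)%:E)%E = (IX (fun x => h x * \1_(orthant q) x))%:E.
      move=> Ih; have mI : measurable_fun setT (\1_(orthant q) : V -> R) by exact: measurable_indic.
      have Ihq : cube.-integrable setT (EFin \o (fun x => h x * \1_(orthant q) x)).
        apply: (RintegrableMb (M := 1)) => // x _.
        by rewrite indicE; case: (_ \in _); rewrite ?normr1 ?normr0.
      rewrite integral_mkcond /IX /Rintegral fineK; last exact: integrable_fin_num Ihq.
      apply: eq_integral => x _; rewrite patchE indicE.
      by case: (_ \in _); rewrite ?mulr1 ?mulr0.
    by rewrite !Eq//; congr EFin; exact: orthant_IX.
  - by move=> k; apply: (le_lt_trans (probability_le1 _ _)); [exact: orthant_measurable|exact: ltry].
have := @integral_ae_eq _ V R cube setT measurableT (EFin \o g) (EFin \o f) If (measurable_int _ Ig).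
case; first by move=> E _ mE; exact: key.
move=> N [mN N0 sN]; exists N; split => // x /= h; apply: sN => /= h'; apply: h.
by have := h' I => -[].
Qed.

(** All other fields of the record are proofs. Equality as records is what a nonlocal cost requires,
    since it takes a [probability] as argument. *)
Lemma eq_probability (P Q : probability V R) : (P = Q :> (set V -> \bar R)) -> P = Q.
Proof.
case: P => p cp; case: Q => q cq /= pq; case: _ / pq cq => cq; congr Probability.Pack.
case: cp => [[? ?] [?] [?] [?] [?] [?] [?]]; case: cq => [[? ?] [?] [?] [?] [?] [?] [?]].
by repeat match goal with a : ?X, b : ?X |- _ =>
  lazymatch type of X with Prop => move: (Prop_irrelevance a b) => ?; subst b end end.
Qed.

Lemma ae_eq_law (f g : V -> R) : is_density f -> is_density g ->
  {ae cube, forall x, f x = g x} -> law f = law g.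
Proof.
move=> df dg fg; rewrite /law; case: pselect => // df'; case: pselect => // dg'.
apply: eq_probability; apply/funext => A; apply: ge0_ae_integral_subset => //.
  by case: df.
by case: dg.
Qed.

End separation.

(** * Best responses *)

Section best_response.
Context {R : realType} {n : nat}.
Local Notation V := 'rV[R]_n.+1.
Local Notation Q := ('rV[R]_n.+1 * measurableTypeR R)%type.
Local Notation leb := (@lebesgue_measure R).
Local Notation st := (@space_time_leb R n.+1).
Local Notation cube := (cube_leb n.+1).

(** Functions equal almost everywhere have identical mollifications, which converge pointwise to
    each of them by continuity. *)
Lemma ae_eq_continuous (f g : V -> R) : continuous f -> continuous g ->
  Defs.periodic f -> Defs.periodic g -> {ae cube, forall x, f x = g x} -> f =1 g.
Proof.
move=> cf cg pf pg fg y.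
have If := cont_periodic_integrable cf pf; have Ig := cont_periodic_integrable cg pg.
have E : (fun N => cv (bumpn N) f y) = (fun N => cv (bumpn N) g y).
  apply/funext => N; apply: ae_eq_IX.
  - by apply/measurable_EFinP; exact: measurable_int (bumpn_mul_integrable N y If).
  - by apply/measurable_EFinP; exact: measurable_int (bumpn_mul_integrable N y Ig).
  - by apply: filterS fg => x ->.
have := @cv_cvg R n.+1 f y cf pf; rewrite E => l1.
exact: (cvg_unique _ l1 (cv_cvg (y := y) cg pg)).
Qed.

Lemma local_cost_continuous k (f : V -> R -> R) (g : V -> R) : coupling_Ck k (Local_cost f) ->
  continuous g -> (forall x, 0 <= g x) -> continuous (fun x => f x (g x)).
Proof.
move=> [_ hf] cg g0.
have cf : {within [set z : V * R | 0 <= z.2], continuous (fun z => f z.1 z.2)} by case: k hf => [|k] [].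
apply/continuous_subspace_setT.
apply: (@within_comp _ _ _ setT [set z : V * R | 0 <= z.2] (fun x : V => (x, g x)) (fun z => f z.1 z.2)) => // [|x _]; last exact: g0.
by apply: cts_pair => //; exact: cts_id.
Qed.

(** Only [f] is continuous; [g] is an arbitrary representative. Continuity of [x |-> cost c x g] is
    therefore a hypothesis, supplied below by the solvability of the backward equation. *)
Lemma cost_transfer k (c : coupling R n.+1) (f g : V -> R) : coupling_Ck k c ->
  is_density f -> is_density g -> continuous f -> {ae cube, forall x, f x = g x} ->
  continuous (fun x => cost c x g) -> Defs.periodic (fun x => cost c x g) ->
  forall x, cost c x f = cost c x g.
Proof.
case: c => [c|c] hc df dg cf fg cg pg x /=; last by rewrite (ae_eq_law df dg fg).
have [pf _ f0 _] := df; move: x; apply: ae_eq_continuous => //.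
- exact: (local_cost_continuous hc).
- by move=> x i; have [pc _] := hc; rewrite pf; apply: pc.
- by apply: filterS fg => x ->.
Qed.

Variable D : mfg_data R n.+1.
Hypothesis hD : standing_assumptions D.
Local Notation T := (horizon D).
Local Notation nu := (viscosity D).
Let T0 := data_horizon hD.

(** Equality at each time outside a null set of space becomes equality almost everywhere in
    space-time by Fubini's theorem applied to [|r - r'|]. *)
Lemma same_density_ae (r r' : V -> R -> R) (m m' : V -> R -> V) :
  admissible D r m -> admissible D r' m' -> same_density D r r' ->
  {ae st, forall z : Q, QT T z -> r z.1 z.2 = r' z.1 z.2}.
Proof.
move=> a a' h; have mQ := @QT_measurable R n.+1 T.
have If := RintegrableB mQ (admissible_integrable a) (admissible_integrable a').
have Ia := integrable_abse If.
pose F (z : V * R) := `|r z.1 z.2 - r' z.1 z.2|.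
have IF : st.-integrable (QT T) (EFin \o F) by [].
have [_ E] := fubini_QT IF.
have {}E : \int[st]_(z in QT T) F z = 0.
  rewrite E (_ : \int[leb]_(t in `]0, T[) _ = \int[leb]_(t in `]0, T[) cst (0 : R) t).
    by rewrite Rintegral_cst ?mul0r//; exact: itvoo_measurable.
  apply: eq_Rintegral => t; rewrite inE/= in_itv/= => /oo_cc tT.
  rewrite -[RHS](@IX_cst R n.+1); apply: ae_eq_IX.
  - have [_ m1 _ _] := admissible_density a tT; have [_ m2 _ _] := admissible_density a' tT.
    have m3 : measurable_fun setT (fun x => r x t - r' x t) by exact: measurable_funB.
    rewrite (_ : (fun x => F (x, t)) = Num.norm \o (fun x => r x t - r' x t))//; exact: measurableT_comp.
  - exact: measurable_cst.
  - by apply: filterS (h t tT) => x e; rewrite /F /= e subrr normr0.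
have {}E : (\int[st]_(z in QT T) `|(r z.1 z.2 - r' z.1 z.2)%:E| = 0)%E.
  by rewrite -[LHS]fineK; [congr EFin; exact: E|exact: integrable_fin_num IF].
have /ae_eq_integral_abs := E => /(_ mQ (measurable_int _ If)).
apply: filterS => z hz zT; have := hz zT => -[] /eqP.
by rewrite subr_eq0 => /eqP.
Qed.

Lemma same_momentum_trans (m m' m'' : V -> R -> V) :
  same_momentum D m m' -> same_momentum D m' m'' -> same_momentum D m m''.
Proof.
move=> h h'; have {}h : {ae st, forall z : Q, QT T z -> m z.1 z.2 = m' z.1 z.2} := h.
by apply: filterS2 h h' => z e e' zT; rewrite e// e'.
Qed.

Lemma same_momentum_sym (m m' : V -> R -> V) : same_momentum D m m' -> same_momentum D m' m.
Proof.
move=> h; have {}h : {ae st, forall z : Q, QT T z -> m z.1 z.2 = m' z.1 z.2} := h.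
by apply: filterS h => z e zT; rewrite e.
Qed.

Lemma same_density_drift (phi r r' : V -> R -> R) (m m' : V -> R -> V) :
  admissible D r m -> admissible D r' m' -> same_density D r r' ->
  same_momentum D (fun x t => - drift_flux D r phi x t) (fun x t => - drift_flux D r' phi x t).
Proof.
move=> a a' h; apply: filterS (same_density_ae a a' h) => z e zT.
by rewrite /drift_flux e.
Qed.

Section backward.
Variables (rho phi : V -> R -> R).
Hypothesis HJB : solves_HJB D rho phi.

Lemma HJB_c21 : exists phit phix phixx, [/\ c21 T phi phit phix phixx,
  forall i x t, 0 < t < T -> phix i x t = partial i (phi ^~ t) x,
  forall x t, 0 < t < T ->
    - phit x t - nu * (\sum_i phixx i x t) + hphi_H D phix x t = cost (running_cost D) x (rho ^~ t) &
  forall x, phi x T = cost (terminal_cost D) x (rho ^~ T)].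
Proof.
have [pphi cphi run ter] := HJB.
have [phit [phix [phixx [hphi et ex exx]]]] := C21_c21 T0 pphi cphi.
exists phit, phix, phixx; split => // x t tT.
rewrite -(run x t tT) et// /hphi_H; congr (- _ - nu * _ + hamiltonian D x _).
  by apply: eq_bigr => i _; exact: exx.
by apply/rowP => i; rewrite !mxE ex.
Qed.

Lemma HJB_verification (r : V -> R -> R) (m : V -> R -> V) : admissible D r m ->
  ((value D phi)%:E <= total_cost D rho r m)%E /\
  (total_cost D rho r m = (value D phi)%:E <-> same_momentum D m (fun x t => - drift_flux D r phi x t)).
Proof.
have [phit [phix [phixx [hphi ex hrun hter]]]] := HJB_c21.
move=> adm; have [le eq] := verification hD hphi hrun hter adm; split; first exact: le.
rewrite eq; split => h.
  by apply: filterS h => z hz zT; rewrite hz// /drift_flux (grad_pgrad ex).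
have {}h : {ae st, forall z : Q, QT T z -> m z.1 z.2 = - drift_flux D r phi z.1 z.2} := h.
by apply: filterS h => z hz zT; rewrite hz// /drift_flux (grad_pgrad ex).
Qed.

(** The density [rho] is only a measurable representative, but the cost equals the left side of the
    backward equation, which is continuous and periodic. *)
Lemma running_cost_regular t : 0 < t < T -> continuous (fun x => cost (running_cost D) x (rho ^~ t)) /\
  Defs.periodic (fun x => cost (running_cost D) x (rho ^~ t)).
Proof.
have [phit [phix [phixx [hphi ex hrun hter]]]] := HJB_c21.
move=> tT; have tT' := oo_cc tT.
have -> : (fun x => cost (running_cost D) x (rho ^~ t)) =
    (fun x => - phit x t - nu * (\sum_i phixx i x t) + hphi_H D phix x t).
  by apply/funext => x; rewrite hrun.
split.
  apply: ctsD; last exact: cont_QTbar_slice (cont_hphi_H hD hphi) tT'.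
  apply: ctsB; first by apply: ctsN; exact: cont_QTbar_slice (c21_cont_t hphi) tT'.
  apply: ctsM; first exact: cts_cst.
  by apply: cts_sum => i; exact: cont_QTbar_slice (c21_cont_xx hphi i) tT'.
move=> x i; rewrite (c21_per_t T0 hphi tT') (per_hphi_H hD hphi tT'); congr (_ - _ * _ + _).
by apply: eq_bigr => j _; rewrite (c21_per_xx T0 hphi j tT').
Qed.

Lemma terminal_cost_regular : continuous (fun x => cost (terminal_cost D) x (rho ^~ T)) /\
  Defs.periodic (fun x => cost (terminal_cost D) x (rho ^~ T)).
Proof.
have [pphi [cphi _ _ _ _] _ ter] := HJB.
have TT : 0 <= T <= T by rewrite lexx ltW.
have -> : (fun x => cost (terminal_cost D) x (rho ^~ T)) = phi ^~ T by apply/funext => x; rewrite ter.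
by split; [exact: cont_QTbar_slice cphi TT|exact: pphi].
Qed.

Lemma HJB_transfer (r : V -> R -> R) : density_evolution D r -> density_evolution D rho ->
  cont_QTbar T r -> same_density D r rho -> solves_HJB D r phi.
Proof.
move=> dr drho cr sd; have [pphi cphi run ter] := HJB.
have [_ _ _ kf kfT] := hD; have TT : 0 <= T <= T by rewrite lexx ltW.
split => // [x t tT|x].
  have tT' := oo_cc tT; rewrite run//; apply/esym.
  have [h1 h2] := running_cost_regular tT.
  apply: (cost_transfer kf (dr t tT') (drho t tT')) => //; last exact: sd.
  exact: cont_QTbar_slice cr tT'.
rewrite ter; apply/esym; have [h1 h2] := terminal_cost_regular.
apply: (cost_transfer kfT (dr T TT) (drho T TT)) => //; last exact: sd.
exact: cont_QTbar_slice cr TT.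
Qed.

Section forward.
Variable u : V -> R -> R.
Hypothesis FP : solves_FP D phi u.
Hypothesis u_gt0 : forall x t, 0 <= t <= T -> 0 < u x t.

Lemma best_response_admissible : admissible D u (fun x t => - drift_flux D u phi x t).
Proof.
have [phit [phix [phixx [hphi ex hrun hter]]]] := HJB_c21.
have [pu cu _ _ _] := FP; have [ut [ux [uxx [hu et exu exx]]]] := C21_c21 T0 pu cu.
exact: (FP_admissible hD hphi ex hu et exx FP u_gt0).
Qed.

Lemma drift_uniqueness (r : V -> R -> R) (m : V -> R -> V) : admissible D r m ->
  same_momentum D m (fun x t => - drift_flux D r phi x t) -> same_density D r u.
Proof.
move=> adm hm t tT.
have [phit [phix [phixx [hphi ex hrun hter]]]] := HJB_c21.
have [pu cu _ _ u0] := FP; have [ut [ux [uxx [hu et exu exx]]]] := C21_c21 T0 pu cu.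
apply: (density_separation (admissible_density adm tT) (FP_density hD hphi ex hu et exx FP u_gt0 tT)).
move=> be tb.
apply: (weak_uniqueness T0 (data_viscosity hD) (b := hphi_b D phix) _ _ hu u_gt0 (Fd := FP_flux_div D phi u) _ _ _ u0 adm _ tT tb).
- by move=> i; exact: (@cont_hphi_b _ _ _ hD _ _ _ _ hphi i).
- by move=> i s sT; exact: (per_hphi_b hD hphi i sT).
- by move=> i s sT; exact: (FP_flux_regular hD hphi ex hu FP i sT).
- by move=> x s sT; exact: (FP_equation et exx FP x sT).
- by move=> s sT; exact: (FP_mass hD hphi ex hu et exx FP sT).
- have h : {ae st, forall z : Q, QT T z -> m z.1 z.2 = - drift_flux D r phi z.1 z.2} := hm.
  apply: filterS h => z e zT i; rewrite e// mxE (drift_FP_flux (phix := phix) ex)//.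
  by rewrite /FP_flux opprK.
Qed.

Lemma minimal_total_cost : total_cost D rho u (fun x t => - drift_flux D u phi x t) = (value D phi)%:E.
Proof.
have [_ [_]] := HJB_verification best_response_admissible; apply.
exact: (@aeW _ _ _ st).
Qed.

Lemma minimizerP (r : V -> R -> R) (m : V -> R -> V) : admissible D r m ->
  (minimizer D rho r m <-> total_cost D rho r m = (value D phi)%:E).
Proof.
move=> adm; have [le _] := HJB_verification adm; split => [[_ h]|E].
  apply/eqP; rewrite eq_le le andbT -minimal_total_cost; apply: h.
  exact: best_response_admissible.
by split => // r' m' /HJB_verification[le' _]; rewrite E.
Qed.

Lemma minimizer_unique (r r' : V -> R -> R) (m m' : V -> R -> V) :
  minimizer D rho r m -> minimizer D rho r' m' -> same_density D r' r /\ same_momentum D m' m.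
Proof.
move=> h h'; have a := h.1; have a' := h'.1.
have /(HJB_verification a).2 e := (minimizerP a).1 h.
have /(HJB_verification a').2 e' := (minimizerP a').1 h'.
have sd : same_density D r' r.
  move=> t tT; apply: filterS2 (drift_uniqueness a e tT) (drift_uniqueness a' e' tT) => x.
  by move=> -> ->.
split=> //; apply: same_momentum_trans e' _; apply: same_momentum_trans (same_momentum_sym e).
exact: same_density_drift a' a sd.
Qed.

Lemma is_argminP (m : V -> R -> V) : is_argmin D rho rho m <-> minimizer D rho rho m.
Proof. by split => [[]//|h]; split => // r' m'; exact: minimizer_unique. Qed.

Lemma gain_eq0 (m : V -> R -> V) : admissible D rho m ->
  (gain D rho m = 0%E <-> total_cost D rho rho m = (value D phi)%:E).
Proof.
move=> adm; rewrite /gain.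
have -> : ereal_inf [set total_cost D rho z.1 z.2 | z in [set z | admissible D z.1 z.2]] = (value D phi)%:E.
  apply/eqP; rewrite eq_le; apply/andP; split.
    apply: ereal_inf_lbound; exists (u, fun x t => - drift_flux D u phi x t); last exact: minimal_total_cost.
    exact: best_response_admissible.
  by apply: le_ereal_inf_tmp => _ [[r' m'] /= a <-]; have [] := HJB_verification a.
have [le _] := HJB_verification adm.
(* An infinite cost gives an infinite gain, and the lower bound [value] rules out [-oo]. *)
case: (total_cost D rho rho m) le => [x|_|]; [|by split|by rewrite leeNy_eq].
rewrite -EFinB => le.
by split => [[] /eqP|[->]]; rewrite ?subrr// subr_eq0 => /eqP ->.
Qed.

End forward.
End backward.
End best_response.

(** The dimension has the form [n.+1] because the convexity arguments average over the coordinate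
    directions. *)
Theorem mean_field_equilibrium (R : realType) (n : nat) (D : mfg_data R n.+1)
    (rho : 'rV[R]_n.+1 -> R -> R) (m : 'rV[R]_n.+1 -> R -> 'rV[R]_n.+1)
    (hD : standing_assumptions D) (hC : admissible D rho m) (hwp : well_posed D rho) :
  ((exists phi : 'rV[R]_n.+1 -> R -> R,
      same_momentum D m (fun x t => - drift_flux D rho phi x t) /\
      solves_MFG D rho phi)
   <-> is_argmin D rho rho m)
  /\ (is_argmin D rho rho m <-> gain D rho m = 0%E).
Proof.
have [phi0 [HJB _ [u [FP _ u_gt0]]]] := hwp.
have drho : density_evolution D rho by have [[]] := hC.
have argP := is_argminP hD HJB FP u_gt0 m.
have minP := minimizerP hD HJB FP u_gt0 hC.
split; last first.
  have gP := gain_eq0 hD HJB FP u_gt0 hC.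
  by rewrite argP minP gP.
rewrite argP; split => [[phi [hm [r sd [dr HJBr FPr]]]]|h].
  (* The given [phi] solves the backward equation for the smooth version [r] of [rho]. It is carried
     over to [rho], whose costs are regular because [phi0] solves the backward equation for
     [rho]. *)
  have HJBrho : solves_HJB D rho phi.
    split.
    - by have [] := HJBr.
    - by have [] := HJBr.
    - move=> x t tT; have [_ _ run _] := HJBr; rewrite run//.
      have tT' := oo_cc tT; have [h1 h2] := running_cost_regular hD HJB tT.
      have [_ _ _ kf _] := hD; have [_ [cr _ _ _ _] _ _ _] := FPr.
      apply: (cost_transfer kf (dr t tT') (drho t tT')) => //; last exact: sd.
      exact: cont_QTbar_slice cr tT'.
    - move=> x; have [_ _ _ ter] := HJBr; rewrite ter.
      have TT : 0 <= horizon D <= horizon D by rewrite lexx ltW// (data_horizon hD).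
      have [h1 h2] := terminal_cost_regular hD HJB.
      have [_ _ _ _ kf] := hD; have [_ [cr _ _ _ _] _ _ _] := FPr.
      apply: (cost_transfer kf (dr _ TT) (drho _ TT)) => //; last exact: sd.
      exact: cont_QTbar_slice cr TT.
  (* The feedback form of [m] makes the cost equal to the lower bound built from [phi] itself, which
     holds for every admissible pair. *)
  have [_ [_ /(_ hm) E]] := HJB_verification hD HJBrho hC.
  by split => // r' m' /(HJB_verification hD HJBrho)[le _]; rewrite E.
(* Conversely, a minimizer has the feedback momentum of [phi0], so by uniqueness its density agrees
   with the classical solution [u], which serves as the smooth version. *)
have /(HJB_verification hD HJB hC).2 hm := minP.1 h.
have sd := drift_uniqueness hD HJB FP u_gt0 hC hm.
have sd' : same_density D u rho by move=> t tT; apply: filterS (sd t tT) => x ->.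
have adm0 := best_response_admissible hD HJB FP u_gt0.
have du : density_evolution D u by have [[]] := adm0.
exists phi0; split => //; exists u => //; split => //.
by apply: (HJB_transfer hD HJB) => //; have [_ [cu _ _ _ _] _ _ _] := FP.
Qed.

Theorem lemma3p4 (R : realType) (d : nat) (D : mfg_data R d)
    (rho : 'rV[R]_d -> R -> R) (m : 'rV[R]_d -> R -> 'rV[R]_d)
    (d_gt0 : (0 < d)%N) (hD : standing_assumptions D)
    (hC : admissible D rho m)
    (rho_gt0 : forall x t, 0 <= t <= horizon D -> 0 < rho x t)
    (hwp : well_posed D rho) :
  ((exists phi : 'rV[R]_d -> R -> R,
      same_momentum D m (fun x t => - drift_flux D rho phi x t) /\
      solves_MFG D rho phi)
   <-> is_argmin D rho rho m)
  /\ (is_argmin D rho rho m <-> gain D rho m = 0%E).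
Proof.
case: d D rho m d_gt0 hD hC rho_gt0 hwp => // n D rho m _ hD hC _ hwp.
exact: mean_field_equilibrium.
Qed.
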